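(* Let $(\eta_t)_{t\ge0}$ be the multi-type TASEP with $\eta_0(x)=-x$ for all $x\in\mathbb{Z}$. Fix $k_1\in\mathbb{Z}$, and let $L_1(t),L_2(t)$ be the types of the $(k_1,1)$- and $(k_1,2)$-leaders, respectively, at time $t$. Then, as $t\to\infty$, the random vector $$\left(\frac{L_1(t)-k_1}{\sqrt{t}},\frac{L_2(t)-k_1}{\sqrt{t}}\right)$$ converges in distribution to the probability measure on $\{(a_2,a_3): a_2\ge 0,\ a_3\ge 0\}$ with density $G(a_2,a_3)\,da_2\,da_3$, where (the first coordinate $a_2$ corresponding to $L_1$ and the second coordinate $a_3$ to $L_2$) $$G(a_2,a_3)=\begin{cases} d_1(a_3,a_2), & a_2>a_3,\\ d_2(a_2,a_3), & a_2\le a_3,\end{cases}$$ and the functions $d_1,d_2$ of two real variables are $$\begin{aligned} d_1(a_2,a_3)=\frac{-1}{16\pi}\Big(&\left(4\,\mathrm{erf}\left(\tfrac{\sqrt3}{6}(a_2+a_3)\right)-4\right)\exp\left(-\tfrac{(a_2-a_3)^2}{4}\right)\sqrt{\pi}\,(a_2-a_3)\\ &+2\sqrt3\,(a_2^2-6)\exp\left(\tfrac{-a_2^2+a_2a_3-a_3^2}{3}\right)\\ &+\sqrt{\pi}\exp\left(-\tfrac{a_2^2}{4}\right)\left(\mathrm{erf}\left(\tfrac{\sqrt3}{6}(a_2-2a_3)\right)+1\right)\left(-4a_2+a_2^3-2a_2^2a_3+4a_3\right)\Big),\end{aligned}$$ $$\begin{aligned} d_2(a_2,a_3)=\frac{-1}{4\sqrt{\pi}}\Big(&-\exp\left(-\tfrac14(a_2-a_3)^2\right)(a_2-a_3)\left(\mathrm{erf}\left(\tfrac{\sqrt3}{6}(a_2+a_3)\right)-1\right)\\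 &+a_3\exp\left(-\tfrac{a_3^2}{4}\right)\mathrm{erf}\left(\tfrac{\sqrt3}{6}(2a_2-a_3)\right)+a_2\exp\left(-\tfrac{a_2^2}{4}\right)\mathrm{erf}\left(\tfrac{\sqrt3}{6}(a_2-2a_3)\right)\\ &-a_3\exp\left(-\tfrac{a_3^2}{4}\right)+a_2\exp\left(-\tfrac{a_2^2}{4}\right)\Big).\end{aligned}$$
   Context: Multi-type TASEP: states are maps $\eta:\mathbb{Z}\to\mathbb{Z}$, $\eta(x)$ being the type of the particle at position $x$. Each pair of neighboring sites $(x,x+1)$ carries an independent exponential clock of rate $1$; when it rings, the values at $x$ and $x+1$ are swapped if $\eta(x)>\eta(x+1)$, and nothing happens otherwise. Started from $\eta_0(x)=-x$, the map $\eta_t$ is almost surely a bijection of $\mathbb{Z}$, and $\eta_t^{-1}(i)$ is the position at time $t$ of the unique particle of type $i$. For $k\in\mathbb{Z}$ and $s\ge1$, the $(k,s)$-leader at time $t$ is the particle of type $i\ge k$ such that $\eta_t^{-1}(i)$ is the $s$-th largest number among $\{\eta_t^{-1}(z)\}_{z\ge k}$. (So the $(k,1)$-leader is the right-most particle of type $\ge k$, and the $(k,2)$-leader is the second right-most one.) $\mathrm{erf}(z)=\frac{2}{\sqrt{\pi}}\int_0^z e^{-s^2}ds$. *)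

(* Defs.v *)
From HB Require Import structures.
From mathcomp Require Import all_boot all_order all_algebra.
From mathcomp Require Import all_classical all_reals all_analysis.

Set Implicit Arguments.
Unset Strict Implicit.
Unset Printing Implicit Defensive.

Import Order.TTheory GRing.Theory Num.Theory.
Import numFieldNormedType.Exports.

Local Open Scope classical_set_scope.
Local Open Scope ring_scope.

Section probability_notions.
Context {d : measure_display} {Omega : measurableType d} {R : realType}.
Variable P : probability Omega R.

Definition mutually_independent (I : eqType) (X : I -> {RV P >-> R}) : Prop :=
  forall (s : seq I) (B : I -> set R), uniq s ->
    (forall i, measurable (B i)) ->
    P (\bigcap_(i in [set` s]) X i @^-1` B i) =
    (\prod_(i <- s) P (X i @^-1` B i))%E.

(* Only measurable A are tested: on other sets [exponential_prob 1] is just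
   whatever value the total integral happens to take. *)
Definition exponential_rate1 (X : {RV P >-> R}) : Prop :=
  forall A : set R, measurable A -> distribution P X A = exponential_prob 1 A.

Definition cvg_in_distribution (X : R -> Omega -> R * R)
    (mu : probability (R * R)%type R) : Prop :=
  (\forall t \near +oo, measurable_fun [set: Omega] (X t)) /\
  forall f : R * R -> R, continuous f -> (exists M, forall z, `|f z| <= M) ->
    ('E_P[f \o X t])%E @[t --> +oo] --> ('E_mu[f])%E.

End probability_notions.

Definition has_density {R : realType} (mu : probability (R * R)%type R)
    (D : set (R * R)) (g : R -> R -> R) : Prop :=
  forall A : set (R * R), measurable A ->
    mu A = (\int[lebesgue_measure \x lebesgue_measure]_(a in A `&` D)
              (g a.1 a.2)%:E)%E.

Section multitype_tasep.
Context {R : realType}.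

(* [ring x t]: the clock of the pair of sites (x, x + 1) rings at time t.
   Almost surely, the clocks of two adjacent pairs never ring simultaneously and
   the pairs whose clock does not ring before a given time split Z into finite
   blocks, so the two clauses determine the path from its initial state. *)
Definition tasep_path (ring : int -> R -> Prop) (e : R -> int -> int) : Prop :=
  (forall (x : int) (s t : R), 0 <= s -> s <= t ->
     (forall u, s < u -> u <= t -> ~ ring (x - 1) u /\ ~ ring x u) ->
     e t x = e s x) /\
  (forall (x : int) (t : R), 0 < t -> ring x t ->
     \forall s \near t^'-,
       (e t x, e t (x + 1)) =
       if e s (x + 1) < e s x then (e s (x + 1), e s x)
       else (e s x, e s (x + 1))).

Context {d : measure_display} {Omega : measurableType d}.
Variable P : probability Omega R.

(* [tau (x, n)] is the waiting time between the n-th and the (n+1)-st ring of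
   the clock of (x, x + 1), the 0-th ring standing for time 0. *)
Definition rings_at (tau : int * nat -> {RV P >-> R}) (w : Omega)
    (x : int) (t : R) : Prop :=
  exists n : nat, t = \sum_(j < n.+1) tau (x, nat_of_ord j) w.

(* [eta t w x] is the type of the particle at x at time t; only t >= 0 matters. *)
Definition is_multitype_tasep (eta : R -> Omega -> int -> int) : Prop :=
  (forall (t : R) (x i : int), 0 <= t -> measurable [set w | eta t w x = i]) /\
  exists tau : int * nat -> {RV P >-> R},
    [/\ mutually_independent tau,
        forall xn, exponential_rate1 (tau xn) &
        {ae P, forall w, tasep_path (rings_at tau w) (fun t => eta t w)}].

End multitype_tasep.

Definition is_sth_largest (s : nat) (A : set int) (x : int) : Prop :=
  A x /\ ([set y | A y /\ x <= y] #= `I_s)%card.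

(* For bijective [eta], [eta @^-1` [set z | k <= z]] is the set of positions
   eta^-1(z), z >= k. *)
Definition is_leader (eta : int -> int) (k : int) (s : nat) (i : int) : Prop :=
  k <= i /\
  exists2 x, eta x = i & is_sth_largest s (eta @^-1` [set z | k <= z]) x.

(* At most one i satisfies [is_leader eta k s i]; the default value 0 is used
   when there is none, which for s >= 1 has probability zero under the dynamics
   started from x |-> - x. *)
Definition leader (eta : int -> int) (k : int) (s : nat) : int :=
  xget 0 [set i | is_leader eta k s i].

Section limit_density.
Context {R : realType}.

(* The set integral over [0, z] is 0 for z < 0, hence the case distinction. *)
Definition erf (z : R) : R :=
  2 / Num.sqrt pi *
  (if 0 <= z then \int[lebesgue_measure]_(s in `[0, z]) expR (- s ^+ 2)
   else - \int[lebesgue_measure]_(s in `[z, 0]) expR (- s ^+ 2)).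

Definition d1 (a2 a3 : R) : R :=
  - 1 / (16 * pi) *
  ((4 * erf (Num.sqrt 3 / 6 * (a2 + a3)) - 4) * expR (- (a2 - a3) ^+ 2 / 4)
     * Num.sqrt pi * (a2 - a3)
   + 2 * Num.sqrt 3 * (a2 ^+ 2 - 6)
     * expR ((- a2 ^+ 2 + a2 * a3 - a3 ^+ 2) / 3)
   + Num.sqrt pi * expR (- a2 ^+ 2 / 4)
     * (erf (Num.sqrt 3 / 6 * (a2 - 2 * a3)) + 1)
     * (- 4 * a2 + a2 ^+ 3 - 2 * a2 ^+ 2 * a3 + 4 * a3)).

Definition d2 (a2 a3 : R) : R :=
  - 1 / (4 * Num.sqrt pi) *
  (- expR (- (1 / 4) * (a2 - a3) ^+ 2) * (a2 - a3)
     * (erf (Num.sqrt 3 / 6 * (a2 + a3)) - 1)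
   + a3 * expR (- a3 ^+ 2 / 4) * erf (Num.sqrt 3 / 6 * (2 * a2 - a3))
   + a2 * expR (- a2 ^+ 2 / 4) * erf (Num.sqrt 3 / 6 * (a2 - 2 * a3))
   - a3 * expR (- a3 ^+ 2 / 4) + a2 * expR (- a2 ^+ 2 / 4)).

Definition G (a2 a3 : R) : R := if a3 < a2 then d1 a3 a2 else d2 a2 a3.

End limit_density.

(* Main.v *)
Require Import Defs.
From HB Require Import structures.
From mathcomp Require Import all_boot all_order all_algebra.
From mathcomp Require Import all_classical all_reals all_analysis.
From mathcomp Require Import measurable_realfun measurable_fun_approximation.
From mathcomp Require Import ring lra zify.

Import Order.TTheory GRing.Theory Num.Theory.
Import numFieldNormedType.Exports.

Local Open Scope classical_set_scope.
Local Open Scope ring_scope.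

Set Implicit Arguments.
Unset Strict Implicit.
Unset Printing Implicit Defensive.

(* By locality, the state at time t is a finite product of sorting operators applied to the packed
   configuration, and the 0-Hecke relations show that reversing the product inverts the state; hence
   eta_t and its inverse have the same law on finite windows.  In the inverse picture the event that
   the two leaders have types k + a and k + b, with the second one at y, only involves the positions
   of three particles.  Summing over y leaves a gap process with three moves, run at rate 3, and the
   law w_m(a, b) = P(L1 = k + a, L2 >= k + b) after m moves satisfies
   3 w_(m+1)(a, b) = w_m(a+1, b+1) + w_m(a-1, b) + w_m(a, b-1) off the diagonal, with explicit
   boundary conditions.  Under diffusive scaling this is a heat equation solved in closed form by a
   combination W of Gaussians and error functions with - d_b W = G.  Consistency of W with the
   recursion, weighted l^1 estimates in the two wedges and an energy estimate at the wall show that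
   w_m is close to its profile on average; monotonicity in b makes this pointwise after summation
   over a, and Poisson concentration replaces m by 3 t. *)

(** For the state itself, the event that position y carries the second leader constrains all sites
    beyond y; for the inverse configuration it only asks where particle y and the two rightmost
    particles of larger type are, and these positions evolve autonomously. That is why reversal
    comes before any counting. Two facts are read off from probability and not from formulas. The
    boundary value at b = 0 holds because two power series in t compute the same probability. The
    density G is nonnegative because its tail is a limit of probabilities that decrease in b. The
    obstacle is the wall: there the error is a difference of two discrete densities, with no
    smallness known in advance. It is the gradient of an error between distribution functions that
    vanishes at 0, and the dissipation of the l^2 norm of that error bounds it in l^2; a weighted
    arithmetic-geometric inequality then gives a sublinear l^1 total. The wedges need different
    weights: the one above the diagonal leaves a gain on the diagonal, which pays for the source
    feeding the wedge below. *)

(** * Independence of one coordinate from finitely many others *)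

Section independence.
Context {d} {Omega : measurableType d} {R : realType} (P : probability Omega R).
Context {I : eqType} (X : I -> {RV P >-> R}).

Definition cylinder (s : seq I) : set (set Omega) :=
  [set A | exists2 B : I -> set R, (forall i, measurable (B i)) &
           A = \bigcap_(i in [set` s]) X i @^-1` B i].

Lemma cylinder_measurable s : cylinder s `<=` measurable.
Proof.
move=> _ [B mB ->]; apply: fin_bigcap_measurable; first exact: finite_seq.
by move=> i _; rewrite -[X in measurable X]setTI; exact: measurable_funP.
Qed.

Lemma cylinder_setI s : setI_closed (cylinder s).
Proof.
move=> _ _ [B mB ->] [C mC ->]; exists (fun i => B i `&` C i).
  by move=> i; exact: measurableI.
rewrite predeqE => w; split; first by case=> h1 h2 i si; split; [apply: h1|apply: h2].
by move=> h; split=> i si; case: (h i si).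
Qed.

Lemma cylinder_setT s : cylinder s setT.
Proof.
by exists (fun=> setT) => //; rewrite predeqE => w; split=> // _ i _.
Qed.

Lemma measurable_coord s i : i \in s ->
  measurable_fun setT (X i : g_sigma_algebraType (cylinder s) -> R).
Proof.
move=> si _ B mB; rewrite setTI; apply: sub_sigma_algebra.
exists (fun j => if j == i then B else setT); first by move=> j; case: ifP.
rewrite predeqE => w; split=> [XB j _ /=|/(_ i si)]; last by rewrite /= eqxx.
by case: eqP => // ->.
Qed.

Hypothesis indepX : mutually_independent X.

Lemma measurable_cylinder_sub d' (T : measurableType d') s (Z : Omega -> T) :
  measurable_fun setT (Z : g_sigma_algebraType (cylinder s) -> T) ->
  measurable_fun setT Z.
Proof.
move=> mZ _ B mB; rewrite setTI.
have := mZ measurableT B mB; rewrite setTI => h.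
apply: (smallest_sub (@sigma_algebra_measurable _ Omega)) h.
exact: cylinder_measurable.
Qed.

(** Both sides are finite measures in [A], a restriction of [P] and a multiple of [P]; they agree on
    the intersection-stable family of cylinders, hence on the sigma-algebra it generates. *)
Lemma indep_coord s i A B : uniq s -> i \notin s -> <<s cylinder s >> A ->
  measurable B -> P (A `&` X i @^-1` B) = (P A * P (X i @^-1` B))%E.
Proof.
move=> us si sA mB.
have mXB : measurable (X i @^-1` B).
  by rewrite -[Y in measurable Y]setTI; exact: measurable_funP.
have PXB : P (X i @^-1` B) \is a fin_num by exact: fin_num_measure.
pose c : {nonneg R} := NngNum (fine_ge0 (measure_ge0 P (X i @^-1` B))).
have cE : (c%:num%:E = P (X i @^-1` B))%E by rewrite /= fineK.
rewrite muleC -cE.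
rewrite -[LHS]/(mrestr P mXB A) -[RHS]/(mscale c P A).
apply: (g_sigma_algebra_measure_unique (cylinder s) _ (fun=> setT)) sA => //.
- exact: cylinder_measurable.
- by move=> _; exact: cylinder_setT.
- by rewrite bigcup_const //; exists 0%N.
- exact: cylinder_setI.
- move=> _ [C mC ->].
  rewrite -[LHS]/(P _) -[RHS]/(c%:num%:E * P _)%E cE.
  pose C' j := if j == i then B else C j.
  have mC' j : measurable (C' j) by rewrite /C'; case: ifP.
  have C'E j : j \in s -> C' j = C j.
    by rewrite /C'; case: eqP => // ->; rewrite (negbTE si).
  have -> : \bigcap_(j in [set` s]) X j @^-1` C j `&` X i @^-1` B =
      \bigcap_(j in [set` i :: s]) X j @^-1` C' j.
    rewrite predeqE => w; split=> [[h1 h2] j|h].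
      rewrite /= inE => /orP[/eqP ->|js]; first by rewrite /C' eqxx.
      by rewrite C'E //; exact: h1.
    split=> [j js|].
      by rewrite -C'E //; apply: h; rewrite /= inE js orbT.
    have /= := h i; rewrite /C' eqxx; apply; exact: mem_head.
  rewrite indepX //=; last by rewrite si us.
  rewrite big_cons {1}/C' eqxx; congr (_ * _)%E.
  rewrite indepX //; apply: eq_big_seq => j js; by rewrite C'E.
- move=> _; rewrite -[X in (X < _)%E]/(P _).
  by apply: le_lt_trans (probability_le1 _ _) _; rewrite ?ltry //; exact: measurableI.
Qed.

(** Independence makes the joint law of [Z] and [X i] a product measure, so Tonelli allows the new
    coordinate to be integrated as an independent copy while the past stays frozen. *)
Lemma integral_indep d' (T : measurableType d') s i (Z : Omega -> T)
    (f : (T * R)%type -> \bar R) : uniq s -> i \notin s ->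
  measurable_fun setT (Z : g_sigma_algebraType (cylinder s) -> T) ->
  measurable_fun setT f -> (forall x, (0 <= f x)%E) ->
  (\int[P]_w f (Z w, X i w) =
   \int[P]_w \int[P]_w' f (Z w, X i w'))%E.
Proof.
move=> us si mZ mf f0.
have mZ' := measurable_cylinder_sub mZ.
pose Zf : {mfun Omega >-> T} := mfun_Sub (mem_set mZ').
have mW : measurable_fun setT (fun w => (Zf w, X i w)) by exact: measurable_fun_pair.
pose W : {mfun Omega >-> (T * R)%type} := mfun_Sub (mem_set mW).
transitivity (\int[distribution P W]_x f x)%E.
  by rewrite ge0_integral_distribution.
transitivity (\int[distribution P Zf \x distribution P (X i)]_x f x)%E.
  apply: eq_measure_integral => A mA _.
  apply/esym; apply: (product_measure_unique (m' := distribution P W)) => // B C mB mC.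
  apply: (indep_coord us si) => //.
  have := mZ measurableT B mB; by rewrite setTI.
rewrite fubini_tonelli1 // ge0_integral_distribution //.
- apply: eq_integral => w _; rewrite /= /fubini_F ge0_integral_distribution //.
  exact: measurableT_comp.
- exact: measurable_fun_fubini_tonelli_F.
- by move=> y; apply: integral_ge0.
Qed.

End independence.

(** * Exponential densities and elementary integrals *)

Section exponential_density.
Context {d} {Omega : measurableType d} {R : realType} (P : probability Omega R).
Local Open Scope ereal_scope.

(** The law of [X] is known through its values on measurable sets; its Radon-Nikodym derivative
    therefore agrees almost everywhere with the exponential density, and the change of variables
    passes through it. *)
Lemma integral_exponential (X : {RV P >-> R}) (f : R -> \bar R) :
  exponential_rate1 X -> measurable_fun setT f -> (forall x, 0 <= f x) ->
  \int[P]_w f (X w) =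
  \int[lebesgue_measure]_(u in `[0%R, +oo[) (f u * (expR (- u))%:E).
Proof.
move=> eX mf f0.
have mX : @measurable_fun _ _ Omega (measurableTypeR R) setT X.
  have h : measurable_fun setT X by exact: measurable_funP.
  by move=> mT B mB; exact: h.
pose X' : {mfun Omega >-> measurableTypeR R} :=
  @mfun_Sub _ _ Omega (measurableTypeR R) X (mem_set mX).
pose nu : {finite_measure set (measurableTypeR R) -> \bar R} := distribution P X'.
pose mu : {sigma_finite_measure set (measurableTypeR R) -> \bar R} := @lebesgue_measure R.
have mpdf : measurable_fun setT (fun u : measurableTypeR R => (exponential_pdf 1 u)%:E).
  by apply/measurable_EFinP; exact: measurable_exponential_pdf.
have dom : nu `<< mu.
  apply/null_content_dominatesP => A mA muA0.
  rewrite -[LHS]/(distribution P X A) eX // /exponential_prob.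
  by apply: null_set_integral => //; exact: measurable_funTS.
transitivity (\int[nu]_u f u).
  by rewrite (ge0_integral_distribution X').

rewrite -(Radon_Nikodym_SigmaFinite.change_of_variables dom) //.
transitivity (\int[mu]_u (f u * (exponential_pdf 1 u)%:E)).
  apply: ae_eq_integral => //.
  - apply: emeasurable_funM => //.
    exact: measurable_int (Radon_Nikodym_SigmaFinite.f_integrable dom).
  - exact: emeasurable_funM.
  - apply: ae_eqe_mul2l.
    apply: integral_ae_eq => //.
    + exact: Radon_Nikodym_SigmaFinite.f_integrable.
    + move=> E _ mE; rewrite -Radon_Nikodym_SigmaFinite.f_integral //.
      exact: eX.
rewrite [RHS]integral_mkcond; apply: eq_integral => u _.
rewrite patchE; case: ifPn => u0.
  rewrite exponential_pdfE; last by move: u0; rewrite inE /= in_itv /= andbT.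
  by rewrite mul1r mulN1r.
by rewrite /exponential_pdf patchE ifN ?mule0.
Qed.

End exponential_density.
Section pointwise_derivatives.
Context {R : realType}.
Implicit Types (f g : R -> R) (x df dg : R).

Lemma drv_eq f x df dg : is_derive x (1 : R) f df -> df = dg -> is_derive x (1 : R) f dg.
Proof. by move=> h <-. Qed.

Lemma drv_cst (c x : R) : is_derive x (1 : R) (fun=> c) 0.
Proof. exact: is_derive_cst. Qed.

Lemma drv_id x : is_derive x (1 : R) (fun u => u) 1.
Proof. exact: is_derive_id. Qed.

Lemma drvD f g x df dg : is_derive x (1 : R) f df -> is_derive x (1 : R) g dg ->
  is_derive x (1 : R) (fun u => f u + g u) (df + dg).
Proof. by move=> ? ?; exact: is_deriveD. Qed.

Lemma drvN f x df : is_derive x (1 : R) f df ->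
  is_derive x (1 : R) (fun u => - f u) (- df).
Proof. by move=> ?; exact: is_deriveN. Qed.

Lemma drvB f g x df dg : is_derive x (1 : R) f df -> is_derive x (1 : R) g dg ->
  is_derive x (1 : R) (fun u => f u - g u) (df - dg).
Proof. by move=> ? ?; exact: is_deriveB. Qed.

Lemma drvM f g x df dg : is_derive x (1 : R) f df -> is_derive x (1 : R) g dg ->
  is_derive x (1 : R) (fun u => f u * g u) (df * g x + f x * dg).
Proof.
move=> hf hg.
have h : is_derive x (1 : R) (f * g) (f x *: dg + g x *: df) by exact: is_deriveM.
by apply: drv_eq h _; rewrite /GRing.scale /= addrC [g x * _]mulrC.
Qed.

Lemma drvZl (c : R) f x df : is_derive x (1 : R) f df ->
  is_derive x (1 : R) (fun u => c * f u) (c * df).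
Proof.
move=> hf; apply: (drv_eq (drvM (drv_cst c x) hf)).
by rewrite mul0r add0r.
Qed.

Lemma drvZr (c : R) f x df : is_derive x (1 : R) f df ->
  is_derive x (1 : R) (fun u => f u * c) (df * c).
Proof.
move=> hf; apply: (drv_eq (drvM hf (drv_cst c x))).
by rewrite mulr0 addr0.
Qed.

Lemma drvX f x df n : is_derive x (1 : R) f df ->
  is_derive x (1 : R) (fun u => f u ^+ n.+1) (n.+1%:R * f x ^+ n * df).
Proof.
move=> hf; elim: n => [|n IH].
  by rewrite mulr1 mul1r (_ : (fun _ => _) = f) //; apply/funext => u; rewrite expr1.
rewrite (_ : (fun _ => _) = (fun u => f u * f u ^+ n.+1)); last first.
  by apply/funext => u; rewrite exprS.
apply: (drv_eq (drvM hf IH)).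
by rewrite -(natr1 n.+1) (exprS (f x) n); ring.
Qed.

Lemma drv_comp f g x df dg : is_derive (f x) (1 : R) g dg -> is_derive x (1 : R) f df ->
  is_derive x (1 : R) (fun u => g (f u)) (dg * df).
Proof.
move=> hg hf; have h := @is_derive1_comp R g f x dg df hg hf.
exact: drv_eq h _.
Qed.

Lemma drv_exp f x df : is_derive x (1 : R) f df ->
  is_derive x (1 : R) (fun u => expR (f u)) (expR (f x) * df).
Proof. by move=> hf; apply: (drv_comp (g := expR)) => //; exact: is_derive_expR. Qed.

Lemma is_derive_continuous f g : (forall x : R, is_derive x (1 : R) f (g x)) ->
  continuous f.
Proof.
move=> df x; apply: differentiable_continuous; apply/derivable1_diffP.
by have := df x => -[].
Qed.

End pointwise_derivatives.

Section elementary_integrals.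
Context {R : realType}.
Local Notation mu := (@lebesgue_measure R).

Lemma integral_is_derive (f F : R -> R) (a b : R) : a <= b ->
  (forall x : R, is_derive x 1 F (f x)) -> continuous f ->
  (\int[mu]_(x in `[a, b]) (f x)%:E = (F b - F a)%:E)%E.
Proof.
move=> + dF cf; rewrite le_eqVlt => /predU1P[->|ab].
  by rewrite set_itv1 integral_set1 subrr.
rewrite (@continuous_FTC2 _ f F) ?EFinB //.
- exact: continuous_subspaceT.
- split.
  + by move=> x _; have := dF x => -[].
  + by apply: cvg_at_right_filter; exact: (is_derive_continuous dF).
  + by apply: cvg_at_left_filter; exact: (is_derive_continuous dF).
- by move=> x _; rewrite derive1E; have := dF x => -[].
Qed.

Lemma integral_is_derivey (f F : R -> R) (a l : R) : (forall x, 0 <= f x) ->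
  (forall x : R, is_derive x 1 F (f x)) -> continuous f -> F x @[x --> +oo] --> l ->
  (\int[mu]_(x in `[a, +oo[) (f x)%:E = (l - F a)%:E)%E.
Proof.
move=> f0 dF cf Fl; rewrite (@ge0_continuous_FTC2y _ f F a l) ?EFinB //.
- exact: continuous_subspaceT.
- by apply: cvg_at_right_filter; exact: (is_derive_continuous dF).
- by move=> x _; rewrite derive1E; have := dF x => -[].
Qed.

Lemma is_derive_expRN (x : R) : is_derive x 1 (fun u => - expR (- u)) (expR (- x)).
Proof.
apply: (drv_eq (drvN (drv_exp (drvN (drv_id x))))).
by rewrite mulrN1 opprK.
Qed.

Lemma integral_expRN_gt (c : R) : 0 <= c ->
  (\int[mu]_(u in `[0%R, +oo[) ((if c < u then 1 else 0)%:E * (expR (- u))%:E) =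
   (expR (- c))%:E)%E.
Proof.
move=> c0.
transitivity (\int[mu]_(u in `]c, +oo[) (expR (- u))%:E)%E.
  rewrite integral_mkcond [RHS]integral_mkcond; apply: eq_integral => u _.
  rewrite !patchE !mem_setE !in_itv /= ?andbT; case: (ltP c u) => cu.
    by rewrite mul1e (le_trans c0 (ltW cu)).
  by rewrite mul0e if_same.
have cE : continuous (fun u : R => expR (- u)).
  by move=> u; apply: continuous_comp; [exact: continuousN|exact: continuous_expR].
rewrite integral_itv_obnd_cbnd; last first.
  apply/measurable_EFinP; apply: measurable_funTS; exact: continuous_measurable_fun.
have l0 : (- expR (- u) : R) @[u --> +oo] --> (0 : R).
  by rewrite -oppr0; apply: cvgN; exact: cvgr_expR.
by rewrite (integral_is_derivey c (fun u => expR_ge0 _) is_derive_expRN cE l0) sub0r opprK.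
Qed.

Lemma is_derive_pow_div (k : nat) (b x : R) :
  is_derive x 1 (fun u => - ((b - u) ^+ k.+1 / k.+1`!%:R)) ((b - x) ^+ k / k`!%:R).
Proof.
apply: (drv_eq (drvN (drvZr _ (drvX k (drvB (drv_cst b x) (drv_id x)))))).
rewrite factS natrM; field.
by rewrite !pnatr_eq0 /= -lt0n fact_gt0 /= addrC natr1 pnatr_eq0.
Qed.

Lemma integral_pow (k : nat) (c b : R) : 0 <= c -> c <= b ->
  (\int[mu]_(u in `[0%R, +oo[)
     (if (c < u) && (u <= b) then (b - u) ^+ k / k`!%:R else 0)%:E =
   ((b - c) ^+ k.+1 / k.+1`!%:R)%:E)%E.
Proof.
move=> c0 cb.
transitivity (\int[mu]_(u in `]c, b]) ((b - u) ^+ k / k`!%:R)%:E)%E.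
  rewrite integral_mkcond [RHS]integral_mkcond; apply: eq_integral => u _.
  rewrite !patchE !mem_setE !in_itv /= ?andbT; case: (ltP c u) => cu.
    by rewrite (le_trans c0 (ltW cu)) /=; case: ifP.
  by rewrite if_same.
have cE : continuous (fun u : R => (b - u) ^+ k / k`!%:R).
  case: k => [|k].
    by move=> u; rewrite (_ : (fun _ => _) = fun=> 1 / 0`!%:R); [exact: cst_continuous|
      apply/funext => v; rewrite expr0].
  apply: is_derive_continuous => u.
  exact: (drvZr _ (drvX k (drvB (drv_cst b u) (drv_id u)))).
rewrite integral_itv_obnd_cbnd; last first.
  apply/measurable_EFinP; apply: measurable_funTS; exact: continuous_measurable_fun.
rewrite (integral_is_derive cb (@is_derive_pow_div k b)) //.
by rewrite subrr expr0n mul0r oppr0 sub0r opprK.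
Qed.

End elementary_integrals.

(** * Law of the order in which finitely many clocks ring *)

Section word_law.
Context {d} {Omega : measurableType d} {R : realType} (P : probability Omega R).
Context {T : eqType} (tau : T * nat -> {RV P >-> R}).

Definition ring_time (x : T) (n : nat) (w : Omega) : R := \sum_(j < n) tau (x, j : nat) w.

(* Histories list the letters in reverse chronological order. *)
Definition last_time (h : seq T) (w : Omega) : R :=
  if h is x :: h' then ring_time x (count_mem x h').+1 w else 0.

Fixpoint in_order (h : seq T) (w : Omega) : bool :=
  if h is x :: h' then (last_time h' w < last_time h w) && in_order h' w else true.

Lemma ring_timeS x n w : ring_time x n.+1 w = ring_time x n w + tau (x, n) w.
Proof. by rewrite /ring_time big_ord_recr. Qed.

Lemma ring_time0 x w : ring_time x 0 w = 0.
Proof. by rewrite /ring_time big_ord0. Qed.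

Lemma last_time_ge0 h w : in_order h w -> 0 <= last_time h w.
Proof. by case: h => //= x h; elim: h x => [|y h IH] x /andP[h1 h2] //=;
  apply: ltW; [|apply: le_lt_trans h1; apply: IH]. Qed.

Lemma ring_time_le_last h w x : in_order h w ->
  ring_time x (count_mem x h) w <= last_time h w.
Proof.
elim: h => [|y h IH]; first by rewrite ring_time0.
move=> /= /andP[h1 h2]; have [->|yx] := eqVneq y x; first by rewrite add1n.
by rewrite add0n; apply: le_trans (IH h2) (ltW h1).
Qed.

Definition history_coords (B : seq T) (h : seq T) : seq (T * nat) :=
  [seq (y, j) | y <- B, j <- iota 0 (count_mem y h)].

Lemma mem_history_coords B h y j :
  ((y, j) \in history_coords B h) = (y \in B) && (j < count_mem y h)%N.
Proof.
apply/allpairsPdep/idP => /= [[x [i [xB]]]|/andP[yB jc]].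
  by rewrite mem_iota /= add0n => ic [-> ->]; rewrite xB.
by exists y, j; split; rewrite // mem_iota.
Qed.

Lemma uniq_history_coords B h : uniq B -> uniq (history_coords B h).
Proof.
move=> uB; apply: allpairs_uniq_dep => //.
- by move=> x _; exact: iota_uniq.
- by move=> [x i] [y j] _ _ /= [-> ->].
Qed.

Section measurability.
Variable s : seq (T * nat).
Local Notation Os := (g_sigma_algebraType (cylinder tau s)).

Lemma measurable_ring_time x n : (forall j, (j < n)%N -> (x, j) \in s) ->
  measurable_fun setT (ring_time x n : Os -> R).
Proof.
move=> xs; elim: n xs => [|n IH] xs.
  rewrite (_ : ring_time x 0 = cst 0); last by apply/funext => w; rewrite ring_time0.
  exact: measurable_cst.
rewrite (_ : ring_time x n.+1 = ring_time x n \+ tau (x, n)); last first.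
  by apply/funext => w; rewrite ring_timeS.
apply: measurable_funD; first by apply: IH => j jn; apply: xs; exact: ltnW.
by apply: measurable_coord; exact: xs.
Qed.

Variable B : seq T.

Lemma measurable_last_time h : {subset h <= B} -> {subset history_coords B h <= s} ->
  measurable_fun setT (last_time h : Os -> R).
Proof.
case: h => [|x h] hB hs; first exact: measurable_cst.
apply: measurable_ring_time => j jc; apply: hs.
by rewrite mem_history_coords hB ?mem_head //= eqxx add1n.
Qed.

Lemma measurable_in_order h : {subset h <= B} -> {subset history_coords B h <= s} ->
  measurable_fun setT (in_order h : Os -> bool).
Proof.
elim: h => [|x h IH] hB hs; first exact: measurable_cst.
have hB' : {subset h <= B} by move=> y yh; apply: hB; rewrite inE yh orbT.
have hs' : {subset history_coords B h <= s}.
  move=> [y j]; rewrite mem_history_coords => /andP[yB jc]; apply: hs.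
  by rewrite mem_history_coords yB /=; apply: leq_trans jc _; rewrite leq_addl.
apply: measurable_and; last exact: IH.
apply: measurable_fun_ltr; first exact: measurable_last_time.
exact: (@measurable_last_time (x :: h)).
Qed.

End measurability.

Hypothesis indep : mutually_independent tau.
Hypothesis exp1 : forall i, exponential_rate1 (tau i).

Section peel.
Variables (s : seq (T * nat)) (i : T * nat) (us : uniq s) (is_ : i \notin s).
Local Notation Os := (g_sigma_algebraType (cylinder tau s)).
Variables (a L S : Omega -> R) (t : R).
Hypotheses (ma : measurable_fun setT (a : Os -> R))
  (mL : measurable_fun setT (L : Os -> R)) (mS : measurable_fun setT (S : Os -> R)).
Hypothesis a0 : forall w, 0 <= a w.

(** Given the past, an exponential waiting time started at S <= t lasts beyond t with probability
    exp(-(t - S)); where [a] vanishes both sides do. *)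
Lemma integral_peel_tail : (forall w, a w != 0 -> S w <= t) ->
  (\int[P]_w (a w * (if t < S w + tau i w then 1 else 0))%:E =
   \int[P]_w (a w * expR (- (t - S w)))%:E)%E.
Proof.
move=> aS.
(* The absolute value makes [f] nonnegative on the whole space, as [integral_indep] demands; it
   disappears on the values of [a]. *)
pose f (z : (R * R) * R) : \bar R :=
  (`|z.1.1| * (if t < z.1.2 + z.2 then 1 else 0))%:E.
have mf : measurable_fun setT f.
  apply/measurable_EFinP; apply: measurable_funM.
    by apply: measurableT_comp => //; apply: measurableT_comp.
  apply: measurable_fun_ifT => //; apply: measurable_fun_ltr => //.
  by apply: measurable_funD => //; apply: measurableT_comp.
transitivity (\int[P]_w f ((a w, S w), tau i w))%E.
  by apply: eq_integral => w _; rewrite /f /= ger0_norm.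
rewrite (integral_indep indep us is_) //; first last.
- by move=> z; rewrite lee_fin mulr_ge0 //; case: ifP.
- exact: measurable_fun_pair.
apply: eq_integral => w _.
rewrite (integral_exponential (f := fun u => f (a w, S w, u))) //; first last.
- by move=> u; rewrite lee_fin mulr_ge0 //; case: ifP.
- apply: measurableT_comp => //; exact: measurable_pair1.
have [aw0|aw0] := eqVneq (a w) 0.
  rewrite aw0 mul0r integral0_eq // => u _.
  by rewrite /f /= normr0 mul0r mul0e.
have := integral_expRN_gt (c := t - S w).
rewrite subr_ge0 => /(_ (aS w aw0)) E.
rewrite EFinM -E -ge0_integralZl //; first last.
- by rewrite lee_fin.
- move=> u _; rewrite -EFinM lee_fin mulr_ge0 ?expR_ge0 //; case: ifP => //.
- apply: emeasurable_funM; apply/measurable_EFinP; apply: measurable_funTS.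
    by apply: measurable_fun_ifT => //; exact: measurable_fun_ltr.
  by apply: measurableT_comp => //; exact: measurableT_comp.
apply: eq_integral => u _; rewrite /f /= ger0_norm // EFinM muleA.
by congr (_ * _%:E * _)%E; rewrite ltrBlDl.
Qed.

(** The factor [expR (tau i w)] cancels the exponential density, so integrating out the waiting time
    is a Lebesgue integral of a power over the ring times between [L] and [t]. *)
Lemma integral_peel_step k : (forall w, a w != 0 -> S w <= L w) ->
  (\int[P]_w (a w * ((if (L w < S w + tau i w) && (S w + tau i w <= t)
      then (t - (S w + tau i w)) ^+ k / k`!%:R else 0) * expR (tau i w)))%:E =
   \int[P]_w (a w * (if L w <= t then (t - L w) ^+ k.+1 / k.+1`!%:R else 0))%:E)%E.
Proof.
move=> aS.
pose f (z : (R * R * R) * R) : \bar R :=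
  (`|z.1.1.1| * ((if (z.1.1.2 < z.1.2 + z.2) && (z.1.2 + z.2 <= t)
      then (t - (z.1.2 + z.2)) ^+ k / k`!%:R else 0) * expR z.2))%:E.
have pow0 (b : bool) (y : R) : y <= t ->
    0 <= (if b then (t - y) ^+ k / k`!%:R else 0).
  by move=> yt; case: b => //; rewrite divr_ge0 // exprn_ge0 // subr_ge0.
have f0 z : (0 <= f z)%E.
  rewrite lee_fin mulr_ge0 // mulr_ge0 ?expR_ge0 //.
  by case: ifP => // /andP[_ zt]; exact: (pow0 true).
have m12 : measurable_fun setT (fun z : (R * R * R) * R => z.1.2 + z.2).
  by apply: measurable_funD => //; apply: measurableT_comp.
have mf : measurable_fun setT f.
  apply/measurable_EFinP; apply: measurable_funM.
    by apply: measurableT_comp => //; apply: measurableT_comp => //; apply: measurableT_comp.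
  apply: measurable_funM; last exact: measurableT_comp.
  apply: measurable_fun_ifT => //.
    apply: measurable_and; last exact: measurable_fun_ler.
    apply: measurable_fun_ltr => //.
    by apply: measurableT_comp => //; apply: measurableT_comp.
  apply: measurable_funM => //; apply: measurable_funX.
  exact: measurable_funB.
transitivity (\int[P]_w f ((a w, L w, S w), tau i w))%E.
  by apply: eq_integral => w _; rewrite /f /= ger0_norm.
rewrite (integral_indep indep us is_) //; last first.
  by apply: measurable_fun_pair => //; exact: measurable_fun_pair.
apply: eq_integral => w _.
rewrite (integral_exponential (f := fun u => f (a w, L w, S w, u))) //; last first.
  by apply: measurableT_comp => //; exact: measurable_pair1.
transitivity ((a w)%:E * \int[lebesgue_measure]_(u in `[0%R, +oo[)
   (if (L w - S w < u) && (u <= t - S w) then ((t - S w) - u) ^+ k / k`!%:R else 0)%:E)%E.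
  rewrite -ge0_integralZl //; first last.
  - by rewrite lee_fin.
  - move=> u _; rewrite lee_fin; case: ifP => // /andP[_ ut].
    by rewrite divr_ge0 // exprn_ge0 // subr_ge0.
  - apply/measurable_EFinP; apply: measurable_funTS.
    apply: measurable_fun_ifT => //.
      by apply: measurable_and; [exact: measurable_fun_ltr|exact: measurable_fun_ler].
    by apply: measurable_funM => //; apply: measurable_funX; exact: measurable_funB.
  apply: eq_integral => u _; rewrite /f /= ger0_norm // -!EFinM; congr (_%:E).
  rewrite -!mulrA -expRD subrr expR0 mulr1 -ltrBlDl -lerBrDl.
  by rewrite (_ : t - (S w + u) = t - S w - u) // opprD addrA.
have [->|aw0] := eqVneq (a w) 0; first by rewrite mul0e mul0r.
have Sw := aS w aw0; rewrite EFinM; congr (_ * _)%E.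
case: ifPn => [Lt|]; last first.
  rewrite -ltNge => tL; rewrite integral0_eq // => u _; case: ifP => // /andP[h1 h2].
  by move: (lt_le_trans h1 h2); rewrite ltrD2r ltNge (ltW tL).
rewrite integral_pow ?subr_ge0 ?lerD2r //.
by rewrite (_ : t - S w - (L w - S w) = t - L w) //; ring.
Qed.

End peel.

Section word_probability.
Variables (B : seq T) (uB : uniq B) (t : R).

(** The conditional probability, given the rings recorded in [h], that the next ring of [y] comes
    after [t]. *)
Let decay (h : seq T) (y : T) (w : Omega) := expR (- (t - ring_time y (count_mem y h) w)).

(** What is left of a word probability once the survival of all clocks and the last [k] rings have
    been integrated out; the power is the volume of the ordered times of those rings. *)
Let Phi (h : seq T) (k : nat) := (\int[P]_w ((in_order h w)%:R *
  (\prod_(y <- B) decay h y w) *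
  (if last_time h w <= t then (t - last_time h w) ^+ k / k`!%:R else 0))%:E)%E.

Let measurable_decay s h y : y \in B -> {subset history_coords B h <= s} ->
  measurable_fun setT (decay h y : g_sigma_algebraType (cylinder tau s) -> R).
Proof.
move=> yB hs; apply: measurableT_comp => //; apply: measurableT_comp => //.
apply: measurable_funB => //; apply: measurable_ring_time => j jc.
by apply: hs; rewrite mem_history_coords yB.
Qed.

Let measurable_nat_in_order s h : {subset h <= B} -> {subset history_coords B h <= s} ->
  measurable_fun setT
    ((fun w => (in_order h w)%:R) : g_sigma_algebraType (cylinder tau s) -> R).
Proof.
move=> hB hs; rewrite (_ : (fun w => _) = (fun w => if in_order h w then 1 else 0)).
  by apply: measurable_fun_ifT => //; exact: (measurable_in_order hB hs).
by apply/funext => w; case: in_order.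
Qed.

(** Integrates out the last ring: one more ring of [x] multiplies its [decay] by [expR] of the new
    waiting time, exactly the factor that [integral_peel_step] absorbs. *)
Lemma PhiS x h k : x \in B -> {subset h <= B} -> Phi (x :: h) k = Phi h k.+1.
Proof.
move=> xB hB; pose s := history_coords B h.
have us : uniq s by exact: uniq_history_coords.
have is_ : (x, count_mem x h) \notin s by rewrite mem_history_coords ltnn andbF.
pose a w := (in_order h w)%:R * (\prod_(y <- B) decay h y w).
have ma : measurable_fun setT (a : g_sigma_algebraType (cylinder tau s) -> R).
  apply: measurable_funM; first exact: measurable_nat_in_order.
  have : {subset B <= B} by [].
  elim: {1 3}B => [|y l IH] lB.
    rewrite (_ : (fun _ => _) = cst 1); first exact: measurable_cst.
    by apply/funext => w; rewrite big_nil.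
  rewrite (_ : (fun _ => _) = (fun w => decay h y w * \prod_(y <- l) decay h y w)).
    apply: measurable_funM; first by apply: measurable_decay => //; apply: lB; exact: mem_head.
    by apply: IH => z zl; apply: lB; rewrite inE zl orbT.
  by apply/funext => w; rewrite big_cons.
have mL : measurable_fun setT (last_time h : g_sigma_algebraType (cylinder tau s) -> R).
  exact: (measurable_last_time hB).
have mS : measurable_fun setT
    (ring_time x (count_mem x h) : g_sigma_algebraType (cylinder tau s) -> R).
  by apply: measurable_ring_time => j jc; rewrite mem_history_coords xB.
have a0 w : 0 <= a w by rewrite mulr_ge0 // prodr_ge0 // => y _; exact: expR_ge0.
have aS w : a w != 0 -> ring_time x (count_mem x h) w <= last_time h w.
  rewrite /a; case E : (in_order h w); last by rewrite mul0r eqxx.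
  by move=> _; exact: ring_time_le_last.
rewrite [RHS]/Phi -(integral_peel_step us is_ t ma mL mS a0 k aS).
apply: eq_integral => w _; congr (_%:E).
rewrite /a /= -ring_timeS; case: (in_order h w); rewrite ?andbF ?mul0r // andbT !mul1r.
case: (last_time h w < _); rewrite /= ?mul0r ?mulr0 ?mul1r //.
case: (_ <= t); last by rewrite mul0r !mulr0.
rewrite (_ : \prod_(y <- B) decay (x :: h) y w =
    expR (tau (x, count_mem x h) w) * \prod_(y <- B) decay h y w); first by ring.
rewrite (bigD1_seq x) //= [in RHS](bigD1_seq x) //=.
rewrite [RHS]mulrA; congr (_ * _); last first.
  by apply: eq_bigr => y /negbTE yx; rewrite /decay /= eq_sym yx add0n.
by rewrite /decay /= eqxx add1n ring_timeS -expRD; congr expR; ring.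
Qed.

Let factor (h : seq T) (l : seq T) (y : T) (w : Omega) : R :=
  if y \in l then (if t < ring_time y (count_mem y h).+1 w then 1 else 0) else decay h y w.

Lemma Phi0 h l : {subset h <= B} -> {subset l <= B} -> uniq l ->
  (\int[P]_w ((in_order h w && (last_time h w <= t))%:R *
     \prod_(y <- B) factor h l y w)%:E)%E = Phi h 0.
Proof.
move=> hB; elim: l => [|x l IH] lB ul.
  apply: eq_integral => w _; congr (_%:E).
  rewrite expr0 fact0 divr1; case: (in_order h w); last by rewrite !mul0r.
  rewrite /= mul1r; case: ifP => _; last by rewrite mul0r mulr0.
  by rewrite mul1r mulr1; apply: eq_bigr => y _; rewrite /factor in_nil.
have xB : x \in B by apply: lB; exact: mem_head.
have lB' : {subset l <= B} by move=> y yl; apply: lB; rewrite inE yl orbT.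
move: ul => /= /andP[xl ul]; rewrite -IH //.
pose s := history_coords B h ++ [seq (y, count_mem y h) | y <- l].
have us : uniq s.
  rewrite cat_uniq uniq_history_coords //=; apply/andP; split.
    apply/hasPn => _ /mapP[y yl ->].
    by rewrite mem_history_coords ltnn andbF.
  by rewrite map_inj_uniq // => y z [].
have is_ : (x, count_mem x h) \notin s.
  rewrite mem_cat mem_history_coords ltnn andbF /=.
  by apply/mapP => -[y yl [E _]]; rewrite E yl in xl.
have hs : {subset history_coords B h <= s} by move=> z zh; rewrite mem_cat zh.
pose a w := (in_order h w && (last_time h w <= t))%:R *
  \prod_(y <- B | y != x) factor h l y w.
have prod_x l' w : \prod_(y <- B) factor h l' y w =
    factor h l' x w * \prod_(y <- B | y != x) factor h l' y w.
  by rewrite (bigD1_seq x).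
transitivity (\int[P]_w (a w * (if t < ring_time x (count_mem x h) w +
    tau (x, count_mem x h) w then 1 else 0))%:E)%E.
  apply: eq_integral => w _; congr (_%:E); rewrite prod_x /a -mulrA; congr (_ * _).
  rewrite mulrC; congr (_ * _); last by rewrite /factor mem_head ring_timeS.
  by apply: eq_bigr => y /negbTE yx; rewrite /factor inE yx.
have ma : measurable_fun setT (a : g_sigma_algebraType (cylinder tau s) -> R).
  apply: measurable_funM.
    rewrite (_ : (fun w => _) =
      (fun w => if in_order h w && (last_time h w <= t) then 1 else 0)); last first.
      by apply/funext => w; case: (_ && _).
    apply: measurable_fun_ifT => //; apply: measurable_and.
      exact: (measurable_in_order hB hs).
    by apply: measurable_fun_ler => //; exact: (measurable_last_time hB hs).
  have : {subset B <= B} by [].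
  elim: {1 3}B => [|y r IHr] rB.
    rewrite (_ : (fun _ => _) = cst 1); first exact: measurable_cst.
    by apply/funext => w; rewrite big_nil.
  have IHr' := IHr (fun z zr => rB z (mem_behead (s := y :: r) zr)).
  rewrite (_ : (fun _ => _) = if y != x then
      (fun w => factor h l y w * \prod_(y <- r | y != x) factor h l y w)
      else (fun w => \prod_(y <- r | y != x) factor h l y w)); last first.
    by case: ifP => yx; apply/funext => w; rewrite big_cons yx.
  case: ifP => // yx; apply: measurable_funM => //.
  have yB : y \in B by apply: rB; exact: mem_head.
  rewrite /factor; case yl : (y \in l); last exact: measurable_decay.
  apply: measurable_fun_ifT => //; apply: measurable_fun_ltr => //.
  apply: measurable_ring_time => j; rewrite ltnS leq_eqVlt => /predU1P[->|jc].
    by rewrite mem_cat; apply/orP; right; apply/mapP; exists y.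
  by apply: hs; rewrite mem_history_coords yB.
have mS : measurable_fun setT
    (ring_time x (count_mem x h) : g_sigma_algebraType (cylinder tau s) -> R).
  by apply: measurable_ring_time => j jc; apply: hs; rewrite mem_history_coords xB.
have a0 w : 0 <= a w.
  rewrite mulr_ge0 // prodr_ge0 // => y _; rewrite /factor.
  by case: ifP => _; [case: ifP|exact: expR_ge0].
have aS w : a w != 0 -> ring_time x (count_mem x h) w <= t.
  rewrite /a; case E : (_ && _); last by rewrite mul0r eqxx.
  case/andP : E => h1 h2 _; exact: le_trans (ring_time_le_last _ h1) h2.
rewrite (integral_peel_tail us is_ ma mS a0 aS).
apply: eq_integral => w _; congr (_%:E); rewrite [in RHS]prod_x /a -mulrA; congr (_ * _).
by rewrite mulrC /factor (negbTE xl).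
Qed.

Definition word_event (h : seq T) : set Omega :=
  [set w | [&& in_order h w, last_time h w <= t &
    all (fun y => t < ring_time y (count_mem y h).+1 w) B]].

Lemma measurable_word_event h : {subset h <= B} -> measurable (word_event h).
Proof.
move=> hB; pose s := [seq (y, j) | y <- B, j <- iota 0 (count_mem y h).+1].
have sP y j : y \in B -> (j < (count_mem y h).+1)%N -> (y, j) \in s.
  by move=> yB jc; apply/allpairsPdep; exists y, j; rewrite mem_iota.
have hs : {subset history_coords B h <= s}.
  by move=> [y j]; rewrite mem_history_coords => /andP[yB /ltnW jc]; exact: sP.
have mW : measurable_fun setT ((fun w => [&& in_order h w, last_time h w <= t &
    all (fun y => t < ring_time y (count_mem y h).+1 w) B]) :
    g_sigma_algebraType (cylinder tau s) -> bool).
  apply: measurable_and; first exact: (measurable_in_order hB hs).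
  apply: measurable_and.
    by apply: measurable_fun_ler => //; exact: (measurable_last_time hB hs).
  have : {subset B <= B} by [].
  elim: {1 3}B => [|y l IH] lB //=.
  apply: measurable_and; last by apply: IH => z zl; apply: lB; rewrite inE zl orbT.
  apply: measurable_fun_ltr => //; apply: measurable_ring_time => j jc.
  by apply: sP => //; apply: lB; exact: mem_head.
have := measurable_cylinder_sub mW measurableT (Y := [set true]).
by rewrite setTI; apply.
Qed.

(** Peeling the survival events, then the rings from last to first, leaves the volume of ordered
    times. The probability depends on the word only through its length, so reversing a word
    preserves it. *)
Theorem word_law h : {subset h <= B} ->
  P (word_event h) = (expR (- ((size B)%:R * t)) * (if 0 <= t then t ^+ size h / (size h)`!%:R else 0))%:E.
Proof.
move=> hB.
transitivity (Phi h 0).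
  rewrite -(@Phi0 h B) // -[word_event h]setIT -integral_indic //; last first.
    exact: measurable_word_event.
  apply: eq_integral => w _; congr (_%:E).
  rewrite indicE; apply/esym; rewrite (_ : (w \in word_event h) =
    [&& in_order h w, last_time h w <= t &
    all (fun y => t < ring_time y (count_mem y h).+1 w) B]); last first.
    by apply/idP/idP; rewrite inE.
  rewrite andbA; case: (_ && _); last by rewrite mul0r.
  rewrite mul1r /= (eq_big_seq (fun y => ((t < ring_time y (count_mem y h).+1 w)%R)%:R)).
    elim: (B) => [|y l IH]; first by rewrite big_nil.
    by rewrite big_cons IH /=; case: (_ < _); rewrite ?mul1r ?mul0r.
  by move=> y yB; rewrite /factor yB; case: (_ < _).
suff H k : Phi h k = Phi [::] (size h + k).
  rewrite H addn0 /Phi -[RHS]mule1 -(@probability_setT _ _ _ P) -integral_cst //.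
  apply: eq_integral => w _; congr (_%:E).
  rewrite /= subr0 mul1r; congr (_ * _); rewrite /decay.
  under eq_bigr do rewrite ring_time0 subr0.
  rewrite big_const_seq count_predT; elim: (size B) => [|n IH] /=.
    by rewrite mul0r oppr0 expR0.
  by rewrite IH -expRD -natr1; congr expR; ring.
elim: h hB k => [|x h IH] hB k //.
have hB' : {subset h <= B} by move=> y yh; apply: hB; rewrite inE yh orbT.
rewrite PhiS //; last by apply: hB; exact: mem_head.
by rewrite IH // addnS addSn.
Qed.

End word_probability.

End word_law.

(** * Sorting operators and inversion of the state *)

Section sorting.

Definition sort_at (x : int) (e : int -> int) : int -> int := fun z =>
  if e (x + 1) < e x then
    if z == x then e (x + 1) else if z == x + 1 then e x else e z
  else e z.

Definition packed (x : int) : int := - x.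

Definition run (h : seq int) : int -> int := foldr sort_at packed h.

(* [unsort_at] is [sort_at] conjugated by inversion: it acts on types. *)
Definition unsort_at (i : int) (e f : int -> int) : int -> int := fun z =>
  if f (i + 1) < f i then
    if e z == i then i + 1 else if e z == i + 1 then i else e z
  else e z.

(** In the packed state the sites x and x + 1 carry the types -x and -x - 1; [flip x] is the smaller
    of the two. *)
Definition flip (x : int) : int := - x - 1.

Definition reversal (h : seq int) : seq int := rev (map flip h).

(* The left and right actions of the 0-Hecke monoid commute. *)
Lemma sort_unsort (x i : int) (e f : int -> int) : cancel e f -> cancel f e ->
  sort_at x (unsort_at i e f) = unsort_at i (sort_at x e) (unsort_at x f e).
Proof.
move=> ef fe; apply/funext => z.
have fE p q : (f q == p) = (e p == q).
  by apply/eqP/eqP => [<-|<-]; [exact: fe|exact: ef].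
have h1 := fE x i; have h2 := fE x (i + 1).
have h3 := fE (x + 1) i; have h4 := fE (x + 1) (i + 1).
have i1 : f i != f (i + 1) by apply/eqP => /(congr1 e); rewrite !fe; lia.
have x1 : e x != e (x + 1) by apply/eqP => /(congr1 f); rewrite !ef; lia.
have z1 : (e z == e x) = (z == x).
  by apply/eqP/eqP => [/(congr1 f)|->] //; rewrite !ef.
have z2 : (e z == e (x + 1)) = (z == x + 1).
  by apply/eqP/eqP => [/(congr1 f)|->] //; rewrite !ef.
rewrite /sort_at /unsort_at.
(* Only the order and the coincidences of these five values matter; once they are abstracted, the
   identity is a finite case analysis. *)
move: (e z) (e x) (e (x + 1)) (f i) (f (i + 1)) h1 h2 h3 h4 i1 x1 z1 z2 => ez ex ex1 fi fi1.
move=> h1 h2 h3 h4 i1 x1; rewrite h1 h2 h3 h4.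
case: (eqVneq z x) => zx; [move=> /eqP -> _|move=> n1].
  case: (ltP fi1 fi) => c1; case: (ltP ex1 ex) => c2;
  case: (eqVneq ex i) h1 => e1 h1; case: (eqVneq ex (i + 1)) h2 => e2 h2; try lia;
  case: (eqVneq ex1 i) h3 => e3 h3; case: (eqVneq ex1 (i + 1)) h4 => e4 h4; try lia;
  by move=> *; repeat case: ifP; lia.
case: (eqVneq z (x + 1)) => zx1; [move=> /eqP ->|move=> n2].
  case: (ltP fi1 fi) => c1; case: (ltP ex1 ex) => c2;
  case: (eqVneq ex i) h1 => e1 h1; case: (eqVneq ex (i + 1)) h2 => e2 h2; try lia;
  case: (eqVneq ex1 i) h3 => e3 h3; case: (eqVneq ex1 (i + 1)) h4 => e4 h4; try lia;
  by move=> *; repeat case: ifP; lia.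
case: (ltP fi1 fi) => c1; case: (ltP ex1 ex) => c2;
case: (eqVneq ex i) h1 => e1 h1; case: (eqVneq ex (i + 1)) h2 => e2 h2; try lia;
case: (eqVneq ex1 i) h3 => e3 h3; case: (eqVneq ex1 (i + 1)) h4 => e4 h4; try lia;
by move=> *; repeat case: ifP; lia.
Qed.

Lemma sort_at_cancel (x : int) (e f : int -> int) : cancel e f -> cancel f e ->
  cancel (sort_at x e) (unsort_at x f e).
Proof.
move=> ef fe z; rewrite /sort_at /unsort_at; case: (e (x + 1) < e x) => //.
case: (eqVneq z x) => [->|zx] /=; first by rewrite !ef eqxx; case: ifP => //; lia.
case: (eqVneq z (x + 1)) => [->|zx1] /=; first by rewrite !ef eqxx.
by rewrite !ef (negbTE zx) (negbTE zx1).
Qed.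

Lemma unsort_at_cancel (x : int) (e f : int -> int) : cancel e f -> cancel f e ->
  cancel (unsort_at x f e) (sort_at x e).
Proof.
move=> ef fe z; rewrite /sort_at /unsort_at; case: (e (x + 1) < e x) => //.
case: (eqVneq (f z) x) => [E|zx] /=.
  by rewrite eqxx -E fe; case: ifP => //; lia.
case: (eqVneq (f z) (x + 1)) => [E|zx1] /=; first by rewrite eqxx -E fe.
by rewrite (negbTE zx) (negbTE zx1).
Qed.

Lemma packedK : involutive packed. Proof. exact: opprK. Qed.

Lemma sort_packed (x : int) : sort_at x packed = unsort_at (flip x) packed packed.
Proof.
by apply/funext => z; rewrite /sort_at /unsort_at /packed /flip; repeat case: ifP; lia.
Qed.

Lemma run_bij h : exists2 f, cancel (run h) f & cancel f (run h).
Proof.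
elim: h => [|x h [f hf fh]]; first by exists packed; exact: packedK.
exists (unsort_at x f (run h)); first exact: sort_at_cancel.
exact: unsort_at_cancel.
Qed.

Lemma cancel_unique (e f g : int -> int) : cancel e f -> cancel g e -> f = g.
Proof. by move=> ef ge; apply/funext => z; rewrite -{1}(ge z) ef. Qed.

(** The operator applied first meets the packed state, where sorting positions is the same as
    sorting types; by commutation it is then carried through all later sortings. *)
Lemma run_rcons h i f : cancel (run h) f -> cancel f (run h) ->
  run (rcons h i) = unsort_at (flip i) (run h) f.
Proof.
elim: h f => [|x h IH] f hf fh.
  by rewrite /= sort_packed (cancel_unique hf packedK).
have [g hg gh] := run_bij h.
have -> : f = unsort_at x g (run h) by exact: cancel_unique hf (unsort_at_cancel x hg gh).
by rewrite /= (IH g hg gh) sort_unsort.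
Qed.

(* The inverse of a configuration reached from the packed one is reached by the
   reflected word read backwards. *)
Lemma run_reversal h :
  cancel (run h) (run (reversal h)) /\ cancel (run (reversal h)) (run h).
Proof.
elim: h => [|x h [IH1 IH2]]; first by split; exact: packedK.
have -> : run (reversal (x :: h)) = unsort_at x (run (reversal h)) (run h).
  rewrite /reversal /= rev_cons (run_rcons _ IH2 IH1).
  by rewrite (_ : flip (flip x) = x) // /flip; lia.
by split; [exact: sort_at_cancel|exact: unsort_at_cancel].
Qed.

End sorting.

Section words.
Variable B : seq int.

Fixpoint words (n : nat) : seq (seq int) :=
  if n is n'.+1 then [seq x :: h | x <- B, h <- words n'] else [:: [::]].

Lemma mem_words n h : (h \in words n) = (size h == n) && all (mem B) h.
Proof.
elim: n h => [|n IH] [|x h] //=.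
  by apply/allpairsP => -[[y g] /= [_ _]].
apply/allpairsP/idP => [[[y g] /= [yB + [-> ->]]]|/andP[hn /andP[xB hB]]].
  by rewrite IH eqSS => /andP[-> ->]; rewrite andbT.
by exists (x, h); split => //=; rewrite IH -eqSS hn.
Qed.

Lemma uniq_words n : uniq B -> uniq (words n).
Proof.
move=> uB; elim: n => [|n IH] //=.
by apply: allpairs_uniq => // -[x g] [y h] _ _ /= [-> ->].
Qed.

(** Reversal permutes the words of a given length because the alphabet is stable under [flip]. *)
Lemma sum_reversal (V : nmodType) n (f : seq int -> V) : uniq B ->
  (forall x, (flip x \in B) = (x \in B)) ->
  \sum_(h <- words n) f (reversal h) = \sum_(h <- words n) f h.
Proof.
move=> uB flipB; rewrite -(big_map reversal xpredT f); apply: perm_big.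
have revK : involutive reversal.
  move=> h; rewrite /reversal map_rev revK -map_comp map_id_in // => x _.
  by rewrite /= /flip; lia.
apply: uniq_perm; rewrite ?uniq_words // ?map_inj_uniq ?uniq_words //.
  exact: inv_inj.
move=> h; rewrite -{1}(revK h) mem_map; last exact: inv_inj.
rewrite !mem_words /reversal size_rev size_map all_rev all_map; congr (_ && _).
by apply: eq_all => x /=; exact: flipB.
Qed.

End words.

(** * The three-particle chain in the inverse picture *)

Section three_particles.

(* [SI p i j]: the particle of type y is at p + 1 + i, the two rightmost particles
   of larger type are at p and p - 1 - j.  [SII p i j]: it has been overtaken once,
   and the three particles are at p - 1 - i, p and p - 2 - i - j.  [SIII]: it has
   been overtaken twice. *)
Inductive state := SI of int & nat & nat | SII of int & nat & nat | SIII.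

Definition pos0 s : int :=
  match s with SI p i j => p + 1 + i%:Z | SII p i j => p - 1 - i%:Z | SIII => 0 end.
Definition pos1 s : int :=
  match s with SI p i j | SII p i j => p | SIII => 0 end.
Definition pos2 s : int :=
  match s with SI p i j => p - 1 - j%:Z | SII p i j => p - 2 - i%:Z - j%:Z | SIII => 0 end.

(** In [SII p 0 j] the right neighbour of the particle has larger type, so the move is blocked and
    the state stays. *)
Definition move0 s := match s with
  | SI p i j => SI p i.+1 j
  | SII p i.+1 j => SII p i j.+1
  | s => s end.

Definition move1 s := match s with
  | SI p 0 j => SII (p + 1) 0 j
  | SI p i.+1 j => SI (p + 1) i j.+1
  | SII p i j => SII (p + 1) i.+1 j
  | SIII => SIII end.

(** When the two larger particles are adjacent, their possible exchange is invisible because only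
    occupied positions are recorded; this is the predecessor truncated at 0. *)
Definition move2 s := match s with
  | SI p i j => SI p i j.-1
  | SII p i j.+1 => SII p i j
  | _ => SIII end.

Definition step (c : int) s :=
  if s is SIII then SIII else
  if c == pos0 s then move0 s else
  if c == pos1 s then move1 s else
  if c == pos2 s then move2 s else s.

Definition start (y : int) := SI (- y - 1) 0 0.

Definition track (y : int) (h : seq int) := foldr step (start y) h.

(** Right of [pos2] every other site has type below y; nothing is asserted left of it, which is what
    makes the three positions autonomous. *)
Definition tracked_at (y : int) (v : int -> int) (s : state) (t : int) : Prop :=
  [\/ t = pos0 s /\ v t = y, t = pos1 s /\ y < v t, t = pos2 s /\ y < v t |
   t < pos2 s \/ [/\ pos2 s < t, t <> pos0 s, t <> pos1 s & v t < y]].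

(** After two overtakings only the presence of two larger types on the right is retained: it
    persists forever and excludes the leader events. *)
Definition tracked (y : int) (v : int -> int) (s : state) : Prop :=
  if s is SIII then
    exists z q q', [/\ v z = y, z < q, z < q', q <> q' & y < v q /\ y < v q']
  else forall t, tracked_at y v s t.

Ltac tracked_hyp H := case: H => /= [[? ?]|[? ?]|[? ?]|[?|[? ? ? ?]]]; try (exfalso; lia).

Ltac tracked_goal := first [
  by constructor 1; lia | by constructor 2; lia | by constructor 3; lia |
  by constructor 4; left; lia | by constructor 4; right; split; lia].

Ltac tracked_tac v c t Hc Hc1 Ht :=
  rewrite /sort_at /tracked_at in Hc Hc1 Ht *;
  let vc := fresh "vc" in let vc1 := fresh "vc" in let vt := fresh "vt" in
  set vc := v c in Hc Hc1 Ht *; set vc1 := v (c + 1) in Hc Hc1 Ht *;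
  set vt := v t in Hc Hc1 Ht *; clearbody vc vc1 vt;
  case: (eqVneq t c) => ?; case: (eqVneq t (c + 1)) => ? /=; try (exfalso; lia);
  tracked_hyp Hc; tracked_hyp Hc1; case: (ltP vc1 vc) => ? /=; try (exfalso; lia);
  tracked_hyp Ht; tracked_goal.

Lemma tracked_step3 y v c : tracked y v SIII -> tracked y (sort_at c v) SIII.
Proof.
move=> [z [q [q' [vz zq zq' qq' [vq vq']]]]].
(* [sw] follows particles through the possible swap, which never reverses a pair that is already in
   increasing order. *)
pose sw (x : int) : int := if v (c + 1) < v c then (if x == c then c + 1 else if x == c + 1 then c else x) else x.
have swE x : sort_at c v (sw x) = v x.
  rewrite /sort_at /sw; case: (v (c + 1) < v c) => //=.
  case: (eqVneq x c) => [->|xc] /=; first by rewrite eqxx; case: ifP => //; lia.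
  case: (eqVneq x (c + 1)) => [->|xc1] /=; first by rewrite eqxx.
  by rewrite (negbTE xc) (negbTE xc1).
have swlt x x' : v x < v x' -> x < x' -> sw x < sw x'.
  move=> h1 h2; rewrite /sw; case: (ltP (v (c + 1)) (v c)) => // h3.
  case: (eqVneq x c) => xc; case: (eqVneq x' (c + 1)) => xc1; repeat case: ifP; try lia.
  by move: h1; rewrite xc xc1; lia.
have swinj x x' : sw x = sw x' -> x = x'.
  by rewrite /sw; case: ifP => //; repeat case: ifP; lia.
exists (sw z), (sw q), (sw q'); rewrite !swE; split => //.
- by apply: swlt => //; rewrite vz.
- by apply: swlt => //; rewrite vz.
- by move/swinj.
Qed.

Lemma tracked_step1 y v c p i j : tracked y v (SI p i j) ->
  tracked y (sort_at c v) (step c (SI p i j)).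
Proof.
move=> H; have Hc := H c; have Hc1 := H (c + 1).
rewrite /step; case: (eqVneq c _) => /= c0.
  by move=> t; have Ht := H t; clear H; tracked_tac v c t Hc Hc1 Ht.
case: (eqVneq c p) => /= c1.
  case: i H Hc Hc1 c0 => [|i] H Hc Hc1 /= c0 t; have Ht := H t; clear H;
    by tracked_tac v c t Hc Hc1 Ht.
case: (eqVneq c _) => /= c2.
  case: j H Hc Hc1 c2 => [|j] H Hc Hc1 /= c2 t; have Ht := H t; clear H;
    by tracked_tac v c t Hc Hc1 Ht.
by move=> t; have Ht := H t; clear H; tracked_tac v c t Hc Hc1 Ht.
Qed.

Lemma tracked_step2 y v c p i j : tracked y v (SII p i j) ->
  tracked y (sort_at c v) (step c (SII p i j)).
Proof.
move=> H; have Hc := H c; have Hc1 := H (c + 1); have Hp := H p.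
rewrite /step; case: (eqVneq c _) => /= c0.
  clear Hp; case: i H Hc Hc1 c0 => [|i] H Hc Hc1 /= c0 t; have Ht := H t; clear H;
    by tracked_tac v c t Hc Hc1 Ht.
case: (eqVneq c p) => /= c1.
  clear Hp; by move=> t; have Ht := H t; clear H; tracked_tac v c t Hc Hc1 Ht.
case: (eqVneq c _) => /= c2; last first.
  clear Hp; by move=> t; have Ht := H t; clear H; tracked_tac v c t Hc Hc1 Ht.
case: j H Hc Hc1 Hp c2 => [|j] H Hc Hc1 Hp /= c2; last first.
  clear Hp; by move=> t; have Ht := H t; clear H; tracked_tac v c t Hc Hc1 Ht.
have vc : y < v c by rewrite /tracked_at /= in Hc; tracked_hyp Hc.
have vc1 : v (c + 1) = y by rewrite /tracked_at /= in Hc1; tracked_hyp Hc1.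
have vp : y < v p by rewrite /tracked_at /= in Hp; tracked_hyp Hp.
have lt_c : v (c + 1) < v c by rewrite vc1.
have Nc : (c + 1 == c) = false by lia.
have pc : (p == c) = false by lia.
have pc1 : (p == c + 1) = false by lia.
(* The second larger particle has just overtaken y: now y is at c, that particle at c + 1, and the
   first one still at p. *)
exists c, (c + 1), p; rewrite /sort_at lt_c eqxx Nc eqxx pc pc1.
by split=> //; lia.
Qed.

Lemma tracked_step y v s c : tracked y v s -> tracked y (sort_at c v) (step c s).
Proof.
case: s => [p i j|p i j|]; [exact: tracked_step1|exact: tracked_step2|].
exact: tracked_step3.
Qed.

Lemma tracked_run y h : tracked y (run h) (track y h).
Proof.
elim: h => [|c h IH]; last exact: tracked_step.
move=> t; rewrite /tracked_at /= /packed.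
have [t0|t0] := eqVneq t (- y); first by constructor 1; lia.
have [t1|t1] := eqVneq t (- y - 1); first by constructor 2; lia.
have [t2|t2] := eqVneq t (- y - 2); first by constructor 3; lia.
by constructor 4; have [h|h] := ltP t (- y - 2); [left|right; split]; lia.
Qed.

Definition two_leaders (k : int) (a b : nat) (s : state) : bool :=
  if s is SIII then false else
  [&& pos1 s == k + a%:Z, pos0 s == k + b%:Z & pos2 s < k].

Definition one_leader (k : int) (a : nat) (s : state) : bool :=
  if s is SIII then false else (pos0 s == k + a%:Z) && (pos1 s < k).

(* In terms of [e := v^-1]: position y carries the second leader, of type k + b,
   and the leader has type k + a. *)
Definition second_at (k : int) (a b : nat) (y : int) (e : int -> int) : Prop :=
  e y = k + b%:Z /\ exists x, [/\ y < x, e x = k + a%:Z &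
      forall x', y < x' -> x' <> x -> e x' < k].

Definition first_at (k : int) (a : nat) (y : int) (e : int -> int) : Prop :=
  e y = k + a%:Z /\ forall x, y < x -> e x < k.

Lemma trackedP y v s : s <> SIII -> tracked y v s ->
  [/\ v (pos0 s) = y, y < v (pos1 s) & y < v (pos2 s)] /\
  [/\ pos2 s < pos0 s, pos2 s < pos1 s & forall t, pos2 s < t ->
      t <> pos0 s -> t <> pos1 s -> v t < y].
Proof.
move=> sN Hs; have H : forall t, tracked_at y v s t by case: s sN Hs.
have [p20 p21 p01] : [/\ pos2 s < pos0 s, pos2 s < pos1 s & pos0 s <> pos1 s].
  by clear Hs H; case: s sN => [p i j|p i j|] //= _; split; lia.
clear Hs sN; have H0 := H (pos0 s); have H1 := H (pos1 s); have H2 := H (pos2 s).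
move: H H0 H1 H2 p20 p21 p01; rewrite /tracked_at.
move: (pos0 s) (pos1 s) (pos2 s) => p0 p1 p2 H H0 H1 H2 p20 p21 p01.
split; split=> //.
- by clear H H1 H2; tracked_hyp H0.
- by clear H H0 H2; tracked_hyp H1.
- by clear H H0 H1; tracked_hyp H2.
- by move=> t ? ? ?; clear H0 H1 H2; have h := H t; clear H; tracked_hyp h.
Qed.

Section inverse_events.
Variables (y : int) (v e : int -> int) (s : state).
Hypotheses (ve : cancel v e) (ev : cancel e v) (vs : tracked y v s).

(** For [v] inverse to [e], a position beyond y is a particle of type larger than y, so the
    conditions on the leaders become conditions on the two rightmost such particles. *)
Lemma second_atP k a b : second_at k a b y e <-> two_leaders k a b s.
Proof.
have -> : second_at k a b y e <-> [/\ e y = k + b%:Z, exists2 x, y < x & e x = k + a%:Z &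
      forall x, y < x -> e x <> k + a%:Z -> e x < k].
  split=> [[h1 [x [yx ex h2]]]|[h1 [x yx ex] h2]].
    by split=> //; [exists x|move=> x' yx' ex'; apply: h2 => // E; apply: ex'; rewrite E].
  split=> //; exists x; split=> // x' yx' x'x; apply: h2 => // E.
  by apply: x'x; rewrite -(ev x') E -ex ev.
case E : s => [p i j|p i j|]; last first.
  split=> // -[h1 [x xy ex] h2].
  move: vs; rewrite E => -[z [q [q' [vz zq zq' qq' [vq vq']]]]].
  have zE : e y = z by rewrite -vz ve.
  have h3 := h2 _ vq; have h4 := h2 _ vq'; rewrite !ve in h3 h4.
  by have [qa|/eqP qa] := eqVneq q (k + a%:Z); lia.
all: have sN : s <> SIII by rewrite E.
all: rewrite -E; have [[v0 v1 v2] [p20 p21 H]] := trackedP sN vs.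
all: have -> : two_leaders k a b s = [&& pos1 s == k + a%:Z, pos0 s == k + b%:Z & pos2 s < k]
  by rewrite E.
all: have ey : e y = pos0 s by rewrite -v0 ve.
all: split=> [[h1 [x xy ex] h2]|/and3P[/eqP h1 /eqP h2 h3]].
all: try (split; [by rewrite ey|by exists (v (pos1 s)); rewrite ?ve|move=> x xy xa];
  rewrite ltNge; apply/negP => ke;
  have := H (e x); rewrite ev => /(_ (lt_le_trans h3 ke));
  rewrite -h1 in xa; have [x0|/eqP x0] := eqVneq (e x) (pos0 s);
    [by move: xy; rewrite -(ev x) x0 v0 ltxx|by move=> /(_ x0 xa); lia]).
all: have a1 : pos1 s = k + a%:Z by (have [//|/eqP a1] := eqVneq (pos1 s) (k + a%:Z);
  have := h2 _ v1; rewrite ve => /(_ a1) p1k;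
  have := H (e x); rewrite ev ex => /(_ ltac:(lia));
  have [x0|/eqP x0] := eqVneq (k + a%:Z) (pos0 s);
    [by move: xy; rewrite -(ev x) ex x0 v0 ltxx|by move=> /(_ x0 ltac:(lia)); lia]).
all: apply/and3P; split; [exact/eqP|by rewrite -ey h1|].
all: by have := h2 _ v2; rewrite ve => /(_ ltac:(lia)).
Qed.

Lemma first_atP k a : first_at k a y e <-> one_leader k a s.
Proof.
case E : s => [p i j|p i j|]; last first.
  split=> // -[h1 h2].
  move: vs; rewrite E => -[z [q [q' [vz zq zq' qq' [vq vq']]]]].
  have zE : e y = z by rewrite -vz ve.
  by have := h2 _ vq; rewrite ve; lia.
all: have sN : s <> SIII by rewrite E.
all: rewrite -E; have [[v0 v1 v2] [p20 p21 H]] := trackedP sN vs.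
all: have -> : one_leader k a s = (pos0 s == k + a%:Z) && (pos1 s < k) by rewrite E.
all: have ey : e y = pos0 s by rewrite -v0 ve.
all: split=> [[h1 h2]|/andP[/eqP h1 h2]].
all: try (apply/andP; split; [by rewrite -ey h1|by have := h2 _ v1; rewrite ve]).
all: split; [by rewrite ey|move=> x xy; rewrite ltNge; apply/negP => ke].
all: have := H (e x); rewrite ev => /(_ ltac:(lia)).
all: have [x0|/eqP x0] := eqVneq (e x) (pos0 s);
  [by move: xy; rewrite -(ev x) x0 v0 ltxx|by move=> /(_ x0 ltac:(lia)); lia].
Qed.

End inverse_events.

End three_particles.

(** * Counting words by the moves they induce *)

Section counting.
Context {R : realType}.
Implicit Types (phi : state -> R) (s : state) (N n m : nat).

Definition bonds N : seq int := [seq (i%:Z - N%:Z) | i <- iota 0 (N + N)].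

Lemma mem_bonds N (x : int) : (x \in bonds N) = (- N%:Z <= x < N%:Z).
Proof.
apply/mapP/idP => [[i]|h]; first by rewrite mem_iota => ? ->; lia.
by exists (absz (x + N%:Z)); rewrite ?mem_iota; lia.
Qed.

Lemma uniq_bonds N : uniq (bonds N).
Proof. by rewrite map_inj_uniq ?iota_uniq // => i j; lia. Qed.

Lemma size_bonds N : size (bonds N) = (N + N)%N.
Proof. by rewrite size_map size_iota. Qed.

Lemma flip_bonds N (x : int) : (flip x \in bonds N) = (x \in bonds N).
Proof. by rewrite !mem_bonds /flip; lia. Qed.

Definition letter_sum N phi s : R := \sum_(c <- bonds N) phi (step c s).

Definition move_sum phi s : R := phi (move0 s) + phi (move1 s) + phi (move2 s).

Lemma sum_words_track N n phi y :
  \sum_(h <- words (bonds N) n) phi (track y h) = iter n (letter_sum N) phi (start y).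
Proof.
elim: n phi => [|n IH] phi; first by rewrite big_seq1.
rewrite iterSr -IH /= big_allpairs_dep exchange_big /=.
by apply: eq_bigr => h _.
Qed.

(** The larger of the two positions never decreases along moves, so a state that has left the window
    stays out; [SIII] is included because the leader observables vanish on it. *)
Definition dead N s : bool := if s is SIII then true else (N%:Z <= pos0 s) || (N%:Z <= pos1 s).

Definition valid N s : bool := if s is SIII then true else - N%:Z <= pos2 s.

Lemma dead_moves N s : dead N s -> [/\ dead N (move0 s), dead N (move1 s) & dead N (move2 s)].
Proof.
by case: s => [p [|i] [|j]|p [|i] [|j]|] //= h; split => //; lia.
Qed.

Lemma valid_moves N s : valid N s -> [/\ valid N (move0 s), valid N (move1 s) & valid N (move2 s)].
Proof.
by case: s => [p [|i] [|j]|p [|i] [|j]|] //= h; split => //; lia.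
Qed.

Lemma stepP c s : s <> SIII -> [/\ pos0 s != pos1 s, pos0 s != pos2 s & pos1 s != pos2 s] /\
  step c s = if c == pos0 s then move0 s else if c == pos1 s then move1 s else
    if c == pos2 s then move2 s else s.
Proof. by case: s => [p i j|p i j|] //= _; split=> //; split; lia. Qed.

Lemma step_ind (Q : pred state) c s : Q s -> [/\ Q (move0 s), Q (move1 s) & Q (move2 s)] ->
  Q (step c s).
Proof. by case: s => [p i j|p i j|] //= h [h0 h1 h2]; rewrite /step; repeat case: ifP. Qed.

Lemma valid_step N c s : valid N s -> valid N (step c s).
Proof. by move=> h; apply: (step_ind (Q := valid N)) => //; exact: valid_moves. Qed.

Lemma dead_step N c s : dead N s -> dead N (step c s).
Proof. by move=> h; apply: (step_ind (Q := dead N)) => //; exact: dead_moves. Qed.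

(** Three distinct letters of the window act on a live state, one per tracked particle, and all
    others leave it alone; on dead states both sides vanish. *)
Lemma letter_sum_split N phi s : (forall s, dead N s -> phi s = 0) -> valid N s ->
  letter_sum N phi s = ((N + N)%:R - 3) * phi s + move_sum phi s.
Proof.
move=> phi0 vs; have [ds|ds] := boolP (dead N s).
  have [d0 d1 d2] := dead_moves ds.
  rewrite /letter_sum /move_sum !phi0 // big1_seq => [|c _]; first by rewrite mulr0 !addr0.
  by rewrite phi0 //; exact: dead_step.
have sN : s <> SIII by move=> E; rewrite E in ds.
have [p0 p1 p2] : [/\ pos0 s \in bonds N, pos1 s \in bonds N & pos2 s \in bonds N].
  by move: vs ds; case: s sN => [p i j|p i j|] //= _; rewrite !mem_bonds => ? ?; split; lia.
have ind1 (p : int) (X : R) : p \in bonds N -> \sum_(c <- bonds N) (c == p)%:R * X = X.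
  move=> pB; rewrite (bigD1_seq p) ?uniq_bonds //= eqxx mul1r big1 ?addr0 // => c /negbTE ->.
  by rewrite mul0r.
have H c : phi (step c s) = phi s + (c == pos0 s)%:R * (phi (move0 s) - phi s) +
    (c == pos1 s)%:R * (phi (move1 s) - phi s) + (c == pos2 s)%:R * (phi (move2 s) - phi s).
  have [[n01 n02 n12] ->] := stepP c sN.
  case: (eqVneq c (pos0 s)) => [->|_] /=.
    by rewrite (negbTE n01) (negbTE n02) mul1r !mul0r !addr0 addrC subrK.
  case: (eqVneq c (pos1 s)) => [->|_] /=.
    by rewrite (negbTE n12) mul1r !mul0r !addr0 addrC subrK.
  by case: (eqVneq c (pos2 s)) => _ /=; rewrite ?mul1r !mul0r !addr0 // addrC subrK.
rewrite /letter_sum; under eq_bigr do rewrite H.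
rewrite !big_split /= !ind1 // big_const_seq count_predT size_bonds /move_sum.
rewrite iter_addr_0 -mulr_natl; ring.
Qed.

(** Binomial expansion: the idle letters act as the scalar 2N - 3, which commutes with
    [move_sum]. *)
Lemma iter_letter_sum N phi : (forall s, dead N s -> phi s = 0) -> forall n s, valid N s ->
  iter n (letter_sum N) phi s = \sum_(m < n.+1) 'C(n, m)%:R *
    ((N + N)%:R - 3) ^+ (n - m) * iter m move_sum phi s.
Proof.
move=> phi0.
have M0 m s : dead N s -> iter m move_sum phi s = 0.
  elim: m s => [|m IH] s ds; first exact: phi0.
  by have [d0 d1 d2] := dead_moves ds; rewrite iterS /move_sum !IH // !addr0.
elim=> [|n IH] s vs.
  by rewrite big_ord_recl big_ord0 /= bin0 subnn expr0 !mul1r addr0.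
rewrite iterS /letter_sum.
under eq_bigr do rewrite IH ?valid_step //.
rewrite exchange_big /=.
set b : R := _ - 3.
rewrite (eq_bigr (fun m : 'I_n.+1 => 'C(n, m)%:R * b ^+ (n - m) * (b * iter m move_sum phi s) +
    'C(n, m)%:R * b ^+ (n - m) * iter m.+1 move_sum phi s)); last first.
  by move=> m _; rewrite -mulr_sumr -mulrDr; congr (_ * _); exact: letter_sum_split (M0 m) vs.
rewrite big_split /= [in RHS]big_ord_recl /= bin0 mul1r subn0.
rewrite [X in _ = _ + X](_ : _ = \sum_(i < n.+1) 'C(n, i.+1)%:R * b ^+ (n - i) * iter i.+1 move_sum phi s +
   \sum_(i < n.+1) 'C(n, i)%:R * b ^+ (n - i) * iter i.+1 move_sum phi s); last first.
  rewrite -big_split /=; apply: eq_bigr => i _.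
  by rewrite /bump /= add1n binS subSS natrD; ring.
rewrite addrA; congr (_ + _).
rewrite [in LHS]big_ord_recl [in RHS]big_ord_recr /= bin0 bin_small // !mul0r addr0 subn0.
rewrite mul1r mulrA -exprSr; congr (_ + _).
apply: eq_bigr => i _; rewrite /bump /= add1n.
by rewrite !mulrA -[_ * _ * b]mulrA -exprSr subnSK.
Qed.

End counting.

(** * Sample paths as words between silent clocks *)

Section paths.
Context {d} {Omega : measurableType d} {R : realType} (P : probability Omega R).
Variables (tau : int * nat -> {RV P >-> R}) (e : R -> int -> int) (w : Omega).
Hypothesis tau_ge0 : forall i, 0 <= tau i w.
Hypothesis path_e : tasep_path (rings_at tau w) e.
Hypothesis e0 : e 0 = packed.

Lemma ring_time_mono (x : int) m n : (m <= n)%N -> ring_time tau x m w <= ring_time tau x n w.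
Proof.
move=> mn; rewrite -(subnKC mn); elim: (n - m)%N => [|p IH]; first by rewrite addn0.
by rewrite addnS ring_timeS; apply: le_trans IH _; rewrite lerDl.
Qed.

Lemma no_ring (h : seq int) (y : int) s u : in_order tau h w -> last_time tau h w <= s ->
  u < ring_time tau y (count_mem y h).+1 w ->
  forall v, s < v -> v <= u -> ~ rings_at tau w y v.
Proof.
move=> oh hs uy v sv vu [n vE]; have {}vE : v = ring_time tau y n.+1 w by [].
have [nc|cn] := ltnP n (count_mem y h).
  have := ring_time_mono y nc; rewrite -vE => h1.
  have := le_lt_trans (le_trans h1 (le_trans (ring_time_le_last y oh) hs)) sv.
  by rewrite ltxx.
have := ring_time_mono y (n := n.+1) (m := (count_mem y h).+1) cn; rewrite -vE => h1.
by have := lt_le_trans uy (le_trans h1 vu); rewrite ltxx.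
Qed.

(** When the bonds l and r are silent, the sites l + 1, ..., r evolve by themselves. The induction
    removes the latest ring; just before it the state is that of the shorter history. *)
Lemma path_block (B : seq int) (l r : int) (h : seq int) u :
  (forall y, l <= y <= r -> y \in B) -> l \notin h -> r \notin h ->
  in_order tau h w -> last_time tau h w <= u ->
  (forall y, y \in B -> u < ring_time tau y (count_mem y h).+1 w) ->
  forall x, l < x <= r -> e u x = run h x.
Proof.
move=> lrB; elim: h u => [|z h IH] u.
  move=> _ _ _ /= u0 uB x lxr; rewrite -e0; apply: path_e.1 => // v v0 vu.
  by split; apply: (no_ring (h := [::]) (s := 0) (u := u)) => //; apply: uB; apply: lrB; lia.
rewrite !inE !negb_or => /andP[lz lh] /andP[rz rh] oh Lu uB x lxr.
have oh' : in_order tau h w by case/andP: oh.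
set L := last_time tau (z :: h) w in Lu.
have lastL : last_time tau h w < L by case/andP: oh.
have before s : last_time tau h w <= s -> s < L -> forall y, y \in B ->
    s < ring_time tau y (count_mem y h).+1 w.
  move=> _ sL y yB; have [yz|yz] := eqVneq y z; first by rewrite yz.
  have := uB y yB; rewrite /= eq_sym (negbTE yz) add0n.
  by apply: lt_trans; exact: lt_le_trans sL Lu.
have after y : y \in B -> forall v, L < v -> v <= u -> ~ rings_at tau w y v.
  by move=> yB; apply: (no_ring (h := z :: h)) => //; exact: uB.
have L0 : 0 < L by exact: le_lt_trans (last_time_ge0 oh') lastL.
have xB : (x - 1 \in B) /\ (x \in B) by split; apply: lrB; lia.
have ringL : rings_at tau w z L by exists (count_mem z h).
have uL : e u x = e L x.
  apply: path_e.1 => //; first exact: ltW.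
  by move=> v Lv vu; split; apply: after => //; case: xB.
have other y : y \in B -> y <> z -> forall s v, last_time tau h w <= s ->
    s < v -> v <= u -> ~ rings_at tau w y v.
  move=> yB yz s v hs; apply: (no_ring (h := h)) => //.
  by have := uB y yB; rewrite /= eq_sym (negbTE (introN eqP yz)) add0n.
have [xz|xz] := boolP ((x == z) || (x == z + 1)); last first.
  have [xz1 xz2] : x <> z /\ x - 1 <> z by clear - xz; lia.
  rewrite (path_e.1 x (last_time tau h w) u) //; first last.
  - by move=> v hv vu; split; apply: other (lexx _) hv vu => //; case: xB.
  - exact: le_trans (ltW lastL) Lu.
  - exact: last_time_ge0.
  rewrite (IH _ lh rh oh' (lexx _)) //; last exact: before.
  have [n1 n2] : (x == z) = false /\ (x == z + 1) = false by clear - xz; lia.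
  by rewrite /= /sort_at n1 n2 if_same.
have zlr : (l < z) /\ (z < r) by clear - lxr lz rz xz; lia.
have swapL := path_e.2 z L L0 ringL.
(* [tasep_path] compares the state at [L] with states shortly before it; one of these times lies
   after the previous ring, where the induction hypothesis applies. *)
have [s [swap_s [Ls sL]]] : exists s, ((e L z, e L (z + 1)) =
       if e s (z + 1) < e s z then (e s (z + 1), e s z) else (e s z, e s (z + 1))) /\
       last_time tau h w < s /\ s < L.
  near L^'- => s; exists s; split; first by near: s.
  by split; near: s; [exact: nbhs_left_gt|exact: nbhs_left_lt].
have IHs := IH s lh rh oh' (ltW Ls) (before s (ltW Ls) sL).
have hz : l < z <= r by clear - zlr; lia.
have hz1 : l < z + 1 <= r by clear - zlr; lia.
rewrite uL /= /sort_at -(IHs x lxr) -(IHs z hz) -(IHs (z + 1) hz1).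
move: swap_s; case: (e s (z + 1) < e s z) => -[Ez Ez1].
  by case: (eqVneq x z) xz => [->|xz] //= /eqP ->; rewrite eqxx.
by case: (eqVneq x z) xz => [->|xz] //= /eqP ->.
Unshelve. all: by end_near.
Qed.

End paths.

(** * Ring histories partition the sample space *)

Section word_partition.
Context {d} {Omega : measurableType d} {R : realType} (P : probability Omega R).
Context {T : eqType} (tau : T * nat -> {RV P >-> R}).
Variables (B : seq T) (t : R).

Lemma last_time_cat h g w : in_order tau (h ++ g) w ->
  last_time tau g w <= last_time tau (h ++ g) w.
Proof.
elim: h => [|z h IH] //= /andP[h1 h2].
exact: le_trans (IH h2) (ltW h1).
Qed.

(** The ring of x comes directly after the past [g], so the next ring of another letter y is later,
    whether it occurs in [h] or only beyond [t]. *)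
Lemma next_ring h x g w y : word_event tau B t (h ++ x :: g) w -> y \in B -> y != x ->
  last_time tau (x :: g) w < ring_time tau y (count_mem y g).+1 w.
Proof.
move=> /and3P[oh ht /allP hB] yB yx.
have xy0 : (x == y) = false by rewrite eq_sym (negbTE yx).
have [yh|yh] := boolP (y \in h); last first.
  have := hB y yB; rewrite count_cat /= xy0 (count_memPn yh) !add0n.
  by apply: le_lt_trans; exact: le_trans (last_time_cat oh) ht.
clear ht hB; elim: h oh yh => [|z h IH] // /andP[zlt oh].
have [yh _|yh] := boolP (y \in h); first exact: IH.
rewrite inE (negbTE yh) orbF => /eqP yz; subst z.
move: zlt; rewrite /= count_cat /= xy0 (count_memPn yh) !add0n.
exact: (le_lt_trans (last_time_cat (g := x :: g) oh)).
Qed.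

(** Comparison starts at the oldest letters, which stand at the end of the lists. *)
Lemma suffix_cases (u v : seq T) : [\/ u = v, exists p x h, u = h ++ x :: p /\ v = p,
  exists p x h, v = h ++ x :: p /\ u = p |
  exists p x y h h', [/\ x != y, u = h ++ x :: p & v = h' ++ y :: p]].
Proof.
elim/last_ind: u v => [|u a IH] v.
  case/lastP: v => [|v b]; first by constructor 1.
  constructor 3; exists [::]; case: v => [|c v]; first by exists b, [::].
  have : rcons (c :: v) b = belast c (rcons v b) ++ [:: last c (rcons v b)].
    by rewrite cats1 -lastI.
  by move=> E; exists (last c (rcons v b)), (belast c (rcons v b)).
case/lastP: v => [|v b].
  constructor 2; exists [::], a, u; by rewrite cats1.
have [<-|ab] := eqVneq a b; last first.
  by constructor 4; exists [::], a, b, u, v; rewrite !cats1.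
case: (IH v) => [->|[p [x [h [-> ->]]]]|[p [x [h [-> ->]]]]|[p [x [y [h [h' [xy -> ->]]]]]]].
- by constructor 1.
- by constructor 2; exists (rcons p a), x, h; rewrite rcons_cat.
- by constructor 3; exists (rcons p a), x, h; rewrite rcons_cat.
- by constructor 4; exists (rcons p a), x, y, h, h'; rewrite !rcons_cat.
Qed.

Lemma word_event_prefix h x g w : x \in B -> word_event tau B t (h ++ x :: g) w ->
  word_event tau B t g w -> False.
Proof.
move=> xB /and3P[oh ht _] /and3P[_ _ /allP/(_ x xB)].
by rewrite ltNge (le_trans (last_time_cat oh) ht).
Qed.

(** At the first disagreement of two histories, each claims that its own letter rang before the
    other one; and a history that extends another has a ring that the shorter one forbids. *)
Lemma word_event_inj u v w : {subset u <= B} -> {subset v <= B} ->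
  word_event tau B t u w -> word_event tau B t v w -> u = v.
Proof.
move=> uB vB hu hv; case: (suffix_cases u v) => //.
- move=> [p [x [h [E F]]]]; rewrite E F in hu hv uB.
  exfalso; apply: word_event_prefix hu hv; apply: uB.
  by rewrite mem_cat mem_head orbT.
- move=> [p [x [h [E F]]]]; rewrite E F in hu hv vB.
  exfalso; apply: word_event_prefix hv hu; apply: vB.
  by rewrite mem_cat mem_head orbT.
- move=> [p [x [y [h [h' [xy E F]]]]]]; rewrite E F in hu hv uB vB.
  have xB : x \in B by apply: uB; rewrite mem_cat mem_head orbT.
  have yB : y \in B by apply: vB; rewrite mem_cat mem_head orbT.
  have := lt_trans (next_ring hu yB (introN eqP (fun E => elimN eqP xy (esym E))))
    (next_ring hv xB xy).
  by rewrite ltxx.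
Qed.

End word_partition.

Section word_probabilities.
Context {d} {Omega : measurableType d} {R : realType} (P : probability Omega R).
Variable tau : int * nat -> {RV P >-> R}.
Hypothesis indep : mutually_independent tau.
Hypothesis exp1 : forall i, exponential_rate1 (tau i).
Variables (t : R) (t0 : 0 <= t).

Local Notation A N h := (word_event tau (bonds N) t h).

Definition word_union N (f : pred (seq int)) : set Omega :=
  \bigcup_n \bigcup_(h in [set h | h \in words (bonds N) n /\ f h]) A N h.

Lemma words_sub N n h : h \in words (bonds N) n -> {subset h <= bonds N}.
Proof. by rewrite mem_words => /andP[_ /allP]. Qed.

Let level N f n := \big[setU/set0]_(h <- words (bonds N) n | f h) A N h.

Let levelE N f n w : level N f n w <-> exists2 h, h \in words (bonds N) n /\ f h & A N h w.
Proof.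
rewrite /level; elim: (words _ _) => [|g s IH].
  by rewrite big_nil; split=> // -[h []].
rewrite big_cons; case: ifPn => fg.
  split=> [[gw|/IH[h [hs fh] hw]]|[h [+ fh] hw]].
  - by exists g => //; rewrite mem_head.
  - by exists h => //; rewrite inE hs orbT.
  - rewrite inE => /predU1P[<-|hs]; first by left.
    by right; apply/IH; exists h.
rewrite IH; split=> -[h [hs fh] hw]; exists h => //; split=> //.
  by rewrite inE hs orbT.
by move: hs; rewrite inE => /predU1P[E|//]; rewrite -E fh in fg.
Qed.

Let measurable_level N f n : measurable (level N f n).
Proof.
rewrite /level big_seq_cond; apply: bigsetU_measurable => h /andP[hw _].
exact/measurable_word_event/words_sub/hw.
Qed.

Let prob_level N f n : P (level N f n) =
  (expR (- ((N + N)%:R * t)) * (t ^+ n / n`!%:R) * (count f (words (bonds N) n))%:R)%:E.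
Proof.
rewrite /level; have := uniq_words n (uniq_bonds N).
have : {subset words (bonds N) n <= words (bonds N) n} by [].
elim: {1 3 4 5}(words _ _) => [|g s IH] sw; first by rewrite big_nil measure0 mulr0.
have sw' : {subset s <= words (bonds N) n} by move=> h hs; apply: sw; rewrite inE hs orbT.
have gw : g \in words (bonds N) n by apply: sw; exact: mem_head.
move=> /= /andP[gs us]; rewrite big_cons; case: ifPn => fg; last by rewrite IH // add0n.
have ms : measurable (\big[setU/set0]_(h <- s | f h) A N h).
  rewrite big_seq_cond; apply: bigsetU_measurable => h /andP[hs _].
  exact/measurable_word_event/words_sub/(sw' _ hs).
rewrite measureU //; first last.
- rewrite predeqE => w; split=> // -[gA].
  elim: s gs us sw sw' {IH ms} => [|h s IH]; first by rewrite big_nil.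
  rewrite inE negb_or => /andP[gh gs] /= /andP[hs us] sw sw'.
  have hw : h \in words (bonds N) n by apply: sw'; exact: mem_head.
  have IH' : (\big[setU/set0]_(h <- s | f h) A N h) w -> set0 w.
    apply: IH => // x; rewrite ?inE => xs.
      by apply: sw; move: xs; rewrite !inE => /orP[->|->]; rewrite ?orbT.
    by apply: sw'; rewrite inE xs orbT.
  rewrite big_cons; case: ifP => // _ [hA|//].
  by move: gh; rewrite (word_event_inj (words_sub gw) (words_sub hw) gA hA) eqxx.
- exact/measurable_word_event/words_sub/gw.
have := word_law indep exp1 (uniq_bonds N) t (words_sub gw).
rewrite t0 size_bonds; move: gw; rewrite mem_words => /andP[/eqP -> _] Eg.
transitivity (P (A N g) + P (\big[setU/set0]_(h <- s | f h) A N h))%E => //.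
by rewrite Eg (IH sw' us) -EFinD (natrD _ true) mulrDr mulr1.
Qed.

Lemma word_unionE N f : word_union N f = \bigcup_n level N f n.
Proof.
rewrite predeqE => w; split=> -[n _].
  by move=> [h /= hf hA]; exists n => //; apply/levelE; exists h.
by move=> /levelE[h hf hA]; exists n => //; exists h.
Qed.

Lemma measurable_word_union N f : measurable (word_union N f).
Proof. by rewrite word_unionE; apply: bigcupT_measurable => n; exact: measurable_level. Qed.

Lemma prob_word_union N f : P (word_union N f) = (\sum_(n <oo)
  (expR (- ((N + N)%:R * t)) * (t ^+ n / n`!%:R) * (count f (words (bonds N) n))%:R)%:E)%E.
Proof.
rewrite word_unionE measure_bigcup //; first last.
- apply/trivIsetP => i j _ _ ij; rewrite predeqE => w; split=> // -[].
  move=> /levelE[g [gi _] gA] /levelE[h [hj _] hA].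
  have E := word_event_inj (words_sub gi) (words_sub hj) gA hA.
  move: gi hj; rewrite -E !mem_words => /andP[/eqP gi _] /andP[/eqP gj _].
  by move: ij; rewrite -gi -gj eqxx.
rewrite (eq_eseriesl (Q := xpredT)); last by move=> n; rewrite in_setT.
by apply: eq_eseriesr => n _; exact: prob_level.
Qed.

Lemma eseries_exp (x : R) : 0 <= x ->
  (\sum_(n <oo) (x ^+ n / n`!%:R)%:E = (expR x)%:E)%E.
Proof.
move=> x0; apply/cvg_lim => //.
rewrite (_ : (fun n => _) = EFin \o (series (exp_coeff x))); last first.
  by apply/funext => n /=; rewrite /series /= sumEFin.
by apply: cvg_EFin; [near=> n|exact: is_cvg_series_exp_coeff].
Unshelve. all: by end_near.
Qed.

(** The word probabilities sum to 1, so almost surely the window has a finite history; no separate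
    argument against infinitely many rings is made. *)
Lemma prob_word_unionT N : P (word_union N predT) = 1%E.
Proof.
rewrite prob_word_union.
have sz n : count predT (words (bonds N) n) = ((N + N) ^ n)%N.
  elim: n => [|n IH] //=; rewrite count_predT size_allpairs size_bonds.
  by rewrite -(count_predT (words _ _)) IH expnS.
transitivity (\sum_(n <oo) ((expR (- ((N + N)%:R * t)))%:E *
    (((N + N)%:R * t) ^+ n / n`!%:R)%:E))%E.
  by apply: eq_eseriesr => n _; rewrite sz -EFinM natrX exprMn; congr (_%:E); ring.
rewrite nneseriesZl; last by move=> n _; rewrite lee_fin divr_ge0 // exprn_ge0 // mulr_ge0.
rewrite eseries_exp ?mulr_ge0 //.
by rewrite -EFinM -expRD addNr expR0.
Qed.

End word_probabilities.

(** * Silent bonds and passage to infinite volume *)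

Section locality.
Context {d} {Omega : measurableType d} {R : realType} (P : probability Omega R).
Variable tau : int * nat -> {RV P >-> R}.
Hypothesis indep : mutually_independent tau.
Hypothesis exp1 : forall i, exponential_rate1 (tau i).
Variables (t : R) (t0 : 0 <= t).
Variable eta : R -> Omega -> int -> int.
Hypothesis eta0 : forall w x, eta 0 w x = - x.
Hypothesis path_eta :
  {ae P, forall w, tasep_path (rings_at tau w) (fun t => eta t w)}.

(** All clocks of [s] have rung by time [t]; off this event some bond of [s] is silent and separates
    the two sides. *)
Definition rung (s : seq int) : set Omega :=
  \bigcap_(i in [set` [seq (x, 0%N) | x <- s]]) tau i @^-1` `]-oo, t].

Lemma measurable_rung s : measurable (rung s).
Proof.
apply: fin_bigcap_measurable; first exact: finite_seq.
by move=> i _; rewrite -[X in measurable X]setTI; exact: measurable_funP.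
Qed.

Lemma prob_rung s : uniq s -> P (rung s) = ((1 - expR (- t)) ^+ size s)%:E.
Proof.
move=> us; rewrite /rung indep //; last by rewrite map_inj_uniq // => x y [].
have E i : P (tau i @^-1` `]-oo, t]) = (1 - expR (- t))%:E.
  have mt : measurable (tau i @^-1` `]-oo, t]).
    by rewrite -[X in measurable X]setTI; exact: measurable_funP.
  rewrite -[X in P X]setCK probability_setC; last exact: measurableC.
  rewrite EFinB; congr (_ - _)%E.
  have mtau : measurable_fun setT (tau i) by exact: measurable_funP.
  transitivity (\int[P]_w (if (t < tau i w)%R then 1 else 0)%:E)%E.
    rewrite -[X in P X]setIT -integral_indic //; last exact: measurableC.
    apply: eq_integral => w _; rewrite indicE; congr (_%:E).
    have -> : (w \in ~` tau i @^-1` `]-oo, t]) = (t < tau i w); last by case: (t < _).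
    apply/idP/idP; rewrite inE /= in_itv /= => h; first by move/negP : h; rewrite -ltNge.
    by apply/negP; rewrite -ltNge.
  rewrite (integral_exponential (f := fun u => (if (t < u)%R then 1 else 0)%:E)) //.
  - exact: integral_expRN_gt.
  - by apply/measurable_EFinP; apply: measurable_fun_ifT => //; exact: measurable_fun_ltr.
  - by move=> x; rewrite lee_fin; case: ifP.
rewrite big_map (eq_bigr (fun=> (1 - expR (- t))%:E)); last by move=> x _; exact: E.
elim: s {us} => [|x s IH]; first by rewrite big_nil.
by rewrite big_cons IH -EFinM -exprS.
Qed.

Lemma ring_prob_lt1 : 0 <= 1 - expR (- t) < 1.
Proof. by rewrite subr_ge0 -expR0 ler_expR oppr_le0 t0 /= ltrBlDr ltrDl expR_gt0. Qed.

Definition int_interval (l : int) (n : nat) : seq int := [seq l + i%:Z | i <- iota 0 n].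

Lemma uniq_int_interval l n : uniq (int_interval l n).
Proof. by rewrite map_inj_uniq ?iota_uniq // => i j; lia. Qed.

Lemma mem_int_interval l n x : (x \in int_interval l n) = (l <= x < l + n%:Z).
Proof.
apply/mapP/idP => [[i]|h]; first by rewrite mem_iota => ? ->; lia.
by exists (absz (x - l)); rewrite ?mem_iota; lia.
Qed.

Lemma not_rungP s w : ~ rung s w -> exists2 x, x \in s & t < tau (x, 0%N) w.
Proof.
move=> /existsNP[i /not_implyP[/= /mapP[x xs ->]]].
by rewrite in_itv /= => /negP; rewrite -ltNge; exists x.
Qed.

Lemma rung_null (f : nat -> seq int) : (forall n, uniq (f n)) -> (forall n, size (f n) = n) ->
  {ae P, forall w, exists2 n, true & exists2 x, x \in f n & t < tau (x, 0%N) w}.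
Proof.
move=> uf sf; exists (\bigcap_n rung (f n)); split.
- by apply: bigcapT_measurable => n; exact: measurable_rung.
- apply/eqP; rewrite eq_le measure_ge0 andbT; apply/lee_addgt0Pr => e e0.
  have /andP[q0 q1] := ring_prob_lt1.
  have qe : (1 - expR (- t)) ^+ n @[n --> \oo] --> (0 : R) by apply: cvg_expr; rewrite ger0_norm.
  move/cvgrPdist_lt : qe => /(_ e e0)[n _ /(_ n (leqnn n))] /=.
  rewrite sub0r normrN ger0_norm ?exprn_ge0 // => h.
  rewrite add0e; apply: (@le_trans _ _ (P (rung (f n)))).
    apply: le_measure; rewrite ?inE; first by apply: bigcapT_measurable => k; exact: measurable_rung.
      exact: measurable_rung.
    by move=> w; apply.
  by rewrite prob_rung // sf lee_fin ltW.
- move=> w nw n _; apply: contrapT => /not_rungP[x xf tx].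
  by apply: nw; exists n => //; exists x.
Qed.

Definition good (w : Omega) : Prop := [/\ forall i, 0 <= tau i w,
  tasep_path (rings_at tau w) (fun t => eta t w),
  forall z : int, exists2 r : int, z <= r & t < tau (r, 0%N) w,
  forall z : int, exists2 l : int, l <= z & t < tau (l, 0%N) w &
  forall N, exists n h, h \in words (bonds N) n /\ word_event tau (bonds N) t h w].

Lemma tau_ge0_ae i : {ae P, forall w, 0 <= tau i w}.
Proof.
exists (tau i @^-1` `]-oo, 0[); split.
- by rewrite -[X in measurable X]setTI; exact: measurable_funP.
- rewrite -[LHS]/(distribution P (tau i) _) exp1 // /exponential_prob.
  apply: integral0_eq => x; rewrite /= in_itv /= => x0.
  by rewrite lt0_exponential_pdf.
- by move=> w /= /negP; rewrite -ltNge in_itv.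
Qed.

Lemma ae_forall_count (T : countType) (Q : T -> Omega -> Prop) :
  (forall x, {ae P, forall w, Q x w}) -> {ae P, forall w, forall x, Q x w}.
Proof.
move=> hQ; have h n : {ae P, forall w, if unpickle n is Some x then Q x w else True}.
  by case: (unpickle n) => [x|]; [exact: hQ|apply: aeW].
have := ae_foralln h; apply: filterS => w hw x.
by have := hw (pickle x); rewrite pickleK.
Qed.

Lemma good_ae : {ae P, forall w, good w}.
Proof.
have c1 : {ae P, forall w, forall i, 0 <= tau i w}.
  by apply: ae_forall_count => i; exact: tau_ge0_ae.
have sz l n : size (int_interval l n) = n by rewrite size_map size_iota.
have c2 : {ae P, forall w, forall z : int, exists2 r : int, z <= r & t < tau (r, 0%N) w}.
  apply: ae_forall_count => z.
  have := rung_null (uniq_int_interval z) (sz z); apply: filterS => w [m _ [x]].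
  by rewrite mem_int_interval => /andP[? _] ?; exists x.
have c3 : {ae P, forall w, forall z : int, exists2 l : int, l <= z & t < tau (l, 0%N) w}.
  apply: ae_forall_count => z.
  have := rung_null (fun n => uniq_int_interval (z - n%:Z) n) (fun n => sz _ n).
  apply: filterS => w [m _ [x]].
  by rewrite mem_int_interval => /andP[_ ?] ?; exists x => //; lia.
have c4 : {ae P, forall w, forall N, exists n h,
    h \in words (bonds N) n /\ word_event tau (bonds N) t h w}.
  apply: ae_forall_count => N; exists (~` word_union tau t N predT); split.
  - exact/measurableC/measurable_word_union.
  - have := prob_word_unionT indep exp1 t0 N.
    have m := measurable_word_union tau t N predT.
    by rewrite probability_setC // => ->; rewrite subee.
  - move=> w nw [n _ [h /= [hw _] hA]]; apply: nw; by exists n, h.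
near=> w; split; near: w => //.
Unshelve. all: by end_near.
Qed.

(** Nothing crosses a silent bond, so right of r only the types that started there occur. *)
Lemma run_right r h x : r \notin h -> r < x -> run h x < - r.
Proof.
elim: h x => [|c h IH] x; first by rewrite /= /packed; lia.
rewrite inE negb_or => /andP[rc rh] rx /=; rewrite /sort_at.
have h1 := IH _ rh rx; case: ifP => // _.
case: (eqVneq x c) => [E|xc]; first by apply: IH => //; lia.
by case: (eqVneq x (c + 1)) => [E|xc1] //; apply: IH => //; lia.
Qed.

Lemma unrung_notin B h r w : good w -> t < tau (r, 0%N) w ->
  word_event tau B t h w -> r \notin h.
Proof.
move=> [g0 _ _ _ _] tr /and3P[oh ht _]; apply/negP => rh.
have := ring_time_le_last r oh.
have c0 : (0 < count_mem r h)%N by rewrite -has_count has_pred1.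
have := ring_time_mono (w := w) g0 r c0.
rewrite ring_timeS ring_time0 add0r => h1 h2.
by have := lt_le_trans tr (le_trans h1 (le_trans h2 ht)); rewrite ltxx.
Qed.

Lemma good_block N n h l r w : good w -> h \in words (bonds N) n ->
  word_event tau (bonds N) t h w -> - N%:Z <= l -> r < N%:Z ->
  t < tau (l, 0%N) w -> t < tau (r, 0%N) w ->
  forall x, l < x <= r -> eta t w x = run h x.
Proof.
move=> gw hw hA Nl rN tl tr; have [g0 gp _ _ _] := gw.
have lh := unrung_notin gw tl hA; have rh := unrung_notin gw tr hA.
case/and3P : hA => oh ht /allP hB.
apply: (path_block g0 gp _ (B := bonds N)) => //.
- by apply/funext => x; rewrite eta0.
- by move=> y; rewrite mem_bonds; lia.
Qed.

Lemma good_right r w x : good w -> t < tau (r, 0%N) w -> r < x -> eta t w x < - r.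
Proof.
move=> gw tr rx; have [_ _ g3 _ g5] := gw.
have [r' xr' tr'] := g3 x.
have [n [h [hw hA]]] := g5 (maxn `|r|%N `|r'|%N).+1.
rewrite (good_block gw hw hA (l := r) (r := r')) //; try lia.
by apply: run_right => //; exact: unrung_notin hA.
Qed.

Variables (y k : int) (Q : (int -> int) -> Prop).
Hypothesis Q_local : forall e e' : int -> int,
  (forall x, y <= x -> e x = e' x \/ (e x < k /\ e' x < k)) -> Q e -> Q e'.

Definition bad (M n : nat) : set Omega :=
  rung (int_interval M n) `|` rung (int_interval (- (M + n)%:Z) n).

(** [Q_local] lets [Q] see only types at least k at positions from y on. With silent bonds l and r
    on both sides, sites up to r agree with the finite word, and beyond r both configurations carry
    types below k. *)
Lemma good_window M n w : (`|y| < M)%N -> (`|k| < M)%N -> good w -> ~ bad M n w ->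
  Q (eta t w) <-> word_union tau t (M + n) (fun h => `[< Q (run h) >]) w.
Proof.
move=> yM kM gw /not_orP[/not_rungP[r rI tr] /not_rungP[l lI tl]].
move: rI lI; rewrite !mem_int_interval => rI lI.
have [_ _ _ _ g5] := gw; have [m [h [hw hA]]] := g5 (M + n)%N.
have agree x : y <= x -> eta t w x = run h x \/ (eta t w x < k /\ run h x < k).
  move=> yx; have [xr|rx] := leP x r.
    by left; apply: (good_block gw hw hA (l := l) (r := r)) => //; lia.
  right; have := good_right gw tr rx.
  have := run_right (unrung_notin gw tr hA) rx; lia.
split=> [Qe|[m' _ [h' /= [hw' /asboolP Qh'] hA']]].
  exists m => //; exists h => //=; split=> //; apply/asboolP.
  by apply: Q_local Qe; exact: agree.
have E := word_event_inj (words_sub hw) (words_sub hw') hA hA'.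
move: Qh'; rewrite -E; apply: Q_local => x yx.
by case: (agree x yx) => [->|[? ?]]; [left|right].
Qed.

(** The finite-window probabilities are eventually constant, and they differ from the
    infinite-volume one by at most the probability of [bad], which is geometrically small. *)
Lemma prob_local (c : \bar R) N0 : measurable [set w | Q (eta t w)] ->
  (forall N, (N0 <= N)%N -> P (word_union tau t N (fun h => `[< Q (run h) >])) = c) ->
  P [set w | Q (eta t w)] = c.
Proof.
move=> mQ cN; have [Z [mZ PZ0 Zgood]] := good_ae.
pose M := (maxn `|y| `|k|).+1.
pose q := 1 - expR (- t).
have mbad n : measurable (bad M n) by apply: measurableU; exact: measurable_rung.
have Pbad n : (P (bad M n) <= (q ^+ n + q ^+ n)%:E)%E.
  apply: le_trans (measureU2 P (measurable_rung _) (measurable_rung _)) _.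
  have pr l : P (rung (int_interval l n)) = (q ^+ n)%:E.
    by rewrite prob_rung ?uniq_int_interval // size_map size_iota.
  by rewrite EFinD -{1}(pr M) -(pr (- (M + n)%:Z)).
pose S n := word_union tau t (M + n) (fun h => `[< Q (run h) >]).
have mS n : measurable (S n) by exact: measurable_word_union.
have PbZ n : (P (bad M n `|` Z) <= (q ^+ n + q ^+ n)%:E)%E.
  apply: le_trans (measureU2 P (mbad n) mZ) _.
  by apply: (@le_trans _ _ (P (bad M n) + P Z)%E) => //; rewrite PZ0 adde0.
have mbZ n : measurable (bad M n `|` Z) by exact: measurableU.
have winP n w : ~ (bad M n `|` Z) w -> Q (eta t w) <-> S n w.
  move=> /not_orP[nb nZ]; apply: good_window => //; try by rewrite /M; lia.
  by apply: contrapT => ng; apply: nZ; exact: Zgood.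
have le1 n : (P [set w | Q (eta t w)] <= P (S n) + (q ^+ n + q ^+ n)%:E)%E.
  apply: le_trans (leeD (lexx _) (PbZ n)); apply: le_trans (measureU2 P (mS n) (mbZ n)).
  apply: le_measure; rewrite ?inE //; first exact: measurableU.
  move=> w Qw; have [b|nb] := pselect ((bad M n `|` Z) w); first by right.
  by left; apply/(winP _ _ nb).
have le2 n : (P (S n) <= P [set w | Q (eta t w)] + (q ^+ n + q ^+ n)%:E)%E.
  apply: le_trans (leeD (lexx _) (PbZ n)); apply: le_trans (measureU2 P mQ (mbZ n)).
  apply: le_measure; rewrite ?inE //; first exact: measurableU.
  move=> w Qw; have [b|nb] := pselect ((bad M n `|` Z) w); first by right.
  by left; apply/(winP _ _ nb).
have small e : 0 < e -> exists2 n, (N0 <= n)%N & q ^+ n + q ^+ n <= e.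
  move=> e0; have /andP[q0 q1] := ring_prob_lt1.
  have : q ^+ n @[n --> \oo] --> (0 : R) by apply: cvg_expr; rewrite ger0_norm.
  move/cvgrPdist_lt => /(_ (e / 2)); rewrite divr_gt0 // => /(_ isT)[n _ nP].
  exists (maxn n N0); first exact: leq_maxr.
  have := nP _ (leq_maxl n N0); rewrite /= sub0r normrN ger0_norm ?exprn_ge0 // => h.
  by rewrite [leRHS]splitr lerD // ltW.
apply/eqP; rewrite eq_le; apply/andP; split; apply/lee_addgt0Pr => e e0.
  have [n Nn qn] := small e e0; rewrite -(cN (M + n)%N); last exact: leq_trans Nn (leq_addl _ _).
  by apply: le_trans (le1 n) _; rewrite leeD2l // lee_fin.
have [n Nn qn] := small e e0; rewrite -(cN (M + n)%N); last exact: leq_trans Nn (leq_addl _ _).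
by apply: le_trans (le2 n) _; rewrite leeD2l // lee_fin.
Qed.

End locality.

(** * Summation over positions and Poisson thinning *)

Section translation.
Context {R : realType}.
Implicit Types (phi : state -> R) (s : state) (m : nat).

Definition shift (j : int) s := match s with
  | SI p i l => SI (p + j) i l | SII p i l => SII (p + j) i l | SIII => SIII end.

Lemma shift_moves j s : [/\ move0 (shift j s) = shift j (move0 s),
  move1 (shift j s) = shift j (move1 s) & move2 (shift j s) = shift j (move2 s)].
Proof. by case: s => [p [|i] [|l]|p [|i] [|l]|] /=; split; rewrite // addrAC. Qed.

Lemma iter_move_sum_shift j phi m s :
  iter m move_sum (phi \o shift j) s = iter m move_sum phi (shift j s).
Proof.
elim: m s => [|m IH] s //=; rewrite /move_sum /= -/(move_sum _) !IH.
by have [-> -> ->] := shift_moves j s.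
Qed.

Lemma iter_move_sum_ge0 phi m s : (forall s, 0 <= phi s) -> 0 <= iter m move_sum phi s.
Proof. by move=> p0; elim: m s => [|m IH] s //=; rewrite !addr_ge0. Qed.

Lemma iter_move_sum_le phi m s : (forall s, phi s <= 1) -> iter m move_sum phi s <= 3 ^+ m.
Proof.
move=> p1; elim: m s => [|m IH] s //=; rewrite exprS /move_sum.
apply: (@le_trans _ _ (3 ^+ m + 3 ^+ m + 3 ^+ m)); first by rewrite !lerD.
by rewrite -!mulr2n -mulrSr mulr_natl.
Qed.

(** Summation over a parameter commutes with [move_sum], so the observable may be summed in closed
    form before the moves are iterated. *)
Lemma esum_move_sum (T : choiceType) (D : set T) (F : T -> state -> R) (g : state -> R)
    (c : R) : 0 <= c -> (forall x s, 0 <= F x s) ->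
  (forall s, \esum_(x in D) (c * F x s)%:E = (c * g s)%:E)%E ->
  forall m s, (\esum_(x in D) (c * iter m move_sum (F x) s)%:E = (c * iter m move_sum g s)%:E)%E.
Proof.
move=> c0 F0 Fg; elim=> [|m IH] s; first exact: Fg.
have G0 x s' : (0 <= (c * iter m move_sum (F x) s')%:E)%E.
  by rewrite lee_fin mulr_ge0 // iter_move_sum_ge0.
rewrite iterS {2}/move_sum !mulrDr !EFinD -!IH -!esumD //; last by move=> x _; exact: adde_ge0.
by apply: eq_esum => x _; rewrite iterS /move_sum !mulrDr.
Qed.

Lemma esum_point (T : choiceType) (D : set T) (f : T -> R) (x0 : T) :
  (forall x, x != x0 -> f x = 0) -> 0 <= f x0 ->
  (\esum_(x in D) (f x)%:E = (if `[< D x0 >] then f x0 else 0)%:E)%E.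
Proof.
move=> f0 f1; rewrite esum_mkcond.
transitivity (\esum_(x in [set: T]) (if x \in [set x0] then (if `[< D x0 >] then f x0 else 0)%:E else 0%E))%E.
  apply: eq_esum => x _; have [->|xx0] := eqVneq x x0.
    rewrite (mem_set (erefl x0 : [set x0] x0)).
    by case: (asboolP (D x0)) => h; [rewrite (mem_set h)|rewrite (memNset h)].
  rewrite (f0 x xx0) if_same memNset //=; exact/eqP.
rewrite -esum_mkcond esum_set1 //; by rewrite lee_fin; case: ifP.
Qed.

Definition leader_gap (a : nat) (s : state) : R :=
  if s is SI p i j then ((a <= i)%N)%:R else 0.

(** The sum of [two_leaders k a b'] over all y and all b' >= b. A given state fits a single y and a
    single b', equal to a + i + 1 before the overtaking and to a - i - 1 after it. The tail in b is
    what later provides monotonicity. *)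
Definition leaders_gap (a b : nat) (s : state) : R := match s with
  | SI p i j => ((a <= j)%N && (b <= a + i.+1)%N)%:R
  | SII p i j => ((b + i.+1 <= a)%N && (a <= i + j.+1)%N)%:R
  | SIII => 0 end.

Lemma esum_one_leader k a (c : R) s : 0 <= c ->
  (\esum_(y in [set: int]) (c * (one_leader k a (shift (- y) s))%:R)%:E =
   (c * leader_gap a s)%:E)%E.
Proof.
move=> c0; case: s => [p i j|p i j|] /=.
- rewrite (@esum_point _ _ _ (p + 1 + i%:Z - k - a%:Z)) ?mulr_ge0 //.
    by rewrite asboolT //; congr (_%:E); congr (_ * (nat_of_bool _)%:R); lia.
  by move=> y /eqP yx; rewrite (_ : (_ == _) = false) ?mulr0 //; lia.
- rewrite esum1 ?mulr0 // => y _; rewrite (_ : (_ && _) = false) ?mulr0 //; lia.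
- by rewrite esum1 ?mulr0 // => y _; rewrite mulr0.
Qed.

Lemma esum_two_leaders k a b (c : R) s : 0 <= c ->
  (\esum_(x in [set x : int * nat | (b <= x.2)%N])
    (c * (two_leaders k a x.2 (shift (- x.1) s))%:R)%:E = (c * leaders_gap a b s)%:E)%E.
Proof.
move=> c0; case: s => [p i j|p i j|] /=.
- rewrite (@esum_point _ _ _ ((p - k - a%:Z, (a + i.+1)%N))) ?mulr_ge0 //=.
    congr (_%:E); case: asboolP => /= h; last first.
      by rewrite (_ : (_ && _) = false) ?mulr0 //; lia.
    congr (_ * (nat_of_bool _)%:R); lia.
  move=> [y b'] /=; rewrite xpair_eqE negb_and => h.
  by rewrite (_ : [&& _, _ & _] = false) ?mulr0 //; lia.
- have [ai|ai] := leqP i.+1 a; last first.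
    rewrite esum1 => [|[y b'] _ /=].
      by rewrite (_ : (_ && _) = false) ?mulr0 //; lia.
    by rewrite (_ : [&& _, _ & _] = false) ?mulr0 //; lia.
  rewrite (@esum_point _ _ _ ((p - k - a%:Z, (a - i.+1)%N))) ?mulr_ge0 //=.
    congr (_%:E); case: asboolP => /= h; last first.
      by rewrite (_ : (_ && _) = false) ?mulr0 //; lia.
    congr (_ * (nat_of_bool _)%:R); lia.
  move=> [y b'] /=; rewrite xpair_eqE negb_and => h.
  by rewrite (_ : [&& _, _ & _] = false) ?mulr0 //; lia.
- by rewrite esum1 ?mulr0 // => y _; rewrite mulr0.
Qed.

End translation.

Section poissonization.
Context {R : realType}.

(** Thinning of a Poisson process: the b idle letters only dilute the clock, and effective moves
    come at rate 3. *)
Lemma poissonization (a : nat -> R) (b t : R) : 0 <= b -> 0 <= t ->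
  (forall m, 0 <= a m) ->
  (\sum_(n <oo) (expR (- ((b + 3) * t)) * (t ^+ n / n`!%:R) *
     \sum_(m < n.+1) 'C(n, m)%:R * b ^+ (n - m) * a m)%:E =
  \sum_(m <oo) (expR (- (3 * t)) * (t ^+ m / m`!%:R) * a m)%:E)%E.
Proof.
move=> b0 t0 a0.
pose g m n : R := expR (- ((b + 3) * t)) * (t ^+ m / m`!%:R * a m) *
  (if (m <= n)%N then (b * t) ^+ (n - m) / (n - m)`!%:R else 0).
have g0 m n : 0 <= g m n.
  rewrite /g !mulr_ge0 ?expR_ge0 ?invr_ge0 ?exprn_ge0 //; case: ifP => // _.
  by rewrite divr_ge0 // exprn_ge0 // mulr_ge0.
transitivity (\sum_(n <oo) \sum_(m <oo) (g m n)%:E)%E.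
  apply: eq_eseriesr => n _.
  rewrite (nneseries_split 0 n.+1); last by move=> m _; rewrite lee_fin.
  rewrite [X in (_ + X)%E]eseries0; last first.
    by move=> m nm _; rewrite /g leqNgt nm mulr0.
  rewrite adde0 add0n sumEFin big_mkord; congr (_%:E); rewrite mulr_sumr.
  apply: eq_bigr => m _; have mn : (m <= n)%N by rewrite -ltnS.
  rewrite /g mn exprMn -(bin_fact mn) !natrM -{1}(subnKC mn) exprD.
  field; rewrite !pnatr_eq0 -!lt0n !fact_gt0 bin_gt0 mn //.
rewrite nneseries_interchange; last by move=> *; rewrite lee_fin.
apply: eq_eseriesr => m _.
rewrite (nneseries_split 0 m); last by move=> *; rewrite lee_fin.
rewrite add0n big_nat_cond big1 ?add0e => [|n /andP[/andP[_ nm] _]]; last first.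
  by rewrite /g leqNgt nm mulr0.
rewrite -{1}(add0n m) -nneseries_addn; last by move=> *; rewrite lee_fin.
transitivity (\sum_(n <oo) ((expR (- ((b + 3) * t)) * (t ^+ m / m`!%:R * a m))%:E *
    ((b * t) ^+ n / n`!%:R)%:E))%E.
  by apply: eq_eseriesr => n _; rewrite /g leq_addl addnK -EFinM.
rewrite nneseriesZl; last by move=> n _; rewrite lee_fin divr_ge0 ?exprn_ge0 ?mulr_ge0.
rewrite eseries_exp ?mulr_ge0 // -EFinM; congr (_%:E).
by rewrite (_ : - ((b + 3) * t) = - (b * t) - 3 * t) ?expRD ?expRN; [field; rewrite ?gt_eqF ?expR_gt0 ?ltr0n ?fact_gt0 //|ring].
Qed.

End poissonization.

Section measurable_predicates.
Context {d} {Omega : measurableType d}.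
Implicit Types Q : Omega -> Prop.

Lemma measurable_const (Q : Prop) : measurable [set w : Omega | Q].
Proof.
have [q|q] := pselect Q; [rewrite (_ : [set _ | _] = setT)|rewrite (_ : [set _ | _] = set0)] => //;
  by rewrite predeqE.
Qed.

Lemma measurable_not Q : measurable [set w | Q w] -> measurable [set w | ~ Q w].
Proof. exact: measurableC. Qed.

Lemma measurable_and Q Q' : measurable [set w | Q w] -> measurable [set w | Q' w] ->
  measurable [set w | Q w /\ Q' w].
Proof. exact: measurableI. Qed.

Lemma measurable_imply Q Q' : measurable [set w | Q w] -> measurable [set w | Q' w] ->
  measurable [set w | Q w -> Q' w].
Proof.
move=> mQ mQ'; rewrite (_ : [set w | _] = ~` [set w | Q w] `|` [set w | Q' w]).
  by apply: measurableU => //; exact: measurableC.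
rewrite predeqE => w; split=> [h|[q /q //|q _ //]].
by have [q|q] := pselect (Q w); [right; exact: h|left].
Qed.

Lemma measurable_exists (T : countType) (Q : T -> Omega -> Prop) :
  (forall x, measurable [set w | Q x w]) -> measurable [set w | exists x, Q x w].
Proof.
move=> mQ; rewrite (_ : [set w | _] = \bigcup_x [set w | Q x w]).
  exact: countable_bigcupT_measurable.
by rewrite predeqE => w; split=> [[x]|[x _]]; exists x.
Qed.

Lemma measurable_forall (T : countType) (Q : T -> Omega -> Prop) :
  (forall x, measurable [set w | Q x w]) -> measurable [set w | forall x, Q x w].
Proof.
move=> mQ; rewrite (_ : [set w | _] = ~` [set w | exists x, ~ Q x w]).
  by apply/measurableC/measurable_exists => x; exact: measurable_not.
by rewrite predeqE => w; split=> [h [x]|/forallNP h x]; [exact|exact: contrapT].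
Qed.

End measurable_predicates.

(** * Leader events as Poisson averages over the chain *)

Section leader_probabilities.
Context {d} {Omega : measurableType d} {R : realType} (P : probability Omega R).
Variable tau : int * nat -> {RV P >-> R}.
Hypothesis indep : mutually_independent tau.
Hypothesis exp1 : forall i, exponential_rate1 (tau i).
Variables (t : R) (t0 : 0 <= t).
Variable eta : R -> Omega -> int -> int.
Hypothesis eta0 : forall w x, eta 0 w x = - x.
Hypothesis path_eta :
  {ae P, forall w, tasep_path (rings_at tau w) (fun t => eta t w)}.
Hypothesis meas_eta : forall x i, measurable [set w | eta t w x = i].

Definition indic (f : state -> bool) (s : state) : R := (f s)%:R.

(** Combines locality, the equal weight of a word and its reversal, and thinning: an event of the
    state is computed by following one type in the inverse configuration. *)
Lemma prob_tracked (Q : (int -> int) -> Prop) (f : state -> bool) k y N0 :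
  (forall e e' : int -> int, (forall x, y <= x -> e x = e' x \/ (e x < k /\ e' x < k)) -> Q e -> Q e') ->
  measurable [set w | Q (eta t w)] ->
  (forall v e s, cancel v e -> cancel e v -> tracked y v s -> Q e <-> f s) ->
  (forall N s, (N0 <= N)%N -> dead N s -> f s = false) ->
  P [set w | Q (eta t w)] = (\sum_(m <oo) (expR (- (3 * t)) * (t ^+ m / m`!%:R) *
    iter m move_sum (indic f) (start y))%:E)%E.
Proof.
move=> Q_local mQ Qf f0.
apply: (@prob_local _ _ _ _ _ indep exp1 _ t0 eta eta0 path_eta y k Q Q_local _
  (N0 + absz y + 2)%N) => // N NN.
rewrite prob_word_union // -(poissonization (b := (N + N)%:R - 3)) //; first last.
- by move=> m; apply: iter_move_sum_ge0 => s; rewrite ler0n.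
- by rewrite subr_ge0 ler_nat; lia.
apply: eq_eseriesr => n _; congr (_%:E).
rewrite (_ : (N + N)%:R - 3 + 3 = (N + N)%:R); last by rewrite subrK.
congr (_ * _); rewrite -iter_letter_sum; last 2 first.
- by move=> s ds; rewrite /indic (f0 N) //; lia.
- by rewrite /= ; lia.
(* The sum over words is reversed here, so that the tracked configuration becomes the inverse of
   [run h]. *)
rewrite -sum_words_track -sum_reversal ?uniq_bonds //; last exact: flip_bonds.
rewrite -sum1_count natr_sum big_mkcond; apply: eq_bigr => h _.
have [c1 c2] := run_reversal h.
have := Qf _ _ _ c2 c1 (tracked_run y (reversal h)).
rewrite /indic; case: asboolP; case: (f _) => // h1 [h2 h3].
  by have := h2 h1.
by case: h1; exact: h3.
Qed.

Lemma measurable_eta_lt (x k : int) : measurable [set w | eta t w x < k].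
Proof.
rewrite (_ : [set w | _] = [set w | exists i, eta t w x = i /\ i < k]).
  apply: measurable_exists => i; apply: measurable_and => //; exact: measurable_const.
by rewrite predeqE => w; split=> /= [h|[i [-> //]]]; exists (eta t w x).
Qed.

Lemma measurable_first_at k a y : measurable [set w | first_at k a y (eta t w)].
Proof.
apply: measurable_and => //; apply: measurable_forall => x.
by apply: measurable_imply; [exact: measurable_const|exact: measurable_eta_lt].
Qed.

Lemma measurable_second_at k a b y : measurable [set w | second_at k a b y (eta t w)].
Proof.
apply: measurable_and => //; apply: measurable_exists => x.
rewrite (_ : [set w | _] = [set w | (y < x /\ eta t w x = k + a%:Z) /\
   forall x', y < x' -> x' <> x -> eta t w x' < k]); last first.
  by rewrite predeqE => w; split=> [[]|[[]]].
apply: measurable_and; first by apply: measurable_and => //; exact: measurable_const.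
apply: measurable_forall => x'; apply: measurable_imply; first exact: measurable_const.
by apply: measurable_imply; [exact: measurable_const|exact: measurable_eta_lt].
Qed.

Lemma prob_first_at k a y : P [set w | first_at k a y (eta t w)] =
  (\sum_(m <oo) (expR (- (3 * t)) * (t ^+ m / m`!%:R) *
    iter m move_sum (indic (one_leader k a)) (start y))%:E)%E.
Proof.
apply: (@prob_tracked _ _ k _ (absz (k + a%:Z) + absz k).+1).
- move=> e e' ee' [h1 h2]; split.
    by case: (ee' y (lexx _)) => [<- //|[]]; rewrite h1; lia.
  by move=> x yx; case: (ee' x (ltW yx)) => [<-|[]//]; exact: h2.
- exact: measurable_first_at.
- by move=> v e s ve ev /(first_atP ve ev).
- by move=> N s NN; rewrite /dead /one_leader; case: s => // *; lia.
Qed.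

Lemma prob_second_at k a b y : P [set w | second_at k a b y (eta t w)] =
  (\sum_(m <oo) (expR (- (3 * t)) * (t ^+ m / m`!%:R) *
    iter m move_sum (indic (two_leaders k a b)) (start y))%:E)%E.
Proof.
apply: (@prob_tracked _ _ k _ (absz (k + a%:Z) + absz (k + b%:Z)).+1).
- move=> e e' ee' [h1 [x [yx ex h2]]]; split.
    by case: (ee' y (lexx _)) => [<- //|[]]; rewrite h1; lia.
  exists x; split=> //.
    by case: (ee' x (ltW yx)) => [<- //|[]]; rewrite ex; lia.
  by move=> x' yx' xx'; case: (ee' x' (ltW yx')) => [<-|[]//]; exact: h2.
- exact: measurable_second_at.
- by move=> v e s ve ev /(second_atP ve ev).
- by move=> N s NN; rewrite /dead /two_leaders; case: s => // *; lia.
Qed.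

End leader_probabilities.

Section countable_additivity.
Context {R : realType}.
Local Open Scope ereal_scope.

Lemma measure_countable d (Omega : measurableType d) (mu : {measure set Omega -> \bar R})
    (T : countType) (D : set T) (F : T -> set Omega) :
  (forall x, measurable (F x)) -> trivIset D F ->
  mu (\bigcup_(x in D) F x) = \esum_(x in D) mu (F x).
Proof.
move=> mF tF.
pose H n := if pickle_inv n is Some x then (if x \in D then F x else set0) else set0.
have HE x : D x -> H (pickle x) = F x by move=> Dx; rewrite /H pickleK_inv mem_set.
have -> : \bigcup_(x in D) F x = \bigcup_n H n.
  rewrite predeqE => w; split=> [[x Dx Fx]|[n _]].
    by exists (pickle x) => //; rewrite HE.
  rewrite /H; case: (pickle_inv n) => [x|//]; case: ifPn => // /set_mem Dx Fx.
  by exists x.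
have mH n : measurable (H n).
  by rewrite /H; case: (pickle_inv n) => [x|//]; case: ifP.
rewrite measure_bigcup //; last first.
  move=> i j _ _ [w [Hi Hj]]; move: Hi Hj; rewrite /H.
  have := pickle_invK (T := T) i; have := pickle_invK (T := T) j.
  case: (pickle_inv i) => [x|//]; case: (pickle_inv j) => [x'|//] /= <- <-.
  case: ifPn => // /set_mem Dx Fx; case: ifPn => // /set_mem Dx' Fx'.
  by rewrite (tF x x' Dx Dx' (ex_intro _ w (conj Fx Fx'))).
rewrite nneseries_esum // (_ : [set x | _] = [set: nat]); last by rewrite predeqE => n; rewrite /= inE.
transitivity (\esum_(n in pickle @` D) mu (H n)).
  rewrite [RHS]esum_mkcond; apply: eq_esum => n _; case: ifPn => // /negP nD.
  rewrite /H; have := pickle_invK (T := T) n.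
  case: (pickle_inv n) => [x /= xn|_]; last by rewrite measure0.
  case: ifPn => [/set_mem Dx|_]; last by rewrite measure0.
  by case: nD; apply/mem_set; exists x.
rewrite esum_image; last by move=> x x' _ _; exact: (pcan_inj pickleK).
by apply: eq_esum => x Dx; rewrite HE.
Qed.

Lemma esum_nneseries (T : choiceType) (D : set T) (f : T -> nat -> \bar R) :
  (forall x m, 0 <= f x m) ->
  \esum_(x in D) \sum_(m <oo) f x m = \sum_(m <oo) \esum_(x in D) f x m.
Proof.
move=> f0; rewrite nneseries_esumT; last by move=> m; exact: esum_ge0.
under eq_esum do rewrite nneseries_esumT //.
rewrite !esum_esum //.
rewrite (reindex_esum ([set: nat] `*`` (fun=> D)) (D `*`` (fun=> [set: nat])) (fun p => (p.2, p.1))) //.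
split=> //=.
- by move=> [m x] [_ /= Dx].
- by move=> [m x] [m' x'] _ _ /= [-> ->].
- by move=> [x m] [/= Dx _]; exists (m, x).
Qed.

End countable_additivity.

(** * The gap chain seen from the leaders *)

Section gap_chain.
Context {d} {Omega : measurableType d} {R : realType} (P : probability Omega R).
Variable tau : int * nat -> {RV P >-> R}.
Hypothesis indep : mutually_independent tau.
Hypothesis exp1 : forall i, exponential_rate1 (tau i).
Variables (t : R) (t0 : 0 <= t).
Variable eta : R -> Omega -> int -> int.
Hypothesis eta0 : forall w x, eta 0 w x = - x.
Hypothesis path_eta :
  {ae P, forall w, tasep_path (rings_at tau w) (fun t => eta t w)}.
Hypothesis meas_eta : forall x i, measurable [set w | eta t w x = i].

Definition leads (k : int) (a : nat) (e : int -> int) : Prop :=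
  exists y, first_at k a y e.

Definition leads2 (k : int) (a b : nat) (e : int -> int) : Prop :=
  exists x : int * nat, (b <= x.2)%N /\ second_at k a x.2 x.1 e.

Definition gap_count (f : state -> R) (m : nat) : R := iter m move_sum f (SI 0 0 0).

Lemma start_shift y : start y = shift (- y) (SI (-1) 0 0).
Proof. by rewrite /start /=; congr (SI _ 0 0); lia. Qed.

Lemma gap_count_shift (f : state -> R) m j : (forall s, f (shift j s) = f s) ->
  iter m move_sum f (shift j (SI 0 0 0)) = gap_count f m.
Proof.
move=> fj; rewrite -iter_move_sum_shift; congr (iter m move_sum _ _).
by apply/funext => s /=.
Qed.

Let c m : R := expR (- (3 * t)) * (t ^+ m / m`!%:R).

Let c_ge0 m : 0 <= c m.
Proof. by rewrite /c mulr_ge0 ?expR_ge0 // divr_ge0 ?exprn_ge0. Qed.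

Lemma prob_leads k a : P [set w | leads k a (eta t w)] =
  (\sum_(m <oo) (c m * gap_count (leader_gap a) m)%:E)%E.
Proof.
rewrite (_ : [set w | _] = \bigcup_(y in [set: int]) [set w | first_at k a y (eta t w)]); last first.
  by rewrite predeqE => w; split=> [[y]|[y _]]; exists y.
rewrite measure_countable; last 2 first.
- by move=> y; exact: measurable_first_at.
- move=> y y' _ _ [w [[e1 h1] [e2 h2]]].
  have [yy|yy|//] := ltgtP y y'; [have := h1 _ yy|have := h2 _ yy]; lia.
rewrite (eq_esum (fun y _ => prob_first_at indep exp1 t0 eta0 path_eta meas_eta k a y)).
rewrite esum_nneseries; last first.
  move=> y m; rewrite lee_fin mulr_ge0 ?c_ge0 // iter_move_sum_ge0 // => s; exact: ler0n.
apply: eq_eseriesr => m _.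
rewrite -(@gap_count_shift _ m (-1)); last by case.
rewrite -[RHS](@esum_move_sum _ _ [set: int] (fun y s => indic (one_leader k a) (shift (- y) s))) //.
- apply: eq_esum => y _; rewrite start_shift -iter_move_sum_shift //.
- by move=> s; rewrite esum_one_leader.
Qed.

Lemma prob_leads2 k a b : P [set w | leads2 k a b (eta t w)] =
  (\sum_(m <oo) (c m * gap_count (leaders_gap a b) m)%:E)%E.
Proof.
rewrite (_ : [set w | _] = \bigcup_(x in [set x : int * nat | (b <= x.2)%N])
    [set w | second_at k a x.2 x.1 (eta t w)]); last first.
  by rewrite predeqE => w; split=> [[x []]|[x]]; exists x.
rewrite measure_countable; last 2 first.
- by move=> x; exact: measurable_second_at.
- move=> [y b1] [y' b2] _ _ [w [[/= e1 [x1 [yx1 ex1 h1]]] [/= e2 [x2 [yx2 ex2 h2]]]]].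
  (* Two second leaders at z < z' are incompatible: z' would be the leader in front of z, and the
     leader in front of z' would then be a further type at least k beyond z. *)
  have ordered (z z' x x' : int) (i : nat) : eta t w z' = k + i%:Z -> z < z' -> z' < x' ->
      eta t w x' = k + a%:Z -> ~ (forall u, z < u -> u <> x -> eta t w u < k).
    move=> ez' zz' zx' ex' h; have [z'x|/eqP z'x] := eqVneq z' x.
      by have := h x' (lt_trans zz' zx') ltac:(lia); lia.
    by have := h z' zz' z'x; lia.
  have yE : y = y'.
    have [yy|yy|//] := ltgtP y y'; exfalso.
      exact: (ordered _ _ x1 x2 b2 e2 yy yx2 ex2 h1).
    exact: (ordered _ _ x2 x1 b1 e1 yy yx1 ex1 h2).
  by move: e1; rewrite yE e2 => ?; congr (_, _); lia.
rewrite (eq_esum (fun x _ => prob_second_at indep exp1 t0 eta0 path_eta meas_eta k a x.2 x.1)).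
rewrite esum_nneseries; last first.
  move=> y m; rewrite lee_fin mulr_ge0 ?c_ge0 // iter_move_sum_ge0 // => s; exact: ler0n.
apply: eq_eseriesr => m _.
rewrite -(@gap_count_shift _ m (-1)); last by case.
rewrite -[RHS](@esum_move_sum _ _ [set x : int * nat | (b <= x.2)%N]
  (fun x s => indic (two_leaders k a x.2) (shift (- x.1) s))) //.
- apply: eq_esum => y _; rewrite start_shift -iter_move_sum_shift //.
- by move=> s; rewrite esum_two_leaders.
Qed.

End gap_chain.

Lemma run_left (l : int) h (x : int) : l \notin h -> x <= l -> - l <= run h x.
Proof.
elim: h x => [|c h IH] x; first by rewrite /= /packed; lia.
rewrite inE negb_or => /andP[rc rh] rx /=; rewrite /sort_at.
have h1 := IH _ rh rx; case: ifP => // _.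
case: (eqVneq x c) => [E|xc]; first by apply: IH => //; lia.
by case: (eqVneq x (c + 1)) => [E|xc1] //; apply: IH => //; lia.
Qed.

Lemma measure_ae_eq d (T : measurableType d) (R : realType) (mu : {measure set T -> \bar R})
  (A B : set T) : measurable A -> measurable B -> {ae mu, forall x, A x <-> B x} ->
  mu A = mu B.
Proof.
move=> + + [Z [mZ Z0 ZP]].
have le A' B' : measurable A' -> measurable B' -> (forall x, ~ Z x -> A' x <-> B' x) ->
    (mu A' <= mu B')%E.
  move=> mA mB AB; rewrite -[leRHS]adde0 -Z0.
  apply: le_trans (measureU2 mu mB mZ); apply: le_measure; rewrite ?inE //.
    exact: measurableU.
  move=> x Ax; have [Zx|nZ] := pselect (Z x); first by right.
  by left; apply/AB.
have nZ x : ~ Z x -> A x <-> B x by move=> nZ; apply: contrapT => h; apply: nZ; exact: ZP.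
move=> mA mB; apply/eqP; rewrite eq_le !le // => x /nZ [? ?]; by split.
Qed.

(** * Uniqueness of coefficients of nonnegative power series *)

Section power_series.
Context {R : realType}.
Implicit Types (a b : nat -> R) (t : R).

Let term a t m : \bar R := (t ^+ m / m`!%:R * a m)%:E.

Lemma pseries_tail a t m : 0 <= t -> (forall n, 0 <= a n) -> (forall n, a n <= 3 ^+ n) ->
  (\sum_(m <= n <oo) term a t n <= ((3 * t) ^+ m * expR (3 * t))%:E)%E.
Proof.
move=> t0 a0 a3.
have u0 n : 0 <= (3 * t) ^+ n / n`!%:R by rewrite divr_ge0 // exprn_ge0 // mulr_ge0.
apply: (@le_trans _ _ (\sum_(n <oo) (((3 * t) ^+ m)%:E * ((3 * t) ^+ n / n`!%:R)%:E))%E).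
  rewrite -{1}(add0n m) -nneseries_addn; last first.
    by move=> n; rewrite lee_fin mulr_ge0 // divr_ge0 // exprn_ge0.
  apply: lee_nneseries => n _; first by rewrite lee_fin mulr_ge0 // divr_ge0 // exprn_ge0.
  rewrite -EFinM lee_fin.
  apply: (@le_trans _ _ (t ^+ (n + m) / (n + m)`!%:R * 3 ^+ (n + m))).
    by rewrite ler_wpM2l // divr_ge0 // exprn_ge0.
  rewrite (_ : _ * _ = (3 * t) ^+ m * ((3 * t) ^+ n * (n + m)`!%:R^-1)); last first.
    by rewrite !exprMn !exprD; ring.
  rewrite !ler_wpM2l ?exprn_ge0 ?mulr_ge0 // lef_pV2 ?posrE ?ltr0n ?fact_gt0 //.
  by rewrite ler_nat; apply: leq_fact; exact: leq_addr.
rewrite (@nneseriesZl _ (fun n => ((3 * t) ^+ n / n`!%:R)%:E) xpredT) => [|n _]; last first.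
  by rewrite lee_fin.
by rewrite eseries_exp ?mulr_ge0 // -EFinM.
Qed.

(** After the common terms are cancelled, division by t^m / m! leaves a tail of order t, which
    disappears as t tends to 0. *)
Let pseries_le a b m : (forall n, 0 <= a n) -> (forall n, 0 <= b n) ->
  (forall n, b n <= 3 ^+ n) -> (forall n, (n < m)%N -> a n = b n) ->
  (forall t, 0 <= t -> (\sum_(m <oo) term a t m = \sum_(m <oo) term b t m)%E) ->
  a m <= b m.
Proof.
move=> a0 b0 b3 ab E.
have term0 (c : nat -> R) t n : (forall n, 0 <= c n) -> 0 <= t -> (0 <= term c t n)%E.
  by move=> c0 t0; rewrite lee_fin mulr_ge0 // divr_ge0 // exprn_ge0.
have F0 : 0 < (m`!%:R : R) by rewrite ltr0n fact_gt0.
have key t : 0 < t -> a m <= b m + m`!%:R * (3 ^+ m.+1 * expR (3 * t)) * t.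
  move=> t0; have t0' := ltW t0.
  have := E t t0'; rewrite (nneseries_split 0 m); last by move=> *; exact: term0.
  rewrite [RHS](nneseries_split 0 m); last by move=> *; exact: term0.
  rewrite !add0n.
  have -> : (\sum_(0 <= k < m) term a t k = \sum_(0 <= k < m) term b t k)%E.
    rewrite !big_mkord; apply: eq_bigr => k _; rewrite /term ab //.
  have cancel_fin (x : R) (u v : \bar R) : (x%:E + u = x%:E + v -> u = v)%E.
    by case: u v => [u| |] [v| |] // [] /addrI ->.
  rewrite sumEFin => /cancel_fin {}E.
  have : (term a t m <= term b t m + ((3 * t) ^+ m.+1 * expR (3 * t))%:E)%E.
    apply: (@le_trans _ _ (\sum_(m <= n <oo) term a t n)%E).
      rewrite (nneseries_split m 1); last by move=> *; exact: term0.
      rewrite addn1 big_nat1 leeDl //; apply: nneseries_ge0 => n _ _; exact: term0.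
    rewrite E (nneseries_split m 1); last by move=> *; exact: term0.
    by rewrite addn1 big_nat1 leeD2l // pseries_tail.
  rewrite -EFinD lee_fin => h.
  have u0 : 0 < t ^+ m / m`!%:R by rewrite divr_gt0 // exprn_gt0.
  rewrite -(ler_pM2l u0); apply: le_trans h _; rewrite mulrDr lerD2l.
  rewrite le_eqVlt; apply/orP; left; apply/eqP; rewrite exprMn [t ^+ m.+1]exprS; field.
  by rewrite gt_eqF.
apply/ler_addgt0Pr => e e0.
pose C : R := m`!%:R * (3 ^+ m.+1 * expR 3).
have C0 : 0 < C by rewrite !mulr_gt0 ?exprn_gt0 ?expR_gt0.
pose t := Num.min 1 (e / C).
have t0 : 0 < t by rewrite lt_min ltr01 divr_gt0.
apply: le_trans (key t t0) _; rewrite lerD2l.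
apply: (@le_trans _ _ (C * t)).
  apply: (ler_wpM2r (ltW t0)); apply: (ler_wpM2l (ltW F0)).
  by apply: ler_wpM2l; rewrite ?exprn_ge0 // ler_expR ger_pMr // ge_min lexx.
by rewrite mulrC -ler_pdivlMr // ge_min lexx orbT.
Qed.

Lemma pseries_unique a b : (forall n, 0 <= a n) -> (forall n, a n <= 3 ^+ n) ->
  (forall n, 0 <= b n) -> (forall n, b n <= 3 ^+ n) ->
  (forall t, 0 <= t -> (\sum_(m <oo) (t ^+ m / m`!%:R * a m)%:E =
    \sum_(m <oo) (t ^+ m / m`!%:R * b m)%:E)%E) -> a = b.
Proof.
move=> a0 a3 b0 b3 E; apply/funext; apply: ltn_ind => m IH.
apply/eqP; rewrite eq_le; apply/andP; split; apply: pseries_le => //.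
  by move=> n /IH ->.
by move=> t t0; rewrite E.
Qed.

End power_series.

(** * Almost sure existence of a second leader *)

Section second_leader.
Context {d} {Omega : measurableType d} {R : realType} (P : probability Omega R).
Variable tau : int * nat -> {RV P >-> R}.
Hypothesis indep : mutually_independent tau.
Hypothesis exp1 : forall i, exponential_rate1 (tau i).
Variables (t : R) (t0 : 0 <= t).
Variable eta : R -> Omega -> int -> int.
Hypothesis eta0 : forall w x, eta 0 w x = - x.
Hypothesis path_eta :
  {ae P, forall w, tasep_path (rings_at tau w) (fun t => eta t w)}.
Hypothesis meas_eta : forall x i, measurable [set w | eta t w x = i].

Lemma good_left (l : int) w (x : int) : good tau t eta w -> t < tau (l, 0%N) w -> x <= l ->
  - l <= eta t w x.
Proof.
move=> gw tl xl; have [_ _ _ g4 g5] := gw.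
have [l' xl' tl'] := g4 (x - 1).
have [n [h [hw hA]]] := g5 (maxn `|l|%N `|l'|%N).+1.
rewrite (good_block t0 eta0 gw hw hA (l := l') (r := l)) //; try lia.
by apply: run_left => //; exact: (unrung_notin gw tl hA).
Qed.

Lemma largest_below (Q : pred int) (y x : int) : y < x -> Q y ->
  exists2 z, Q z & z < x /\ forall z', z < z' -> z' < x -> ~~ Q z'.
Proof.
move=> yx Qy.
have ex : exists n, Q (x - 1 - n%:Z).
  exists (absz (x - 1 - y)%R); rewrite (_ : _ - _ = y) //; lia.
exists (x - 1 - (ex_minn ex)%:Z); case: ex_minnP => n Qn nmin //; split; first by lia.
move=> z' z1 z2; apply/negP => Qz'.
by have := nmin (absz (x - 1 - z')%R); rewrite (_ : _ - _ = z') => [/(_ Qz')|]; lia.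
Qed.

Lemma leads2_leads k a b e : leads2 k a b e -> leads k a e.
Proof.
move=> [[y b'] [/= _ [e1 [x [yx ex h]]]]]; exists x; split=> // x' xx'.
by apply: h; lia.
Qed.

(** Left of a silent bond that is far enough to the left all types are at least k, so there is
    always a next position to find. *)
Lemma good_leads w k a : good tau t eta w -> leads k a (eta t w) <-> leads2 k a 0 (eta t w).
Proof.
move=> gw; split; last exact: leads2_leads.
move=> [x [ex hx]]; have [_ _ _ g4 _] := gw.
have [l lx tl] := g4 (Order.min (x - 1) (- k)).
have lk : k <= eta t w l by have := good_left gw tl (lexx _); lia.
have [y ky [yx hy]] := @largest_below (fun z => k <= eta t w z) l x ltac:(lia) lk.
exists (y, absz (eta t w y - k)%R); split=> //; split=> /=; first by lia.
exists x; split=> // x' yx' /eqP; rewrite neq_lt => /orP[x'x|]; last exact: hx.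
by have := hy _ yx' x'x; rewrite -ltNge.
Qed.

Lemma measurable_leads k a : measurable [set w | leads k a (eta t w)].
Proof. by apply: measurable_exists => y; exact: measurable_first_at. Qed.

Lemma measurable_leads2 k a b : measurable [set w | leads2 k a b (eta t w)].
Proof.
apply: measurable_exists => y; apply: measurable_and; first exact: measurable_const.
exact: measurable_second_at.
Qed.

Lemma prob_leads_leads2 k a :
  P [set w | leads k a (eta t w)] = P [set w | leads2 k a 0 (eta t w)].
Proof.
apply: measure_ae_eq; [exact: measurable_leads|exact: measurable_leads2|].
by apply: filterS (good_ae indep exp1 t0 path_eta) => w; exact: good_leads.
Qed.

End second_leader.

(** * Recursions and boundary conditions of the leader laws *)

Section gap_recursion.
Context {R : realType}.
Implicit Types (m a b : nat).

(** Division by 3^m makes this an average over m uniform moves. By [leader_lawS] it is also the law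
    of a lazy simple walk on the naturals started at 0, with its steps to -1 suppressed. *)
Definition leader_law m a : R := gap_count (leader_gap a) m / 3 ^+ m.

Definition leaders_law m a b : R := gap_count (leaders_gap a b) m / 3 ^+ m.

Lemma gap_countS (f : state -> R) m : gap_count f m.+1 = gap_count (move_sum f) m.
Proof. by rewrite /gap_count iterSr. Qed.

Lemma gap_countD (f g : state -> R) m :
  gap_count (fun s => f s + g s) m = gap_count f m + gap_count g m.
Proof.
rewrite /gap_count; elim: m (SI 0 0 0) => [|m IH] s //=.
by rewrite /move_sum !IH; ring.
Qed.

Lemma gap_count_mono (f g : state -> R) m : (forall s, f s <= g s) ->
  gap_count f m <= gap_count g m.
Proof.
move=> fg; rewrite /gap_count; elim: m (SI 0 0 0) => [|m IH] s //=.
by rewrite /move_sum !lerD.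
Qed.

Lemma gap_count3 (f g h : state -> R) m :
  gap_count (fun s => f s + g s + h s) m = gap_count f m + gap_count g m + gap_count h m.
Proof. by rewrite (gap_countD (fun s => f s + g s)) gap_countD. Qed.

Let pow3 m : (3 : R) ^+ m != 0.
Proof. by rewrite expf_neq0. Qed.

Let pow3_ge0 m : 0 <= ((3 : R) ^+ m)^-1.
Proof. by rewrite invr_ge0 exprn_ge0. Qed.

Lemma leaders_law_ge0 m a b : 0 <= leaders_law m a b.
Proof.
rewrite mulr_ge0 // iter_move_sum_ge0 // => -[p i j|p i j|] //=; exact: ler0n.
Qed.

Lemma leader_law_ge0 m a : 0 <= leader_law m a.
Proof.
rewrite mulr_ge0 // iter_move_sum_ge0 // => -[p i j|p i j|] //=; exact: ler0n.
Qed.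

Lemma leaders_law_mono m a b b' : (b <= b')%N -> leaders_law m a b' <= leaders_law m a b.
Proof.
move=> bb'; rewrite ler_wpM2r //; apply: gap_count_mono => -[p i j|p i j|] //=;
  rewrite ler_nat; [case: (leqP a j) => //= _|case: (leqP a (i + j.+1)) => _; rewrite ?andbT ?andbF //];
  case: leqP; case: leqP; lia.
Qed.

Lemma leaders_law_init a b : leaders_law 0 a b = ((a == 0)%N && (b <= 1)%N)%:R.
Proof.
rewrite /leaders_law /gap_count /= expr0 divr1.
by congr (nat_of_bool _)%:R; lia.
Qed.

Lemma leader_law_init a : leader_law 0 a = (a == 0)%N%:R.
Proof. by rewrite /leader_law /gap_count /= expr0 divr1 leqn0. Qed.

(** The leaders have distinct types, so the value b = a carries no mass. *)
Lemma leaders_law_diag m a : leaders_law m a a = leaders_law m a a.+1.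
Proof.
congr (_ / _); congr (gap_count _ m); apply/funext => -[p i j|p i j|] //=;
  congr (nat_of_bool _)%:R; lia.
Qed.

(** With a = 0 the condition on the second gap is void and no overtaken state qualifies; what
    remains is the observable of the first leader. *)
Lemma leaders_law_left m b : leaders_law m 0 b.+1 = leader_law m b.
Proof.
congr (_ / _); congr (gap_count _ m); apply/funext => -[p i j|p i j|] //=.
Qed.

(** A duality at the level of observables: the three moves of the state act on [leaders_gap] as
    three shifts of (a, b). *)
Lemma leaders_lawS m a b : a.+1 != b.+1 ->
  3 * leaders_law m.+1 a.+1 b.+1 =
  leaders_law m a.+2 b.+2 + leaders_law m a b.+1 + leaders_law m a.+1 b.
Proof.
move=> ab; rewrite /leaders_law gap_countS exprS -!mulrDl.
rewrite (_ : move_sum _ = (fun s => leaders_gap a.+2 b.+2 s + leaders_gap a b.+1 s +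
    leaders_gap a.+1 b s)); first by rewrite gap_count3; field; rewrite pow3.
apply/funext => -[p [|i] [|j]|p [|i] [|j]|]; rewrite /move_sum /= ?addr0 ?add0r -?natrD //;
  congr (_%:R); lia.
Qed.

Lemma leader_lawS m a :
  3 * leader_law m.+1 a = leader_law m a.-1 + leader_law m a + leader_law m a.+1.
Proof.
rewrite /leader_law gap_countS exprS -!mulrDl.
rewrite (_ : move_sum _ = (fun s => leader_gap a.-1 s + leader_gap a s +
    leader_gap a.+1 s)); first by rewrite gap_count3; field; rewrite pow3.
apply/funext => -[p [|i] j|p [|i] [|j]|]; rewrite /move_sum /= ?addr0 ?add0r -?natrD //;
  congr (_%:R); lia.
Qed.

End gap_recursion.

Section leader_laws.
Context {d} {Omega : measurableType d} {R : realType} (P : probability Omega R).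
Variable tau : int * nat -> {RV P >-> R}.
Hypothesis indep : mutually_independent tau.
Hypothesis exp1 : forall i, exponential_rate1 (tau i).
Variable eta : R -> Omega -> int -> int.
Hypothesis eta0 : forall w x, eta 0 w x = - x.
Hypothesis path_eta :
  {ae P, forall w, tasep_path (rings_at tau w) (fun t => eta t w)}.
Hypothesis meas_eta : forall (t : R) x i, 0 <= t -> measurable [set w | eta t w x = i].

Definition poisson_weight (x : R) (m : nat) : R := expR (- x) * (x ^+ m / m`!%:R).

Let gap_count_pow (f : state -> R) m : gap_count f m = 3 ^+ m * (gap_count f m / 3 ^+ m).
Proof. by rewrite mulrCA divff ?mulr1 // expf_neq0. Qed.

Lemma prob_leaders_law t k a b : 0 <= t -> P [set w | leads2 k a b (eta t w)] =
  (\sum_(m <oo) (poisson_weight (3 * t) m * leaders_law m a b)%:E)%E.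
Proof.
move=> t0; rewrite (prob_leads2 indep exp1 t0 eta0 path_eta) => [|x i]; last exact: meas_eta.
apply: eq_eseriesr => m _; rewrite gap_count_pow /poisson_weight /leaders_law exprMn.
by congr (_%:E); ring.
Qed.

(** The two observables differ, so the identity is invisible state by state. For every t >= 0 both
    sides average to the probability that the first leader has type k + a, as a second leader exists
    almost surely; uniqueness of power series identifies the coefficients. *)
Lemma leaders_law_bottom m a : leaders_law m a 0 = leader_law m a :> R.
Proof.
congr (_ / _); move: m; suff E : gap_count (leaders_gap a 0) = gap_count (leader_gap a) :> (nat -> R).
  by move=> m; rewrite E.
have g0 : forall n, 0 <= gap_count (leaders_gap a 0) n :> R.
  by move=> n; apply: iter_move_sum_ge0 => -[p i j|p i j|] //=; exact: ler0n.
have h0 : forall n, 0 <= gap_count (leader_gap a) n :> R.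
  by move=> n; apply: iter_move_sum_ge0 => -[p i j|p i j|] //=; exact: ler0n.
apply: pseries_unique => //.
- by move=> n; apply: iter_move_sum_le => -[p i j|p i j|] //=; rewrite lern1 leq_b1.
- by move=> n; apply: iter_move_sum_le => -[p i j|p i j|] //=; rewrite lern1 leq_b1.
move=> t t0.
have meas x i : measurable [set w | eta t w x = i] by exact: meas_eta.
have := prob_leads_leads2 indep exp1 t0 eta0 path_eta meas 0 a.
rewrite (prob_leads indep exp1 t0 eta0 path_eta meas) (prob_leads2 indep exp1 t0 eta0 path_eta meas).
have e0 : 0 < expR (- (3 * t)) by exact: expR_gt0.
have drop (f : nat -> R) : (forall n, 0 <= f n) -> (\sum_(m <oo) (expR (- (3 * t)) * (t ^+ m / m`!%:R) * f m)%:E =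
    (expR (- (3 * t)))%:E * \sum_(m <oo) (t ^+ m / m`!%:R * f m)%:E)%E.
  move=> f0; rewrite -nneseriesZl; last first.
    by move=> n _; rewrite lee_fin mulr_ge0 // divr_ge0 // exprn_ge0.
  by apply: eq_eseriesr => n _; rewrite -EFinM -!mulrA.
rewrite !drop // => /(congr1 (fun x => ((expR (3 * t))%:E * x)%E)).
by rewrite !muleA -!EFinM -expRD subrr expR0 !mul1e => ->.
Qed.

End leader_laws.

(** * The error function and its complement *)

Section error_function.
Context {R : realType}.
Implicit Types (x z : R).
Local Notation mu := (@lebesgue_measure R).
Local Notation rpi := (Num.sqrt (pi : R)).

Lemma sqrt_pi_gt0 : 0 < rpi.
Proof. by rewrite sqrtr_gt0 pi_gt0. Qed.

Let primitive (a z : R) : R := \int[mu]_(s in `[a, z]) gauss_fun s.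

Let primitiveB a y z : a <= y -> y <= z ->
  \int[mu]_(s in `[y, z]) gauss_fun s = primitive a z - primitive a y.
Proof.
move=> ay yz; have int I : mu.-integrable [set` Interval I (BRight z)] (EFin \o gauss_fun).
  exact: integrableS integrableT_gauss.
rewrite (Rintegral_itvB (int _)) // ?Rintegral_itv_obnd_cbnd //.
Qed.

Let erf_primitive a z : a <= z -> a <= 0 ->
  erf z = 2 / rpi * (primitive a z - primitive a 0).
Proof.
move=> az a0; rewrite /erf; congr (_ * _); case: leP => z0.
  by rewrite -(primitiveB a0 z0).
by rewrite -[LHS]/(- \int[mu]_(s in `[z, 0]) gauss_fun s) (primitiveB az (ltW z0)) opprB.
Qed.

(** To avoid the case distinction at 0, [erf] is written near z through a primitive based at a point
    [a] left of both z and 0. *)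
Lemma is_derive_erf z : is_derive z (1 : R) erf (2 / rpi * expR (- z ^+ 2)).
Proof.
pose a := Num.min z 0 - 1.
have az : a < z by rewrite ltrBlDr gt_min ltrDl ltr01.
have a0 : a < 0 by rewrite ltrBlDr gt_min [0 + 1]add0r ltr01 orbT.
have [d dE] : derivable (primitive a) z 1 /\ derive1 (primitive a) z = gauss_fun z.
  have z1 : z < z + 1 by rewrite ltrDl.
  apply: (continuous_FTC1_closed z1) => //; last exact: continuous_gauss_fun.
  exact: integrableS integrableT_gauss.
apply: (@near_eq_is_derive _ _ _ (fun y => 2 / rpi * (primitive a y - primitive a 0))).
  near=> y; rewrite (@erf_primitive a) // ltW //; near: y.
  exact: lt_nbhsr.
have hd : is_derive z (1 : R) (primitive a) (gauss_fun z).
  by split; [exact: d|rewrite -derive1E; exact: dE].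
apply: (drv_eq (drvZl _ (drvB hd (drv_cst _ _)))).
by rewrite subr0.
Unshelve. all: by end_near. Qed.

Lemma erf_cvg : erf x @[x --> +oo] --> (1 : R).
Proof.
have := @gauss_integral_proof.cvg_integral0_gauss_sqr R => /(cvg_comp _ Num.sqrt) h.
have {}h : gauss_integral_proof.integral0_gauss x @[x --> +oo] --> rpi / 2.
  rewrite (_ : rpi / 2 = Num.sqrt (pi / 4)); last first.
    rewrite sqrtrM ?pi_ge0 // sqrtrV // (_ : 4 = 2 ^+ 2) ?sqrtr_sqr ?ger0_norm //.
    by rewrite expr2 -natrM.
  apply: cvg_trans (h _ _); last exact: sqrt_continuous.
  apply: near_eq_cvg; near=> x; rewrite /= sqrtr_sqr ger0_norm //.
  by rewrite gauss_integral_proof.integral0_gauss_ge0.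
have {}h : 2 / rpi * gauss_integral_proof.integral0_gauss x @[x --> +oo] --> 2 / rpi * (rpi / 2).
  by apply: cvgM; [exact: cvg_cst|exact: h].
rewrite (_ : 1 = 2 / rpi * (rpi / 2)); last first.
  by field; rewrite gt_eqF // sqrt_pi_gt0.
apply: cvg_trans h; apply: near_eq_cvg; near=> x.
by rewrite /erf ifT //; near: x; exact: nbhs_pinfty_ge.
Unshelve. all: by end_near. Qed.

Definition erfc z : R := 1 - erf z.

Lemma is_derive_erfc z : is_derive z (1 : R) erfc (- (2 / rpi) * expR (- z ^+ 2)).
Proof. by apply: (drv_eq (drvB (drv_cst 1 z) (is_derive_erf z))); rewrite sub0r mulNr. Qed.

Lemma is_derive_nonincreasing (f df : R -> R) a : (forall x, is_derive x (1 : R) f (df x)) ->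
  (forall x, a <= x -> df x <= 0) -> forall x y, a <= x -> x <= y -> f y <= f x.
Proof.
move=> fd df0 x y ax xy.
have cf := is_derive_continuous fd.
have [c] := MVT_segment xy (fun z _ => fd z) (continuous_subspaceT cf).
rewrite in_itv /= => /andP[xc _] /eqP; rewrite subr_eq => /eqP ->.
by rewrite gerDr mulr_le0_ge0 ?subr_ge0 // df0 // (le_trans ax).
Qed.

Lemma nonincreasing_cvg_ge (f : R -> R) a l : (forall x y, a <= x -> x <= y -> f y <= f x) ->
  f x @[x --> +oo] --> l -> forall x, a <= x -> l <= f x.
Proof.
move=> fm fl x ax; apply: (cvgr_to_le fl); near=> y; apply: (fm x y ax).
near: y; exact: (nbhs_pinfty_ge (num_real x)).
Unshelve. all: by end_near. Qed.

Let c2_gt0 : 0 < 2 / rpi.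
Proof. by rewrite divr_gt0 // sqrt_pi_gt0. Qed.

Lemma erfc_cvg : erfc x @[x --> +oo] --> (0 : R).
Proof. by rewrite -(subrr 1); apply: cvgB; [exact: cvg_cst|exact: erf_cvg]. Qed.

Lemma erfc_mono x z : x <= z -> erfc z <= erfc x.
Proof.
move=> xz; apply: (is_derive_nonincreasing (a := x) is_derive_erfc _ (lexx x) xz) => y _.
by rewrite mulNr oppr_le0 mulr_ge0 ?expR_ge0 // ltW.
Qed.

Lemma erfc_ge0 z : 0 <= erfc z.
Proof.
have m (x y : R) : z <= x -> x <= y -> erfc y <= erfc x by move=> _; exact: erfc_mono.
exact: (nonincreasing_cvg_ge m erfc_cvg (lexx z)).
Qed.

Lemma erf0 : erf (0 : R) = 0.
Proof. by rewrite /erf lexx set_itv1 Rintegral_set1 mulr0. Qed.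

Lemma erfN z : erf (- z) = - erf z.
Proof.
pose h (u : R) := erf u + erf (- u).
have dh (u : R) : is_derive u (1 : R) h 0.
  apply: (drv_eq (drvD (is_derive_erf u) (drv_comp (g := erf) (is_derive_erf _) (drvN (drv_id u))))).
  by rewrite sqrrN mulrN1 subrr.
have h0 u v : u <= v -> h u = h v.
  move=> uv; have [w _ /eqP] := MVT_segment uv (fun z _ => dh z)
    (continuous_subspaceT (is_derive_continuous dh)).
  by rewrite mul0r subr_eq0 => /eqP.
have : h z = h 0 by have [/h0|/ltW/h0 ->] := leP z 0.
by rewrite /h oppr0 erf0 addr0 => /eqP; rewrite addrC addr_eq0 => /eqP.
Qed.

Lemma erfcN z : erfc (- z) = 2 - erfc z.
Proof. by rewrite /erfc erfN; ring. Qed.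

Lemma erfc_le2 z : erfc z <= 2.
Proof. by rewrite -(opprK z) erfcN gerBl erfc_ge0. Qed.

Lemma erfc_le1 z : 0 <= z -> erfc z <= 1.
Proof. by move=> /erfc_mono; rewrite {2}/erfc erf0 subr0. Qed.

Lemma rpi_ge1 : 1 <= rpi.
Proof. by rewrite -[leLHS]sqrtr1 ler_wsqrtr // (le_trans _ (pi_ge2 R)) // ler1n. Qed.

(** The factor e makes the right side at least 1 for z <= 1. From 1 on, the right side minus the
    left side is nonincreasing with limit 0. *)
Lemma erfc_gauss z : 0 <= z -> erfc z <= expR 1 * expR (- z ^+ 2).
Proof.
move=> z0; have [z1|z1] := leP z 1.
  apply: le_trans (erfc_le1 z0) _.
  by rewrite -expRD -{1}expR0 ler_expR subr_ge0 expr_le1.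
have e1 : 1 <= expR (1 : R) by rewrite -expR0 ler_expR.
pose h (u : R) := expR 1 * expR (- u ^+ 2) - erfc u.
have dh (u : R) : is_derive u (1 : R) h ((2 / rpi - 2 * expR 1 * u) * expR (- u ^+ 2)).
  apply: (drv_eq (drvB (drvZl (expR 1) (drv_exp (drvN (drvX 1 (drv_id u))))) (is_derive_erfc u))).
  by rewrite expr1; ring.
have hm x y : 1 <= x -> x <= y -> h y <= h x.
  apply: (is_derive_nonincreasing dh) => u u1.
  rewrite mulr_le0_ge0 ?expR_ge0 // subr_le0.
  apply: (@le_trans _ _ 2); last by nra.
  by rewrite ler_pdivrMr ?sqrt_pi_gt0 // ler_peMr // rpi_ge1.
have h0 : h x @[x --> +oo] --> (expR 1 * 0 - 0 : R).
  apply: cvgB; last exact: erfc_cvg.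
  by apply: cvgM; [exact: cvg_cst|exact: cvg_gauss_fun].
rewrite -subr_ge0; have := nonincreasing_cvg_ge hm h0 (ltW z1).
by rewrite mulr0 subr0.
Qed.

End error_function.

(** * Gaussians and error functions on the wedge 0 <= x <= y *)

Section wedge_functions.
Context {R : realType}.
Implicit Types (x y u v : R).

Definition wc : R := Num.sqrt 3 / 6.

Definition wk : R := (Num.sqrt pi)^-1.

Lemma wc2 : wc ^+ 2 = 1 / 12.
Proof. by rewrite /wc expr_div_n sqr_sqrtr //; field. Qed.

(** In [bump1], [bump2] and [bump3] the Gaussian times exp of minus the squared argument of [erfc]
    is always [bump0], since wc^2 = 1/12; hence derivatives produce no new function. *)
Definition bump1 x y := expR (- (x - y) ^+ 2 / 4) * erfc (wc * (x + y)).
Definition bump2 x y := expR (- y ^+ 2 / 4) * erfc (wc * (2 * x - y)).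
Definition bump3 x y := expR (- x ^+ 2 / 4) * erfc (wc * (2 * y - x)).
Definition bump0 x y := expR (- (x ^+ 2 - x * y + y ^+ 2) / 3).

(* Expressions in the coordinates, constants and the four bumps: a class of functions of two
   variables that is closed under differentiation. *)
Inductive wexpr := WX | WY | WC of R | W0 | W1 | W2 | W3
  | WAdd of wexpr & wexpr | WMul of wexpr & wexpr.

Local Notation "a [+] b" := (WAdd a b) (at level 50, left associativity).
Local Notation "a [*] b" := (WMul a b) (at level 40, left associativity).

Fixpoint weval (e : wexpr) x y : R := match e with
  | WX => x | WY => y | WC a => a
  | W0 => bump0 x y | W1 => bump1 x y | W2 => bump2 x y | W3 => bump3 x y
  | WAdd a b => weval a x y + weval b x y
  | WMul a b => weval a x y * weval b x y end.

Fixpoint wdx (e : wexpr) : wexpr := match e with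
  | WX => WC 1 | WY => WC 0 | WC a => WC 0
  | W0 => (WC (- (2 / 3)) [*] WX [+] WC (1 / 3) [*] WY) [*] W0
  | W1 => (WC (- (1 / 2)) [*] WX [+] WC (1 / 2) [*] WY) [*] W1 [+] WC (- (2 * wc * wk)) [*] W0
  | W2 => WC (- (4 * wc * wk)) [*] W0
  | W3 => WC (- (1 / 2)) [*] WX [*] W3 [+] WC (2 * wc * wk) [*] W0
  | WAdd a b => wdx a [+] wdx b
  | WMul a b => wdx a [*] b [+] a [*] wdx b end.

Fixpoint wdy (e : wexpr) : wexpr := match e with
  | WX => WC 0 | WY => WC 1 | WC a => WC 0
  | W0 => (WC (1 / 3) [*] WX [+] WC (- (2 / 3)) [*] WY) [*] W0
  | W1 => (WC (1 / 2) [*] WX [+] WC (- (1 / 2)) [*] WY) [*] W1 [+] WC (- (2 * wc * wk)) [*] W0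
  | W2 => WC (- (1 / 2)) [*] WY [*] W2 [+] WC (2 * wc * wk) [*] W0
  | W3 => WC (- (4 * wc * wk)) [*] W0
  | WAdd a b => wdy a [+] wdy b
  | WMul a b => wdy a [*] b [+] a [*] wdy b end.

Lemma is_derive_weval (e : wexpr) (p q : R -> R) (t dp dq : R) :
  is_derive t (1 : R) p dp -> is_derive t (1 : R) q dq ->
  is_derive t (1 : R) (fun s => weval e (p s) (q s))
    (dp * weval (wdx e) (p t) (q t) + dq * weval (wdy e) (p t) (q t)).
Proof.
move=> hp hq; have kE : 2 / Num.sqrt pi = 2 * wk by [].
elim: e => [| |a| | | | |a IHa b IHb|a IHa b IHb] /=.
- by apply: (drv_eq hp); ring.
- by apply: (drv_eq hq); ring.
- by apply: (drv_eq (drv_cst a t)); ring.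
- rewrite /bump0; apply: (drv_eq (drv_exp (drvZr _ (drvN (drvD (drvB (drvX 1 hp) (drvM hp hq))
    (drvX 1 hq)))))).
  by rewrite !expr1; field.
- rewrite /bump1 /bump0.
  have h := drvM (drv_exp (drvZr (4^-1) (drvN (drvX 1 (drvB hp hq)))))
    (drv_comp (g := erfc) (is_derive_erfc _) (drvZl wc (drvD hp hq))).
  apply: (drv_eq h); rewrite kE.
  have E : expR (- (p t - q t) ^+ 2 / 4) * expR (- (wc * (p t + q t)) ^+ 2) =
      expR (- (p t ^+ 2 - p t * q t + q t ^+ 2) / 3).
    by rewrite -expRD exprMn wc2; congr expR; field.
  by rewrite -E; field.
- rewrite /bump2 /bump0.
  have h := drvM (drv_exp (drvZr (4^-1) (drvN (drvX 1 hq))))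
    (drv_comp (g := erfc) (is_derive_erfc _) (drvZl wc (drvB (drvZl 2 hp) hq))).
  apply: (drv_eq h); rewrite kE.
  have E : expR (- q t ^+ 2 / 4) * expR (- (wc * (2 * p t - q t)) ^+ 2) =
      expR (- (p t ^+ 2 - p t * q t + q t ^+ 2) / 3).
    by rewrite -expRD exprMn wc2; congr expR; field.
  by rewrite -E; field.
- rewrite /bump3 /bump0.
  have h := drvM (drv_exp (drvZr (4^-1) (drvN (drvX 1 hp))))
    (drv_comp (g := erfc) (is_derive_erfc _) (drvZl wc (drvB (drvZl 2 hq) hp))).
  apply: (drv_eq h); rewrite kE.
  have E : expR (- p t ^+ 2 / 4) * expR (- (wc * (2 * q t - p t)) ^+ 2) =
      expR (- (p t ^+ 2 - p t * q t + q t ^+ 2) / 3).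
    by rewrite -expRD exprMn wc2; congr expR; field.
  by rewrite -E; field.
- by apply: (drv_eq (drvD IHa IHb)); ring.
- by apply: (drv_eq (drvM IHa IHb)); ring.
Qed.

(** Every summand carries a bump factor, hence Gaussian decay on the wedge; derivatives keep this
    property. *)
Fixpoint wsmall (e : wexpr) : bool := match e with
  | WX | WY | WC _ => false
  | WAdd a b => wsmall a && wsmall b
  | WMul a b => wsmall a || wsmall b
  | _ => true end.

Definition wdir (u v : R) (e : wexpr) := WC u [*] wdx e [+] WC v [*] wdy e.

Lemma wsmall_dx e : wsmall e -> wsmall (wdx e).
Proof.
elim: e => //= a IHa b IHb.
  by move=> /andP[ha hb]; rewrite IHa // IHb.
by case/orP => h; [rewrite (IHa h) h|rewrite (IHb h) h !orbT].
Qed.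

Lemma wsmall_dy e : wsmall e -> wsmall (wdy e).
Proof.
elim: e => //= a IHa b IHb.
  by move=> /andP[ha hb]; rewrite IHa // IHb.
by case/orP => h; [rewrite (IHa h) h|rewrite (IHb h) h !orbT].
Qed.

Lemma wsmall_dir u v e : wsmall e -> wsmall (wdir u v e).
Proof. by move=> h /=; rewrite wsmall_dx // wsmall_dy. Qed.

Let z x y := (1 + x) * (1 + y).
Let gauss x y := expR (- (x ^+ 2 + y ^+ 2) / 8).
Let M : R := 2 * expR 1.

Let z1 x y : 0 <= x -> x <= y -> 1 <= z x y.
Proof. by move=> x0 xy; rewrite /z; nra. Qed.

Let gauss1 x y : gauss x y <= 1.
Proof. by rewrite expR_le1; nra. Qed.

Let M0 : 0 <= M. Proof. by rewrite mulr_ge0 // expR_ge0. Qed.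

Let M1 : 2 <= M /\ expR 1 <= M.
Proof.
have e1 : 1 <= expR (1 : R) by rewrite -expR0 ler_expR.
by rewrite /M; split; lra.
Qed.

Let wc_ge0 : 0 <= wc.
Proof. by rewrite divr_ge0 // sqrtr_ge0. Qed.

(** The wedge matters most for [bump2]: its [erfc] may have a negative argument and is only bounded
    by 2, but exp(-y^2/4) alone dominates both variables when x <= y. *)
Lemma bump_le x y : 0 <= x -> x <= y ->
  [/\ 0 <= bump0 x y <= M * gauss x y, 0 <= bump1 x y <= M * gauss x y,
      0 <= bump2 x y <= M * gauss x y & 0 <= bump3 x y <= M * gauss x y].
Proof.
move=> x0 xy; have [M2 Me] := M1.
have b0 : bump0 x y <= gauss x y by rewrite ler_expR; nra.
have g0 : 0 <= gauss x y by exact: expR_ge0.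
have eb : expR 1 * bump0 x y <= M * gauss x y.
  by rewrite ler_pM // expR_ge0.
split; apply/andP; split; try exact: expR_ge0.
- by rewrite -[leLHS]mul1r ler_pM ?expR_ge0 //; apply: le_trans M2; lra.
- by rewrite mulr_ge0 ?expR_ge0 ?erfc_ge0.
- apply: le_trans eb; apply: (@le_trans _ _ (expR (- (x - y) ^+ 2 / 4) *
    (expR 1 * expR (- (wc * (x + y)) ^+ 2)))).
    by rewrite ler_wpM2l ?expR_ge0 // erfc_gauss // mulr_ge0 // addr_ge0 // (le_trans x0).
  rewrite mulrCA ler_wpM2l ?expR_ge0 // -expRD ler_expR exprMn wc2; nra.
- by rewrite mulr_ge0 ?expR_ge0 ?erfc_ge0.
- rewrite mulrC ler_pM ?expR_ge0 ?erfc_ge0 ?(le_trans (erfc_le2 _)) // ler_expR; nra.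
- by rewrite mulr_ge0 ?expR_ge0 ?erfc_ge0.
- apply: le_trans eb; apply: (@le_trans _ _ (expR (- x ^+ 2 / 4) *
    (expR 1 * expR (- (wc * (2 * y - x)) ^+ 2)))).
    rewrite ler_wpM2l ?expR_ge0 // erfc_gauss // mulr_ge0 //; lra.
  rewrite mulrCA ler_wpM2l ?expR_ge0 // -expRD ler_expR exprMn wc2; nra.
Qed.

Let zpow x y m n : 0 <= x -> x <= y -> (m <= n)%N -> z x y ^+ m <= z x y ^+ n.
Proof. by move=> x0 xy mn; rewrite ler_weXn2l // z1. Qed.

Let z0 x y n : 0 <= x -> x <= y -> 0 <= z x y ^+ n.
Proof. by move=> x0 xy; rewrite exprn_ge0 // (le_trans _ (z1 x0 xy)). Qed.

Let weval_poly (e : wexpr) : exists C n, 0 <= C /\ forall x y, 0 <= x -> x <= y ->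
  `|weval e x y| <= C * z x y ^+ n.
Proof.
have bump (f : R -> R -> R) : (forall x y, 0 <= x -> x <= y -> 0 <= f x y <= M * gauss x y) ->
    exists C n, 0 <= C /\ forall x y, 0 <= x -> x <= y -> `|f x y| <= C * z x y ^+ n.
  move=> h; exists M, 0%N; split=> // x y x0 xy; have /andP[f0 f1] := h x y x0 xy.
  by rewrite expr0 mulr1 ger0_norm // (le_trans f1) // ler_piMr.
elim: e => [| |a| | | | |a [C [n [C0 IHa]]] b [D [m [D0 IHb]]]|a [C [n [C0 IHa]]] b [D [m [D0 IHb]]]].
- exists 1, 1%N; split=> // x y x0 xy; rewrite mul1r expr1 ger0_norm //= /z.
  by have xy0 := mulr_ge0 x0 (le_trans x0 xy); lra.
- exists 1, 1%N; split=> // x y x0 xy; rewrite mul1r expr1 ger0_norm /z /=; last first.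
    by rewrite (le_trans x0).
  by have xy0 := mulr_ge0 x0 (le_trans x0 xy); lra.
- by exists `|a|, 0%N; split=> // x y x0 xy; rewrite expr0 mulr1.
- by apply: bump => x y x0 xy; have [] := bump_le x0 xy.
- by apply: bump => x y x0 xy; have [] := bump_le x0 xy.
- by apply: bump => x y x0 xy; have [] := bump_le x0 xy.
- by apply: bump => x y x0 xy; have [] := bump_le x0 xy.
- exists (C + D), (n + m)%N; split; first exact: addr_ge0.
  move=> x y x0 xy; apply: le_trans (ler_normD _ _) _; rewrite mulrDl lerD //.
    by apply: le_trans (IHa _ _ x0 xy) _; rewrite ler_wpM2l // zpow // leq_addr.
  by apply: le_trans (IHb _ _ x0 xy) _; rewrite ler_wpM2l // zpow // leq_addl.
- exists (C * D), (n + m)%N; split; first exact: mulr_ge0.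
  move=> x y x0 xy; rewrite normrM exprD mulrACA ler_pM //; [exact: IHa|exact: IHb].
Qed.

Let weval_small (e : wexpr) : wsmall e -> exists C n, 0 <= C /\ forall x y, 0 <= x -> x <= y ->
  `|weval e x y| <= C * z x y ^+ n * gauss x y.
Proof.
have bump (f : R -> R -> R) : (forall x y, 0 <= x -> x <= y -> 0 <= f x y <= M * gauss x y) ->
    exists C n, 0 <= C /\ forall x y, 0 <= x -> x <= y -> `|f x y| <= C * z x y ^+ n * gauss x y.
  move=> h; exists M, 0%N; split=> // x y x0 xy; have /andP[f0 f1] := h x y x0 xy.
  by rewrite expr0 mulr1 ger0_norm.
elim: e => [| |a| | | | |a IHa b IHb|a IHa b IHb] //.
- by move=> _; apply: bump => x y x0 xy; have [] := bump_le x0 xy.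
- by move=> _; apply: bump => x y x0 xy; have [] := bump_le x0 xy.
- by move=> _; apply: bump => x y x0 xy; have [] := bump_le x0 xy.
- by move=> _; apply: bump => x y x0 xy; have [] := bump_le x0 xy.
- case/andP => /IHa[C [n [C0 {}IHa]]] /IHb[D [m [D0 {}IHb]]].
  exists (C + D), (n + m)%N; split; first exact: addr_ge0.
  move=> x y x0 xy; apply: le_trans (ler_normD _ _) _; rewrite !mulrDl lerD //.
    apply: le_trans (IHa _ _ x0 xy) _; rewrite ler_wpM2r ?expR_ge0 // ler_wpM2l // zpow //.
    exact: leq_addr.
  apply: le_trans (IHb _ _ x0 xy) _; rewrite ler_wpM2r ?expR_ge0 // ler_wpM2l // zpow //.
  exact: leq_addl.
- case/orP => [/IHa[C [n [C0 {}IHa]]]|/IHb[D [m [D0 {}IHb]]]].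
    have [D [m [D0 {}IHb]]] := weval_poly b.
    exists (C * D), (n + m)%N; split; first exact: mulr_ge0.
    move=> x y x0 xy; rewrite normrM.
    apply: le_trans (ler_pM _ _ (IHa _ _ x0 xy) (IHb _ _ x0 xy)) _ => //.
    by rewrite le_eqVlt exprD; apply/orP; left; apply/eqP; ring.
  have [C [n [C0 {}IHa]]] := weval_poly a.
  exists (C * D), (n + m)%N; split; first exact: mulr_ge0.
  move=> x y x0 xy; rewrite normrM.
  apply: le_trans (ler_pM _ _ (IHa _ _ x0 xy) (IHb _ _ x0 xy)) _ => //.
  by rewrite le_eqVlt exprD; apply/orP; left; apply/eqP; ring.
Qed.

Let pow_gauss (x : R) n : 0 <= x -> (1 + x) ^+ n * expR (- x ^+ 2 / 8) <= n`!%:R * expR 3.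
Proof.
move=> x0; have x1 : 0 <= 1 + x by rewrite addr_ge0.
have F0 : 0 < (n`!%:R : R) by rewrite ltr0n fact_gt0.
have h : (1 + x) ^+ n <= n`!%:R * expR (1 + x).
  rewrite -ler_pdivrMl // mulrC; case: n F0 => [|n] F0.
    by rewrite expr0 fact0 divr1 (le_trans _ (expR_ge1Dx _)) // lerDl.
  by apply: le_trans (expR_ge1Dxn n x1); rewrite lerDr.
apply: (@le_trans _ _ (n`!%:R * expR (1 + x) * expR (- x ^+ 2 / 8))).
  by rewrite ler_wpM2r ?expR_ge0.
rewrite -mulrA -expRD ler_wpM2l // ler_expR.
by have := sqr_ge0 (x - 4); nra.
Qed.

(** Cubic decay in each variable is enough for lattice sums against a linear weight. *)
Definition decay x y : R := ((1 + x) * (1 + y)) ^- 3.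

Lemma weval_decay (e : wexpr) : wsmall e -> exists2 C, 0 <= C & forall x y, 0 <= x -> x <= y ->
  `|weval e x y| <= C * decay x y.
Proof.
move=> /weval_small[C [n [C0 h]]].
exists (C * ((n + 3)`!%:R * expR 3) ^+ 2).
  by rewrite mulr_ge0 // exprn_ge0 // mulr_ge0 // expR_ge0.
move=> x y x0 xy; have y0 := le_trans x0 xy.
have zp : 0 < z x y ^+ 3 by rewrite exprn_gt0 // (lt_le_trans _ (z1 x0 xy)).
rewrite /decay -/(z x y) ler_pdivlMr //.
apply: (@le_trans _ _ (C * z x y ^+ n * gauss x y * z x y ^+ 3)).
  by rewrite ler_wpM2r ?(ltW zp) // h.
rewrite (_ : _ * _ = C * (((1 + x) ^+ (n + 3) * expR (- x ^+ 2 / 8)) *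
   ((1 + y) ^+ (n + 3) * expR (- y ^+ 2 / 8)))); last first.
  rewrite /gauss (_ : - (x ^+ 2 + y ^+ 2) / 8 = - x ^+ 2 / 8 + - y ^+ 2 / 8); last by field.
  by rewrite expRD /z !exprD !exprMn; ring.
by rewrite ler_wpM2l // expr2 ler_pM ?pow_gauss // mulr_ge0 ?expR_ge0 // exprn_ge0 // addr_ge0.
Qed.

End wedge_functions.

(** * Uniform Taylor expansions on the wedge *)

Section wedge_taylor.
Context {R : realType}.
Implicit Types (x y u v h : R) (e : @wexpr R).

(** One step of Taylor's formula by the mean value theorem; repeated through successive derivatives
    it gives the remainders below. *)
Lemma derive_pow_bound (f df : R -> R) (h M : R) n :
  (forall t : R, is_derive t (1 : R) f (df t)) -> f 0 = 0 -> 0 <= h -> 0 <= M ->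
  (forall t, 0 <= t -> t <= h -> `|df t| <= M * t ^+ n) -> `|f h| <= M * h ^+ n.+1.
Proof.
move=> fd f0 h0 M0 dfM.
have [c] := MVT_segment h0 (fun z _ => fd z) (continuous_subspaceT (is_derive_continuous fd)).
rewrite in_itv /= f0 !subr0 => /andP[c0 ch] ->; rewrite normrM (ger0_norm h0) exprSr mulrA.
rewrite ler_wpM2r //; apply: le_trans (dfM _ c0 ch) _; rewrite ler_wpM2l //.
by rewrite lerXn2r.
Qed.

Lemma decay_ge0 x y : 0 <= x -> 0 <= y -> 0 <= decay x y.
Proof. by move=> x0 y0; rewrite /decay invr_ge0 exprn_ge0 // mulr_ge0 // addr_ge0. Qed.

Lemma decay_shift x y x' y' : 0 <= x -> 0 <= y -> 0 <= x' -> 0 <= y' ->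
  x <= 2 * x' + 1 -> y <= 2 * y' + 1 -> decay x' y' <= 64 * decay x y.
Proof.
move=> x0 y0 x'0 y'0 xx yy; rewrite /decay.
have p : 0 < (1 + x) * (1 + y) by rewrite mulr_gt0 // ltr_wpDr.
have p' : 0 < (1 + x') * (1 + y') by rewrite mulr_gt0 // ltr_wpDr.
rewrite ler_pdivlMr ?exprn_gt0 // mulrC ler_pdivrMr ?exprn_gt0 //.
rewrite (_ : 64 = 4 ^+ 3); last by ring.
have q : (1 + x) * (1 + y) <= 4 * ((1 + x') * (1 + y')).
  rewrite (_ : 4 * _ = (2 * (1 + x')) * (2 * (1 + y'))); last by ring.
  by apply: ler_pM; lra.
rewrite -exprMn; apply: lerXn2r q; rewrite nnegrE; first exact: ltW.
by rewrite mulr_ge0 // ltW.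
Qed.

Definition wedge x y := 0 <= x /\ x <= y.

Lemma is_derive_ray e u v x y (t : R) :
  is_derive t (1 : R) (fun s => weval e (x + s * u) (y + s * v))
    (weval (wdir u v e) (x + t * u) (y + t * v)).
Proof.
have hp (a b : R) : is_derive t (1 : R) (fun s => a + s * b) b.
  by apply: (drv_eq (drvD (drv_cst a t) (drvZr b (drv_id t)))); rewrite add0r mul1r.
by apply: (drv_eq (is_derive_weval e (hp x u) (hp y v))).
Qed.

Lemma wedge_ray x y u v h t : wedge x y -> wedge (x + h * u) (y + h * v) ->
  0 <= t -> t <= h -> wedge (x + t * u) (y + t * v).
Proof.
move=> [x0 xy] [x0' xy'] t0; rewrite le_eqVlt => /predU1P[-> //|th].
have h0 : 0 < h by exact: le_lt_trans th.
have E a b : a + t * b = ((h - t) * a + t * (a + h * b)) / h by field; rewrite gt_eqF.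
have ht : 0 <= h - t by rewrite subr_ge0 ltW.
split.
  by rewrite E divr_ge0 ?(ltW h0) // addr_ge0 // mulr_ge0.
rewrite (E x u) (E y v) ler_pM2r ?invr_gt0 //; apply: lerD; exact: ler_wpM2l.
Qed.

Lemma decay_ray x y u v h t : `|u| <= 1 -> `|v| <= 1 -> h <= 1 -> wedge x y ->
  wedge (x + h * u) (y + h * v) -> 0 <= t -> t <= h ->
  decay (x + t * u) (y + t * v) <= 64 * decay x y.
Proof.
move=> /ler_normlP[u1 u2] /ler_normlP[v1 v2] h1 w w' t0 th.
have [a0 ab] := wedge_ray w w' t0 th; case: w => x0 xy.
have tb (b : R) : - b <= 1 -> - 1 <= t * b.
  by move=> b1; have := ler_wpM2l t0 b1; nra.
have y0 := le_trans x0 xy; have b0 := le_trans a0 ab; have tu := tb _ u1; have tv := tb _ v1.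
by apply: decay_shift => //; lra.
Qed.

Lemma weval_taylor1 e u v : `|u| <= 1 -> `|v| <= 1 -> wsmall e ->
  exists2 C, 0 <= C & forall x y h, 0 <= h <= 1 -> wedge x y ->
    wedge (x + h * u) (y + h * v) ->
    `|weval e (x + h * u) (y + h * v) - weval e x y| <= C * h * decay x y.
Proof.
move=> u1 v1 se; have [C C0 hC] := weval_decay (wsmall_dir u v se).
exists (C * 64) => [|x y h /andP[h0 h1] w w']; first by rewrite mulr_ge0.
have [x0 xy] := w.
pose f t := weval e (x + t * u) (y + t * v) - weval e x y.
have fd t : is_derive t (1 : R) f (weval (wdir u v e) (x + t * u) (y + t * v)).
  by apply: (drv_eq (drvB (is_derive_ray e u v x y t) (drv_cst _ t))); rewrite subr0.
rewrite mulrAC -[h]expr1.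
apply: (derive_pow_bound (n := 0) fd) => //.
- by rewrite /f !mul0r !addr0 subrr.
- by rewrite !mulr_ge0 // decay_ge0 // (le_trans x0).
move=> t t0 th; rewrite mulr1; have [a0 ab] := wedge_ray w w' t0 th.
apply: le_trans (hC _ _ a0 ab) _; rewrite -mulrA ler_wpM2l //.
exact: decay_ray w' t0 th.
Qed.

Lemma weval_taylor2 e u v : `|u| <= 1 -> `|v| <= 1 -> wsmall e ->
  exists2 C, 0 <= C & forall x y h, 0 <= h <= 1 -> wedge x y ->
    wedge (x + h * u) (y + h * v) ->
    `|weval e (x + h * u) (y + h * v) - weval e x y - h * weval (wdir u v e) x y|
      <= C * h ^+ 2 * decay x y.
Proof.
move=> u1 v1 se; have [C C0 hC] := weval_taylor1 u1 v1 (wsmall_dir u v se).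
exists C => // x y h /andP[h0 h1] w w'.
have [x0 xy] := w.
pose f t := weval e (x + t * u) (y + t * v) - weval e x y - t * weval (wdir u v e) x y.
have fd t : is_derive t (1 : R) f (weval (wdir u v e) (x + t * u) (y + t * v) -
    weval (wdir u v e) x y).
  apply: (drv_eq (drvB (drvB (is_derive_ray e u v x y t) (drv_cst _ t))
    (drvZr (weval (wdir u v e) x y) (drv_id t)))).
  by rewrite subr0 mul1r.
rewrite [leRHS]mulrAC; apply: (derive_pow_bound (n := 1) fd) => //.
- by rewrite /f !mul0r !addr0 subrr subr0.
- by rewrite !mulr_ge0 // decay_ge0 // (le_trans x0).
move=> t t0 th; rewrite expr1 [leRHS]mulrAC; apply: hC => //; first by rewrite t0 (le_trans th).
exact: wedge_ray w w' t0 th.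
Qed.

Lemma weval_taylor3 e u v : `|u| <= 1 -> `|v| <= 1 -> wsmall e ->
  exists2 C, 0 <= C & forall x y h, 0 <= h <= 1 -> wedge x y ->
    wedge (x + h * u) (y + h * v) ->
    `|weval e (x + h * u) (y + h * v) - weval e x y - h * weval (wdir u v e) x y
      - h ^+ 2 / 2 * weval (wdir u v (wdir u v e)) x y| <= C * h ^+ 3 * decay x y.
Proof.
move=> u1 v1 se; have [C C0 hC] := weval_taylor2 u1 v1 (wsmall_dir u v se).
exists C => // x y h /andP[h0 h1] w w'.
have [x0 xy] := w.
pose f t := weval e (x + t * u) (y + t * v) - weval e x y - t * weval (wdir u v e) x y
  - t ^+ 2 / 2 * weval (wdir u v (wdir u v e)) x y.
have fd t : is_derive t (1 : R) f (weval (wdir u v e) (x + t * u) (y + t * v) -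
    weval (wdir u v e) x y - t * weval (wdir u v (wdir u v e)) x y).
  apply: (drv_eq (drvB (drvB (drvB (is_derive_ray e u v x y t) (drv_cst _ t))
    (drvZr (weval (wdir u v e) x y) (drv_id t)))
    (drvZr (weval (wdir u v (wdir u v e)) x y) (drvZr (2^-1) (drvX 1 (drv_id t)))))).
  by rewrite subr0 mul1r expr1; field.
rewrite [leRHS]mulrAC; apply: (derive_pow_bound (n := 2) fd) => //.
- by rewrite /f !mul0r !addr0 subrr subr0 expr0n /= !mul0r subr0.
- by rewrite !mulr_ge0 // decay_ge0 // (le_trans x0).
move=> t t0 th; rewrite [leRHS]mulrAC; apply: hC => //; first by rewrite t0 (le_trans th).
exact: wedge_ray w w' t0 th.
Qed.

(** The Euler operator, generator of dilations: the change of mesh from m to m + 1 is a dilation of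
    the profile. *)
Definition wradial e := WAdd (WMul (@WX R) (wdx e)) (WMul (@WY R) (wdy e)).

Let wradial2 e := WAdd (WAdd (WMul (WMul (@WX R) (@WX R)) (wdx (wdx e)))
    (WMul (WMul (@WX R) (@WY R)) (WAdd (wdx (wdy e)) (wdy (wdx e)))))
  (WMul (WMul (@WY R) (@WY R)) (wdy (wdy e))).

Lemma weval_radial e : wsmall e -> exists2 C, 0 <= C & forall x y r, wedge x y ->
  1 / 2 <= r <= 1 ->
  `|weval e (r * x) (r * y) - weval e x y - (r - 1) * weval (wradial e) x y|
    <= C * (1 - r) ^+ 2 * decay x y.
Proof.
move=> se; have [|C C0 hC] := @weval_decay R (wradial2 e).
  by rewrite /= !wsmall_dx ?wsmall_dy // ?wsmall_dx // !orbT.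
exists (C * 4 * 64) => [|x y r [x0 xy] /andP[r2 r1]]; first by rewrite !mulr_ge0.
have y0 := le_trans x0 xy.
pose e1 := wdir (- x) (- y) e.
pose f t := weval e (x + t * - x) (y + t * - y) - weval e x y - t * weval e1 x y.
pose g t := weval e1 (x + t * - x) (y + t * - y) - weval e1 x y.
have fd t : is_derive t (1 : R) f (g t).
  apply: (drv_eq (drvB (drvB (is_derive_ray e (- x) (- y) x y t) (drv_cst _ t))
    (drvZr (weval e1 x y) (drv_id t)))).
  by rewrite subr0 mul1r.
have gd t : is_derive t (1 : R) g (weval (wdir (- x) (- y) e1) (x + t * - x) (y + t * - y)).
  by apply: (drv_eq (drvB (is_derive_ray e1 (- x) (- y) x y t) (drv_cst _ t))); rewrite subr0.
have h0 : 0 <= 1 - r by rewrite subr_ge0.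
have d0 := decay_ge0 x0 y0.
have -> : weval e (r * x) (r * y) - weval e x y - (r - 1) * weval (wradial e) x y = f (1 - r).
  rewrite /f /e1 /=; have E (a : R) : a + (1 - r) * - a = r * a by ring.
  by rewrite !E; ring.
rewrite [leRHS]mulrAC; apply: (derive_pow_bound (n := 1) fd) => //.
- by rewrite /f !mul0r !addr0 subrr subr0.
- by rewrite !mulr_ge0.
move=> t t0 th; apply: (derive_pow_bound (n := 0) gd) => //.
- by rewrite /g !mul0r !addr0 subrr.
- by rewrite !mulr_ge0.
move=> s s0 st; rewrite expr0 mulr1.
have s1 : 1 / 2 <= 1 - s by lra.
have E (a : R) : a + s * - a = (1 - s) * a by ring.
(* The coordinates in the direction (-x, -y) are rescaled to the point (1 - s)(x, y), where the
   decay bound applies; this costs (1 - s)^-2, at most 4. *)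
have -> : weval (wdir (- x) (- y) e1) (x + s * - x) (y + s * - y) =
    weval (wradial2 e) ((1 - s) * x) ((1 - s) * y) / (1 - s) ^+ 2.
  rewrite !E /e1 /=; field; lra.
rewrite normrM normfV [`|(1 - s) ^+ 2|]ger0_norm ?sqr_ge0 //.
have i4 : ((1 - s) ^+ 2)^-1 <= 4.
  rewrite -[4]invrK lef_pV2 ?posrE ?exprn_gt0 //; try lra.
  by rewrite expr2; nra.
have sx (a : R) : 0 <= a -> 0 <= (1 - s) * a /\ a <= 2 * ((1 - s) * a) + 1.
  by move=> a0; split; [rewrite mulr_ge0 //; lra|have := ler_wpM2r a0 s1; lra].
have [sx0 sx1] := sx _ x0; have [sy0 sy1] := sx _ y0.
have sxy : (1 - s) * x <= (1 - s) * y by rewrite ler_wpM2l //; lra.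
apply: (@le_trans _ _ (C * (64 * decay x y) * 4)); last by rewrite le_eqVlt; apply/orP; left; apply/eqP; ring.
apply: ler_pM => //; first by rewrite invr_ge0 sqr_ge0.
by apply: le_trans (hC _ _ sx0 sxy) _; rewrite ler_wpM2l // decay_shift.
Qed.

End wedge_taylor.

(** * The limiting profile and its consistency with the recursion *)

Section limit_tail.
Context {R : realType}.
Implicit Types (x y r : R).

Local Notation "a [+] b" := (WAdd a b) (at level 50, left associativity).
Local Notation "a [*] b" := (WMul a b) (at level 40, left associativity).

(** W on the wedge x <= y: the limit density of the first leader at x with the second leader beyond
    y. The two lemmas below identify its derivatives with [d1] and [d2]. *)
Definition wtail : @wexpr R :=
  WC (wk / 2) [*] (@W1 R [+] @W2 R) [+] WC (- (3 / 2 * wc * wk ^+ 2)) [*] @WX R [*] @W0 R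
  [+] WC (wk / 8) [*] @WX R [*] (WC 2 [*] @WY R [+] WC (-1) [*] @WX R) [*] @W3 R.

Let wk_neq0 : Num.sqrt (pi : R) != 0.
Proof. by rewrite gt_eqF // sqrt_pi_gt0. Qed.

Let pi_wk : (pi : R) = wk ^- 2.
Proof. by rewrite /wk exprVn invrK sqr_sqrtr // pi_ge0. Qed.

Let sqrt_wk : Num.sqrt (pi : R) = wk^-1.
Proof. by rewrite /wk invrK. Qed.

Let sqrt3 : Num.sqrt 3 = 6 * wc :> R.
Proof. by rewrite /wc mulrC divfK. Qed.

Let erf_erfc x : erf x = 1 - erfc x.
Proof. by rewrite /erfc; ring. Qed.

Let wk0 : (wk : R) != 0.
Proof. by rewrite invr_eq0. Qed.

Lemma wdx_wtail x y : weval (wdx wtail) x y = - d1 x y.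
Proof.
rewrite /d1 sqrt3 (_ : 6 * wc / 6 = wc); last by field.
rewrite sqrt_wk pi_wk.
rewrite (_ : wc * (x - 2 * y) = - (wc * (2 * y - x))); last by ring.
rewrite erfN !erf_erfc (_ : (- x ^+ 2 + x * y - y ^+ 2) / 3 = - (x ^+ 2 - x * y + y ^+ 2) / 3); last by ring.
by rewrite /= /bump0 /bump1 /bump2 /bump3; field.
Qed.

Lemma wdy_wtail x y : weval (wdy wtail) x y = - d2 x y.
Proof.
rewrite /d2 sqrt3 (_ : 6 * wc / 6 = wc); last by field.
rewrite sqrt_wk.
rewrite (_ : wc * (x - 2 * y) = - (wc * (2 * y - x))); last by ring.
rewrite (_ : - (1 / 4) * (x - y) ^+ 2 = - (x - y) ^+ 2 / 4); last by field.
rewrite erfN !erf_erfc.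
by rewrite /= /bump0 /bump1 /bump2 /bump3; field.
Qed.

Lemma wtail_small : wsmall wtail.
Proof. by []. Qed.

(** The heat equation along the three move directions for a self-similar solution, whose time
    derivative has become a dilation. Both sides are combinations of the four bumps and agree
    coefficientwise. *)
Lemma wtail_pde x y : weval (wdir 1 1 (wdir 1 1 wtail)) x y +
    weval (wdir (-1) 0 (wdir (-1) 0 wtail)) x y + weval (wdir 0 (-1) (wdir 0 (-1) wtail)) x y =
  - (weval wtail x y + weval (wradial wtail) x y).
Proof. by rewrite /=; field. Qed.

(** The continuous counterpart of [leaders_law_diag]. *)
Lemma wtail_diag x : weval (wdy wtail) x x = 0.
Proof.
rewrite /= /bump0 /bump1 /bump2 /bump3.
rewrite (_ : 2 * x - x = x); last by ring.
by field.
Qed.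

Lemma wtail_axis y : weval wtail 0 y = wk * expR (- y ^+ 2 / 4).
Proof.
rewrite /= /bump0 /bump1 /bump2 /bump3.
rewrite (_ : wc * (2 * 0 - y) = - (wc * (0 + y))); last by ring.
by rewrite erfcN sub0r sqrrN; field.
Qed.

(** Here r = (1 + eps^2/3)^(-1/2) is the ratio of consecutive meshes, so r - 1 is -eps^2/6 up to
    order eps^4. *)
Lemma step_scaleP (eps r : R) : 0 < eps <= 1 -> 0 < r -> r ^+ 2 * (1 + eps ^+ 2 / 3) = 1 ->
  [/\ 1 / 2 <= r <= 1, 1 - r <= eps ^+ 2 & `|r - 1 + eps ^+ 2 / 6| <= eps ^+ 4].
Proof.
move=> /andP[e0 e1] r0 rE.
have E0 : 0 < eps ^+ 2 by rewrite exprn_gt0.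
have E1 : eps ^+ 2 <= 1 by rewrite expr_le1 // ltW.
rewrite (_ : eps ^+ 4 = (eps ^+ 2) ^+ 2); last by rewrite -exprM.
move: (eps ^+ 2) E0 E1 rE => E E0 E1 rE; rewrite expr2 in rE *.
have r1 : r <= 1 by rewrite leNgt; apply/negP => r1; nra.
have r2 : 1 / 2 <= r by rewrite leNgt; apply/negP => r2; nra.
have d1 : 1 - r <= E.
  rewrite leNgt; apply/negP => h; nra.
split=> //; first by rewrite r2.
have F : (r - 1 + E / 6) * (6 * (1 + r)) = E * (1 - r) * (1 + 2 * r).
  have -> : (r - 1 + E / 6) * (6 * (1 + r)) = 6 * (r * r) - 6 + E + E * r by field.
  have -> : r * r = 1 - r * r * E / 3 by lra.
  lra.
have p : 0 < 6 * (1 + r) by lra.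
have q0 : 0 <= E * (1 - r) * (1 + 2 * r) by rewrite !mulr_ge0 //; lra.
have q1 : E * (1 - r) * (1 + 2 * r) <= E ^+ 2 * (6 * (1 + r)).
  by rewrite expr2 -!mulrA; apply: ler_wpM2l; [exact: ltW|apply: ler_pM; lra].
rewrite ger0_norm; last by rewrite -(pmulr_lge0 _ p) F.
by rewrite -(ler_pM2r p) F.
Qed.

(** First-order terms cancel because the three directions sum to 0. At second order the dilation by
    r, of size eps^2/6, is balanced against half the second derivatives by [wtail_pde]. Order eps^3
    remains. *)
Lemma wtail_consistent : exists2 C, 0 <= C & forall (eps r x y : R), 0 < eps <= 1 -> 0 < r ->
  r ^+ 2 * (1 + eps ^+ 2 / 3) = 1 -> eps <= x -> x + eps <= y ->
  `|3 * (r * weval wtail (r * x) (r * y)) - weval wtail (x + eps) (y + eps)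
    - weval wtail (x - eps) y - weval wtail x (y - eps)| <= C * eps ^+ 3 * decay x y.
Proof.
have n0 : `|0 : R| <= 1 by rewrite normr0.
have n1 : `|1 : R| <= 1 by rewrite normr1.
have nN : `|-1 : R| <= 1 by rewrite normrN1.
have [A A0 hA] := weval_taylor3 n1 n1 wtail_small.
have [B B0 hB] := weval_taylor3 nN n0 wtail_small.
have [C C0 hC] := weval_taylor3 n0 nN wtail_small.
have [D D0 hD] := weval_radial wtail_small.
have sr : wsmall (wradial wtail) by [].
have [F F0 hF] := weval_decay wtail_small.
have [G G0 hG] := weval_decay sr.
exists (A + B + C + 3 * D + 3 * F + 6 * G) => [|eps r x y eps1 r0 rE ex xy].
  by rewrite !addr_ge0 ?mulr_ge0.
have [r12 r1 rr] := step_scaleP eps1 r0 rE.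
have /andP[e0 e1] := eps1; have e01 : 0 <= eps <= 1 by rewrite (ltW e0).
have w : wedge x y by clear - e0 ex xy; split; lra.
have [p1 p2 p3] : [/\ wedge (x + eps * 1) (y + eps * 1), wedge (x + eps * -1) (y + eps * 0) &
    wedge (x + eps * 0) (y + eps * -1)].
  by clear - e0 ex xy; split; split; lra.
have {}hA := hA x y eps e01 w p1.
have {}hB := hB x y eps e01 w p2.
have {}hC := hC x y eps e01 w p3.
have {}hD := hD x y r w r12.
have {}hF := hF x y w.1 w.2; have {}hG := hG x y w.1 w.2.
rewrite mulr1 in hA; rewrite mulr0 mulrN1 addr0 in hB; rewrite mulr0 mulrN1 addr0 in hC.
have d0 : 0 <= decay x y by apply: decay_ge0; clear - e0 ex xy; lra.
have pde := wtail_pde x y.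
move: hA hB hC hD hF hG pde.
have D1 : weval (wdir 1 1 wtail) x y + weval (wdir (-1) 0 wtail) x y +
   weval (wdir 0 (-1) wtail) x y = 0 by rewrite /=; ring.
move: D1.
set w1 := weval (wdir 1 1 wtail) x y; set w2 := weval (wdir (-1) 0 wtail) x y.
set w3 := weval (wdir 0 (-1) wtail) x y.
set v1 := weval (wdir 1 1 (wdir 1 1 wtail)) x y.
set v2 := weval (wdir (-1) 0 (wdir (-1) 0 wtail)) x y.
set v3 := weval (wdir 0 (-1) (wdir 0 (-1) wtail)) x y.
set V := weval wtail x y; set Q := weval (wradial wtail) x y.
set U1 := weval wtail (x + eps) (y + eps); set U2 := weval wtail (x - eps) y.
set U3 := weval wtail x (y - eps); set S := weval wtail (r * x) (r * y).
move=> D1 hA hB hC hD hF hG pde.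
have -> : 3 * (r * S) - U1 - U2 - U3 = 3 * r * (S - V - (r - 1) * Q)
  + 3 * (r - 1 + eps ^+ 2 / 6) * V + 3 * ((r - 1) + eps ^+ 2 / 6) * Q + 3 * (r - 1) ^+ 2 * Q
  - (U1 - V - eps * w1 - eps ^+ 2 / 2 * v1) - (U2 - V - eps * w2 - eps ^+ 2 / 2 * v2)
  - (U3 - V - eps * w3 - eps ^+ 2 / 2 * v3).
  have -> : v1 = - (V + Q) - v2 - v3 by rewrite -pde; ring.
  have -> : w1 = - w2 - w3 by rewrite -[LHS]addr0 -[X in _ + X]subr0 -{2}D1; ring.
  by field.
clear pde D1.
have e43 : eps ^+ 4 <= eps ^+ 3 by rewrite ler_wiXn2l // ltW.
have e3 : 0 <= eps ^+ 3 by rewrite exprn_ge0 // ltW.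
have r4 : (1 - r) ^+ 2 <= eps ^+ 4.
  have /andP[_ ?] := r12.
  by rewrite (_ : eps ^+ 4 = (eps ^+ 2) ^+ 2) ?lerXn2r ?nnegrE ?sqr_ge0 // -?exprM //; lra.
have r43 := le_trans r4 e43; have rr3 := le_trans rr e43.
have t1 : `|3 * r * (S - V - (r - 1) * Q)| <= 3 * D * eps ^+ 3 * decay x y.
  rewrite normrM (ger0_norm (_ : 0 <= 3 * r)); last by rewrite mulr_ge0 // ltW.
  apply: (@le_trans _ _ (3 * (D * (1 - r) ^+ 2 * decay x y))).
    by apply: ler_pM => //; [rewrite mulr_ge0 // ltW|rewrite ger_pMr //; case/andP: r12].
  rewrite (_ : 3 * (D * _ * _) = 3 * D * decay x y * (1 - r) ^+ 2); last by ring.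
  by rewrite [leRHS]mulrAC ler_wpM2l // !mulr_ge0.
have t2 : `|3 * (r - 1 + eps ^+ 2 / 6) * V| <= 3 * F * eps ^+ 3 * decay x y.
  rewrite !normrM (ger0_norm (_ : 0 <= 3)) // (_ : 3 * F * _ * _ = 3 * eps ^+ 3 * (F * decay x y)).
    by apply: ler_pM => //; rewrite ?mulr_ge0 // ler_wpM2l.
  by ring.
have t3 : `|3 * (r - 1 + eps ^+ 2 / 6) * Q| <= 3 * G * eps ^+ 3 * decay x y.
  rewrite !normrM (ger0_norm (_ : 0 <= 3)) // (_ : 3 * G * _ * _ = 3 * eps ^+ 3 * (G * decay x y)).
    by apply: ler_pM => //; rewrite ?mulr_ge0 // ler_wpM2l.
  by ring.
have t4 : `|3 * (r - 1) ^+ 2 * Q| <= 3 * G * eps ^+ 3 * decay x y.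
  rewrite normrM (ger0_norm (_ : 0 <= 3 * (r - 1) ^+ 2)); last by rewrite mulr_ge0 ?sqr_ge0.
  rewrite (_ : 3 * G * _ * _ = 3 * eps ^+ 3 * (G * decay x y)); last by ring.
  apply: ler_pM => //; first by rewrite mulr_ge0 ?sqr_ge0.
  by rewrite ler_wpM2l // -sqrrN opprB.
rewrite (_ : _ * decay x y = 3 * D * eps ^+ 3 * decay x y + 3 * F * eps ^+ 3 * decay x y +
  3 * G * eps ^+ 3 * decay x y + 3 * G * eps ^+ 3 * decay x y + A * eps ^+ 3 * decay x y +
  B * eps ^+ 3 * decay x y + C * eps ^+ 3 * decay x y); last by ring.
by do 6 (apply: le_trans (ler_normD _ _) _; rewrite ?normrN; apply: lerD => //).
Qed.

(** This is sqrt 3 / 2. At the diagonal point with coordinates [wdiag * x] the function [bump1]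
    becomes erfc(x/2), so one-variable expansions of [erfc] are instances of those on the wedge. *)
Definition wdiag : R := 3 * wc.

Lemma wdiag2 : wdiag ^+ 2 = 3 / 4.
Proof. by rewrite exprMn wc2; field. Qed.

Lemma wdiag_itv : 1 / 2 <= wdiag <= 1.
Proof.
have h : 0 <= wdiag by rewrite mulr_ge0 // divr_ge0 // sqrtr_ge0.
by have := wdiag2; rewrite expr2 => E; apply/andP; split; nra.
Qed.

Lemma erfc_wdiag x : erfc (x / 2) = weval (@W1 R) (wdiag * x) (wdiag * x).
Proof.
rewrite /= /bump1 subrr expr0n /= oppr0 mul0r expR0 mul1r; congr erfc.
rewrite (_ : wc * _ = 6 * wc ^+ 2 * x); last by rewrite /wdiag; ring.
by rewrite wc2; field.
Qed.

Lemma wdiag_wedge x : 0 <= x -> wedge (wdiag * x) (wdiag * x).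
Proof. by move=> x0; split=> //; rewrite mulr_ge0 //; have := wdiag_itv; lra. Qed.

Lemma decay_wdiag x : 0 <= x -> decay (wdiag * x) (wdiag * x) <= 64 * decay x x.
Proof.
move=> x0; have /andP[k1 k2] := wdiag_itv; have h := ler_wpM2r x0 k1.
by apply: decay_shift => //; rewrite ?mulr_ge0 //; lra.
Qed.

Lemma wdir_wdiag x : weval (wdir wdiag wdiag (@W1 R)) (wdiag * x) (wdiag * x) =
  - (wk * expR (- x ^+ 2 / 4)).
Proof.
rewrite /= /bump0; have -> : - ((wdiag * x) ^+ 2 - wdiag * x * (wdiag * x) + (wdiag * x) ^+ 2) / 3 =
  - x ^+ 2 / 4.
  rewrite (_ : _ / 3 = - wdiag ^+ 2 * x ^+ 2 / 3); last by field.
  by rewrite wdiag2; field.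
set b := bump1 _ _; set g := expR _.
have -> : wdiag * ((- (1 / 2) * (wdiag * x) + 1 / 2 * (wdiag * x)) * b + - (2 * wc * wk) * g) +
    wdiag * ((1 / 2 * (wdiag * x) + - (1 / 2) * (wdiag * x)) * b + - (2 * wc * wk) * g) =
  - (12 * wc ^+ 2 * wk * g) by rewrite /wdiag; ring.
by rewrite wc2; field.
Qed.

(** Both endpoints are needed, as the two walls compare the same law with the profile at
    neighbouring sites. *)
Lemma erfc_taylor : exists2 C, 0 <= C & forall (eps x : R), 0 < eps <= 1 -> 0 <= x ->
  `|erfc (x / 2) - erfc ((x + eps) / 2) - eps * (wk * expR (- x ^+ 2 / 4))|
     <= C * eps ^+ 2 * decay x x /\
  `|erfc (x / 2) - erfc ((x + eps) / 2) - eps * (wk * expR (- (x + eps) ^+ 2 / 4))|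
     <= C * eps ^+ 2 * decay x x.
Proof.
have /andP[k1 k2] := wdiag_itv.
have kn : `|wdiag| <= 1 by rewrite ger0_norm //; lra.
have [A A0 hA] := weval_taylor2 kn kn (isT : wsmall (@W1 R)).
have [B B0 hB] := weval_taylor1 kn kn (wsmall_dir wdiag wdiag (isT : wsmall (@W1 R))).
exists (64 * (A + B)) => [|eps x /andP[e0 e1] x0]; first by rewrite mulr_ge0 // addr_ge0.
have e01 : 0 <= eps <= 1 by rewrite ltW.
have w := wdiag_wedge x0.
have xe0 : 0 <= x + eps by rewrite addr_ge0 // ltW.
have w' := wdiag_wedge xe0.
have E : wdiag * x + eps * wdiag = wdiag * (x + eps) by ring.
have {}hA := hA _ _ eps e01 w; rewrite E in hA; have {}hA := hA w'.
have {}hB := hB _ _ eps e01 w; rewrite E in hB; have {}hB := hB w'.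
rewrite !wdir_wdiag -!erfc_wdiag in hA hB.
have dd := decay_wdiag x0; have d0 := decay_ge0 x0 x0.
have e2 : 0 <= eps ^+ 2 := sqr_ge0 _.
have a1 : A * eps ^+ 2 * decay (wdiag * x) (wdiag * x) <= 64 * A * eps ^+ 2 * decay x x.
  rewrite (_ : 64 * A * _ * _ = A * eps ^+ 2 * (64 * decay x x)); last by ring.
  by rewrite ler_wpM2l // mulr_ge0.
have b1 : B * eps * decay (wdiag * x) (wdiag * x) <= 64 * B * eps * decay x x.
  rewrite (_ : 64 * B * _ * _ = B * eps * (64 * decay x x)); last by ring.
  by rewrite ler_wpM2l // mulr_ge0 // ltW.
have b2 : eps * (B * eps * decay (wdiag * x) (wdiag * x)) <= 64 * B * eps ^+ 2 * decay x x.
  rewrite (_ : 64 * B * _ * _ = eps * (64 * B * eps * decay x x)); last by ring.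
  by rewrite ler_wpM2l // ltW.
have c1 : 0 <= 64 * B * eps ^+ 2 * decay x x.
  exact: mulr_ge0 (mulr_ge0 (mulr_ge0 (ler0n _ _) B0) e2) d0.
have {}hA := le_trans hA a1; have {}hB := le_trans (ler_wpM2l (ltW e0) hB) b2.
rewrite (_ : 64 * (A + B) * _ * _ = 64 * A * eps ^+ 2 * decay x x + 64 * B * eps ^+ 2 * decay x x); last by ring.
have hA' : `|erfc (x / 2) - erfc ((x + eps) / 2) - eps * (wk * expR (- x ^+ 2 / 4))| <=
    64 * A * eps ^+ 2 * decay x x.
  by rewrite -normrN; apply: le_trans hA; rewrite le_eqVlt; apply/orP; left; apply/eqP; congr `|_|; ring.
split; first by apply: le_trans hA' _; rewrite lerDl.
rewrite (_ : _ - _ - _ = (erfc (x / 2) - erfc ((x + eps) / 2) - eps * (wk * expR (- x ^+ 2 / 4))) +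
   eps * (- (wk * expR (- (x + eps) ^+ 2 / 4)) - - (wk * expR (- x ^+ 2 / 4)))); last by ring.
by apply: le_trans (ler_normD _ _) _; rewrite lerD // normrM (ger0_norm (ltW e0)).
Qed.

Lemma wtail_diag_taylor : exists2 C, 0 <= C & forall (eps x : R), 0 < eps <= 1 -> 0 <= x ->
  `|weval wtail x (x + eps) - weval wtail x x| <= C * eps ^+ 2 * decay x x.
Proof.
have n0 : `|0 : R| <= 1 by rewrite normr0.
have n1 : `|1 : R| <= 1 by rewrite normr1.
have [A A0 hA] := weval_taylor2 n0 n1 wtail_small.
exists A => // eps x /andP[e0 e1] x0.
have e01 : 0 <= eps <= 1 by rewrite (ltW e0).
have := hA x x eps e01 ltac:(split; lra) ltac:(split; lra).
have -> : weval (wdir 0 1 wtail) x x = 0.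
  rewrite -[LHS]/(0 * weval (wdx wtail) x x + 1 * weval (wdy wtail) x x).
  by rewrite wtail_diag mul0r mulr0 addr0.
by rewrite mulr0 addr0 mulr1 subr0.
Qed.

End limit_tail.

Section heat_consistency.
Context {R : realType}.
Implicit Types (x r : R).

(** Obtained by differentiating [wdir_wdiag] along the diagonal and invoking uniqueness of
    derivatives. *)
Lemma wdir2_wdiag x : weval (wdir wdiag wdiag (wdir wdiag wdiag (@W1 R))) (wdiag * x) (wdiag * x) =
  wk * x / 2 * expR (- x ^+ 2 / 4).
Proof.
have h1 := is_derive_ray (wdir wdiag wdiag (@W1 R)) wdiag wdiag (wdiag * x) (wdiag * x) 0.
have h2 : is_derive (0 : R) (1 : R) (fun s => - (wk * expR (- (x + s) ^+ 2 / 4)))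
    (wk * x / 2 * expR (- x ^+ 2 / 4)).
  apply: (drv_eq (drvN (drvZl wk (drv_exp (drvZr (4^-1) (drvN (drvX 1 (drvD (drv_cst x _) (drv_id _))))))))).
  by rewrite !addr0 add0r expr1; field.
have E : (fun s : R => weval (wdir wdiag wdiag (@W1 R)) (wdiag * x + s * wdiag) (wdiag * x + s * wdiag))
    = (fun s => - (wk * expR (- (x + s) ^+ 2 / 4))).
  by apply/funext => s; rewrite (_ : _ + s * wdiag = wdiag * (x + s)) ?wdir_wdiag //; ring.
rewrite E in h1; have [_ <-] := h2; have [_ h3] := h1.
by rewrite h3 mul0r addr0.
Qed.

(** The cancellation of [wtail_consistent], now for the one-dimensional heat equation of the lazy
    walk. *)
Lemma erfc_consistent : exists2 C, 0 <= C & forall (eps r x : R), 0 < eps <= 1 -> 0 < r ->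
  r ^+ 2 * (1 + eps ^+ 2 / 3) = 1 -> eps <= x ->
  `|3 * erfc (r * x / 2) - erfc ((x - eps) / 2) - erfc (x / 2) - erfc ((x + eps) / 2)|
    <= C * eps ^+ 3 * decay x x.
Proof.
have /andP[k1 k2] := @wdiag_itv R.
have k0 : 0 <= wdiag :> R by exact: le_trans k1.
have kn : `|wdiag : R| <= 1 by rewrite ger0_norm.
have kN : `|- wdiag : R| <= 1 by rewrite normrN.
have s1 : wsmall (@W1 R) by [].
have [A A0 hA] := weval_taylor3 kn kn s1.
have [B B0 hB] := weval_taylor3 kN kN s1.
have [D D0 hD] := weval_radial s1.
have sr : wsmall (wradial (@W1 R)) by [].
have [G G0 hG] := weval_decay sr.
exists (64 * (A + B + 3 * D + 3 * G)) => [|eps r x eps1 r0 rE ex].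
  by rewrite mulr_ge0 // !addr_ge0 // mulr_ge0.
have [r12 r1 rr] := step_scaleP eps1 r0 rE.
have /andP[e0 e1] := eps1; have e01 : 0 <= eps <= 1 by rewrite (ltW e0).
have x0 : 0 <= x := le_trans (ltW e0) ex.
have w := wdiag_wedge x0.
have xp : 0 <= x + eps by rewrite addr_ge0 // ltW.
have xm : 0 <= x - eps by rewrite subr_ge0.
have E1 : wdiag * x + eps * wdiag = wdiag * (x + eps) by ring.
have E2 : wdiag * x + eps * - wdiag = wdiag * (x - eps) by ring.
have E3 : r * (wdiag * x) = wdiag * (r * x) by ring.
have {}hA := hA _ _ eps e01 w; rewrite E1 in hA; have {}hA := hA (wdiag_wedge xp).
have {}hB := hB _ _ eps e01 w; rewrite E2 in hB; have {}hB := hB (wdiag_wedge xm).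
have {}hD := hD _ _ r w r12; rewrite E3 in hD.
have {}hG := hG _ _ w.1 w.2.
have rad : weval (wradial (@W1 R)) (wdiag * x) (wdiag * x) = - (wk * x * expR (- x ^+ 2 / 4)).
  rewrite (_ : weval _ _ _ = x * weval (wdir wdiag wdiag (@W1 R)) (wdiag * x) (wdiag * x)).
    by rewrite wdir_wdiag; ring.
  by rewrite /=; ring.
have wN y : weval (wdir (- wdiag) (- wdiag) (@W1 R)) y y = - weval (wdir wdiag wdiag (@W1 R)) y y.
  by rewrite /=; ring.
have wN2 y : weval (wdir (- wdiag) (- wdiag) (wdir (- wdiag) (- wdiag) (@W1 R))) y y =
    weval (wdir wdiag wdiag (wdir wdiag wdiag (@W1 R))) y y.
  by rewrite /=; ring.
rewrite wN wN2 in hB; rewrite wdir2_wdiag wdir_wdiag in hA; rewrite wdir2_wdiag wdir_wdiag in hB.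
rewrite rad in hD hG; rewrite -!erfc_wdiag in hA hB hD.
have dd := decay_wdiag x0; have d0 := decay_ge0 x0 x0.
have dk0 : 0 <= decay (wdiag * x) (wdiag * x) by apply: decay_ge0; exact: mulr_ge0.
have e43 : eps ^+ 4 <= eps ^+ 3 by rewrite ler_wiXn2l // ltW.
have e3 : 0 <= eps ^+ 3 by rewrite exprn_ge0 // ltW.
have r4 : (1 - r) ^+ 2 <= eps ^+ 4.
  have /andP[_ ?] := r12.
  by rewrite (_ : eps ^+ 4 = (eps ^+ 2) ^+ 2) ?lerXn2r ?nnegrE ?sqr_ge0 ?subr_ge0 // -exprM.
have r43 := le_trans r4 e43; have rr3 := le_trans rr e43.
set S := erfc (r * x / 2) in hD *; set V := erfc (x / 2) in hA hB hD *.
set U1 := erfc ((x + eps) / 2) in hA *; set U2 := erfc ((x - eps) / 2) in hB *.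
set g := expR _ in hA hB hD hG; set dk := decay (wdiag * x) _ in hA hB hD hG dd dk0.
have -> : 3 * S - U2 - V - U1 = 3 * (S - V - (r - 1) * - (wk * x * g))
  + 3 * (r - 1 + eps ^+ 2 / 6) * - (wk * x * g)
  - (U1 - V - eps * - (wk * g) - eps ^+ 2 / 2 * (wk * x / 2 * g))
  - (U2 - V - eps * - - (wk * g) - eps ^+ 2 / 2 * (wk * x / 2 * g)) by field.
have t1 : `|3 * (S - V - (r - 1) * - (wk * x * g))| <= 3 * D * eps ^+ 3 * dk.
  rewrite normrM (ger0_norm (_ : 0 <= 3)) //.
  rewrite (_ : 3 * D * _ * _ = 3 * (D * eps ^+ 3 * dk)); last by ring.
  by rewrite ler_wpM2l //; apply: le_trans hD _; rewrite ler_wpM2r // ler_wpM2l.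
have t2 : `|3 * (r - 1 + eps ^+ 2 / 6) * - (wk * x * g)| <= 3 * G * eps ^+ 3 * dk.
  rewrite !normrM (ger0_norm (_ : 0 <= 3)) // (_ : 3 * G * _ * _ = 3 * eps ^+ 3 * (G * dk)).
    by apply: ler_pM => //; rewrite ?mulr_ge0 // ler_wpM2l.
  by ring.
apply: (@le_trans _ _ ((3 * D + 3 * G + A + B) * eps ^+ 3 * dk)).
  rewrite (_ : _ * dk = 3 * D * eps ^+ 3 * dk + 3 * G * eps ^+ 3 * dk + A * eps ^+ 3 * dk +
    B * eps ^+ 3 * dk); last by ring.
  by do 3 (apply: le_trans (ler_normD _ _) _; rewrite ?normrN; apply: lerD => //).
rewrite (_ : 64 * _ * _ * decay x x = (3 * D + 3 * G + A + B) * eps ^+ 3 * (64 * decay x x)); last by ring.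
by apply: ler_wpM2l dd; rewrite mulr_ge0 // !addr_ge0 // mulr_ge0.
Qed.

End heat_consistency.

(** * Discretized profiles and sums of decaying functions *)

Section lattice_profiles.
Context {R : realType}.
Implicit Types (m a b i j : nat) (x y : R).

(** At rate 3, m moves take a time of about m/3, so this is 1/sqrt t. *)
Definition mesh m : R := Num.sqrt (3 / m%:R).

Definition mesh_ratio m : R := Num.sqrt (m%:R / m.+1%:R).

(** W is extended symmetrically across the diagonal, since the recursion is symmetric in (a, b) and
    the two walls have the same limiting values. *)
Definition tail_limit x y : R := if x <= y then weval wtail x y else weval wtail y x.

Definition profile m a b : R := mesh m * tail_limit (a%:R * mesh m) (b%:R * mesh m).

Lemma mesh_gt0 m : (0 < m)%N -> 0 < mesh m.
Proof. by move=> m0; rewrite sqrtr_gt0 divr_gt0 // ltr0n. Qed.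

Lemma mesh_ge0 m : 0 <= mesh m.
Proof. exact: sqrtr_ge0. Qed.

Lemma mesh2 m : mesh m ^+ 2 = 3 / m%:R.
Proof. by rewrite sqr_sqrtr // divr_ge0. Qed.

Lemma mesh_le1 m : (3 <= m)%N -> mesh m <= 1.
Proof.
move=> m3; rewrite -[leRHS]sqrtr1 ler_wsqrtr // ler_pdivrMr ?mul1r ?ltr0n; last by case: m m3.
by rewrite ler_nat.
Qed.

Lemma mesh_itv m : (3 <= m)%N -> 0 < mesh m <= 1.
Proof. by move=> m3; rewrite mesh_gt0 ?mesh_le1 //; case: m m3. Qed.

Lemma meshS m : (0 < m)%N -> mesh m.+1 = mesh m * mesh_ratio m.
Proof.
move=> m0; rewrite /mesh /mesh_ratio -sqrtrM ?divr_ge0 //; congr Num.sqrt.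
by rewrite mulrA divfK // pnatr_eq0 -lt0n.
Qed.

Lemma mesh_ratioP m : (0 < m)%N -> 0 < mesh_ratio m /\
  mesh_ratio m ^+ 2 * (1 + mesh m ^+ 2 / 3) = 1.
Proof.
move=> m0; split; first by rewrite sqrtr_gt0 divr_gt0 // ltr0n.
have n0 : (m%:R : R) != 0 by rewrite pnatr_eq0 -lt0n.
have n1 : (m%:R + 1 : R) != 0 by rewrite natr1 pnatr_eq0.
by rewrite mesh2 sqr_sqrtr ?divr_ge0 // -natr1; field; rewrite n0 n1.
Qed.

Lemma tail_limitC x y : tail_limit x y = tail_limit y x.
Proof. by rewrite /tail_limit; case: (ltgtP x y) => [//|//|->]. Qed.

Lemma tail_limit_wedge x y : x <= y -> tail_limit x y = weval wtail x y.
Proof. by rewrite /tail_limit => ->. Qed.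

Lemma profileC m a b : profile m a b = profile m b a.
Proof. by rewrite /profile tail_limitC. Qed.

Lemma profile_wedge m a b : (a <= b)%N ->
  profile m a b = mesh m * weval wtail (a%:R * mesh m) (b%:R * mesh m).
Proof. by move=> ab; rewrite /profile tail_limit_wedge // ler_wpM2r ?mesh_ge0 // ler_nat. Qed.

Definition decay1 x : R := (1 + x) ^- 3.

Lemma decayM x y : decay x y = decay1 x * decay1 y.
Proof. by rewrite /decay /decay1 exprMn invfM. Qed.

Lemma decay1_ge0 x : 0 <= x -> 0 <= decay1 x.
Proof. by move=> x0; rewrite invr_ge0 exprn_ge0 // addr_ge0. Qed.

Lemma decay1_le1 x : 0 <= x -> decay1 x <= 1.
Proof.
by move=> x0; rewrite invf_le1 ?exprn_gt0 ?exprn_ege1 // ?ltr_wpDr // lerDl.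
Qed.

Lemma decay1_mono x y : 0 <= x -> x <= y -> decay1 y <= decay1 x.
Proof.
move=> x0 xy; rewrite lef_pV2 ?posrE ?exprn_gt0 ?ltr_wpDr //; last exact: le_trans xy.
by rewrite lerXn2r ?nnegrE ?addr_ge0 ?lerD2l //; exact: le_trans xy.
Qed.

Lemma profile_consistent : exists2 C, 0 <= C & forall m a b, (3 <= m)%N -> (0 < a)%N -> (a < b)%N ->
  `|3 * profile m.+1 a b - profile m a.+1 b.+1 - profile m a.-1 b - profile m a b.-1|
    <= C * mesh m ^+ 4 * (decay1 (a%:R * mesh m) * decay1 (b%:R * mesh m)).
Proof.
have [C C0 hC] := @wtail_consistent R; exists C => // m a b m3 a0 ab.
have m0 : (0 < m)%N by case: m m3.
have e01 := mesh_itv m3; have /andP[e0 e1] := e01.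
have [r0 rE] := mesh_ratioP m0.
rewrite !profile_wedge; try lia.
have {}hC := hC (mesh m) (mesh_ratio m) (a%:R * mesh m) (b%:R * mesh m) e01 r0 rE.
have ae : mesh m <= a%:R * mesh m by rewrite ler_peMl ?(ltW e0) // ler1n.
have abe : a%:R * mesh m + mesh m <= b%:R * mesh m.
  by rewrite -[X in _ + X]mul1r -mulrDl natr1 ler_wpM2r ?(ltW e0) // ler_nat.
have {}hC := hC ae abe.
have ap : a.-1%:R * mesh m = a%:R * mesh m - mesh m.
  by rewrite -{2}(prednK a0) -natr1; ring.
have bp : b.-1%:R * mesh m = b%:R * mesh m - mesh m.
  by rewrite -{2}(prednK (leq_ltn_trans (leq0n a) ab)) -natr1; ring.
have sa k : k.+1%:R * mesh m = k%:R * mesh m + mesh m by rewrite -natr1; ring.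
rewrite ap bp !sa meshS // -decayM.
rewrite (_ : 3 * _ - _ - _ - _ = mesh m * (3 * (mesh_ratio m * weval wtail
    (mesh_ratio m * (a%:R * mesh m)) (mesh_ratio m * (b%:R * mesh m)))
  - weval wtail (a%:R * mesh m + mesh m) (b%:R * mesh m + mesh m)
  - weval wtail (a%:R * mesh m - mesh m) (b%:R * mesh m)
  - weval wtail (a%:R * mesh m) (b%:R * mesh m - mesh m))); last first.
  rewrite (_ : a%:R * (mesh m * mesh_ratio m) = mesh_ratio m * (a%:R * mesh m)); last by ring.
  rewrite (_ : b%:R * (mesh m * mesh_ratio m) = mesh_ratio m * (b%:R * mesh m)); last by ring.
  move: (weval _ _ _) (weval _ _ _) (weval _ _ _) (weval _ _ _) => ? ? ? ?.
  by ring.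
rewrite normrM (gtr0_norm e0) (_ : C * _ * _ = mesh m * (C * mesh m ^+ 3 *
  decay (a%:R * mesh m) (b%:R * mesh m))); last by ring.
by apply: (ler_wpM2l (ltW e0)).
Qed.

Lemma profile_diag : exists2 C, 0 <= C & forall m a, (3 <= m)%N ->
  `|profile m a a.+1 - profile m a a| <= C * mesh m ^+ 3 * decay1 (a%:R * mesh m).
Proof.
have [C C0 hC] := @wtail_diag_taylor R; exists C => // m a m3.
have e01 := mesh_itv m3; have /andP[e0 e1] := e01.
have x0 : 0 <= a%:R * mesh m by rewrite mulr_ge0 // ltW.
rewrite !profile_wedge // -mulrBr normrM (gtr0_norm e0).
rewrite (_ : a.+1%:R * mesh m = a%:R * mesh m + mesh m); last by rewrite -natr1; ring.
rewrite (_ : C * _ * _ = mesh m * (C * mesh m ^+ 2 * decay1 (a%:R * mesh m))); last by ring.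
apply: ler_wpM2l; first exact: ltW.
apply: le_trans (hC _ _ e01 x0) _; rewrite decayM; apply: ler_wpM2l.
  by rewrite mulr_ge0 // sqr_ge0.
by rewrite ler_piMr ?decay1_ge0 ?decay1_le1.
Qed.

Lemma profile_le : exists2 C, 0 <= C & forall m a b,
  `|profile m a b| <= C * mesh m * (decay1 (a%:R * mesh m) * decay1 (b%:R * mesh m)).
Proof.
have [C C0 hC] := weval_decay (@wtail_small R); exists C => // m a b.
wlog ab : a b / (a <= b)%N => [h|].
  by have [/h//|/ltnW/h] := leqP a b; rewrite profileC [_ * decay1 _]mulrC.
rewrite profile_wedge // normrM (ger0_norm (mesh_ge0 m)) -decayM [C * _]mulrC -mulrA.
apply: (ler_wpM2l (mesh_ge0 m)); apply: hC; first by rewrite mulr_ge0 // mesh_ge0.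
by rewrite ler_wpM2r ?mesh_ge0 // ler_nat.
Qed.

Lemma profile_axis m b : profile m 0 b = mesh m * (wk * expR (- (b%:R * mesh m) ^+ 2 / 4)).
Proof. by rewrite profile_wedge // mul0r wtail_axis. Qed.

(** Telescoping comparison with the integral of (1 + x e)^-2; the resulting 1 + 1/e is at most 2/e
    because e <= 1. *)
Lemma sum_inv_sqr (e : R) (A : nat) : 0 < e <= 1 -> \sum_(i < A) (1 + i%:R * e) ^- 2 <= 2 / e.
Proof.
move=> /andP[e0 e1]; have p (i : nat) : 0 < 1 + i%:R * e by rewrite ltr_wpDr // mulr_ge0 // ltW.
suff h : \sum_(i < A.+1) (1 + i%:R * e) ^- 2 <= 1 + (1 - (1 + A%:R * e)^-1) / e.
  apply: le_trans (_ : \sum_(i < A.+1) (1 + i%:R * e) ^- 2 <= _).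
    by rewrite big_ord_recr /= lerDl invr_ge0 sqr_ge0.
  apply: le_trans h _; rewrite (_ : 2 / e = 1 / e + 1 / e) ?lerD //; last by field; rewrite gt_eqF.
    by rewrite ler_pdivlMr // mul1r.
  by rewrite ler_pM2r ?invr_gt0 // gerBl invr_ge0 ltW.
elim: A => [|A IH].
  by rewrite big_ord1 mul0r addr0 expr1n invr1 subrr mul0r addr0.
rewrite big_ord_recr /=; apply: le_trans (lerD IH (lexx _)) _.
rewrite -addrA lerD2l -lerBrDl -mulrBl ler_pdivlMr //.
have pA := p A; have pA1 := p A.+1.
rewrite (_ : 1 - (1 + A.+1%:R * e)^-1 - (1 - (1 + A%:R * e)^-1) =
   e / ((1 + A%:R * e) * (1 + A.+1%:R * e))); last first.
  by rewrite -natr1 in pA1 *; field; rewrite !gt_eqF.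
rewrite mulrC ler_pM2l // lef_pV2 ?posrE ?exprn_gt0 ?mulr_gt0 // expr2 ler_pM2r //.
by rewrite lerD2l ler_wpM2r ?(ltW e0) // ler_nat.
Qed.

Lemma sum_decay1 (e : R) (A : nat) : 0 < e <= 1 -> \sum_(i < A) decay1 (i%:R * e) <= 2 / e.
Proof.
move=> e01; apply: le_trans (sum_inv_sqr A e01); apply: ler_sum => i _.
have /andP[e0 _] := e01.
rewrite lef_pV2 ?posrE ?exprn_gt0 ?ltr_wpDr ?mulr_ge0 ?(ltW e0) //.
by rewrite ler_weXn2l // lerDl mulr_ge0 // ltW.
Qed.

Lemma sum_ndecay1 (e : R) (A : nat) : 0 < e <= 1 ->
  \sum_(i < A) i%:R * decay1 (i%:R * e) <= 2 / e ^+ 2.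
Proof.
move=> e01; have /andP[e0 _] := e01.
rewrite (_ : 2 / e ^+ 2 = e^-1 * (2 / e)); last by field; rewrite gt_eqF.
apply: le_trans (_ : e^-1 * \sum_(i < A) (1 + i%:R * e) ^- 2 <= _); last first.
  by rewrite ler_pM2l ?invr_gt0 // sum_inv_sqr.
rewrite mulr_sumr; apply: ler_sum => i _.
have p : 0 < 1 + i%:R * e by rewrite ltr_wpDr // mulr_ge0 // ltW.
rewrite (_ : i%:R * _ = e^-1 * (i%:R * e * decay1 (i%:R * e))); last by field; rewrite gt_eqF.
rewrite ler_pM2l ?invr_gt0 // /decay1 ler_pdivrMr ?exprn_gt0 //.
rewrite (_ : _ * _ ^+ 3 = 1 + i%:R * e); last by field; rewrite gt_eqF.
by rewrite lerDr.
Qed.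

End lattice_profiles.

(** * Weighted sums on the lattice and moments of the first leader *)

Section lattice_sums.
Context {R : realType}.
Implicit Types (f g : nat -> nat -> R) (A B i j m n : nat).

Lemma sum_shift_le (g : nat -> R) A : (forall i, 0 <= g i) ->
  \sum_(i < A) g i.+1 <= \sum_(i < A.+1) g i.
Proof. by move=> g0; rewrite big_ord_recl /= lerDr. Qed.

Lemma sum_unshift_le (g : nat -> R) A : (forall i, 0 <= g i) ->
  \sum_(i < A) g i <= g 0%N + \sum_(i < A) g i.+1.
Proof.
move=> g0; apply: (@le_trans _ _ (\sum_(i < A.+1) g i)).
  by rewrite big_ord_recr /= lerDl.
by rewrite big_ord_recl.
Qed.

Lemma sum_widen_le (g : nat -> R) A B : (A <= B)%N -> (forall i, 0 <= g i) ->
  \sum_(i < A) g i <= \sum_(i < B) g i.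
Proof.
move=> AB g0; rewrite -(subnKC AB); elim: (B - A)%N => [|n IH]; first by rewrite addn0.
by rewrite addnS big_ord_recr /= (le_trans IH) // lerDl.
Qed.

Section weighted_step.
Variables (f f' c theta : nat -> nat -> R) (d sigma : nat -> R).
Hypotheses (f0 : forall i j, 0 <= f i j) (d0 : forall i, 0 <= d i)
  (theta0 : forall i j, 0 <= theta i j)
  (theta1 : forall j, theta 1 j <= 1) (sigma0 : forall i, 0 <= sigma i).
Hypothesis rec : forall i j, 3 * f' i.+1 j <=
  f i.+2 j + f i j.+1 + (if j is j'.+1 then f i.+1 j' else d i.+1) + c i.+1 j.
Hypothesis superharmonic : forall i j,
  theta i j + (if j is j'.+1 then theta i.+2 j' else 0) + theta i.+1 j.+1 +
    (if j is 0%N then sigma i.+1 else 0) <= 3 * theta i.+1 j.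

Definition weighted_sum (t g : nat -> nat -> R) A B : R :=
  \sum_(i < A) \sum_(j < B) t i.+1 j * g i.+1 j.

(** Summation by parts moves the stencil from [f] onto [theta], where superharmonicity bounds it.
    The wall i = 0 enters with weight [theta 1 j] <= 1, the diagonal through [d], and the slack
    [sigma] on the row j = 0 is kept as a gain. *)
Lemma weighted_step A B :
  3 * weighted_sum theta f' A B + \sum_(i < A) sigma i.+1 * f i.+1 0%N <=
  3 * weighted_sum theta f A.+1 B.+1 + \sum_(j < B.+1) f 0%N j
  + \sum_(i < A) theta i.+1 0%N * d i.+1 + weighted_sum theta c A B.
Proof.
pose G i := \sum_(j < B.+1) theta i j * f i.+1 j.
have G0 i : 0 <= G i by apply: sumr_ge0 => j _; rewrite mulr_ge0.
pose K i j := (if j is j'.+1 then theta i.+1 j' else 0) * f i j.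
have K0 i j : 0 <= K i j by rewrite mulr_ge0 //; case: j.
pose M i := \sum_(j < B.+1) K i j.
have M0 i : 0 <= M i by exact: sumr_ge0.
pose N i := \sum_(j < B.+1) theta i.+1 j.+1 * f i.+1 j.
have s1 : \sum_(i < A) \sum_(j < B) theta i.+1 j * f i.+2 j <= \sum_(i < A.+1) G i.
  apply: le_trans (sum_shift_le A G0); apply: ler_sum => i _.
  by apply: (@sum_widen_le (fun j => theta i.+1 j * f i.+2 j)) => // j; rewrite mulr_ge0.
have s2 : \sum_(i < A) \sum_(j < B) theta i.+1 j * f i j.+1 <=
    \sum_(j < B.+1) f 0%N j + \sum_(i < A.+1) M i.+1.
  apply: (@le_trans _ _ (\sum_(i < A) M i)).
    by apply: ler_sum => i _; apply: (@sum_shift_le (K i)).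
  apply: le_trans (sum_unshift_le A M0) _; apply: lerD.
    apply: ler_sum => j _; rewrite /K; case: (nat_of_ord j) => [|j']; first by rewrite mul0r.
    by rewrite ler_piMl.
  exact: (@sum_widen_le (fun i => M i.+1)).
have s3 : \sum_(i < A) \sum_(j < B) theta i.+1 j * (if nat_of_ord j is j'.+1 then f i.+1 j' else d i.+1)
    <= \sum_(i < A) theta i.+1 0%N * d i.+1 + \sum_(i < A.+1) N i.
  apply: (@le_trans _ _ (\sum_(i < A) (theta i.+1 0%N * d i.+1 + N i))); last first.
    rewrite big_split /= lerD2l; apply: (@sum_widen_le N) => // i.
    by apply: sumr_ge0 => j _; rewrite mulr_ge0.
  apply: ler_sum => i _.
  have h0 j : 0 <= theta i.+1 j * (if j is j'.+1 then f i.+1 j' else d i.+1).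
    by rewrite mulr_ge0 //; case: j.
  apply: le_trans (sum_unshift_le B h0) _; rewrite lerD2l.
  apply: (@sum_widen_le (fun j => theta i.+1 j.+1 * f i.+1 j)) => // j; exact: mulr_ge0.
have s4 : \sum_(i < A.+1) (G i + M i.+1 + N i) + \sum_(i < A.+1) sigma i.+1 * f i.+1 0%N <=
    3 * weighted_sum theta f A.+1 B.+1.
  rewrite /weighted_sum mulr_sumr -big_split /=; apply: ler_sum => i _.
  rewrite mulr_sumr /G /M /N -!big_split /=.
  apply: (@le_trans _ _ (\sum_(j < B.+1) ((theta i j * f i.+1 j + K i.+1 j + theta i.+1 j.+1 * f i.+1 j) +
     (if nat_of_ord j is 0%N then sigma i.+1 else 0) * f i.+1 j))).
    rewrite [leRHS]big_split /= lerD2l big_ord_recl /= lerDl; apply: sumr_ge0 => j _.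
    by rewrite mul0r.
  apply: ler_sum => j _; rewrite /K -!mulrDl mulrA; apply: ler_wpM2r => //.
have s5 : \sum_(i < A) sigma i.+1 * f i.+1 0%N <= \sum_(i < A.+1) sigma i.+1 * f i.+1 0%N.
  by apply: (@sum_widen_le (fun i => sigma i.+1 * f i.+1 0%N)) => // i; rewrite mulr_ge0.
have s0 : 3 * weighted_sum theta f' A B <=
   \sum_(i < A) \sum_(j < B) theta i.+1 j * f i.+2 j +
   \sum_(i < A) \sum_(j < B) theta i.+1 j * f i j.+1 +
   \sum_(i < A) \sum_(j < B) theta i.+1 j * (if nat_of_ord j is j'.+1 then f i.+1 j' else d i.+1) +
   weighted_sum theta c A B.
  rewrite /weighted_sum mulr_sumr -!big_split /=; apply: ler_sum => i _.
  rewrite mulr_sumr -!big_split /=; apply: ler_sum => j _.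
  by rewrite -!mulrDr mulrCA ler_wpM2l.
rewrite !big_split /= in s4.
by clear - s0 s1 s2 s3 s4 s5; lra.
Qed.

End weighted_step.

(** Each step back in m enlarges the window by one, so the start is seen through a window of size A
    + n; the bounds fed in are uniform in the window. *)
Lemma telescope (X G e : nat -> nat -> R) m0 :
  (forall m A, (m0 <= m)%N -> X m.+1 A + G m A <= X m A.+1 + e m A) ->
  (forall m A, G m A <= G m A.+1) -> (forall m A, e m A <= e m A.+1) -> forall n A,
  X (m0 + n)%N A + \sum_(k < n) G (m0 + k)%N A <=
  X m0 (A + n)%N + \sum_(k < n) e (m0 + k)%N (A + n)%N.
Proof.
move=> step Gm em; elim=> [|n IH] A; first by rewrite !big_ord0 !addn0.
have h := step (m0 + n)%N A (leq_addr _ _); have {}IH := IH A.+1.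
rewrite !big_ord_recr /= -addSnnS addnS.
have : \sum_(k < n) G (m0 + k)%N A <= \sum_(k < n) G (m0 + k)%N A.+1.
  by apply: ler_sum => k _; exact: Gm.
have : e (m0 + n)%N A <= e (m0 + n)%N (A.+1 + n)%N.
  rewrite addSnnS; elim: n.+1 => [|p IHp]; first by rewrite addn0.
  by rewrite addnS; apply: le_trans (em _ _).
by lra.
Qed.

Lemma sum_leader_law m A : \sum_(a < A) leader_law m a <= 1 :> R.
Proof.
have r0 k a : 0 <= leader_law k a :> R := leader_law_ge0 k a.
elim: m A => [|m IH] A.
  apply: (@le_trans _ _ (\sum_(a < A.+1) (leader_law 0 a : R))).
    by rewrite big_ord_recr /= lerDl.
  rewrite big_ord_recl /= leader_law_init /= big1 ?addr0 // => i _.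
  by rewrite leader_law_init.
rewrite -(ler_pM2l (ltr0n _ 3)) mulr1 mulr_sumr.
under eq_bigr do rewrite leader_lawS.
rewrite !big_split /=.
have h1 := sum_unshift_le A (fun a => r0 m a.-1).
rewrite /= in h1.
have h2 : \sum_(i < A) leader_law m i.+1 + leader_law m 0 <= 1 :> R.
  by apply: le_trans (IH A.+1); rewrite big_ord_recl /= addrC.
have h3 := IH A.
have h4 : leader_law m 0 + \sum_(i < A) leader_law m i.+1 <= 1 :> R by rewrite addrC.
by lra.
Qed.

Lemma sum_sqr_leader_law m A : \sum_(a < A) a%:R ^+ 2 * leader_law m a <= m%:R :> R.
Proof.
have r0 k a : 0 <= leader_law k a :> R := leader_law_ge0 k a.
elim: m A => [|m IH] A.
  rewrite big1 // => i _; rewrite leader_law_init.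
  by case: (nat_of_ord i) => [|j]; rewrite ?expr0n ?mul0r ?mulr0.
rewrite -(ler_pM2l (ltr0n _ 3)) mulr_sumr.
have E (i : nat) : 3 * (i%:R ^+ 2 * leader_law m.+1 i) =
   i%:R ^+ 2 * leader_law m i.-1 + i%:R ^+ 2 * leader_law m i + i%:R ^+ 2 * leader_law m i.+1 :> R.
  by rewrite mulrCA leader_lawS !mulrDr.
rewrite (eq_bigr _ (fun (i : 'I_A) _ => E i)) !big_split /=.
have s0 (k : nat) : 0 <= k%:R ^+ 2 :> R by rewrite sqr_ge0.
have h1 := sum_unshift_le A (fun a => mulr_ge0 (s0 a) (r0 m a.-1)).
have h2 := sum_shift_le A (fun a => mulr_ge0 (s0 a.-1) (r0 m a)).
rewrite /= in h1 h2.
have h3 : \sum_(i < A) (i%:R ^+ 2 * leader_law m i : R) <= \sum_(i < A.+1) i%:R ^+ 2 * leader_law m i.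
  by rewrite big_ord_recr /= lerDl mulr_ge0.
have h4 : \sum_(i < A) (i.+1%:R ^+ 2 * leader_law m i : R) <= \sum_(i < A.+1) i.+1%:R ^+ 2 * leader_law m i.
  by rewrite big_ord_recr /= lerDl mulr_ge0.
have h5 : \sum_(i < A.+1) (i.+1%:R ^+ 2 * leader_law m i : R) +
    \sum_(i < A.+1) i%:R ^+ 2 * leader_law m i + \sum_(i < A.+1) i.-1%:R ^+ 2 * leader_law m i
    <= 3 * (\sum_(i < A.+1) i%:R ^+ 2 * leader_law m i) + 2 * \sum_(i < A.+1) leader_law m i.
  rewrite !mulr_sumr -!big_split /=; apply: ler_sum => i _; rewrite -!mulrDl mulrA -mulrDl.
  apply: ler_wpM2r => //; case: (nat_of_ord i) => [|k] /=.
    by rewrite !expr0n /= expr1n; lra.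
  by rewrite -!(natr1 k.+1) -!(natr1 k); lra.
have h6 := IH A.+1; have h7 := sum_leader_law m A.+1.
rewrite expr0n /= mul0r add0r in h1.
have -> : 3 * m.+1%:R = 3 * m%:R + 3 :> R by rewrite -natr1; ring.
by lra.
Qed.

End lattice_sums.

(** * Energy estimate for the first leader *)

Section leader_asymptotics.
Context {R : realType}.
Implicit Types (m n a i j k A B N : nat).
Local Notation mesh := (@mesh R).

Let r0 m a : 0 <= leader_law m a :> R := leader_law_ge0 m a.

Definition leader_tail m a : R := 1 - \sum_(i < a) leader_law m i.

Lemma leader_tailS m a : leader_tail m a.+1 = leader_tail m a - leader_law m a.
Proof. by rewrite /leader_tail big_ord_recr /= opprD addrA. Qed.

Lemma leader_tail_itv m a : 0 <= leader_tail m a <= 1.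
Proof. by rewrite subr_ge0 sum_leader_law /= gerBl sumr_ge0. Qed.

Lemma leader_tail_step m a :
  3 * leader_tail m.+1 a.+1 = leader_tail m a + leader_tail m a.+1 + leader_tail m a.+2.
Proof.
elim: a => [|a IH].
  rewrite /leader_tail !big_ord_recr !big_ord0 /= add0r mulrBr leader_lawS /=; ring.
by rewrite leader_tailS mulrBr IH leader_lawS /= !leader_tailS; ring.
Qed.

Lemma sum_leader_tail m A : \sum_(a < A) leader_tail m a.+1 <= m%:R.
Proof.
have t0 k a : 0 <= leader_tail k a by case/andP: (leader_tail_itv k a).
elim: m A => [|m IH] A.
  rewrite big1 // => a _; rewrite /leader_tail big_ord_recl /= leader_law_init.
  by rewrite big1 ?addr0 ?subrr // => i _; rewrite leader_law_init.
rewrite -(ler_pM2l (ltr0n _ 3)) mulr_sumr.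
rewrite (eq_bigr _ (fun (i : 'I_A) _ => leader_tail_step m i)).
have -> : \sum_(i < A) (leader_tail m i + leader_tail m i.+1 + leader_tail m i.+2) =
   \sum_(i < A) leader_tail m i + \sum_(i < A) leader_tail m i.+1 + \sum_(i < A) leader_tail m i.+2.
  by rewrite -!big_split.
have h1 := sum_unshift_le A (t0 m).
have h2 := IH A; have h3 := IH A.+1.
have h4 : \sum_(i < A) leader_tail m i.+2 <= \sum_(i < A.+1) leader_tail m i.+1.
  exact: (@sum_shift_le R (fun i => leader_tail m i.+1)).
have h5 : leader_tail m 0 <= 1 by case/andP: (leader_tail_itv m 0).
have -> : 3 * m.+1%:R = 3 * m%:R + 3 :> R by rewrite -natr1; ring.
by lra.
Qed.

(** Distribution functions are compared instead of densities because this defect vanishes at a = 0,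
    so summing its squares leaves no boundary term. *)
Definition tail_defect m a : R := leader_tail m a - erfc (a%:R * mesh m / 2).

Lemma tail_defect0 m : tail_defect m 0 = 0.
Proof. by rewrite /tail_defect /leader_tail big_ord0 !mul0r /erfc erf0 !subr0 subrr. Qed.

Let xge0 m a : 0 <= a%:R * mesh m :> R.
Proof. by rewrite mulr_ge0 // mesh_ge0. Qed.

Lemma tail_defect_le1 m a : `|tail_defect m a| <= 1.
Proof.
have /andP[h0 h1] := leader_tail_itv m a.
have h2 := erfc_ge0 (a%:R * mesh m / 2); have h3 : erfc (a%:R * mesh m / 2) <= 1.
  by rewrite erfc_le1 // divr_ge0.
by rewrite ler_norml /tail_defect; apply/andP; split; lra.
Qed.

Lemma tail_defect_step : exists2 C, 0 <= C & forall m a, (3 <= m)%N ->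
  `|3 * tail_defect m.+1 a.+1 - tail_defect m a - tail_defect m a.+1 - tail_defect m a.+2|
    <= C * mesh m ^+ 3 * decay1 (a%:R * mesh m).
Proof.
have [C C0 hC] := @erfc_consistent R; exists C => // m a m3.
have m0 : (0 < m)%N by case: m m3.
have e01 := @mesh_itv R _ m3; have /andP[e0 e1] := e01.
have [q0 qE] := @mesh_ratioP R _ m0.
have ex : mesh m <= a.+1%:R * mesh m :> R by rewrite ler_peMl ?(ltW e0) // ler1n.
have := hC _ _ _ e01 q0 qE ex.
rewrite (_ : a.+1%:R * mesh m - mesh m = a%:R * mesh m); last by rewrite -natr1; ring.
rewrite (_ : a.+1%:R * mesh m + mesh m = a.+2%:R * mesh m); last by rewrite -[a.+2%:R]natr1; ring.
rewrite (_ : mesh_ratio m * _ = a.+1%:R * mesh m.+1); last by rewrite meshS //; ring.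
move=> h.
have -> : 3 * tail_defect m.+1 a.+1 - tail_defect m a - tail_defect m a.+1 - tail_defect m a.+2 =
  - (3 * erfc (a.+1%:R * mesh m.+1 / 2) - erfc (a%:R * mesh m / 2) - erfc (a.+1%:R * mesh m / 2)
     - erfc (a.+2%:R * mesh m / 2)).
  rewrite /tail_defect mulrBr leader_tail_step.
  move: (erfc _) (erfc _) (erfc _) (erfc _) (leader_tail m a) (leader_tail m _) (leader_tail m _).
  by move=> *; ring.
rewrite normrN.
apply: le_trans h _; rewrite decayM; apply: ler_wpM2l.
  by rewrite mulr_ge0 // exprn_ge0 // ltW.
apply: (@le_trans _ _ (decay1 (a.+1%:R * mesh m))).
  by rewrite ler_piMr ?decay1_ge0 ?decay1_le1.
by apply: decay1_mono => //; rewrite ler_wpM2r ?(ltW e0) // ler_nat.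
Qed.

Lemma erfc_decay : exists2 C, 0 <= C & forall x : R, 0 <= x -> erfc (x / 2) <= C * decay1 x.
Proof.
have [C C0 hC] := weval_decay (isT : wsmall (@W1 R)).
exists (C * 64) => [|x x0]; first by rewrite mulr_ge0.
have [w0 w1] := wdiag_wedge x0.
rewrite erfc_wdiag; apply: le_trans (ler_norm _) _; apply: le_trans (hC _ _ w0 w1) _.
rewrite -mulrA ler_wpM2l //; apply: le_trans (decay_wdiag x0) _; rewrite ler_wpM2l // decayM.
by rewrite ler_piMr ?decay1_ge0 ?decay1_le1.
Qed.

(** The mean of three squares exceeds the square of the mean by a ninth of the squared differences.
    Summed over the lattice, the l^2 norm of the defect loses its gradient energy at each step, up
    to the consistency error. The start m = 3 is where the mesh equals 1. *)
Lemma energy_bound : exists2 C, 0 <= C & forall n A,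
  \sum_(k < n) \sum_(a < A) (tail_defect (3 + k) a - tail_defect (3 + k) a.+1) ^+ 2
    <= C * (1 + \sum_(k < n) mesh (3 + k) ^+ 2).
Proof.
have [C C0 hC] := tail_defect_step; have [F F0 hF] := erfc_decay.
pose X m A := \sum_(a < A) tail_defect m a.+1 ^+ 2.
pose G m A := \sum_(a < A) (tail_defect m a - tail_defect m a.+1) ^+ 2 / 9.
pose e m : R := 2 * C * mesh m ^+ 2.
have step m A : (3 <= m)%N -> X m.+1 A + G m A <= X m A.+1 + e m.
  move=> m3; have e01 := @mesh_itv R _ m3; have /andP[e0 e1] := e01.
  have pt a : tail_defect m.+1 a.+1 ^+ 2 + (tail_defect m a - tail_defect m a.+1) ^+ 2 / 9 <=
      (tail_defect m a ^+ 2 + tail_defect m a.+1 ^+ 2 + tail_defect m a.+2 ^+ 2) / 3 +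
      C * mesh m ^+ 3 * decay1 (a%:R * mesh m).
    have := hC m a m3.
    have := tail_defect_le1 m a; have := tail_defect_le1 m a.+1; have := tail_defect_le1 m a.+2.
    have := tail_defect_le1 m.+1 a.+1.
    move: (tail_defect m a) (tail_defect m a.+1) (tail_defect m a.+2) (tail_defect m.+1 a.+1).
    move: (C * _ * _) => K p q s u.
    rewrite !ler_norml => /andP[u1 u2] /andP[s1 s2] /andP[q1 q2] /andP[p1 p2] /andP[c1 c2].
    have K0 : 0 <= K by lra.
    pose c := 3 * u - p - q - s.
    have -> : u = (p + q + s + c) / 3 by rewrite /c; field.
    (* Of the three squared differences only that of [p] and [q] is retained on the left; the other
       two have a favourable sign. *)
    have -> : ((p + q + s + c) / 3) ^+ 2 + (p - q) ^+ 2 / 9 =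
       (p ^+ 2 + q ^+ 2 + s ^+ 2) / 3 - ((q - s) ^+ 2 + (p - s) ^+ 2) / 9 +
       c / 3 * (u + (p + q + s) / 3) by rewrite /c; field.
    have h1 : 0 <= ((q - s) ^+ 2 + (p - s) ^+ 2) / 9 by rewrite divr_ge0 ?addr_ge0 ?sqr_ge0.
    have h2 : c / 3 * (u + (p + q + s) / 3) <= K.
      have cK : `|c| <= K by rewrite ler_norml; apply/andP; split; rewrite /c; lra.
      apply: le_trans (ler_norm _) _; rewrite normrM.
      apply: (@le_trans _ _ (K / 3 * 2)); last by lra.
      apply: ler_pM => //; first by rewrite normrM [`|3^-1|]ger0_norm ?invr_ge0 // ler_wpM2r ?invr_ge0.
      by rewrite ler_norml; apply/andP; split; lra.
    by lra.
  rewrite /X /G -big_split /=; apply: le_trans (ler_sum _ (fun (i : 'I_A) _ => pt i)) _.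
  rewrite big_split /= -mulr_suml !big_split /= -mulr_sumr.
  have sq0 k : 0 <= tail_defect m k ^+ 2 := sqr_ge0 _.
  have h1 := sum_unshift_le A sq0; rewrite /= tail_defect0 expr0n /= add0r in h1.
  have h2 : \sum_(i < A) tail_defect m i.+1 ^+ 2 <= \sum_(i < A.+1) tail_defect m i.+1 ^+ 2.
    by rewrite big_ord_recr /= lerDl.
  have h3 : \sum_(i < A) tail_defect m i.+2 ^+ 2 <= \sum_(i < A.+1) tail_defect m i.+1 ^+ 2.
    exact: (@sum_shift_le R (fun i => tail_defect m i.+1 ^+ 2)).
  have h4 : C * mesh m ^+ 3 * \sum_(i < A) decay1 (i%:R * mesh m) <= e m.
    rewrite /e (_ : 2 * C * mesh m ^+ 2 = C * mesh m ^+ 3 * (2 / mesh m)); last first.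
      by field; rewrite gt_eqF.
    by rewrite ler_wpM2l ?sum_decay1 // mulr_ge0 // exprn_ge0 // ltW.
  by lra.
have Gm m A : G m A <= G m A.+1.
  by rewrite /G big_ord_recr /= lerDl divr_ge0 // sqr_ge0.
have X3 A : X 3 A <= 3 + 2 * F.
  have e01 := @mesh_itv R _ (leqnn 3); have /andP[e0 e1] := e01.
  apply: (@le_trans _ _ (\sum_(a < A) (leader_tail 3 a.+1 + F * decay1 (a%:R * mesh 3)))).
    apply: ler_sum => a _; rewrite -real_normK ?num_real //.
    apply: (@le_trans _ _ `|tail_defect 3 a.+1|).
      by rewrite expr2 ler_piMr ?tail_defect_le1.
    have /andP[h0 _] := leader_tail_itv 3 a.+1.
    have h1 := erfc_ge0 (a.+1%:R * mesh 3 / 2).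
    apply: le_trans (ler_normB _ _) _; rewrite !ger0_norm // lerD2l.
    apply: le_trans (hF _ (xge0 3 _)) _; rewrite ler_wpM2l // decay1_mono //.
    by rewrite ler_wpM2r ?(ltW e0) // ler_nat.
  rewrite big_split /= -mulr_sumr lerD ?sum_leader_tail //.
  rewrite [2 * F]mulrC; apply: ler_wpM2l => //.
  apply: le_trans (sum_decay1 _ e01) _.
  have -> : mesh 3 = 1 :> R by rewrite /mesh divff ?sqrtr1 // pnatr_eq0.
  by rewrite divr1.
exists (9 * (3 + 2 * F + 2 * C)) => [|n A]; first by rewrite mulr_ge0 // !addr_ge0 // mulr_ge0.
have h := @telescope R X G (fun m _ => e m) 3 step Gm (fun _ _ => lexx _) n A.
have X0 : 0 <= X (3 + n)%N A by apply: sumr_ge0 => a _; exact: sqr_ge0.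
have E : \sum_(k < n) G (3 + k)%N A = (\sum_(k < n) \sum_(a < A)
    (tail_defect (3 + k) a - tail_defect (3 + k) a.+1) ^+ 2) / 9.
  by rewrite mulr_suml; apply: eq_bigr => k _; rewrite mulr_suml.
rewrite E /e -mulr_sumr in h; have h3 := X3 (A + n)%N.
set S := \sum_(k < n) \sum_(a < A) _ in h *; set T := \sum_(k < n) _ in h *.
have T0 : 0 <= T by apply: sumr_ge0 => k _; exact: sqr_ge0.
have CT : 0 <= C * T by exact: mulr_ge0.
have FT : 0 <= F * T by exact: mulr_ge0.
rewrite (_ : 9 * _ * (1 + T) = 9 * (3 + 2 * F + 2 * C * T) + 9 * (3 * T + 2 * (F * T) + 2 * C)); last by ring.
by move: CT; rewrite mulrA; lra.
Qed.

End leader_asymptotics.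

(** * Sublinear bounds and the error at the walls *)

Section sublinear.
Context {R : realType}.
Implicit Types (F G : nat -> nat -> R) (n m k A B N j : nat).
Local Notation mesh := (@mesh R).
Local Notation leader_law := (@leader_law R).
Local Notation profile := (@profile R).

(** Arbitrarily small slope in n, uniformly in the window A, which grows with n in [telescope]. *)
Definition sublinear F := forall eta : R, 0 < eta -> exists C, forall n A, F n A <= C + eta * n%:R.

Lemma sublinear_le F G : (forall n A, F n A <= G n A) -> sublinear G -> sublinear F.
Proof.
move=> FG hG eta eta0; have [C hC] := hG eta eta0.
by exists C => n A; apply: le_trans (hC n A).
Qed.

Lemma sublinearD F G : sublinear F -> sublinear G -> sublinear (fun n A => F n A + G n A).
Proof.
move=> hF hG eta eta0; have eta2 : 0 < eta / 2 by rewrite divr_gt0.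
have [C hC] := hF _ eta2; have [D hD] := hG _ eta2.
exists (C + D) => n A; apply: le_trans (lerD (hC n A) (hD n A)) _.
by lra.
Qed.

Lemma sublinearZ (c : R) F : 0 <= c -> sublinear F -> sublinear (fun n A => c * F n A).
Proof.
move=> c0 hF eta eta0.
have c1 : 0 < c + 1 by rewrite ltr_wpDl.
have [C hC] := hF (eta / (c + 1)) (divr_gt0 eta0 c1).
exists (c * C) => n A; apply: le_trans (ler_wpM2l c0 (hC n A)) _.
rewrite mulrDr lerD2l mulrA ler_wpM2r // mulrCA ler_piMr ?(ltW eta0) //.
by rewrite ler_pdivrMr // mul1r lerDl.
Qed.

Lemma sublinear_cst (c : R) : sublinear (fun _ _ => c).
Proof. by move=> eta eta0; exists c => n A; rewrite lerDl mulr_ge0 // ltW. Qed.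

Lemma nat_above (x : R) : exists M : nat, x <= M%:R.
Proof.
have [x0|x0] := leP 0 x; last by exists 0%N; exact: ltW.
by exists (Num.bound x); apply: ltW; exact: archi_boundP.
Qed.

Lemma mesh_small (eta : R) : 0 < eta -> exists M : nat, forall m, (M <= m)%N -> mesh m <= eta.
Proof.
move=> eta0; have [M hM] := nat_above (3 / eta ^+ 2).
exists M.+1 => m Mm; rewrite -[leRHS](ger0_norm (ltW eta0)) -sqrtr_sqr; apply: ler_wsqrtr.
have m0 : 0 < (m%:R : R) by rewrite ltr0n; case: m Mm.
rewrite ler_pdivrMr // mulrC -ler_pdivrMr ?exprn_gt0 //.
by apply: le_trans hM _; rewrite ler_nat ltnW.
Qed.

Lemma sum_mesh_sublinear : sublinear (fun n _ => \sum_(k < n) mesh (3 + k)).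
Proof.
move=> eta eta0; have [M hM] := mesh_small eta0.
exists M%:R => n _; apply: (@le_trans _ _ (\sum_(k < n) ((k < M)%N%:R + eta))).
  apply: ler_sum => k _; case: ltnP => kM.
    by apply: (@le_trans _ _ 1); [exact: mesh_le1|rewrite lerDl ltW].
  by rewrite add0r hM // (leq_trans kM) // leq_addl.
rewrite big_split /= sumr_const card_ord mulr_natr lerD2r -natr_sum ler_nat.
elim: n => [|n IH]; first by rewrite big_ord0.
rewrite big_ord_recr /=; case: ltnP => nM; last by rewrite addn0.
rewrite addn1; apply: leq_ltn_trans nM.
rewrite -[leqRHS]card_ord -sum1_card; apply: leq_sum => i _; exact: leq_b1.
Qed.

Let q n : R := Num.sqrt (3 + n)%:R.

Let q2 n : q n ^+ 2 = (3 + n)%:R. Proof. by rewrite sqr_sqrtr. Qed.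

Let q_ge1 n : 1 <= q n.
Proof. by rewrite -[leLHS]sqrtr1 ler_wsqrtr // ler1n. Qed.

(** The sum grows like log n; only its smallness against sqrt n is recorded. *)
Lemma sum_mesh2 (eta : R) : 0 < eta -> exists C, forall n,
  \sum_(k < n) mesh (3 + k) ^+ 2 <= C + eta * q n.
Proof.
(* 81 = 9^2: once q n >= 9 / eta, the increment 3 / (q n)^2 is at most eta / (3 q n), which eta (q
   (n + 1) - q n) dominates. *)
move=> eta0; have [M hM] := nat_above (81 / eta ^+ 2).
exists M%:R => n; elim: n => [|n IH].
  by rewrite big_ord0 addr_ge0 // mulr_ge0 ?(ltW eta0) // sqrtr_ge0.
have qq : q n <= q n.+1 by rewrite ler_wsqrtr // ler_nat addnS.
have [nM|Mn] := ltnP n M.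
  apply: (@le_trans _ _ M%:R); last by rewrite lerDl mulr_ge0 ?(ltW eta0) // sqrtr_ge0.
  apply: (@le_trans _ _ (\sum_(k < n.+1) 1)); last by rewrite sumr_const card_ord ler_nat.
  by apply: ler_sum => k _; rewrite expr_le1 // ?mesh_ge0 // mesh_le1.
rewrite big_ord_recr /=; apply: le_trans (lerD IH (lexx _)) _.
rewrite -addrA lerD2l -lerBrDl -mulrBr mesh2.
have u1 := q_ge1 n.
have h81 : 81 / eta ^+ 2 <= q n ^+ 2.
  by rewrite q2; apply: le_trans hM _; rewrite ler_nat (leq_trans Mn) // leq_addl.
have h9 : 9 / eta <= q n.
  rewrite -(@ler_pXn2r _ 2) ?nnegrE ?divr_ge0 ?(ltW eta0) ?sqrtr_ge0 //.
  by rewrite expr_div_n (_ : 9 ^+ 2 = 81) //; ring.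
have v2 : q n.+1 ^+ 2 = q n ^+ 2 + 1 by rewrite !q2 natr1 addnS.
rewrite -(q2 n); move: (q n) (q n.+1) qq u1 h9 v2 => u v uv u1 h9 v2.
have u0 : 0 < u by exact: lt_le_trans u1.
have vu : v <= 2 * u by rewrite leNgt; apply/negP => h; rewrite !expr2 in v2; nra.
have D : (v - u) * (v + u) = 1 by rewrite -subr_sqr v2; ring.
have vu0 : 0 < v + u by rewrite addr_gt0 // (lt_le_trans u0).
have d3 : 1 <= (v - u) * (3 * u) by rewrite -[leLHS]D; apply: ler_wpM2l; lra.
rewrite ler_pdivrMr ?exprn_gt0 //.
have e9 : 9 <= eta * u by rewrite mulrC -ler_pdivrMr.
have h : 9 <= 3 * (eta * (v - u) * u ^+ 2).
  rewrite (_ : 3 * _ = (eta * u) * ((v - u) * (3 * u))); last by ring.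
  by rewrite -[leLHS]mulr1; apply: ler_pM.
by lra.
Qed.

(** The wall a = 0 carries [leader_law m j] at b = j + 1, the wall b = 0 carries it at a = j; hence
    both sites of the profile. *)
Definition wall_gap m j : R :=
  `|leader_law m j - profile m 0 j| + `|leader_law m j - profile m 0 j.+1|.

Let slope m j : R := tail_defect m j - tail_defect m j.+1.

Lemma wall_gap_slope : exists2 C, 0 <= C & forall m j, (3 <= m)%N ->
  wall_gap m j <= 2 * `|slope m j| + C * mesh m ^+ 2 * decay1 (j%:R * mesh m).
Proof.
have [C C0 hC] := @erfc_taylor R; exists (2 * C) => [|m j m3]; first by rewrite mulr_ge0.
have e01 := @mesh_itv R _ m3; have /andP[e0 e1] := e01.
have x0 : 0 <= j%:R * mesh m by rewrite mulr_ge0 // ltW.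
have [] := hC _ _ e01 x0; rewrite decayM /wall_gap !profile_axis.
rewrite (_ : j.+1%:R * mesh m = j%:R * mesh m + mesh m); last by rewrite -natr1; ring.
have -> : slope m j = leader_law m j - (erfc (j%:R * mesh m / 2) - erfc ((j%:R * mesh m + mesh m) / 2)).
  rewrite /slope /tail_defect leader_tailS (_ : j.+1%:R * mesh m = j%:R * mesh m + mesh m); last first.
    by rewrite -natr1; ring.
  by ring.
have dd : C * mesh m ^+ 2 * (decay1 (j%:R * mesh m) * decay1 (j%:R * mesh m)) <=
   C * mesh m ^+ 2 * decay1 (j%:R * mesh m).
  apply: ler_wpM2l; first by rewrite mulr_ge0 // sqr_ge0.
  by rewrite ler_piMr ?decay1_ge0 ?decay1_le1.
set E := erfc _ - erfc _; set p := mesh m * (wk * expR _); set p' := mesh m * (wk * expR _).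
set l := leader_law m j; set K := C * _ * (_ * _) in dd *; set K' := C * _ * decay1 _ in dd * => h1 h2.

have t1 : `|l - p| <= `|l - E| + `|E - p|.
  by rewrite (_ : l - p = (l - E) + (E - p)) ?ler_normD //; ring.
have t2 : `|l - p'| <= `|l - E| + `|E - p'|.
  by rewrite (_ : l - p' = (l - E) + (E - p')) ?ler_normD //; ring.
rewrite (_ : 2 * C * _ * _ = 2 * K'); last by rewrite /K'; ring.
by lra.
Qed.


(** Chebyshev's inequality: beyond N the law is controlled by its second moment and the profile by
    its decay. *)
Lemma wall_gap_far : exists2 C, 0 <= C & forall m j N, (3 <= m)%N -> (0 < N)%N -> (N <= j)%N ->
  wall_gap m j <= 2 * (j%:R ^+ 2 * leader_law m j) / N%:R ^+ 2 +
    C * mesh m / N%:R * (j%:R * decay1 (j%:R * mesh m)).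
Proof.
have [C C0 hC] := @profile_le R; exists (2 * C) => [|m j N m3 N0 Nj]; first by rewrite mulr_ge0.
have e01 := @mesh_itv R _ m3; have /andP[e0 e1] := e01.
have x0 k : 0 <= k%:R * mesh m by rewrite mulr_ge0 // ltW.
have n0 : 0 < (N%:R : R) by rewrite ltr0n.
have jN : 1 <= j%:R / N%:R :> R by rewrite ler_pdivlMr // mul1r ler_nat.
have jN2 : 1 <= j%:R ^+ 2 / N%:R ^+ 2 :> R by rewrite -expr_div_n exprn_ege1.
have l0 : 0 <= leader_law m j by exact: leader_law_ge0.
have pb k : (j <= k)%N -> `|profile m 0 k| <= C * mesh m * decay1 (j%:R * mesh m) * (j%:R / N%:R).
  move=> jk; apply: (@le_trans _ _ (C * mesh m * decay1 (j%:R * mesh m))).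
    apply: le_trans (hC m 0%N k) _; apply: ler_wpM2l; first by rewrite mulr_ge0 // ltW.
    rewrite mul0r (_ : decay1 0 = 1) ?mul1r; last by rewrite /decay1 addr0 expr1n invr1.
    by apply: decay1_mono => //; rewrite ler_wpM2r ?(ltW e0) // ler_nat.
  by rewrite ler_peMr // !mulr_ge0 ?(ltW e0) // decay1_ge0.
have rb : leader_law m j <= j%:R ^+ 2 / N%:R ^+ 2 * leader_law m j :> R by rewrite ler_peMl.
have h1 := pb j (leqnn j); have h2 := pb j.+1 (leqnSn j).
have t1 := ler_normB (leader_law m j) (profile m 0 j).
have t2 := ler_normB (leader_law m j) (profile m 0 j.+1).
rewrite (ger0_norm l0) in t1 t2.
apply: (@le_trans _ _ (2 * (j%:R ^+ 2 / N%:R ^+ 2 * leader_law m j) +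
   2 * (C * mesh m * decay1 (j%:R * mesh m) * (j%:R / N%:R)))).
  by rewrite /wall_gap; lra.
rewrite le_eqVlt; apply/orP; left; apply/eqP; field.
by rewrite gt_eqF.
Qed.

Lemma wall_gap_sum : exists2 C, 0 <= C & forall m N B, (3 <= m)%N -> (0 < N)%N ->
  \sum_(j < B) wall_gap m j <= 2 * (\sum_(j < N) `|slope m j|) + C * mesh m +
    2 * m%:R / N%:R ^+ 2 + C / (N%:R * mesh m).
Proof.
have [C C0 hC] := wall_gap_slope; have [D D0 hD] := wall_gap_far.
exists (2 * C + 2 * D) => [|m N B m3 N0]; first by rewrite addr_ge0 // mulr_ge0.
have e01 := @mesh_itv R _ m3; have /andP[e0 e1] := e01.
have n0 : 0 < (N%:R : R) by rewrite ltr0n.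
have x0 k : 0 <= k%:R * mesh m by rewrite mulr_ge0 // ltW.
have a0 j : 0 <= C * mesh m ^+ 2 * decay1 (j%:R * mesh m).
  by rewrite mulr_ge0 ?decay1_ge0 // mulr_ge0 ?sqr_ge0.
have b0 j : 0 <= 2 * (j%:R ^+ 2 * leader_law m j) / N%:R ^+ 2.
  by rewrite divr_ge0 ?sqr_ge0 // mulr_ge0 // mulr_ge0 ?sqr_ge0 ?leader_law_ge0.
have c0 j : 0 <= D * mesh m / N%:R * (j%:R * decay1 (j%:R * mesh m)).
  apply: mulr_ge0; last by apply: mulr_ge0 => //; exact: decay1_ge0.
  exact: divr_ge0 (mulr_ge0 D0 (ltW e0)) (ltW n0).
have pt j : wall_gap m j <= (if (j < N)%N then 2 * `|slope m j| else 0) +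
    C * mesh m ^+ 2 * decay1 (j%:R * mesh m) + 2 * (j%:R ^+ 2 * leader_law m j) / N%:R ^+ 2 +
    D * mesh m / N%:R * (j%:R * decay1 (j%:R * mesh m)).
  case: ltnP => jN.
    by apply: le_trans (hC m j m3) _; rewrite -addrA lerDl addr_ge0.
  by apply: le_trans (hD m j N m3 N0 jN) _; rewrite -!addrA add0r lerDr.
apply: le_trans (ler_sum _ (fun (j : 'I_B) _ => pt j)) _.
rewrite !big_split /= -!mulr_sumr -mulr_suml -mulr_sumr.
have s1 : \sum_(j < B) (if (j < N)%N then 2 * `|slope m j| else 0) <= 2 * \sum_(j < N) `|slope m j|.
  rewrite mulr_sumr; pose g j := if (j < N)%N then 2 * `|slope m j| else 0.
  have g0 j : 0 <= g j by rewrite /g; case: ifP => // _; rewrite mulr_ge0.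
  have -> : \sum_(j < N) 2 * `|slope m j| = \sum_(j < N) g j.
    by apply: eq_bigr => j _; rewrite /g ltn_ord.
  have [NB|BN] := leqP B N; first exact: (@sum_widen_le R g).
  rewrite -(subnKC (ltnW BN)); elim: (B - N)%N => [|p IH]; first by rewrite addn0.
  by rewrite addnS big_ord_recr /= ltnNge leq_addr addr0.
have s2 : C * mesh m ^+ 2 * (\sum_(j < B) decay1 (j%:R * mesh m)) <= 2 * C * mesh m.
  rewrite (_ : 2 * C * _ = C * mesh m ^+ 2 * (2 / mesh m)); last by field; rewrite gt_eqF.
  by rewrite ler_wpM2l ?sum_decay1 // mulr_ge0 ?sqr_ge0.
have s3 : 2 * (\sum_(j < B) j%:R ^+ 2 * leader_law m j) / N%:R ^+ 2 <= 2 * m%:R / N%:R ^+ 2.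
  by rewrite ler_wpM2r ?invr_ge0 ?sqr_ge0 // ler_wpM2l // sum_sqr_leader_law.
have s4 : D * mesh m / N%:R * (\sum_(j < B) j%:R * decay1 (j%:R * mesh m)) <= 2 * D / (N%:R * mesh m).
  rewrite (_ : 2 * D / _ = D * mesh m / N%:R * (2 / mesh m ^+ 2)); last first.
    by field; rewrite !gt_eqF.
  by rewrite ler_wpM2l ?sum_ndecay1 // divr_ge0 ?(ltW n0) // mulr_ge0 ?(ltW e0).
have h1 : 0 <= 2 * D * mesh m by rewrite !mulr_ge0 ?(ltW e0).
have h2 : 0 <= 2 * C / (N%:R * mesh m) by rewrite divr_ge0 // ?mulr_ge0 // ?(ltW e0) // ltW.
by rewrite !mulrDl; lra.
Qed.

(** Up to N of order sqrt n, slopes are traded for their squares with weight sqrt n, and the energy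
    is o(sqrt n). Beyond N the second moment is small compared with N^2. *)
Lemma wall_gap_sublinear : sublinear (fun n B => \sum_(k < n) \sum_(j < B) wall_gap (3 + k) j).
Proof.
have [C C0 hC] := wall_gap_sum; have [E E0 hE] := @energy_bound R.
move=> eta eta0.
(* [K] makes the far part, [mu] the linear part of the arithmetic-geometric inequality and [nu] the
   energy part contribute at most eta / 4 per step each; the last quarter goes to the sum of the
   meshes. *)
pose K := 4 * (2 + C) / eta + 1.
have K1 : 1 <= K by rewrite lerDr divr_ge0 ?(ltW eta0) // mulr_ge0 // addr_ge0.
have K0 : 0 < K by exact: lt_le_trans K1.
pose mu := eta / (4 * (K + 1)).
have mu0 : 0 < mu by rewrite divr_gt0 // mulr_gt0 // addr_gt0.
pose nu := eta * mu / (8 * (E + 1)).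
have E10 : 0 < E + 1 by rewrite ltr_wpDl.
have nu0 : 0 < nu.
  by apply: divr_gt0; apply: mulr_gt0.
have eta4 : 0 < eta / 4 by rewrite divr_gt0.
have [M hM] := sublinearZ C0 sum_mesh_sublinear eta4.
have [C1 hC1] := sum_mesh2 nu0.
pose c1 := `|1 + C1|.
exists (M + E / mu * (c1 ^+ 2 / nu + 6 * nu)) => n B.
have qn0 : 0 < q n by exact: lt_le_trans (q_ge1 n).
pose N := (Num.truncn (K * q n)).+1.
have /andP[Nl Nu] : K * q n <= N%:R <= K * q n + 1.
  have /andP[h1 h2] := truncn_itv (mulr_ge0 (ltW K0) (ltW qn0)).
  by rewrite (ltW h2) /= /N -natr1 lerD2r.
have N0 : 0 < (N%:R : R) by rewrite ltr0n.
have slopes : 2 * (\sum_(k < n) \sum_(j < N) `|slope (3 + k) j|) <=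
    n%:R * (mu * (K + 1)) + E / mu * (q n * (1 + \sum_(k < n) mesh (3 + k) ^+ 2)).
  have ag (x : R) : 2 * `|x| <= mu / q n + q n / mu * x ^+ 2.
    rewrite -real_normK ?num_real //; move: (normr_ge0 x); move: `|x| => y y0.
    rewrite -subr_ge0 (_ : _ - _ = (mu - q n * y) ^+ 2 / (mu * q n)); last first.
      by field; rewrite !gt_eqF.
    by rewrite divr_ge0 ?sqr_ge0 // mulr_ge0 ?ltW.
  apply: (@le_trans _ _ (\sum_(k < n) \sum_(j < N) (mu / q n + q n / mu * slope (3 + k) j ^+ 2))).
    by rewrite mulr_sumr; apply: ler_sum => k _; rewrite mulr_sumr; apply: ler_sum.
  under eq_bigr do rewrite big_split /= sumr_const card_ord -mulr_sumr.
  rewrite big_split /= sumr_const card_ord -mulr_sumr -mulrnA; apply: lerD.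
    rewrite -[leLHS]mulr_natl natrM (_ : N%:R * n%:R * _ = n%:R * (mu * (N%:R / q n))); last by ring.
    rewrite ler_wpM2l // ler_wpM2l ?(ltW mu0) // ler_pdivrMr //.
    by have := q_ge1 n; lra.
  rewrite (_ : E / mu * _ = q n / mu * (E * (1 + \sum_(k < n) mesh (3 + k) ^+ 2))); last by field; rewrite gt_eqF.
  by apply: (ler_wpM2l (divr_ge0 (ltW qn0) (ltW mu0))); exact: hE.
have qs : q n * (1 + \sum_(k < n) mesh (3 + k) ^+ 2) <= c1 ^+ 2 / nu + 6 * nu + 2 * nu * n%:R.
  apply: (@le_trans _ _ (q n * (c1 + nu * q n))).
    rewrite ler_wpM2l ?(ltW qn0) //; have := hC1 n; have := ler_norm (1 + C1); rewrite -/c1.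
    by lra.
  have ag : q n * c1 <= c1 ^+ 2 / nu + nu * q n ^+ 2.
    rewrite -subr_ge0 (_ : _ - _ = ((c1 - nu * q n) ^+ 2 + c1 * (nu * q n)) / nu); last first.
      by field; rewrite gt_eqF.
    exact: divr_ge0 (addr_ge0 (sqr_ge0 _) (mulr_ge0 (normr_ge0 _) (mulr_ge0 (ltW nu0) (ltW qn0)))) (ltW nu0).
  rewrite mulrDr mulrCA -expr2.
  have := q2 n; rewrite natrD => E2; rewrite E2 in ag *.
  by lra.
have each (k : 'I_n) : \sum_(j < B) wall_gap (3 + k) j <= 2 * (\sum_(j < N) `|slope (3 + k) j|) +
    C * mesh (3 + k) + eta / 4.
  have m3 : (3 <= 3 + k)%N by rewrite leq_addr.
  have /andP[e0 e1] := @mesh_itv R _ m3.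
  apply: le_trans (hC _ N B m3 isT) _; rewrite -addrA lerD2l.
  have kq : (3 + k)%:R <= q n ^+ 2 by rewrite q2 ler_nat leq_add2l ltnW.
  have iq : q n <= K * q n by rewrite ler_peMl // ltW.
  have a1 : 2 * (3 + k)%:R / N%:R ^+ 2 <= 2 / K.
    rewrite ler_pdivrMr ?exprn_gt0 // -mulrA ler_wpM2l // mulrC ler_pdivlMr //.
    apply: (@le_trans _ _ (q n ^+ 2 * K)); first by rewrite ler_wpM2r // ltW.
    apply: (@le_trans _ _ ((K * q n) ^+ 2)).
      by rewrite exprMn mulrC ler_wpM2r ?sqr_ge0 // expr2 ler_peMr // ltW.
    by rewrite lerXn2r ?nnegrE ?(ltW N0) // mulr_ge0 ?ltW.
  have a2 : C / (N%:R * mesh (3 + k)) <= C / K.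
    rewrite ler_wpM2l // lef_pV2 ?posrE ?mulr_gt0 //.
    have qe : 1 <= q n * mesh (3 + k).
      rewrite -(@ler_pXn2r _ 2) ?nnegrE ?mulr_ge0 ?(ltW qn0) ?(ltW e0) // expr1n exprMn mesh2.
      rewrite mulrA ler_pdivlMr ?ltr0n // mul1r; apply: le_trans kq _.
      by rewrite ler_peMr ?sqr_ge0 // ler1n.
    apply: (@le_trans _ _ (K * (q n * mesh (3 + k)))); first by rewrite ler_peMr // ltW.
    by rewrite mulrA ler_wpM2r // ltW.
  have a3 : 2 / K + C / K <= eta / 4.
    rewrite -mulrDl ler_pdivrMr // /K mulrDr mulr1 (_ : eta / 4 * (4 * (2 + C) / eta) = 2 + C).
      by rewrite lerDl ltW.
    by field; rewrite gt_eqF.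
  by lra.
have tot : \sum_(k < n) \sum_(j < B) wall_gap (3 + k) j <=
    2 * (\sum_(k < n) \sum_(j < N) `|slope (3 + k) j|) + C * (\sum_(k < n) mesh (3 + k)) + n%:R * (eta / 4).
  have -> : n%:R * (eta / 4) = \sum_(k < n) (eta / 4) by rewrite sumr_const card_ord mulr_natl.
  rewrite !mulr_sumr -!big_split /=.
  by apply: ler_sum => k _; exact: each.
apply: le_trans tot _.
have hm := hM n 0%N.
have e1 : E / mu * (q n * (1 + \sum_(k < n) mesh (3 + k) ^+ 2)) <=
    E / mu * (c1 ^+ 2 / nu + 6 * nu) + eta / 4 * n%:R.
  apply: le_trans (ler_wpM2l (divr_ge0 E0 (ltW mu0)) qs) _; rewrite mulrDr lerD2l mulrA.
  apply: ler_wpM2r => //.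
  rewrite (_ : _ * (2 * nu) = eta / 4 * (E / (E + 1))); last first.
    by rewrite /nu; field; rewrite !gt_eqF.
  by rewrite ler_piMr ?(ltW eta4) // ler_pdivrMr // mul1r lerDl.
have e2 : n%:R * (mu * (K + 1)) = eta / 4 * n%:R.
  by rewrite /mu; field; rewrite gt_eqF // addr_gt0.
by lra.
Qed.

End sublinear.

(** * Weighted l^1 estimates in the two wedges *)

Section profile_error.
Context {R : realType}.
Implicit Types (n m k a b A B i j : nat).
Local Notation mesh := (@mesh R).
Local Notation leader_law := (@leader_law R).
Local Notation leaders_law := (@leaders_law R).
Local Notation profile := (@profile R).

Hypothesis bottom : forall m a, leaders_law m a 0 = leader_law m a.

Definition profile_error m a b : R := `|leaders_law m a b - profile m a b|.

Local Notation err := profile_error.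

Let err0 m a b : 0 <= err m a b. Proof. exact: normr_ge0. Qed.

Lemma profile_error_step : exists2 C, 0 <= C & forall m a b, (3 <= m)%N -> a != b ->
  3 * err m.+1 a.+1 b.+1 <= err m a.+2 b.+2 + err m a b.+1 + err m a.+1 b +
    C * mesh m ^+ 4 * (decay1 (a.+1%:R * mesh m) * decay1 (b.+1%:R * mesh m)).
Proof.
have [C C0 hC] := @profile_consistent R; exists C => // m a b m3 ab.
have {}hC : `|3 * profile m.+1 a.+1 b.+1 - profile m a.+2 b.+2 - profile m a b.+1 - profile m a.+1 b|
    <= C * mesh m ^+ 4 * (decay1 (a.+1%:R * mesh m) * decay1 (b.+1%:R * mesh m)).
  move: ab; rewrite neq_ltn => /orP[ab|ba]; first exact: (hC m a.+1 b.+1).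
  have := hC m b.+1 a.+1 m3 isT ba; rewrite /= !(profileC _ b.+1) !(profileC _ b.+2) (profileC m b).
  by rewrite [decay1 _ * _]mulrC addrAC.
have ab' : a.+1 != b.+1 by [].
have w := @leaders_lawS R m a b ab'.
have -> : 3 * err m.+1 a.+1 b.+1 = `|3 * leaders_law m.+1 a.+1 b.+1 - 3 * profile m.+1 a.+1 b.+1|.
  by rewrite -mulrBr normrM ger0_norm.
rewrite w /profile_error.
move: hC; set p' := 3 * profile _ _ _; set p1 := profile m a.+2 _; set p2 := profile m a _.
set p3 := profile m a.+1 b; set K := C * _ * _; set w1 := leaders_law _ a.+2 _.
set w2 := leaders_law _ a _; set w3 := leaders_law _ a.+1 b => hC.
rewrite (_ : w1 + w2 + w3 - p' = (w1 - p1) + (w2 - p2) + (w3 - p3) - (p' - p1 - p2 - p3)); last by ring.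
apply: le_trans (ler_normB _ _) _; apply: lerD hC.
by do 2 (apply: le_trans (ler_normD _ _) _; apply: lerD => //).
Qed.

Lemma profile_error_diag : exists2 C, 0 <= C & forall m a, (3 <= m)%N ->
  err m a a <= err m a a.+1 + C * mesh m ^+ 3 * decay1 (a%:R * mesh m).
Proof.
have [C C0 hC] := @profile_diag R; exists C => // m a m3.
rewrite /profile_error leaders_law_diag.
rewrite (_ : leaders_law m a a.+1 - profile m a a = (leaders_law m a a.+1 - profile m a a.+1) +
  (profile m a a.+1 - profile m a a)); last by ring.
by apply: le_trans (ler_normD _ _) _; rewrite lerD2l hC.
Qed.

(* The lattice quarter plane parametrizes the points [b > a] by [(a, b - a - 1)] and the
   points [a > b] by [(b, a - b - 1)]; in both cases it is stepped by the same stencil. *)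
Definition above m i j := err m i (i + j).+1.
Definition below m i j := err m (i + j).+1 i.

(** Harmonic for the adjoint stencil inside the wedge; on the row j = 0 one term is missing, and
    this leaves the slack i + 1 at column i. *)
Definition weight_above i j : R := i%:R.
(** In the original coordinates this is b (a - b) / a: at most 1 next to the wall and next to the
    diagonal, the two places where the wedge below receives sources. *)
Definition weight_below i j : R := i%:R * j.+1%:R / (i + j).+1%:R.

Lemma weight_below_ge0 i j : 0 <= weight_below i j.
Proof. by rewrite divr_ge0 // mulr_ge0. Qed.

Lemma weight_below_le i j : weight_below i j <= i%:R.
Proof. by rewrite ler_pdivrMr ?ltr0n // ler_wpM2l // ler_nat ltnS leq_addl. Qed.

Lemma weight_below1 i : weight_below i 0 <= 1.
Proof. by rewrite ler_pdivrMr ?ltr0n // mulr1 mul1r addn0 ler_nat. Qed.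

Lemma weight_below_wall j : weight_below 1 j <= 1.
Proof. by rewrite ler_pdivrMr ?ltr0n // !mul1r ler_nat ltnS add1n. Qed.

Lemma weight_below_superharmonic i j :
  weight_below i j + (if j is j'.+1 then weight_below i.+2 j' else 0) + weight_below i.+1 j.+1
    <= 3 * weight_below i.+1 j.
Proof.
have -> : (if j is j'.+1 then weight_below i.+2 j' else 0) = i.+2%:R * j%:R / (i.+2 + j)%:R.
  by case: j => [|j']; rewrite ?mulr0 ?mul0r // /weight_below !addnS.
rewrite /weight_below -subr_ge0.
rewrite (_ : i.+2%:R = i%:R + 2 :> R); last by rewrite -!natr1; ring.
rewrite (_ : i.+1%:R = i%:R + 1 :> R); last by rewrite -natr1.
rewrite (_ : j.+1%:R = j%:R + 1 :> R); last by rewrite -natr1.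
rewrite (_ : j.+2%:R = j%:R + 2 :> R); last by rewrite -!natr1; ring.
rewrite (_ : (i + j).+1%:R = i%:R + j%:R + 1 :> R); last by rewrite -natr1 natrD.
rewrite (_ : (i.+2 + j)%:R = i%:R + j%:R + 2 :> R); last by rewrite natrD -!natr1; ring.
rewrite (_ : (i.+1 + j.+1).+1%:R = i%:R + j%:R + 3 :> R); last by rewrite -natr1 natrD -!natr1; ring.
have x0 : 0 <= (i%:R : R) by []; have y0 : 0 <= (j%:R : R) by [].
move: (i%:R : R) (j%:R : R) x0 y0 => x y x0 y0.
rewrite (_ : _ - _ = 2 * (x + 1) ^+ 2 / ((x + y + 1) * (x + y + 2) * (x + y + 3)) +
  (2 * y + 1) / ((x + y + 1) * (x + y + 2))); last by field; lra.
rewrite addr_ge0 // divr_ge0 // ?mulr_ge0 ?sqr_ge0 //; lra.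
Qed.

Lemma weighted_sum_decay (theta c : nat -> nat -> R) (e K : R) A B : 0 < e <= 1 -> 0 <= K ->
  (forall i j, 0 <= theta i j) -> (forall i j, theta i j <= i%:R) ->
  (forall i j, c i j <= K * (decay1 (i%:R * e) * decay1 (j%:R * e))) ->
  weighted_sum theta c A B <= 4 * K / e ^+ 3.
Proof.
move=> e01 K0 t0 t1 ck; have /andP[e0 _] := e01.
have x0 k : 0 <= decay1 (k%:R * e) by rewrite decay1_ge0 // mulr_ge0 // ltW.
apply: (@le_trans _ _ (K * ((\sum_(i < A.+1) i%:R * decay1 (i%:R * e)) * (\sum_(j < B) decay1 (j%:R * e))))).
  rewrite big_ord_recl /= mul0r add0r mulr_suml mulr_sumr; apply: ler_sum => i _.
  rewrite !mulr_sumr; apply: ler_sum => j _.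
  apply: (@le_trans _ _ (theta i.+1 j * (K * (decay1 (i.+1%:R * e) * decay1 (j%:R * e))))).
    by rewrite ler_wpM2l.
  rewrite [leRHS](_ : _ = i.+1%:R * (K * (decay1 (i.+1%:R * e) * decay1 (j%:R * e)))); last by rewrite /bump /= add1n; ring.
  by rewrite ler_wpM2r // mulr_ge0 // mulr_ge0.
rewrite (_ : 4 * K / e ^+ 3 = K * ((2 / e ^+ 2) * (2 / e))); last by field; rewrite gt_eqF.
apply: ler_wpM2l => //; apply: ler_pM; rewrite ?sum_ndecay1 ?sum_decay1 // sumr_ge0 // => i _.
by rewrite mulr_ge0.
Qed.

Lemma weighted_sumD (theta c c' : nat -> nat -> R) A B :
  weighted_sum theta (fun i j => c i j + c' i j) A B =
  weighted_sum theta c A B + weighted_sum theta c' A B.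
Proof.
rewrite /weighted_sum -big_split; apply: eq_bigr => i _; rewrite -big_split.
by apply: eq_bigr => j _; rewrite mulrDr.
Qed.

Lemma weighted_sum_le (theta c c' : nat -> nat -> R) A B : (forall i j, 0 <= theta i j) ->
  (forall i j, c i j <= c' i j) -> weighted_sum theta c A B <= weighted_sum theta c' A B.
Proof.
by move=> t0 cc; apply: ler_sum => i _; apply: ler_sum => j _; exact: ler_wpM2l.
Qed.

Lemma weighted_sum_first (theta : nat -> nat -> R) (e K : R) A B : 0 < e <= 1 -> 0 <= K ->
  (forall i j, 0 <= theta i j) -> (forall i j, theta i j <= i%:R) ->
  weighted_sum theta (fun i j => if j is 0%N then K * decay1 (i%:R * e) else 0) A B
    <= 2 * K / e ^+ 2.
Proof.
move=> e01 K0 t0 t1; have /andP[e0 _] := e01.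
have x0 k : 0 <= decay1 (k%:R * e) by rewrite decay1_ge0 // mulr_ge0 // ltW.
apply: (@le_trans _ _ (K * (\sum_(i < A.+1) i%:R * decay1 (i%:R * e)))); last first.
  rewrite (_ : 2 * K / e ^+ 2 = K * (2 / e ^+ 2)); last by field; rewrite gt_eqF.
  by rewrite ler_wpM2l // sum_ndecay1.
rewrite big_ord_recl /= mul0r add0r mulr_sumr; apply: ler_sum => i _.
case: B => [|B]; first by rewrite big_ord0 !mulr_ge0.
rewrite big_ord_recl /= big1 => [|j _]; last by rewrite mulr0.
by rewrite addr0 mulrCA ler_wpM2l // ler_wpM2r.
Qed.

Let profile_weighted (theta : nat -> nat -> R) : (forall i j, 0 <= theta i j) ->
  (forall i j, theta i j <= i%:R) -> exists C, forall A B,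
  weighted_sum theta (fun i j => `|profile 3 i (i + j).+1|) A B <= C.
Proof.
move=> t0 t1; have [C C0 hC] := @profile_le R.
have m3 : mesh 3 = 1 by rewrite /mesh divff ?sqrtr1 // pnatr_eq0.
exists (4 * C / 1 ^+ 3) => A B; apply: weighted_sum_decay => //; first by rewrite ltr01 lexx.
move=> i j; apply: le_trans (hC _ _ _) _; rewrite m3 !mulr1 ler_wpM2l // ler_wpM2l ?decay1_ge0 //.
by rewrite decay1_mono // ler_nat; lia.
Qed.

Let sum0 A : \sum_(i < A) (0 : R) = 0. Proof. by rewrite sumr_const mul0rn. Qed.

(** The laws themselves obey the recursion without consistency error, and wall and diagonal each
    contribute at most 1 per step. At m = 3 this gives a bound, uniform in the window, from which
    the error recursion starts. *)
Let init_bound (theta : nat -> nat -> R) (g : nat -> nat -> nat -> R) (d : nat -> nat -> R)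
    (sigma : nat -> R) :
  (forall i j, 0 <= theta i j) -> (forall j, theta 1 j <= 1) ->
  (forall i, 0 <= sigma i) ->
  (forall i j, theta i j + (if j is j'.+1 then theta i.+2 j' else 0) + theta i.+1 j.+1 +
    (if j is 0%N then sigma i.+1 else 0) <= 3 * theta i.+1 j) ->
  (forall m i j, 0 <= g m i j) -> (forall m i, 0 <= d m i) -> (forall i j, g 0 i.+1 j = 0) ->
  (forall m i j, 3 * g m.+1 i.+1 j <= g m i.+2 j + g m i j.+1 +
    (if j is j'.+1 then g m i.+1 j' else d m i.+1) + 0) ->
  (forall m A, \sum_(j < A) g m 0 j <= 1) ->
  (forall m A, \sum_(i < A) theta i.+1 0 * d m i.+1 <= \sum_(i < A) sigma i.+1 * g m i.+1 0 + 1) ->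
  forall m A, 3 * weighted_sum theta (g m) A A <= 2 * m%:R.
Proof.
move=> t0 t1 s0 sup g0 d0 g00 gS wall diag; elim=> [|m IH] A.
  rewrite /weighted_sum big1 ?mulr0 // => i _; rewrite big1 // => j _.
  by rewrite g00 mulr0.
have h := @weighted_step R (g m) (g m.+1) (fun _ _ => 0) theta (d m) sigma (g0 m) (d0 m) t0 t1 s0
  (gS m) sup A A.
have h1 := wall m A.+1; have h2 := diag m A; have h3 := IH A.+1.
have h4 : weighted_sum theta (fun _ _ => 0) A A = 0.
  by rewrite /weighted_sum big1 // => i _; rewrite big1 // => j _; rewrite mulr0.
rewrite h4 addr0 in h.
have -> : 2 * m.+1%:R = 2 * m%:R + 2 :> R by rewrite -natr1; ring.
by lra.
Qed.

Let superharmonic_above i j : weight_above i j + (if j is j'.+1 then weight_above i.+2 j' else 0) +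
  weight_above i.+1 j.+1 + (if j is 0%N then i.+2%:R else 0) <= 3 * weight_above i.+1 j.
Proof.
rewrite /weight_above -[i.+2%:R]natr1 -[i.+1%:R]natr1.
by case: j => [|j]; lra.
Qed.

Let superharmonic_below i j : weight_below i j + (if j is j'.+1 then weight_below i.+2 j' else 0) +
  weight_below i.+1 j.+1 + (if j is 0%N then 0 else 0) <= 3 * weight_below i.+1 j.
Proof.
have := weight_below_superharmonic i j.
by case: j => [|j]; rewrite !addr0.
Qed.

Let above_law m A : 3 * weighted_sum weight_above (fun i j => leaders_law m i (i + j).+1) A A <= 2 * m%:R.
Proof.
pose g m i j := leaders_law m i (i + j).+1.
have g0 k i j : 0 <= g k i j by exact: leaders_law_ge0.
apply: (@init_bound weight_above g (fun m i => g m i 0%N) (fun i => i.+1%:R)) => //.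
- by move=> i j; rewrite /g leaders_law_init.
- move=> k i j; rewrite /g addSn leaders_lawS; last by lia.
  rewrite addr0 !addnS !addSn; case: j => [|j].
    by rewrite !addn0 (leaders_law_diag k i.+1).
  by rewrite addnS.
- by move=> k B; under eq_bigr do rewrite /g add0n leaders_law_left; exact: sum_leader_law.
- move=> k B; rewrite -[leLHS]addr0; apply: lerD => //; apply: ler_sum => i _.
  by rewrite ler_wpM2r // ler_nat.
Qed.

Let below_law m A : 3 * weighted_sum weight_below (fun i j => leaders_law m (i + j).+1 i) A A <= 2 * m%:R.
Proof.
pose g m i j := leaders_law m (i + j).+1 i.
have g0 k i j : 0 <= g k i j by exact: leaders_law_ge0.
have l0 k i : 0 <= leader_law k i by exact: leader_law_ge0.
apply: (@init_bound weight_below g (fun m i => leaders_law m i i) (fun i => 0)) => //.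
- exact: weight_below_ge0.
- exact: weight_below_wall.
- by move=> k i; exact: leaders_law_ge0.
- by move=> i j; rewrite /g leaders_law_init.
- move=> k i j; rewrite /g addSn leaders_lawS; last by lia.
  rewrite addr0 !addnS !addSn; case: j => [|j]; first by rewrite !addn0 addrAC.
  by rewrite addnS addrAC.
- move=> k B; under eq_bigr do rewrite /g add0n bottom.
  apply: le_trans (sum_leader_law k B.+1); exact: (@sum_shift_le R (leader_law k)).
- move=> k B; rewrite [X in X + 1]big1 => [|i _]; last by rewrite mul0r.
  rewrite add0r; apply: le_trans (sum_leader_law k B.+1).
  apply: le_trans (@sum_shift_le R (leader_law k) B (l0 k)); apply: ler_sum => i _.
  rewrite -[leRHS]mul1r; apply: ler_pM; rewrite ?weight_below_ge0 ?weight_below1 ?leaders_law_ge0 //.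
  by rewrite -bottom leaders_law_mono.
Qed.

Let above_init : exists C, forall A, weighted_sum weight_above (above 3) A A <= C.
Proof.
have [|//|C hC] := @profile_weighted weight_above; first by move=> i j; exact: ler0n.
exists (3 + C) => A.
apply: (@le_trans _ _ (weighted_sum weight_above (fun i j => leaders_law 3 i (i + j).+1 +
   `|profile 3 i (i + j).+1|) A A)).
  apply: weighted_sum_le => i j; first exact: ler0n.
  by apply: le_trans (ler_normB _ _) _; rewrite ger0_norm ?leaders_law_ge0.
by rewrite weighted_sumD; have := hC A A; have := above_law 3 A; lra.
Qed.

Let below_init : exists C, forall A, weighted_sum weight_below (below 3) A A <= C.
Proof.
have [C hC] := profile_weighted weight_below_ge0 weight_below_le.
exists (3 + C) => A.
apply: (@le_trans _ _ (weighted_sum weight_below (fun i j => leaders_law 3 (i + j).+1 i +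
   `|profile 3 i (i + j).+1|) A A)).
  apply: weighted_sum_le => i j; first exact: weight_below_ge0.
  apply: le_trans (ler_normB _ _) _; rewrite ger0_norm ?leaders_law_ge0 //.
  by rewrite (profileC 3 i).
by rewrite weighted_sumD; have := hC A A; have := below_law 3 A; lra.
Qed.

Let above_wall m j : above m 0 j <= wall_gap m j.
Proof. by rewrite /above /err add0n leaders_law_left /wall_gap lerDr. Qed.

Let below_wall m j : below m 0 j <= wall_gap m j.+1.
Proof. by rewrite /below /err add0n bottom profileC /wall_gap lerDl. Qed.

Let walls m A := \sum_(j < A.+2) wall_gap m j : R.

Let wall0 m j : 0 <= wall_gap m j :> R.
Proof. by rewrite addr_ge0. Qed.

Let decay_above m i j : decay1 (i%:R * mesh m) * decay1 ((i + j).+1%:R * mesh m) <=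
  decay1 (i%:R * mesh m) * decay1 (j%:R * mesh m).
Proof.
rewrite ler_wpM2l ?decay1_ge0 ?mulr_ge0 ?mesh_ge0 // decay1_mono ?mulr_ge0 ?mesh_ge0 //.
by rewrite ler_wpM2r ?mesh_ge0 // ler_nat; lia.
Qed.

(** The second summand is the gain on the diagonal accumulated over time; it is the source of the
    wedge below. *)
Lemma above_sublinear : sublinear (fun n A => 3 * weighted_sum weight_above (above (3 + n)) A A +
  \sum_(k < n) \sum_(i < A) above (3 + k) i.+1 0).
Proof.
have [C C0 hC] := profile_error_step; have [D D0 hD] := profile_error_diag.
have [I hI] := above_init.
(* On the row j = 0 the condition across the diagonal adds an error of order mesh^3. *)
pose c m i j := C * mesh m ^+ 4 * (decay1 (i%:R * mesh m) * decay1 (j%:R * mesh m)) +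
  (if j is 0%N then D * mesh m ^+ 3 * decay1 (i%:R * mesh m) else 0).
have rec m i j : (3 <= m)%N -> 3 * above m.+1 i.+1 j <= above m i.+2 j + above m i j.+1 +
    (if j is j'.+1 then above m i.+1 j' else above m i.+1 0%N) + c m i.+1 j.
  move=> m3; rewrite /above addSn; apply: le_trans (hC m i (i + j).+1 m3 _) _; first by lia.
  have h := ler_wpM2l (mulr_ge0 C0 (exprn_ge0 4 (mesh_ge0 m))) (decay_above m i.+1 j).
  rewrite !addnS !addSn in h *; rewrite /c.
  case: j h => [|j] h; last by rewrite ?addnS in h *; lra.
  by rewrite !addn0 in h *; have := hD m i.+1 m3; lra.
pose X m A := 3 * weighted_sum weight_above (above m) A A.
pose G m A := \sum_(i < A) above m i.+1 0.
pose e m A := walls m A + (4 * C + 2 * D) * mesh m.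
have step m A : (3 <= m)%N -> X m.+1 A + G m A <= X m A.+1 + e m A.
  move=> m3; have e01 := @mesh_itv R _ m3; have /andP[e0 e1] := e01.
  have a0 k i j : 0 <= above k i j by exact: err0.
  have h := @weighted_step R (above m) (above m.+1) (c m) weight_above (fun i => above m i 0%N)
    (fun i => i.+1%:R) (a0 m) (fun i => a0 m i 0%N) (fun i j => ler0n _ _) (fun j => lexx _)
    (fun i => ler0n _ _) (fun i j => rec m i j m3) superharmonic_above A A.
  have h1 : \sum_(j < A.+1) above m 0 j <= walls m A.
    apply: (@le_trans _ _ (\sum_(j < A.+1) wall_gap m j)); first by apply: ler_sum => j _; exact: above_wall.
    by rewrite /walls [leRHS]big_ord_recr /= lerDl.
  have h2 : weighted_sum weight_above (c m) A A <= (4 * C + 2 * D) * mesh m.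
    rewrite weighted_sumD mulrDl; apply: lerD.
      rewrite (_ : 4 * C * mesh m = 4 * (C * mesh m ^+ 4) / mesh m ^+ 3); last by field; rewrite gt_eqF.
      by apply: weighted_sum_decay => //; rewrite mulr_ge0 ?exprn_ge0 // ltW.
    rewrite (_ : 2 * D * mesh m = 2 * (D * mesh m ^+ 3) / mesh m ^+ 2); last by field; rewrite gt_eqF.
    by apply: weighted_sum_first => //; rewrite mulr_ge0 ?exprn_ge0 // ltW.
  rewrite /weight_above in h h2 *; rewrite /X /G /e /weight_above.
  (* The reflected row returns with weight i + 1 against a slack of weight i + 2; the difference is
     exactly [G]. *)
  have h3 : \sum_(i < A) (i.+2%:R : R) * above m i.+1 0 =
     \sum_(i < A) (i.+1%:R : R) * above m i.+1 0 + \sum_(i < A) above m i.+1 0.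
    by rewrite -big_split /=; apply: eq_bigr => i _; rewrite -[i.+2%:R]natr1 mulrDl mul1r.
  by lra.
have Gm m A : G m A <= G m A.+1 by rewrite /G big_ord_recr /= lerDl; exact: err0.
have em m A : e m A <= e m A.+1 by rewrite lerD2r /walls [leRHS]big_ord_recr /= lerDl.
apply: (@sublinear_le R _ (fun n A => 3 * I + (\sum_(k < n) walls (3 + k) (A + n) +
    (4 * C + 2 * D) * \sum_(k < n) mesh (3 + k)))).
  move=> n A; apply: le_trans (telescope step Gm em n A) _.
  rewrite /e big_split /= -mulr_sumr; apply: lerD => //.
  by rewrite /X ler_wpM2l.
apply: sublinearD; first exact: sublinear_cst.
apply: sublinearD; last first.
  by apply: sublinearZ; [rewrite addr_ge0 // mulr_ge0|exact: sum_mesh_sublinear].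
move=> eta eta0; have [M hM] := @wall_gap_sublinear R eta eta0.
by exists M => n A; exact: hM n (A + n).+2.
Qed.

(** Here the diagonal error is prescribed data. Its weight is at most 1, so the time sum controlled
    by [above_sublinear] suffices. *)
Lemma below_sublinear : sublinear (fun n A => 3 * weighted_sum weight_below (below (3 + n)) A A).
Proof.
have [C C0 hC] := profile_error_step; have [D D0 hD] := profile_error_diag.
have [I hI] := below_init.
pose c m i j := C * mesh m ^+ 4 * (decay1 (i%:R * mesh m) * decay1 (j%:R * mesh m)).
pose diag m i := above m i 0 + D * mesh m ^+ 3 * decay1 (i%:R * mesh m).
have x0 m k : 0 <= decay1 (k%:R * mesh m) by rewrite decay1_ge0 // mulr_ge0 // mesh_ge0.
have diag0 m i : 0 <= diag m i.
  by rewrite addr_ge0 ?err0 // mulr_ge0 // mulr_ge0 // exprn_ge0 // mesh_ge0.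
have rec m i j : (3 <= m)%N -> 3 * below m.+1 i.+1 j <= below m i.+2 j + below m i j.+1 +
    (if j is j'.+1 then below m i.+1 j' else diag m i.+1) + c m i.+1 j.
  move=> m3; rewrite /below addSn; apply: le_trans (hC m (i + j).+1 i m3 _) _; first by lia.
  have h := ler_wpM2l (mulr_ge0 C0 (exprn_ge0 4 (mesh_ge0 m))) (decay_above m i.+1 j).
  rewrite [decay1 (_%:R * _) * decay1 (i.+1%:R * _)]mulrC /c.
  rewrite !addnS !addSn in h *.
  case: j h => [|j] h; last by rewrite ?addnS in h *; lra.
  by rewrite !addn0 in h *; have := hD m i.+1 m3; rewrite /diag /above addn0; lra.
pose X m A := 3 * weighted_sum weight_below (below m) A A.
pose e m A := walls m A + \sum_(i < A) above m i.+1 0 + (4 * C + 2 * D) * mesh m.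
have step m A : (3 <= m)%N -> X m.+1 A + 0 <= X m A.+1 + e m A.
  move=> m3; have e01 := @mesh_itv R _ m3; have /andP[e0 e1] := e01.
  have a0 k i j : 0 <= below k i j by exact: err0.
  have h := @weighted_step R (below m) (below m.+1) (c m) weight_below (diag m)
    (fun i => 0) (a0 m) (diag0 m) weight_below_ge0 weight_below_wall
    (fun i => lexx _) (fun i j => rec m i j m3) superharmonic_below A A.
  have h1 : \sum_(j < A.+1) below m 0 j <= walls m A.
    apply: (@le_trans _ _ (\sum_(j < A.+1) wall_gap m j.+1)); first by apply: ler_sum => j _; exact: below_wall.
    exact: (@sum_shift_le R (wall_gap m)).
  have h2 : weighted_sum weight_below (c m) A A <= 4 * C * mesh m.
    rewrite (_ : 4 * C * mesh m = 4 * (C * mesh m ^+ 4) / mesh m ^+ 3); last by field; rewrite gt_eqF.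
    apply: weighted_sum_decay => //; first by rewrite mulr_ge0 ?exprn_ge0 // ltW.
      exact: weight_below_ge0.
    exact: weight_below_le.
  have h3 : \sum_(i < A) weight_below i.+1 0 * diag m i.+1 <=
      \sum_(i < A) above m i.+1 0 + 2 * D * mesh m.
    rewrite (_ : 2 * D * mesh m = D * mesh m ^+ 3 * (2 / mesh m ^+ 2)); last by field; rewrite gt_eqF.
    apply: (@le_trans _ _ (\sum_(i < A) above m i.+1 0 +
        D * mesh m ^+ 3 * \sum_(i < A.+1) i%:R * decay1 (i%:R * mesh m))); last first.
      by rewrite lerD2l ler_wpM2l ?sum_ndecay1 // mulr_ge0 ?exprn_ge0 // ltW.
    rewrite big_ord_recl mul0r add0r mulr_sumr -big_split /=; apply: ler_sum => i _.
    rewrite /diag mulrDr; apply: lerD; first by rewrite ler_piMl ?err0 ?weight_below1.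
    rewrite /bump /= add1n [leRHS]mulrCA ler_wpM2r ?weight_below_le // mulr_ge0 ?mulr_ge0 ?exprn_ge0 ?(ltW e0) //.
  have h4 : \sum_(i < A) 0 * below m i.+1 0 = 0 :> R by rewrite big1 // => i _; rewrite mul0r.
  by rewrite h4 in h; rewrite /X /e; lra.
have em m A : e m A <= e m A.+1.
  rewrite lerD2r; apply: lerD; first by rewrite /walls [leRHS]big_ord_recr /= lerDl.
  by rewrite [leRHS]big_ord_recr /= lerDl; exact: err0.
have wn m A : 0 <= weighted_sum weight_above (above m) A A.
  by apply: sumr_ge0 => i _; apply: sumr_ge0 => j _; rewrite mulr_ge0 ?err0 // ler0n.
apply: (@sublinear_le R _ (fun n A => 3 * I + (\sum_(k < n) walls (3 + k) (A + n) +
    (3 * weighted_sum weight_above (above (3 + n)) (A + n) (A + n) +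
      \sum_(k < n) \sum_(i < A + n) above (3 + k) i.+1 0) +
    (4 * C + 2 * D) * \sum_(k < n) mesh (3 + k)))).
  move=> n A; have := @telescope R X (fun _ _ => 0) e 3 step (fun _ _ => lexx _) em n A.
  rewrite big1 // addr0 => h; apply: le_trans h _.
  rewrite /e !big_split /= -mulr_sumr; apply: lerD; first by rewrite /X ler_wpM2l.
  by rewrite lerD2r lerD2l lerDr mulr_ge0.
apply: sublinearD; first exact: sublinear_cst.
apply: sublinearD; last first.
  by apply: sublinearZ; [rewrite addr_ge0 // mulr_ge0|exact: sum_mesh_sublinear].
apply: sublinearD.
  move=> eta eta0; have [M hM] := @wall_gap_sublinear R eta eta0.
  by exists M => n A; exact: hM n (A + n).+2.
move=> eta eta0; have [M hM] := above_sublinear eta0.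
by exists M => n A; exact: hM n (A + n)%N.
Qed.

End profile_error.

(** * Errors summed over a macroscopic box *)

Section box_estimate.
Context {R : realType}.
Implicit Types (n m k a b h A B i j : nat).
Local Notation mesh := (@mesh R).
Local Notation leader_law := (@leader_law R).
Local Notation leaders_law := (@leaders_law R).
Local Notation profile := (@profile R).
Local Notation err := (@profile_error R).
Local Notation above := (@above R).
Local Notation below := (@below R).
Local Notation weight_above := (@weight_above R).
Local Notation weight_below := (@weight_below R).

Hypothesis bottom : forall m a, leaders_law m a 0 = leader_law m a.

Lemma sum_from_le (F : nat -> R) A k : (forall i, 0 <= F i) ->
  \sum_(b < A) (if (k <= b)%N then F (b - k)%N else 0) <= \sum_(j < A) F j.
Proof.
move=> F0; elim: k A => [|k IH] A; first by apply: ler_sum => b _; rewrite subn0.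
case: A => [|A]; first by rewrite !big_ord0.
rewrite big_ord_recl add0r; apply: (@le_trans _ _ (\sum_(j < A) F j)); last first.
  by rewrite big_ord_recr /= lerDl.
by apply: le_trans (IH A); apply: ler_sum => b _; rewrite /= /bump /= add1n ltnS subSS.
Qed.

Let err0 m a b : 0 <= err m a b. Proof. exact: normr_ge0. Qed.

Lemma sum_above m A : \sum_(a < A) \sum_(b < A) (if (a < b)%N then a%:R * err m a b else 0) <=
  weighted_sum weight_above (above m) A A.
Proof.
have f0 i j : 0 <= i%:R * above m i j by apply: mulr_ge0 => //; exact: err0.
apply: (@le_trans _ _ (\sum_(a < A.+1) \sum_(j < A) a%:R * above m a j)).
  apply: (@le_trans _ _ (\sum_(a < A) \sum_(j < A) a%:R * above m a j)); last first.
    by rewrite [leRHS]big_ord_recr /= lerDl sumr_ge0.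
  apply: ler_sum => a _; apply: le_trans (@sum_from_le (fun j => a%:R * above m a j) A a.+1 (f0 a)).
  apply: ler_sum => b _; case: ltnP => ab //.
  by rewrite /above (_ : (a + (b - a.+1)).+1 = b) //; lia.
rewrite big_ord_recl big1 ?add0r => [|j _]; last by rewrite mul0r.
by apply: ler_sum => a _; rewrite /= /bump /= add1n.
Qed.

Lemma sum_below m A : \sum_(a < A) \sum_(b < A)
    (if (b < a)%N then weight_below b (a - b.+1) * err m a b else 0) <=
  weighted_sum weight_below (below m) A A.
Proof.
have f0 i j : 0 <= weight_below i j * below m i j :> R.
  by apply: mulr_ge0; [exact: weight_below_ge0|exact: err0].
rewrite exchange_big /=.
apply: (@le_trans _ _ (\sum_(b < A.+1) \sum_(j < A) weight_below b j * below m b j)).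
  apply: (@le_trans _ _ (\sum_(b < A) \sum_(j < A) weight_below b j * below m b j)); last first.
    by rewrite [leRHS]big_ord_recr /= lerDl sumr_ge0.
  apply: ler_sum => b _; apply: le_trans (@sum_from_le (fun j => weight_below b j * below m b j) A b.+1 (f0 b)).
  apply: ler_sum => a _; case: ltnP => ab //.
  by rewrite /below (_ : (b + (a - b.+1)).+1 = a) //; lia.
rewrite big_ord_recl big1 ?add0r => [|j _]; last by rewrite /weight_below !mul0r.
by apply: ler_sum => a _; rewrite /= /bump /= add1n.
Qed.

Lemma sum_strip (a h A : nat) : \sum_(b < A) ((b <= a)%N && (a < b + h)%N)%:R <= h%:R :> R.
Proof.
apply: (@le_trans _ _ (\sum_(b < A) (if (a.+1 - h <= b)%N then (b - (a.+1 - h) < h)%N%:R else 0))).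
  apply: ler_sum => b _; case: (leqP (a.+1 - h)%N b) => h1; last first.
    by rewrite (_ : (_ && _) = false) //; lia.
  rewrite ler_nat; case: (boolP ((b <= a)%N && (a < b + h)%N)) => // /andP[h2 h3].
  by rewrite (_ : (_ < h)%N = true) //; lia.
apply: le_trans (@sum_from_le (fun j => (j < h)%N%:R) A _ _) _ => //.
rewrite -natr_sum ler_nat; elim: A => [|A IH]; first by rewrite big_ord0.
rewrite big_ord_recr /=; case: ltnP => hA; last by rewrite addn0.
rewrite addn1; apply: leq_ltn_trans hA.
rewrite -[leqRHS]card_ord -sum1_card; apply: leq_sum => i _; exact: leq_b1.
Qed.

(** In the box both weights are at least of order 1/mesh, except just below the diagonal. That strip
    consists of about kap / mesh lattice diagonals, on each of which law and profile have total mass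
    at most 1 + C. *)
Lemma box_bound : exists2 C, 0 <= C & forall x0 y0 X kap : R, 0 < x0 -> 0 < y0 -> 0 < X ->
  0 < kap -> forall m A, (3 <= m)%N ->
  \sum_(a < A) \sum_(b < A) (if [&& x0 <= a%:R * mesh m, a%:R * mesh m <= X & y0 <= b%:R * mesh m]
      then err m a b else 0) <=
   mesh m / x0 * weighted_sum weight_above (above m) A A +
   X * mesh m / (y0 * kap) * weighted_sum weight_below (below m) A A +
   (kap / mesh m + 1) * (1 + C).
Proof.
have [C C0 hC] := @profile_le R.
exists (2 * C) => [|x0 y0 X kap x00 y00 X0 kap0 m A m3]; first by rewrite mulr_ge0.
have e01 := @mesh_itv R _ m3; have /andP[e0 e1] := e01.
have z0 k : 0 <= k%:R * mesh m by rewrite mulr_ge0 // ltW.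
pose h := (Num.truncn (kap / mesh m)).+1.
have /andP[hl hu] : kap / mesh m <= h%:R <= kap / mesh m + 1.
  have /andP[h1 h2] := truncn_itv (divr_ge0 (ltW kap0) (ltW e0)).
  by rewrite (ltW h2) /= /h -natr1 lerD2r.
have h0 : (0 < h)%N by [].
clearbody h.
pose g a := leader_law m a + C * mesh m * decay1 (a%:R * mesh m).
have g0 a : 0 <= g a.
  by rewrite addr_ge0 ?leader_law_ge0 // mulr_ge0 ?decay1_ge0 // mulr_ge0 // ltW.
have c1 : 0 <= mesh m / x0 by rewrite divr_ge0 // ltW.
have c2 : 0 <= X * mesh m / (y0 * kap) by rewrite divr_ge0 ?mulr_ge0 // ltW.
pose T1 a b := if (a < b)%N then a%:R * err m a b else 0.
pose T2 a b := if (b < a)%N then weight_below b (a - b.+1) * err m a b else 0.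
pose T3 a b := ((b <= a)%N && (a < b + h)%N)%:R * g a.
have T10 a b : 0 <= T1 a b by rewrite /T1; case: ifP => // _; apply: mulr_ge0 => //; exact: err0.
have T20 a b : 0 <= T2 a b.
  by rewrite /T2; case: ifP => // _; apply: mulr_ge0; [exact: weight_below_ge0|exact: err0].
have T30 a b : 0 <= T3 a b by rewrite mulr_ge0.
have pt a b : (if [&& x0 <= a%:R * mesh m, a%:R * mesh m <= X & y0 <= b%:R * mesh m]
      then err m a b else 0) <=
    mesh m / x0 * T1 a b + X * mesh m / (y0 * kap) * T2 a b + T3 a b.
  case: and3P => [[xa aX yb]|_]; last by rewrite !addr_ge0 // mulr_ge0.
  have [ab|ba] := ltnP a b.
    apply: (@le_trans _ _ (mesh m / x0 * T1 a b)); last first.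
      by rewrite -addrA lerDl addr_ge0 // mulr_ge0.
    rewrite /T1 ab mulrA ler_peMl ?err0 // mulrAC [mesh m * _]mulrC ler_pdivlMr // mul1r.
    exact: xa.
  have [ah|ha] := ltnP a (b + h).
    apply: (@le_trans _ _ (T3 a b)); last by rewrite lerDr addr_ge0 // mulr_ge0.
    rewrite /T3 ba ah mul1r /g; apply: le_trans (ler_normB _ _) _.
    rewrite ger0_norm ?leaders_law_ge0 // -bottom; apply: lerD; first exact: leaders_law_mono.
    apply: le_trans (hC m a b) _; rewrite ler_wpM2l ?mulr_ge0 ?(ltW e0) //.
    by rewrite ler_piMr ?decay1_ge0 ?decay1_le1.
  have ab : (b < a)%N by clear - ha h0; lia.
  apply: (@le_trans _ _ (X * mesh m / (y0 * kap) * T2 a b)); last first.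
    by rewrite -addrA [leRHS]addrCA lerDl addr_ge0 // mulr_ge0.
  rewrite /T2 ab mulrA ler_peMl ?err0 // /weight_below.
  have a0 : 0 < (a%:R : R) by rewrite ltr0n; exact: leq_ltn_trans ab.
  rewrite (_ : (b + (a - b.+1)).+1 = a); last by clear - ab; lia.
  rewrite (_ : (a - b.+1).+1 = (a - b)%N); last by clear - ab; lia.
  have hab : kap / mesh m <= (a - b)%:R by apply: le_trans hl _; rewrite ler_nat; clear - ha; lia.
  rewrite (_ : _ * (_ / _) = (b%:R * mesh m) * ((a - b)%:R * mesh m) * X / (a%:R * mesh m * (y0 * kap))); last first.
    by field; rewrite !gt_eqF.
  rewrite ler_pdivlMr ?mulr_gt0 // mul1r [leRHS]mulrC; apply: ler_pM => //.
    by rewrite mulr_ge0 // ltW.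
  apply: ler_pM => //; [exact: ltW|exact: ltW|].
  by rewrite -ler_pdivrMr.
apply: (@le_trans _ _ (\sum_(a < A) \sum_(b < A) (mesh m / x0 * T1 a b +
   X * mesh m / (y0 * kap) * T2 a b + T3 a b))).
  by apply: ler_sum => a _; apply: ler_sum => b _; exact: pt.
have split3 (F1 F2 F3 : nat -> nat -> R) : \sum_(a < A) \sum_(b < A) (F1 a b + F2 a b + F3 a b) =
   \sum_(a < A) \sum_(b < A) F1 a b + \sum_(a < A) \sum_(b < A) F2 a b + \sum_(a < A) \sum_(b < A) F3 a b.
  by rewrite -!big_split; apply: eq_bigr => a _; rewrite -!big_split.
have scale (c : R) (F : nat -> nat -> R) : \sum_(a < A) \sum_(b < A) c * F a b = c * \sum_(a < A) \sum_(b < A) F a b.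
  by rewrite mulr_sumr; apply: eq_bigr => a _; rewrite mulr_sumr.
rewrite (split3 (fun a b => mesh m / x0 * T1 a b) (fun a b => X * mesh m / (y0 * kap) * T2 a b) T3) !scale.
apply: lerD; first apply: lerD.
- by rewrite ler_wpM2l // sum_above.
- by rewrite ler_wpM2l // sum_below.
apply: (@le_trans _ _ (h%:R * \sum_(a < A) g a)).
  rewrite mulr_sumr; apply: ler_sum => a _; rewrite -mulr_suml ler_wpM2r //; exact: sum_strip.
have k0 : 0 <= kap / mesh m by rewrite divr_ge0 // ltW.
apply: ler_pM => //; first by rewrite sumr_ge0.
rewrite big_split /= -mulr_sumr; apply: lerD; first exact: sum_leader_law.
rewrite (_ : 2 * C = C * mesh m * (2 / mesh m)); last by field; rewrite gt_eqF.
by rewrite ler_wpM2l ?sum_decay1 // mulr_ge0 // ltW.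
Qed.

(** The box has of order 1/mesh^2 sites, so this is an average error of order e1 times the mesh, the
    size of the profile itself being the mesh. *)
Lemma box_error (x0 y0 X e1 : R) : 0 < x0 -> 0 < y0 -> 0 < X -> 0 < e1 -> exists M, forall m A,
  (M <= m)%N ->
  \sum_(a < A) \sum_(b < A) (if [&& x0 <= a%:R * mesh m, a%:R * mesh m <= X & y0 <= b%:R * mesh m]
      then err m a b else 0) <= e1 / mesh m.
Proof.
move=> x00 y00 X0 e10.
have [C C0 hC] := box_bound.
have D0 : 0 < 1 + C by rewrite ltr_wpDr.
(* [kap] disposes of the strip. [eta] disposes of the weighted sums, since n times mesh^2 is at most
   3. *)
pose kap := e1 / (4 * (1 + C)).
have kap0 : 0 < kap by apply: divr_gt0 => //; exact: mulr_gt0.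
pose p := x0^-1; pose q := X / (y0 * kap).
have p0 : 0 < p by rewrite invr_gt0.
have q0 : 0 < q by rewrite divr_gt0 // mulr_gt0.
have pq0 : 0 < p + q by rewrite addr_gt0.
pose eta := e1 / (12 * (p + q)).
have eta0 : 0 < eta by apply: divr_gt0 => //; exact: mulr_gt0.
have [C1 hC1] := above_sublinear eta0; have [C2 hC2] := below_sublinear bottom eta0.
pose c := `|C1| + `|C2|.
have c0 : 0 <= c by rewrite addr_ge0.
pose K := (p + q) * c + 1 + C.
have K0 : 0 < K by rewrite /K -addrA ltr_wpDl // mulr_ge0 // ltW.
have [M hM] := mesh_small (divr_gt0 (divr_gt0 e10 (ltr0n R 4)) K0).
exists (maxn 3 M) => m A; rewrite geq_max => /andP[m3 Mm].
have e01 := @mesh_itv R _ m3; have /andP[e0 e1'] := e01.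
have {}hM := hM m Mm; rewrite ler_pdivlMr // in hM.
apply: le_trans (hC x0 y0 X kap x00 y00 X0 kap0 m A m3) _.
have mE : m = (3 + (m - 3))%N by rewrite subnKC.
set n := (m - 3)%N in mE.
have a0 i j : 0 <= above m i j by exact: err0.
have wa : weighted_sum weight_above (above m) A A <= c + eta * n%:R.
  have := hC1 n A; rewrite -mE.
  have s0 : 0 <= \sum_(k < n) \sum_(i < A) above (3 + k) i.+1 0.
    by apply: sumr_ge0 => k _; apply: sumr_ge0 => i _; exact: err0.
  have w0 : 0 <= weighted_sum weight_above (above m) A A.
    by apply: sumr_ge0 => i _; apply: sumr_ge0 => j _; exact: mulr_ge0 (ler0n _ _) (err0 _ _ _).
  have := ler_norm C1; have := normr_ge0 C2; rewrite /c.
  by move: (weighted_sum _ _ _ _) s0 w0 => w s0 w0; lra.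
have wb : weighted_sum weight_below (below m) A A <= c + eta * n%:R.
  have := hC2 n A; rewrite -mE.
  have w0 : 0 <= weighted_sum weight_below (below m) A A.
    by apply: sumr_ge0 => i _; apply: sumr_ge0 => j _; apply: mulr_ge0; [exact: weight_below_ge0|exact: err0].
  have := ler_norm C2; have := normr_ge0 C1; rewrite /c.
  by move: (weighted_sum _ _ _ _) w0 => w w0; lra.
have nm : n%:R * mesh m ^+ 2 <= 3.
  rewrite mesh2 mulrA ler_pdivrMr ?ltr0n; last exact: ltn_trans m3.
  by rewrite mulrC ler_wpM2l // ler_nat mE leq_addl.
apply: (@le_trans _ _ (mesh m * (p + q) * (c + eta * n%:R) + (kap / mesh m + 1) * (1 + C))).
  rewrite lerD2r (_ : mesh m * (p + q) * (c + eta * n%:R) = mesh m * p * (c + eta * n%:R) +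
    mesh m * q * (c + eta * n%:R)); last by rewrite -mulrDl -mulrDr.
  apply: lerD; first by apply: ler_wpM2l => //; apply: mulr_ge0; exact: ltW.
  rewrite (_ : X * mesh m / (y0 * kap) = mesh m * q); last by rewrite /q [RHS]mulrC mulrAC.
  by apply: ler_wpM2l => //; apply: mulr_ge0; exact: ltW.
rewrite ler_pdivlMr //.
have E : ((mesh m * (p + q)) * (c + eta * n%:R) + (kap / mesh m + 1) * (1 + C)) * mesh m =
  mesh m * (mesh m * ((p + q) * c)) + (eta * (p + q)) * (n%:R * mesh m ^+ 2) + (kap * (1 + C)) + (1 + C) * mesh m.
  by field; rewrite gt_eqF.
rewrite E.
have k1 : kap * (1 + C) = e1 / 4 by rewrite /kap; field; rewrite gt_eqF.
have k2 : eta * (p + q) = e1 / 12 by rewrite /eta; field; rewrite gt_eqF.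
have k3 : mesh m * (mesh m * ((p + q) * c)) <= mesh m * ((p + q) * c).
  by rewrite ler_piMl // mulr_ge0 ?(ltW e0) // mulr_ge0 // ltW.
have k4 : e1 / 12 * (n%:R * mesh m ^+ 2) <= e1 / 4.
  apply: (@le_trans _ _ (e1 / 12 * 3)); last by lra.
  by rewrite ler_wpM2l // divr_ge0 // ltW.
by rewrite k1 k2; rewrite /K in hM; lra.
Qed.

End box_estimate.

(** * Regularity of the limiting tail *)

Section tail_limit_regularity.
Context {R : realType}.
Implicit Types (x y : R).
Local Notation tail_limit := (@tail_limit R).
Local Notation mu := (@lebesgue_measure R).

Lemma weval_lipschitz (e : @wexpr R) : wsmall e -> exists2 L, 0 <= L & forall x y x' y',
  wedge x y -> wedge x' y' ->
  `|weval e x' y' - weval e x y| <= L * (`|x' - x| + `|y' - y|).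
Proof.
move=> se; have [A A0 hA] := weval_decay (wsmall_dx se); have [B B0 hB] := weval_decay (wsmall_dy se).
exists (A + B) => [|x y x' y' w w']; first exact: addr_ge0.
pose u := x' - x; pose v := y' - y; pose f t := weval e (x + t * u) (y + t * v) - weval e x y.
have fd t : is_derive t (1 : R) f (weval (wdir u v e) (x + t * u) (y + t * v)).
  by apply: (drv_eq (drvB (is_derive_ray _ _ _ _ _ _) (drv_cst _ _))); rewrite subr0.
have w1 : wedge (x + 1 * u) (y + 1 * v) by rewrite !mul1r /u /v !(addrC _ (_ - _)) !subrK.
have f0 : f 0 = 0 by rewrite /f !mul0r !addr0 subrr.
have M0 : 0 <= (A + B) * (`|u| + `|v|) by rewrite mulr_ge0 // addr_ge0.
have fb t : 0 <= t -> t <= 1 ->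
    `|weval (wdir u v e) (x + t * u) (y + t * v)| <= (A + B) * (`|u| + `|v|) * t ^+ 0.
  move=> t0 t1; have [p q] := wedge_ray w w1 t0 t1.
  have d : decay (x + t * u) (y + t * v) <= 1.
    have q0 := le_trans p q.
    by rewrite decayM mulr_ile1 ?decay1_ge0 ?decay1_le1.
  have {}hA := le_trans (hA _ _ p q) (ler_piMr A0 d).
  have {}hB := le_trans (hB _ _ p q) (ler_piMr B0 d).
  rewrite /= expr0 mulr1; apply: le_trans (ler_normD _ _) _; rewrite !normrM [leRHS]mulrDr.
  apply: lerD; rewrite mulrC ler_wpM2r // ?(le_trans hA) ?(le_trans hB) // ?lerDl ?lerDr //.
have := derive_pow_bound fd f0 ler01 M0 fb.
by rewrite expr1 mulr1 /f !mul1r /u /v !(addrC _ (_ - _)) !subrK.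
Qed.

Lemma tail_limit_min_max x y : tail_limit x y = weval wtail (Num.min x y) (Num.max x y).
Proof. by rewrite /tail_limit; case: leP. Qed.

Lemma tail_limit_lipschitz : exists2 L, 0 <= L & forall x y x' y',
  0 <= x -> 0 <= y -> 0 <= x' -> 0 <= y' ->
  `|tail_limit x' y' - tail_limit x y| <= L * (`|x' - x| + `|y' - y|).
Proof.
have [L L0 hL] := weval_lipschitz (@wtail_small R).
exists (L * 2) => [|x y x' y' x0 y0 x0' y0']; first exact: mulr_ge0.
rewrite !tail_limit_min_max -mulrA.
have w (a b : R) : 0 <= a -> 0 <= b -> wedge (Num.min a b) (Num.max a b).
  by move=> a0 b0; split; rewrite ?le_min ?a0 ?b0 // ge_min !le_max !lexx.
apply: le_trans (hL _ _ _ _ (w _ _ x0 y0) (w _ _ x0' y0')) _; apply: ler_wpM2l => //.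
have h (a b c : R) : `|a| <= c -> `|b| <= c -> `|a| + `|b| <= 2 * c by lra.
have nx := ler_norm (x' - x); have ny := ler_norm (y' - y).
have nx' := ler_norm (- (x' - x)); have ny' := ler_norm (- (y' - y)); rewrite !normrN in nx' ny'.
apply: h; rewrite ler_norml; move: (`|_|) (`|_|) nx ny nx' ny' => p q;
  by case: (leP x y) => ?; case: (leP x' y') => ?; lra.
Qed.

Lemma tail_limit_bounded : exists2 F, 0 <= F & forall x y, 0 <= x -> 0 <= y ->
  `|tail_limit x y| <= F.
Proof.
have [C C0 hC] := weval_decay (@wtail_small R); exists C => // x y x0 y0.
rewrite tail_limit_min_max; apply: le_trans (hC _ _ _ _) _.
- by rewrite le_min x0.
- by rewrite ge_min !le_max !lexx.
have d0 : 0 <= Num.min x y by rewrite le_min x0.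
have d1 : 0 <= Num.max x y by rewrite le_max x0.
by rewrite ler_piMr // decayM mulr_ile1 ?decay1_ge0 ?decay1_le1.
Qed.

Lemma tail_limit_continuous y x : 0 <= y -> 0 < x ->
  {for x, continuous (fun u => tail_limit u y)}.
Proof.
move=> y0 x0; have [L L0 hL] := tail_limit_lipschitz.
apply/cvgrPdist_le => e e0; have L1 : 0 < L + 1 by rewrite ltr_wpDl.
exists (Num.min x (e / (L + 1))) => [|z /=]; first by rewrite /= lt_min x0 divr_gt0.
rewrite lt_min => /andP[xz]; rewrite ltr_pdivlMr // => ez.
have z0 : 0 <= z by have := ler_norm (x - z); lra.
apply: le_trans (hL _ _ _ _ z0 y0 (ltW x0) y0) _; rewrite subrr normr0 addr0.
by apply: le_trans (ltW ez); rewrite mulrDr mulr1 mulrC lerDl.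
Qed.

(** The base point is positive because two-sided continuity in x is established at x > 0. *)
Lemma tail_limit_primitive y x0 : 0 <= y -> 0 < x0 -> exists F : R -> R,
  (forall x, x0 < x -> is_derive x (1 : R) F (tail_limit x y)) /\
  (forall x x', x0 < x -> x <= x' ->
    (\int[mu]_(u in `[x, x']) (tail_limit u y)%:E)%E = (F x' - F x)%:E).
Proof.
move=> y0 x00; pose f u := tail_limit u y; pose F x := (\int[mu]_(t in `[x0, x]) f t)%R.
have cf a b : x0 <= a -> {within `[a, b], continuous f}.
  move=> xa; apply: continuous_in_subspaceT => z; rewrite inE /= in_itv /= => /andP[az _].
  by apply: tail_limit_continuous => //; apply: lt_le_trans az; exact: lt_le_trans xa.
have dF x : x0 < x -> is_derive x (1 : R) F (f x).
  move=> xx; have fi : mu.-integrable `[x0, x + 1] (EFin \o f).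
    by apply: continuous_compact_integrable; [exact: segment_compact|exact: cf].
  have fx : {for x, continuous f} by apply: tail_limit_continuous => //; exact: lt_trans xx.
  have xx1 : x < x + 1 by rewrite ltrDl.
  have [dF FE] := continuous_FTC1_closed xx1 fi xx fx.
  have E : 'D_1 F x = f x by rewrite -derive1E FE.
  exact: (DeriveDef dF E).
exists F; split=> // x x' xx; rewrite le_eqVlt => /predU1P[->|xx'].
  by rewrite set_itv1 integral_set1 subrr.
have dc z : x0 < z -> F u @[u --> z] --> F z.
  by move=> /dF h; apply: differentiable_continuous; apply/derivable1_diffP; exact: ex_derive.
rewrite (@continuous_FTC2 _ f F) ?EFinB //.
- exact: cf (ltW xx).
- split.
  + by move=> z; rewrite in_itv /= => /andP[xz _]; have [] := dF z (lt_trans xx xz).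
  + by apply: cvg_at_right_filter; exact: dc.
  + by apply: cvg_at_left_filter; apply: dc; exact: lt_trans xx'.
- move=> z; rewrite in_itv /= => /andP[xz _]; rewrite derive1E.
  by have [_ ->] := dF z (lt_trans xx xz).
Qed.

End tail_limit_regularity.

(** * Convergence of the discrete law *)

Section discrete_limit.
Context {R : realType}.
Implicit Types (x y : R) (m a b h A : nat).
Local Notation mesh := (@mesh R).
Local Notation leader_law := (@leader_law R).
Local Notation leaders_law := (@leaders_law R).
Local Notation profile := (@profile R).
Local Notation err := (@profile_error R).
Local Notation tail_limit := (@tail_limit R).

Lemma is_derive_MVT (F f : R -> R) (x x' : R) : x <= x' ->
  (forall z, x <= z -> z <= x' -> is_derive z (1 : R) F (f z)) ->
  exists2 c, x <= c <= x' & F x' - F x = f c * (x' - x).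
Proof.
move=> xx' dF; case: (@MVT_segment R F f x x' xx') => [z|z|c].
- by rewrite in_itv /= => /andP[xz zx']; apply: dF; exact: ltW.
- apply: continuous_in_subspaceT => u; rewrite inE /= in_itv /= => /andP[xu ux].
  by apply: differentiable_continuous; apply/derivable1_diffP; have [] := dF u xu ux.
- by rewrite in_itv /= => cI E; exists c.
Qed.

Lemma sum_nat_le (F G : nat -> R) (i j A : nat) : (forall a, 0 <= F a) -> (j <= A)%N ->
  (forall a, (i <= a < j)%N -> G a <= F a) -> \sum_(i <= a < j) G a <= \sum_(a < A) F a.
Proof.
move=> F0 jA GF; have [ij|ji] := leqP i j; last first.
  by rewrite big_geq ?(ltnW ji) // sumr_ge0.
rewrite -(big_mkord xpredT F) (big_cat_nat (leq0n i) (leq_trans ij jA)) (big_cat_nat ij jA) /= addrCA.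
apply: ler_wpDr; first by rewrite addr_ge0 // sumr_ge0.
by rewrite big_nat [leRHS]big_nat; apply: ler_sum.
Qed.

Section riemann_sum.
Variables (F : R -> R) (x0 y L : R).
Hypotheses (x00 : 0 < x0) (y0 : 0 <= y) (L0 : 0 <= L).
Hypothesis dF : forall x, x0 < x -> is_derive x (1 : R) F (tail_limit x y).
Hypothesis lip : forall x y x' y', 0 <= x -> 0 <= y -> 0 <= x' -> 0 <= y' ->
  `|tail_limit x' y' - tail_limit x y| <= L * (`|x' - x| + `|y' - y|).

Lemma riemann_sum (eta : R) m A1 A2 b : 0 <= eta -> x0 < A1%:R * mesh m -> (A1 <= A2)%N ->
  `|b%:R * mesh m - y| <= eta ->
  `|\sum_(A1 <= a < A2) profile m a b - (F (A2%:R * mesh m) - F (A1%:R * mesh m))| <=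
  (A2 - A1)%:R * (mesh m * (L * (mesh m + eta))).
Proof.
move=> eta0 xA A12 by_; have e0 := @mesh_ge0 R m.
rewrite -(telescope_sumr (fun a => F (a%:R * mesh m)) A12) -sumrB.
apply: le_trans (ler_norm_sum _ _ _) _.
rewrite mulr_natl -sumr_const_nat; rewrite big_nat [leRHS]big_nat; apply: ler_sum => a /andP[Aa aA].
have xa : x0 < a%:R * mesh m by apply: lt_le_trans xA _; rewrite ler_wpM2r // ler_nat.
have aa : a%:R * mesh m <= a.+1%:R * mesh m by rewrite ler_wpM2r // ler_nat.
have dz z (az : a%:R * mesh m <= z) (_ : z <= a.+1%:R * mesh m) : is_derive z (1 : R) F (tail_limit z y).
  by apply: dF; exact: lt_le_trans az.
have [c /andP[ac ca] ->] := is_derive_MVT aa dz.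
have a0 := le_trans (ltW x00) (ltW xa).
have c0 := le_trans a0 ac.
have E : a.+1%:R * mesh m - a%:R * mesh m = mesh m by rewrite -natr1 mulrDl mul1r addrC addKr.
rewrite E /profile mulrC -mulrBl normrM (ger0_norm e0) [leRHS]mulrC ler_wpM2r //.
apply: le_trans (lip c0 y0 a0 _) _; first by rewrite mulr_ge0.
rewrite ler_wpM2l // lerD // ler0_norm ?subr_le0 // opprB; lra.
Qed.

End riemann_sum.

Hypothesis bottom : forall m a, leaders_law m a 0 = leader_law m a.

(** The box estimate controls the sum over a only on average over b. That sum decreases in b, so it
    lies between its averages over windows of length [h] on either side of b, and the limit varies
    little with y. *)
Lemma leaders_law_cvg (F : R -> R) (x0 x x' y : R) : 0 < x0 -> x0 < x -> x < x' -> 0 < y ->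
  (forall z, x0 < z -> is_derive z (1 : R) F (tail_limit z y)) ->
  forall e, 0 < e -> exists2 del, 0 < del & exists M, forall m A1 A2 b, (M <= m)%N ->
    `|A1%:R * mesh m - x| <= del -> `|A2%:R * mesh m - x'| <= del -> `|b%:R * mesh m - y| <= del ->
    `|\sum_(A1 <= a < A2) leaders_law m a b - (F x' - F x)| <= e.
Proof.
move=> x00 x0x xx' y0 dF e e0.
have [L L0 lip] := @tail_limit_lipschitz R; have [B B0 hB] := @tail_limit_bounded R.
pose K := 2 * B + 4 * L * (x' - x + 2) + 1.
have K0 : 0 < K.
  by rewrite ltr_wpDl // addr_ge0 // ?mulr_ge0 // addr_ge0 // subr_ge0 ltW.
have [del [del0 del1 delx delxx [dely delK]]] : exists del : R,
    [/\ 0 < del, del <= 1, 2 * del <= x - x0, 4 * del <= x' - x & 8 * del <= y /\ K * del <= e / 2].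
  exists (Num.min 1 (Num.min ((x - x0) / 2) (Num.min ((x' - x) / 4) (Num.min (y / 8) (e / 2 / K))))).
  split; first by rewrite !lt_min !divr_gt0 ?subr_gt0 // ltr01.
  - by rewrite ge_min lexx.
  - by rewrite mulrC -ler_pdivlMr // !ge_min lexx !orbT.
  - by rewrite mulrC -ler_pdivlMr // !ge_min lexx !orbT.
  split; first by rewrite mulrC -ler_pdivlMr // !ge_min lexx !orbT.
  by rewrite mulrC -ler_pdivlMr // !ge_min lexx !orbT.
exists del => //.
(* A window contains at least del / mesh values of b, so a box error of del (e / 2) / mesh is at
   most e / 2 on average. *)
have e10 : 0 < del * (e / 2) by rewrite mulr_gt0 // divr_gt0.
have X0 : 0 < x' + 1 by rewrite ltr_wpDl // ltW // (lt_trans x00) // (lt_trans x0x).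
have [M1 hM1] := mesh_small del0.
have [M2 hM2] := box_error bottom x00 (divr_gt0 y0 (ltr0n R 2)) X0 e10.
exists (maxn 3 (maxn M1 M2)) => m A1 A2 b; rewrite !geq_max => /and3P[m3 m1 m2] hA1 hA2 hb.
have /andP[ms0 ms1] := @mesh_itv R _ m3.
have msd := hM1 m m1.
have [a1l a1u] : x - del <= A1%:R * mesh m /\ A1%:R * mesh m <= x + del.
  by move: hA1; rewrite ler_norml => /andP[]; lra.
have [a2l a2u] : x' - del <= A2%:R * mesh m /\ A2%:R * mesh m <= x' + del.
  by move: hA2; rewrite ler_norml => /andP[]; lra.
have [bl bu] : y - del <= b%:R * mesh m /\ b%:R * mesh m <= y + del.
  by move: hb; rewrite ler_norml => /andP[]; lra.
have A12 : (A1 <= A2)%N by rewrite -(ler_nat R) -(ler_pM2r ms0); lra.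
have x0A : x0 < A1%:R * mesh m by lra.
pose D := F (A2%:R * mesh m) - F (A1%:R * mesh m).
pose S b := \sum_(A1 <= a < A2) leaders_law m a b.
have [n0 n1] : 0 <= (A2 - A1)%:R * mesh m /\ (A2 - A1)%:R * mesh m <= x' - x + 2.
  by split; [rewrite mulr_ge0 // ltW|rewrite natrB // mulrBl; lra].
pose h := (Num.truncn (del / mesh m)).+1.
have [hl hu] : del <= h%:R * mesh m /\ h%:R * mesh m <= del + mesh m.
  have /andP[h1 h2] := truncn_itv (divr_ge0 (ltW del0) (ltW ms0)).
  split; first by rewrite -ler_pdivrMr // ltW.
  by rewrite /h -natr1 mulrDl mul1r lerD2r -ler_pdivlMr.
have h0 : 0 < h%:R :> R by rewrite ltr0n.
clearbody h.
pose T := (A2 - A1)%:R * mesh m * (L * (4 * del)).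
have win b0 : (forall b', (b0 <= b' < b0 + h)%N -> `|b'%:R * mesh m - y| <= 3 * del) ->
    `|\sum_(b0 <= b' < b0 + h) S b' - h%:R * D| <= h%:R * (e / 2 + T).
  move=> hb0; rewrite (_ : h%:R * D = \sum_(b0 <= b' < b0 + h) D); last first.
    by rewrite sumr_const_nat addKn mulr_natl.
  rewrite -sumrB; apply: le_trans (ler_norm_sum _ _ _) _.
  apply: (@le_trans _ _ (\sum_(b0 <= b' < b0 + h) (\sum_(A1 <= a < A2) err m a b' + T))).
    rewrite big_nat [leRHS]big_nat; apply: ler_sum => b' /hb0 yb'.
    rewrite (_ : S b' - D = \sum_(A1 <= a < A2) (leaders_law m a b' - profile m a b') +
      (\sum_(A1 <= a < A2) profile m a b' - D)); last by rewrite sumrB addrA subrK.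
    apply: le_trans (ler_normD _ _) _; apply: lerD; first exact: ler_norm_sum.
    have e30 : 0 <= 3 * del by rewrite mulr_ge0 // ltW.
    apply: le_trans (riemann_sum x00 (ltW y0) L0 dF lip e30 x0A A12 yb') _.
    by rewrite mulrA /T ler_wpM2l // ler_wpM2l //; lra.
  rewrite big_split /= sumr_const_nat addKn -[T *+ h]mulr_natl mulrDr lerD2r exchange_big_nat /=.
  apply: le_trans (_ : del * (e / 2) / mesh m <= _); last first.
    by rewrite mulrAC ler_wpM2r ?divr_ge0 ?(ltW e0) // ler_pdivrMr.
  apply: le_trans (hM2 m (A2 + (b0 + h))%N m2).
  have err0 a b' : 0 <= (if [&& x0 <= a%:R * mesh m, a%:R * mesh m <= x' + 1 & y / 2 <= b'%:R * mesh m]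
      then err m a b' else 0) by case: ifP => // _; exact: normr_ge0.
  apply: (sum_nat_le (F := fun a => \sum_(b' < A2 + (b0 + h))
     (if [&& x0 <= a%:R * mesh m, a%:R * mesh m <= x' + 1 & y / 2 <= b'%:R * mesh m]
      then err m a b' else 0))); [by move=> a; exact: sumr_ge0|exact: leq_addr|move=> a /andP[Aa aA]].
  apply: (sum_nat_le (F := fun b' =>
     (if [&& x0 <= a%:R * mesh m, a%:R * mesh m <= x' + 1 & y / 2 <= b'%:R * mesh m]
      then err m a b' else 0))) => // [|b' hb']; first exact: leq_addl.
  have a1 : A1%:R * mesh m <= a%:R * mesh m by rewrite ler_pM2r // ler_nat.
  have a2 : a%:R * mesh m <= A2%:R * mesh m by rewrite ler_pM2r // ler_nat ltnW.
  have := hb0 _ hb'; rewrite ler_norml => /andP[h1 h2].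
  rewrite ifT //; apply/and3P; split; lra.
have Smono b1 b2 : (b1 <= b2)%N -> S b2 <= S b1.
  by move=> b12; apply: ler_sum => a _; exact: leaders_law_mono.
have hSum b0 : h%:R * S b = \sum_(b0 <= b' < b0 + h) S b by rewrite sumr_const_nat addKn mulr_natl.
have up : h%:R * (S b - D) <= h%:R * (e / 2 + T).
  have hb' : (h <= b)%N by rewrite -(ler_nat R) -(ler_pM2r ms0); lra.
  have := win (b - h)%N; rewrite subnK // => w; rewrite mulrBr (hSum (b - h)%N) subnK //.
  apply: le_trans (le_trans (ler_norm _) (w _)); last first.
    move=> b' /andP[b1 b2].
    have c1 : (b%:R - h%:R) * mesh m <= b'%:R * mesh m by rewrite ler_pM2r // -natrB // ler_nat.
    have c2 : b'%:R * mesh m <= b%:R * mesh m by rewrite ler_pM2r // ler_nat ltnW.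
    by rewrite mulrBl in c1; rewrite ler_norml; apply/andP; split; lra.
  rewrite lerD2r big_nat [leRHS]big_nat; apply: ler_sum => b' /andP[_ b2]; apply: Smono; exact: ltnW.
have lo : - (h%:R * (e / 2 + T)) <= h%:R * (S b - D).
  have /(_ _) := win b; rewrite ler_norml => w; rewrite mulrBr (hSum b).
  have /andP[w1 _] : - (h%:R * (e / 2 + T)) <= \sum_(b <= b' < b + h) S b' - h%:R * D <= h%:R * (e / 2 + T).
    apply: w => b' /andP[b1 b2].
    have c1 : b%:R * mesh m <= b'%:R * mesh m by rewrite ler_pM2r // ler_nat.
    have c2 : b'%:R * mesh m <= (b%:R + h%:R) * mesh m by rewrite ler_pM2r // -natrD ler_nat ltnW.
    by rewrite mulrDl in c2; rewrite ler_norml; apply/andP; split; lra.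
  apply: le_trans w1 _.
  by rewrite lerD2r big_nat [leRHS]big_nat; apply: ler_sum => b' /andP[b1 _]; exact: Smono.
rewrite -mulrN in lo; rewrite !ler_pM2l // in up lo.
have Flip u v : x0 < u -> x0 < v -> `|F u - F v| <= B * `|u - v|.
  wlog vu : u v / v <= u => [hw u1 v1|u1 v1].
    by have [/hw|/ltW/hw] := leP v u; [exact|rewrite distrC [in leRHS]distrC; exact].
  have dz z (vz : v <= z) (_ : z <= u) : is_derive z (1 : R) F (tail_limit z y).
    by apply: dF; exact: lt_le_trans vz.
  have [c /andP[vc _] ->] := is_derive_MVT vu dz.
  by rewrite normrM ler_wpM2r // hB // ?(ltW y0) // (le_trans _ vc) // ltW // (lt_trans x00).
have f1 := Flip _ _ (lt_trans x0x xx') (_ : x0 < A2%:R * mesh m).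
have {}f1 : `|F x' - F (A2%:R * mesh m)| <= B * del.
  apply: le_trans (f1 _) _; first by lra.
  by rewrite ler_wpM2l // distrC.
have f2 : `|F x - F (A1%:R * mesh m)| <= B * del.
  by apply: le_trans (Flip _ _ x0x x0A) _; rewrite ler_wpM2l // distrC.
have TK : T + 2 * (B * del) <= e / 2.
  apply: le_trans delK; rewrite /K.
  have : T <= (x' - x + 2) * (L * (4 * del)) by rewrite ler_wpM2r // !mulr_ge0 // ltW.
  have : 0 <= del by exact: ltW.
  by move: (T) => W; lra.
move: f1 f2; rewrite !ler_norml => /andP[f1 f1'] /andP[f2 f2']; rewrite -/(S b).
clear win hSum Smono.
by move: up lo f1 f1' f2 f2' TK; rewrite /D; move: (S b) (T) => s t; move: (F _) (F _) (F _) (F _) => p1 p2 p3 p4 *;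
  apply/andP; split; lra.
Qed.

End discrete_limit.

(** * Poisson concentration *)

Section poisson_moments.
Context {R : realType}.
Variable x : R.
Hypothesis x0 : 0 <= x.
Implicit Types (g h : nat -> R).
Local Notation w := (poisson_weight x).

Lemma poisson_weight_ge0 m : 0 <= w m.
Proof. by rewrite mulr_ge0 ?expR_ge0 // divr_ge0 // exprn_ge0. Qed.

Definition poisson_mean g : \bar R := (\sum_(m <oo) (w m * g m)%:E)%E.

Let term_ge0 g m : (forall n, 0 <= g n) -> (0 <= (w m * g m)%:E)%E.
Proof. by move=> g0; rewrite lee_fin mulr_ge0 // poisson_weight_ge0. Qed.

Lemma poisson_meanD g h : (forall n, 0 <= g n) -> (forall n, 0 <= h n) ->
  poisson_mean (fun m => g m + h m) = (poisson_mean g + poisson_mean h)%E.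
Proof.
move=> g0 h0; rewrite /poisson_mean -nneseriesD; try by move=> i _ _; exact: term_ge0.
by apply: eq_eseriesr => m _; rewrite mulrDr EFinD.
Qed.

Lemma poisson_meanZ (c : R) g : (forall n, 0 <= g n) ->
  poisson_mean (fun m => c * g m) = (c%:E * poisson_mean g)%E.
Proof.
move=> g0; rewrite /poisson_mean -nneseriesZl; last by move=> i _; exact: term_ge0.
by apply: eq_eseriesr => m _; rewrite mulrCA EFinM.
Qed.

Lemma poisson_mean_le g h : (forall n, 0 <= g n) -> (forall n, g n <= h n) ->
  (poisson_mean g <= poisson_mean h)%E.
Proof.
move=> g0 gh; apply: lee_nneseries => [i _ _|i _]; first exact: term_ge0.
by rewrite lee_fin ler_wpM2l // poisson_weight_ge0.
Qed.

Lemma poisson_mean_cst (c : R) : 0 <= c -> poisson_mean (fun=> c) = c%:E.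
Proof.
move=> c0; rewrite -[c]mulr1 (poisson_meanZ c (g := fun=> 1)) //.
rewrite (_ : poisson_mean _ = 1%E) ?mule1 ?mulr1 // /poisson_mean.
under eq_eseriesr do rewrite mulr1 /poisson_weight EFinM.
rewrite nneseriesZl; last by move=> i _; rewrite lee_fin divr_ge0 // exprn_ge0.
by rewrite eseries_exp // -EFinM -expRD addNr expR0.
Qed.

Lemma poisson_mean_shift h : (forall n, 0 <= h n) ->
  poisson_mean (fun m => m%:R * h m) = poisson_mean (fun m => x * h m.+1).
Proof.
move=> h0; rewrite /poisson_mean nneseries_recl //; last first.
  by move=> k _; apply: (term_ge0 (g := fun m => m%:R * h m)) => n; exact: mulr_ge0.
rewrite mul0r mulr0 add0e -nneseries_addn; last first.
  by move=> k; apply: (term_ge0 (g := fun m => m%:R * h m)) => n; exact: mulr_ge0.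
apply: eq_eseriesr => m _; congr (_%:E); rewrite addn1 /poisson_weight factS natrM exprS.
have f0 : (m`!%:R : R) != 0 by rewrite pnatr_eq0 -lt0n fact_gt0.
by have m0 : (m.+1%:R : R) != 0 by []; field; rewrite f0 nat1r m0.
Qed.

Lemma poisson_variance : poisson_mean (fun m => (m%:R - x) ^+ 2) = x%:E.
Proof.
have n0 n : 0 <= (n%:R : R) by [].
have m1 : poisson_mean (fun m => m%:R) = x%:E.
  have := @poisson_mean_shift (fun=> 1) (fun=> ler01).
  rewrite (_ : (fun m => m%:R * 1) = (fun m => m%:R : R)); last by apply/funext => m; rewrite mulr1.
  by move=> ->; rewrite mulr1 poisson_mean_cst.
have m2 : poisson_mean (fun m => m%:R * m%:R) = (x * (x + 1))%:E.
  rewrite poisson_mean_shift // poisson_meanZ // EFinM; congr (_ * _)%E.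
  rewrite (_ : (fun m => m.+1%:R) = (fun m => m%:R + 1 : R)); last by apply/funext => m; rewrite -natr1.
  by rewrite poisson_meanD // m1 poisson_mean_cst.
(* The square is completed across the equality, so that every series has nonnegative terms. *)
have : poisson_mean (fun m => (m%:R - x) ^+ 2 + (2 * x) * m%:R) = poisson_mean (fun m => m%:R * m%:R + x ^+ 2).
  by congr poisson_mean; apply/funext => m; ring.
rewrite !poisson_meanD //; try by [move=> n; exact: sqr_ge0|move=> n; exact: mulr_ge0|move=> n; rewrite !mulr_ge0].
rewrite poisson_meanZ // m1 m2 poisson_mean_cst ?sqr_ge0 // -!EFinM -EFinD.
move=> /(congr1 (fun u => (u - (2 * x * x)%:E)%E)); rewrite addeK // => ->.
by rewrite -EFinB; congr (_%:E); ring.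
Qed.

(** Chebyshev's inequality in averaged form: a quadratic penalty for leaving the mean averages to
    the variance, which is x. *)
Lemma poisson_average (c : nat -> R) (L e K pr : R) : 0 <= e -> 0 <= K -> (forall m, 0 <= c m) ->
  (forall m, `|c m - L| <= e + K * (m%:R - x) ^+ 2) -> poisson_mean c = pr%:E ->
  `|pr - L| <= e + K * x.
Proof.
move=> e0 K0 c0 cL E.
have s0 n : 0 <= (n%:R - x) ^+ 2 by exact: sqr_ge0.
have L0 := normr_ge0 L; have LL := ler_norm L; have NL := ler_norm (- L); rewrite normrN in NL.
have Ks n : 0 <= K * (n%:R - x) ^+ 2 by exact: mulr_ge0.
(* The constants add the absolute value of [L] on both sides, which keeps the averaged quantities
   nonnegative. *)
have [p pE] : exists p, p = L + `|L| + e by exists (L + `|L| + e).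
have [q qE] : exists q, q = `|L| + e by exists (`|L| + e).
have [r rE] : exists r, r = L + `|L| by exists (L + `|L|).
have up : (poisson_mean (fun m => c m + `|L|)%R <= poisson_mean (fun m => p + K * (m%:R - x) ^+ 2)%R)%E.
  apply: poisson_mean_le => n; first exact: addr_ge0.
  by have := cL n; rewrite ler_norml => /andP[_]; lra.
have lo : (poisson_mean (fun=> r) <= poisson_mean (fun m => (c m + q) + K * (m%:R - x) ^+ 2)%R)%E.
  apply: poisson_mean_le => n; first by lra.
  by have := cL n; rewrite ler_norml => /andP[]; lra.
have p0 : 0 <= p by lra.
have q0 : 0 <= q by lra.
have r0 : 0 <= r by lra.
move: up lo; rewrite !poisson_meanD //; try by move=> n; exact: addr_ge0.
rewrite !poisson_mean_cst // (poisson_meanZ K s0) poisson_variance E -!EFinM -!EFinD !lee_fin => up lo.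
by rewrite ler_norml; apply/andP; split; lra.
Qed.

End poisson_moments.

(** * Cell probabilities in continuous time *)

Section rescaled_tails.
Context {d} {Omega : measurableType d} {R : realType} (P : probability Omega R).
Variable tau : int * nat -> {RV P >-> R}.
Hypothesis indep : mutually_independent tau.
Hypothesis exp1 : forall i, exponential_rate1 (tau i).
Variable eta : R -> Omega -> int -> int.
Hypothesis eta0 : forall w x, eta 0 w x = - x.
Hypothesis path_eta :
  {ae P, forall w, tasep_path (rings_at tau w) (fun t => eta t w)}.
Hypothesis meas_eta : forall (t : R) x i, 0 <= t -> measurable [set w | eta t w x = i].

Local Notation mesh := (@mesh R).
Local Notation leaders_law := (@leaders_law R).
Local Notation tail_limit := (@tail_limit R).

(** For z >= 0 this is the least integer above z sqrt t, matching cells that are open on the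
    left. *)
Definition cutoff (z t : R) : nat := (Num.truncn (z * Num.sqrt t)).+1.

Definition leaders_cell (k : int) (A1 A2 b : nat) (e : int -> int) : Prop :=
  exists a, (A1 <= a < A2)%N /\ leads2 k a b e.

Lemma measurable_leaders_cell t k A1 A2 b : 0 <= t ->
  measurable [set w | leaders_cell k A1 A2 b (eta t w)].
Proof.
move=> t0; apply: measurable_exists => a.
apply: (@measurableI _ _ [set w | (A1 <= a < A2)%N] [set w | leads2 k a b (eta t w)]); first exact: measurable_const.
by apply: measurable_leads2 => x i; exact: meas_eta.
Qed.

Lemma first_at_inj k a a' y y' e : first_at k a y e -> first_at k a' y' e -> y = y' /\ a = a'.
Proof.
move=> [ya hy] [ya' hy']; have E : y = y'.
  by case: (ltgtP y y') => // [/hy|/hy']; rewrite ?ya ?ya' => h; exfalso; lia.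
by split=> //; subst y'; move: ya; rewrite ya' => h; lia.
Qed.

Lemma prob_leaders_cell t k A1 A2 b : 0 <= t ->
  P [set w | leaders_cell k A1 A2 b (eta t w)] =
  poisson_mean (3 * t) (fun m => \sum_(A1 <= a < A2) leaders_law m a b).
Proof.
move=> t0.
have meas a : measurable [set w | leads2 k a b (eta t w)].
  by apply: measurable_leads2 => x i; exact: meas_eta.
have triv : trivIset [set a | (A1 <= a < A2)%N] (fun a => [set w | leads2 k a b (eta t w)]).
  move=> a a' _ _ [w [/= h h']].
  have [[y g] [y' g']] := (leads2_leads t0 h, leads2_leads t0 h').
  by have [] := first_at_inj g g'.
rewrite (_ : [set w | _] = \bigcup_(a in [set a | (A1 <= a < A2)%N]) [set w | leads2 k a b (eta t w)]); last first.
  by rewrite predeqE => w; split=> [[a [? ?]]|[a ? ?]]; exists a.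
rewrite (measure_countable P meas triv) /poisson_mean.
rewrite (_ : [set a | (A1 <= a < A2)%N] = [set` index_iota A1 A2]); last first.
  by rewrite predeqE => a /=; rewrite mem_index_iota.
rewrite esum_fset //= -fsbig_seq ?iota_uniq //.
rewrite (eq_bigr (fun a => \sum_(m <oo) (poisson_weight (3 * t) m * leaders_law m a b)%:E)%E); last first.
  by move=> a _; exact: (prob_leaders_law indep exp1 eta0 path_eta meas_eta).
have w0 m a : (0 <= (poisson_weight (3 * t) m * leaders_law m a b)%:E)%E.
  by rewrite lee_fin mulr_ge0 ?leaders_law_ge0 // poisson_weight_ge0 // mulr_ge0.
rewrite -nneseries_sum //; apply: eq_eseriesr => m _.
by rewrite sumEFin mulr_sumr.
Qed.

Lemma cutoff_itv (z t : R) : 0 <= z -> `|(cutoff z t)%:R - z * Num.sqrt t| <= 1.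
Proof.
move=> z0; have /andP[h1 h2] := truncn_itv (mulr_ge0 z0 (sqrtr_ge0 t)).
by rewrite /cutoff -natr1 in h2 *; rewrite ler_norml; apply/andP; split; lra.
Qed.

Lemma cutoff_mesh (Z del : R) : 0 <= Z -> 0 < del -> exists2 kap, 0 < kap <= 1 / 2 &
  exists T, forall t m, T <= t -> `|m%:R - 3 * t| <= kap * (3 * t) ->
    forall z, 0 <= z <= Z -> `|(cutoff z t)%:R * mesh m - z| <= del.
Proof.
move=> Z0 del0; pose kap := Num.min (1 / 4) (del / (4 * (Z + 1))).
have Z1 : 0 < 4 * (Z + 1) by rewrite mulr_gt0 // ltr_wpDl.
have kap0 : 0 < kap by rewrite lt_min !divr_gt0.
have kap2 : kap <= 1 / 4 by rewrite ge_min lexx.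
have kapZ : kap * (4 * (Z + 1)) <= del by rewrite -ler_pdivlMr // ge_min lexx orbT.
exists kap; first by rewrite kap0 /=; lra.
have d20 : 0 < del / 2 by rewrite divr_gt0.
have [M hM] := mesh_small d20.
exists (M%:R + 1) => t m Tt mt z /andP[z0 zZ].
have M0 : 0 <= M%:R :> R by [].
have t1 : 1 <= t by lra.
have kt : kap * (3 * t) <= 1 / 2 * (3 * t) by rewrite ler_wpM2r //; lra.
move: mt; rewrite ler_norml => /andP[mt1 mt2].
have m0 : 0 < m%:R :> R by lra.
have mM : (M <= m)%N by rewrite -(ler_nat R); lra.
have {}hM := hM m mM.
(* u^2 = 3t / m is close to 1; the whole estimate is that u is within 2 kap of 1. *)
pose u := Num.sqrt t * mesh m.
have u0 : 0 <= u by rewrite mulr_ge0 ?sqrtr_ge0 ?mesh_ge0.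
have u2 : u ^+ 2 * m%:R = 3 * t.
  rewrite exprMn sqr_sqrtr; last by lra.
  by rewrite mesh2 mulrA divfK ?gt_eqF // mulrC.
have ub : `|u - 1| <= 2 * kap.
  rewrite ler_norml; apply/andP; split.
    rewrite leNgt; apply/negP => h.
    have : u ^+ 2 <= (1 - 2 * kap) by rewrite expr2; apply: le_trans (ler_wpM2l u0 (_ : u <= 1 - 2 * kap)) _; [lra|rewrite ler_piMl //; lra].
    move=> /(ler_wpM2r (ltW m0)); rewrite u2.
    have : (1 - 2 * kap) * m%:R <= (1 - 2 * kap) * (3 * t + kap * (3 * t)) by rewrite ler_wpM2l //; lra.
    have : 0 < kap * (3 * t) by rewrite mulr_gt0 //; lra.
    have : 0 < kap * (kap * (3 * t)) by rewrite mulr_gt0 // mulr_gt0 //; lra.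
    by move: (kap * (3 * t)) (kap * (kap * _)) => ? ?; nra.
  rewrite leNgt; apply/negP => h.
  have : 1 + 2 * kap <= u ^+ 2.
    rewrite expr2; apply: le_trans (ler_wpM2l u0 (_ : 1 <= u)); [rewrite mulr1|]; lra.
  move=> /(ler_wpM2r (ltW m0)); rewrite u2.
  have : (1 + 2 * kap) * (3 * t - kap * (3 * t)) <= (1 + 2 * kap) * m%:R by rewrite ler_wpM2l //; lra.
  have : 0 < kap * (3 * t) by rewrite mulr_gt0 //; lra.
  have : kap * (kap * (3 * t)) <= 1 / 4 * (kap * (3 * t)) by rewrite ler_wpM2r // mulr_ge0 //; lra.
  rewrite (_ : (1 + 2 * kap) * (3 * t - kap * (3 * t)) = 3 * t + kap * (3 * t) - 2 * (kap * (kap * (3 * t)))); last by ring.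
  by move: (kap * (3 * t)) (kap * (kap * _)) => p q; lra.
have c1 := cutoff_itv t z0.
rewrite (_ : _ - z = ((cutoff z t)%:R - z * Num.sqrt t) * mesh m + z * (u - 1)); last by rewrite /u; ring.
apply: le_trans (ler_normD _ _) _; rewrite !normrM (ger0_norm z0) (ger0_norm (@mesh_ge0 R m)).
have a1 : `|(cutoff z t)%:R - z * Num.sqrt t| * mesh m <= del / 2.
  by apply: le_trans hM; rewrite ler_piMl // mesh_ge0.
have a2 : z * `|u - 1| <= Z * (2 * kap) by apply: ler_pM.
have : Z * (2 * kap) <= del / 2 by nra.
by move=> a3; apply: le_trans (lerD a1 (le_trans a2 a3)) _; lra.
Qed.

(** For m far from 3t the trivial bound 1 + |L| is dominated by the quadratic penalty [K], whose
    average is of order 1/t. *)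
Lemma prob_leaders_cvg k (F : R -> R) (x0 x x' y : R) : 0 < x0 -> x0 < x -> x < x' -> 0 < y ->
  (forall z, x0 < z -> is_derive z (1 : R) F (tail_limit z y)) ->
  forall e, 0 < e -> exists T, forall t, T <= t ->
  `|fine (P [set w | leaders_cell k (cutoff x t) (cutoff x' t) (cutoff y t) (eta t w)]) - (F x' - F x)| <= e.
Proof.
move=> x00 x0x xx' y0 dF e e0; have bottom := leaders_law_bottom indep exp1 eta0 path_eta meas_eta.
pose L := F x' - F x.
have e20 : 0 < e / 2 by rewrite divr_gt0.
have [del del0 [M hM]] := leaders_law_cvg bottom x00 x0x xx' y0 dF e20.
have xp : 0 < x := lt_trans x00 x0x; have xp' : 0 < x' := lt_trans xp xx'.
have Z0 : 0 <= x' + y by rewrite addr_ge0 // ltW.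
have [kap /andP[kap0 kap1] [T hT]] := cutoff_mesh Z0 del0.
have L1 : 0 < 1 + `|L| by rewrite ltr_wpDr.
have k0 : 0 < kap ^+ 2 by rewrite exprn_gt0.
exists (Num.max T (Num.max (M%:R + 1) ((1 + `|L|) / kap ^+ 2 / (e / 2)))) => t.
rewrite !ge_max => /and3P[Tt Mt et].
have t0 : 0 < t by apply: lt_le_trans Mt; rewrite ltr_wpDl.
have t0' := ltW t0.
pose A1 := cutoff x t; pose A2 := cutoff x' t; pose b := cutoff y t.
pose c m := \sum_(A1 <= a < A2) leaders_law m a b.
have x30 : 0 < 3 * t by rewrite mulr_gt0.
have c0 m : 0 <= c m by apply: sumr_ge0 => a _; exact: leaders_law_ge0.
have c1 m : c m <= 1.
  apply: le_trans (_ : \sum_(a < A2) leader_law m a <= _); last exact: sum_leader_law.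
  apply: (sum_nat_le (F := fun a => leader_law m a)) => // [a|a _]; first exact: leader_law_ge0.
  by rewrite -bottom; exact: leaders_law_mono.
pose K := (1 + `|L|) / (kap * (3 * t)) ^+ 2.
have K0 : 0 <= K by rewrite divr_ge0 ?sqr_ge0 // ltW.
have cL m : `|c m - L| <= e / 2 + K * (m%:R - 3 * t) ^+ 2.
  have [near|far] := leP (`|m%:R - 3 * t|) (kap * (3 * t)).
    apply: ler_wpDr; first by rewrite mulr_ge0 // sqr_ge0.
    have h := hT t m Tt near.
    apply: hM.
    - have kt : kap * (3 * t) <= 1 / 2 * (3 * t) by rewrite ler_wpM2r // ltW.
      by move: near; rewrite -(ler_nat R) ler_norml => /andP[n1 _]; lra.
    - by apply: h; rewrite ltW //=; lra.
    - by apply: h; rewrite ltW //=; lra.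
    - by apply: h; rewrite ltW //=; lra.
  apply: ler_wpDl; first exact: ltW.
  apply: le_trans (_ : 1 + `|L| <= _).
    by apply: le_trans (ler_normB _ _) _; rewrite ger0_norm // lerD2r.
  have s0 : 0 < kap * (3 * t) by rewrite mulr_gt0.
  rewrite /K mulrAC ler_pdivlMr ?exprn_gt0 // ler_wpM2l ?(ltW L1) //.
  by rewrite -(real_normK (num_real (m%:R - 3 * t))) lerXn2r ?nnegrE ?(ltW s0) // ltW.
have E : poisson_mean (3 * t) c = P [set w | leaders_cell k A1 A2 b (eta t w)].
  by rewrite prob_leaders_cell.
have fP : P [set w | leaders_cell k A1 A2 b (eta t w)] \is a fin_num by exact: fin_num_measure (measurable_leaders_cell _ _ _ _ _).
rewrite -(fineK fP) in E.
apply: le_trans (poisson_average (ltW x30) (ltW e20) K0 c0 cL E) _.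
suff : K * (3 * t) <= e / 2 by move: (K * _) => q; lra.
rewrite /K [leLHS](_ : _ = (1 + `|L|) / kap ^+ 2 / (3 * t)); last first.
  by field; rewrite !gt_eqF.
rewrite ler_pdivrMr // [leRHS]mulrC -ler_pdivrMr //; apply: le_trans et _; lra.
Qed.

End rescaled_tails.

(** * Positivity of the limit density *)

Section density_positivity.
Context {R : realType}.
Implicit Types (x y : R).
Local Notation tail_limit := (@tail_limit R).

Lemma is_derive_nonincreasing_le0 (F f : R -> R) (x h L : R) : 0 < h -> 0 <= L ->
  (forall z, x <= z -> z <= x + h -> is_derive z (1 : R) F (f z)) ->
  (forall z, x <= z -> z <= x + h -> `|f z - f x| <= L * (z - x)) ->
  (forall z, x <= z -> z <= x + h -> F z <= F x) -> f x <= 0.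
Proof.
move=> h0 L0 dF lip Fz; rewrite leNgt; apply/negP => fx.
pose s := Num.min h (f x / (L + 1)).
have L1 : 0 < L + 1 by rewrite ltr_wpDl.
have s0 : 0 < s by rewrite lt_min h0 divr_gt0.
have sh : s <= h by rewrite ge_min lexx.
have sf : s * (L + 1) <= f x by rewrite -ler_pdivlMr // ge_min lexx orbT.
have xs : x <= x + s by rewrite lerDl ltW.
have dz z (xz : x <= z) (zs : z <= x + s) : is_derive z (1 : R) F (f z).
  by apply: dF => //; apply: le_trans zs _; rewrite lerD2l.
have [c /andP[xc cs] E] := is_derive_MVT xs dz.
have ch : c <= x + h by apply: le_trans cs _; rewrite lerD2l.
have := lip _ xc ch; rewrite ler_norml => /andP[l1 _].
have Ls : L * (c - x) <= L * s by rewrite ler_wpM2l //; lra.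
have fc : 0 < f c by lra.
have := Fz _ xs (_ : x + s <= x + h); rewrite lerD2l => /(_ sh).
rewrite -subr_le0 E addrAC subrr add0r leNgt => /negP; apply; exact: mulr_gt0.
Qed.

Hypothesis antitone : forall x y y', 0 < x -> 0 < y -> y <= y' -> tail_limit x y' <= tail_limit x y.

(** By the Lipschitz bound a positive value would persist at (x + s, y + 2 s), which lies in the
    open wedge. *)
Lemma weval_le0_closure (e : @wexpr R) : wsmall e ->
  (forall x y, 0 < x -> x < y -> weval e x y <= 0) ->
  forall x y, 0 <= x -> x <= y -> weval e x y <= 0.
Proof.
move=> se h x y x0 xy; have [L L0 hL] := weval_lipschitz se.
rewrite leNgt; apply/negP => ep; pose s := weval e x y / (3 * L + 1).
have L1 : 0 < 3 * L + 1 by rewrite ltr_wpDl // mulr_ge0.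
have s0 : 0 < s by exact: divr_gt0.
have sE : s * (3 * L + 1) = weval e x y by rewrite divfK // gt_eqF.
have w2 : wedge (x + s) (y + 2 * s) by split; lra.
have := hL x y _ _ (conj x0 xy) w2; rewrite !(addrAC _ _ (- _)) !subrr !add0r.
have s20 : 0 < 2 * s by exact: mulr_gt0.
rewrite (gtr0_norm s0) (gtr0_norm s20) => /ler_normlP[l1 _].
have := h (x + s) (y + 2 * s) (_ : 0 < x + s) (_ : x + s < y + 2 * s).
by move=> /(_ ltac:(lra) ltac:(lra)); lra.
Qed.

Lemma wdy_wtail_le0 x y : 0 <= x -> x <= y -> weval (wdy wtail) x y <= 0.
Proof.
apply: weval_le0_closure => // {}x {}y x0 xy.
have [L L0 hL] := weval_lipschitz (wsmall_dy (@wtail_small R)).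
have w z : y <= z -> wedge x z by move=> yz; split; [exact: ltW|apply: le_trans yz; exact: ltW].
refine (@is_derive_nonincreasing_le0 (fun z => weval wtail x z) (fun z => weval (wdy wtail) x z) y 1 L ltr01 L0 _ _ _).
- by move=> z yz _; apply: (drv_eq (is_derive_weval wtail (drv_cst x z) (drv_id z))); rewrite mul0r add0r mul1r.
- move=> z yz _; apply: le_trans (hL _ _ _ _ (w _ (lexx y)) (w _ yz)) _.
  by rewrite subrr normr0 add0r ger0_norm // subr_ge0.
move=> z yz _; have xz := le_trans (ltW xy) yz.
rewrite -!tail_limit_wedge ?(ltW xy) //; apply: antitone => //; exact: lt_trans xy.
Qed.

Lemma wdx_wtail_le0 x y : 0 <= x -> x <= y -> weval (wdx wtail) x y <= 0.
Proof.
apply: weval_le0_closure => // {}x {}y x0 xy.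
have [L L0 hL] := weval_lipschitz (wsmall_dx (@wtail_small R)).
have yx : 0 < y - x by rewrite subr_gt0.
have w z : x <= z -> z <= x + (y - x) -> wedge z y by rewrite addrC subrK => xz zy; split => //; apply: le_trans xz; exact: ltW.
refine (@is_derive_nonincreasing_le0 (fun z => weval wtail z y) (fun z => weval (wdx wtail) z y) x (y - x) L yx L0 _ _ _).
- by move=> z yz _; apply: (drv_eq (is_derive_weval wtail (drv_id z) (drv_cst y z))); rewrite mul0r addr0 mul1r.
- move=> z xz zy; apply: le_trans (hL _ _ _ _ (w _ (lexx x) _) (w _ xz zy)) _; first by rewrite lerDl ltW.
  by rewrite subrr normr0 addr0 ger0_norm // subr_ge0.
move=> z xz; rewrite addrC subrK => zy.
rewrite -!tail_limit_wedge ?(ltW xy) // ![tail_limit _ y]tail_limitC; apply: antitone => //.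
exact: lt_trans xy.
Qed.

(** The sign is not apparent in the formulas. [antitone] makes W decrease in y, symmetry makes it
    decrease in x, and [G] is minus one of these derivatives on each side of the diagonal. *)
Lemma G_ge0 x y : 0 <= x -> 0 <= y -> 0 <= G x y.
Proof.
move=> x0 y0; rewrite /G; case: ltP => [yx|xy].
  by have := wdx_wtail_le0 y0 (ltW yx); rewrite wdx_wtail oppr_le0.
by have := wdy_wtail_le0 x0 xy; rewrite wdy_wtail oppr_le0.
Qed.

End density_positivity.

(** * The limit measure and its tails *)

Section density_tail.
Context {R : realType}.
Implicit Types (x y : R).
Local Notation tail_limit := (@tail_limit R).
Local Notation mu := (@lebesgue_measure R).
Hypothesis antitone : forall x y y', 0 < x -> 0 < y -> y <= y' -> tail_limit x y' <= tail_limit x y.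

Lemma measurable_weval d (T : measurableType d) (e : @wexpr R) (f g : T -> R) :
  measurable_fun [set: T] f -> measurable_fun [set: T] g ->
  measurable_fun [set: T] (fun z => weval e (f z) (g z)).
Proof.
move=> mf mg.
have mexp (h : T -> R) : measurable_fun [set: T] h -> measurable_fun [set: T] (fun z => expR (h z)).
  by move=> mh; apply: measurableT_comp mh; exact: measurable_expR.
have merfc (h : T -> R) : measurable_fun [set: T] h -> measurable_fun [set: T] (fun z => erfc (h z)).
  move=> mh; apply: measurableT_comp mh; apply: continuous_measurable_fun.
  exact: (is_derive_continuous is_derive_erfc).
have ms (h : T -> R) : measurable_fun [set: T] h -> measurable_fun [set: T] (fun z => - h z ^+ 2 / 4).
  by move=> mh; apply: measurable_funM => //; apply: measurableT_comp => //; exact: measurable_funX.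
have mc (c : R) (h : T -> R) : measurable_fun [set: T] h -> measurable_fun [set: T] (fun z => c * h z).
  by move=> mh; exact: measurable_funM.
elim: e => //=.
- apply: mexp; apply: measurable_funM => //; apply: measurableT_comp => //.
  apply: measurable_funD; last exact: measurable_funX.
  by apply: measurable_funB; [exact: measurable_funX|exact: measurable_funM].
- apply: measurable_funM; first by apply: mexp; apply: ms; exact: measurable_funB.
  by apply: merfc; apply: (mc); exact: measurable_funD.
- apply: measurable_funM; first by apply: mexp; apply: ms.
  by apply: merfc; apply: (mc); apply: measurable_funB; [apply: mc|].
- apply: measurable_funM; first by apply: mexp; apply: ms.
  by apply: merfc; apply: (mc); apply: measurable_funB; [apply: mc|].
- by move=> a ha b hb; exact: measurable_funD.
- by move=> a ha b hb; exact: measurable_funM.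
Qed.

Lemma measurable_G d (T : measurableType d) (f g : T -> R) :
  measurable_fun [set: T] f -> measurable_fun [set: T] g ->
  measurable_fun [set: T] (fun z => G (f z) (g z)).
Proof.
move=> mf mg; rewrite (_ : (fun z => _) = (fun z => if g z < f z then - weval (wdx wtail) (g z) (f z)
    else - weval (wdy wtail) (f z) (g z))); last first.
  by apply/funext => z; rewrite /G wdx_wtail wdy_wtail !opprK.
apply: measurable_fun_ifT; first exact: measurable_fun_ltr.
- by apply: measurableT_comp => //; exact: measurable_weval.
- by apply: measurableT_comp => //; exact: measurable_weval.
Qed.

Lemma wtail_cvg0 x : 0 <= x -> weval wtail x y @[y --> +oo] --> (0 : R).
Proof.
move=> x0; have [C C0 hC] := weval_decay (@wtail_small R).
apply/cvgr0Pnorm_le => e e0; near=> y.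
have xy : x <= y by near: y; apply: nbhs_pinfty_ge; exact: num_real.
have y0 := le_trans x0 xy.
have Cy : C / e <= y by near: y; apply: nbhs_pinfty_ge; exact: num_real.
apply: le_trans (hC x y x0 xy) _.
apply: le_trans (_ : C * decay1 y <= _).
  by rewrite ler_wpM2l // decayM ler_piMl ?decay1_ge0 ?decay1_le1.
rewrite ler_pdivrMr ?exprn_gt0 ?ltr_wpDr //; apply: (@le_trans _ _ (e * (1 + y))).
  by rewrite mulrC -ler_pdivrMr // (le_trans Cy) // lerDr.
by rewrite ler_wpM2l ?(ltW e0) // ler_eXnr // lerDl.
Unshelve. all: by end_near. Qed.

(** [G] is minus the derivative of the tail in its second variable; the integral is cut at z = x,
    where the formula changes. *)
Lemma integral_G x y : 0 <= x -> 0 <= y ->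
  (\int[mu]_(z in `[y, +oo[) (G x z)%:E)%E = (tail_limit x y)%:E.
Proof.
move=> x0 y0.
have mG D : measurable D -> measurable_fun D (fun z => (G x z)%:E).
  move=> mD; apply/measurable_EFinP; apply: measurable_funTS; exact: measurable_G.
have upper b : x <= b -> (\int[mu]_(z in `[b, +oo[) (G x z)%:E)%E = (weval wtail x b)%:E.
  move=> xb; rewrite (@eq_integral _ _ _ mu _ (fun z => (- weval (wdy wtail) x z)%:E)); last first.
    move=> z /set_mem zb; have bz : b <= z by move: zb; rewrite /= in_itv /= andbT.
    by rewrite wdy_wtail opprK /G ltNge (le_trans xb bz).
  have dF z : is_derive z (1 : R) (fun z => - weval wtail x z) (- weval (wdy wtail) x z).
    by apply: drvN; apply: (drv_eq (is_derive_weval wtail (drv_cst x z) (drv_id z))); rewrite mul0r add0r mul1r.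
  rewrite (@ge0_continuous_FTC2y _ _ (fun z => - weval wtail x z) b 0).
  - by rewrite add0e -EFinN opprK.
  - by move=> z bz; rewrite oppr_ge0; apply: wdy_wtail_le0 => //; exact: le_trans bz.
  - apply: continuous_subspaceT; apply: (is_derive_continuous (g := fun z => - weval (wdy (wdy wtail)) x z)) => z.
    by apply: drvN; apply: (drv_eq (is_derive_weval (wdy wtail) (drv_cst x z) (drv_id z))); rewrite mul0r add0r mul1r.
  - by rewrite -oppr0; apply: cvgN; exact: wtail_cvg0.
  - by move=> z _; have [] := dF z.
  - by apply: cvg_at_right_filter; exact: (is_derive_continuous dF).
  - by move=> z _; rewrite derive1E; have [_ ->] := dF z.
have [xy|yx] := leP x y; first by rewrite upper // tail_limit_wedge.
rewrite (_ : `[y, +oo[%classic = `[y, x[ `|` `[x, +oo[); last first.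
  rewrite predeqE => z /=; rewrite !in_itv /= !andbT; split.
    by case: (ltP z x) => [zx ->|xz _]; [left|right].
  by move=> [/andP[]|] // /(le_trans (ltW yx)).
rewrite ge0_integral_setU //=; first last.
- apply/disj_setPS => z /= []; rewrite !in_itv /= andbT => /andP[_ zx] xz.
  by move: (lt_le_trans zx xz); rewrite ltxx.
- move=> z; rewrite lee_fin !in_itv /= !andbT => h; apply: G_ge0 => //.
  by case: h => [/andP[yz _]|xz]; [exact: le_trans yz|exact: le_trans xz].
- by apply: mG; exact: measurableU.
rewrite upper //.
have dF z : is_derive z (1 : R) (fun z => - weval wtail z x) (- weval (wdx wtail) z x).
  by apply: drvN; apply: (drv_eq (is_derive_weval wtail (drv_id z) (drv_cst x z))); rewrite mul0r addr0 mul1r.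
rewrite (@eq_integral _ _ _ mu _ (fun z => (- weval (wdx wtail) z x)%:E)); last first.
  move=> z /set_mem zI; have zx : z < x by move: zI; rewrite /= in_itv /= => /andP[].
  by rewrite wdx_wtail opprK /G zx.
have cf : continuous (fun z => - weval (wdx wtail) z x).
  apply: (is_derive_continuous (g := fun z => - weval (wdx (wdx wtail)) z x)) => z.
  by apply: drvN; apply: (drv_eq (is_derive_weval (wdx wtail) (drv_id z) (drv_cst x z))); rewrite mul0r addr0 mul1r.
rewrite integral_itv_bndo_bndc; last first.
  by apply/measurable_EFinP; apply: measurable_funTS; exact: continuous_measurable_fun.
rewrite (integral_is_derive (ltW yx) dF cf) -EFinD tail_limitC tail_limit_wedge ?(ltW yx) //.
by congr (_%:E); ring.
Qed.

End density_tail.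

Section density_probability.
Context {d} {T : measurableType d} {R : realType}.
Variables (m : {measure set T -> \bar R}) (f : T -> \bar R).
Hypotheses (f0 : forall x, (0 <= f x)%E) (mf : measurable_fun [set: T] f)
  (f1 : (\int[m]_x f x = 1)%E).

(** The hypotheses are arguments so that the measure and probability structures can be inferred from
    the term. *)
Definition density_prob of (forall x, (0 <= f x)%E) & measurable_fun [set: T] f &
    (\int[m]_x f x = 1)%E : set T -> \bar R := fun A => (\int[m]_(x in A) f x)%E.

Local Notation prob := (density_prob f0 mf f1).

Let prob0 : prob set0 = 0%E.
Proof. by rewrite /density_prob integral_set0. Qed.

Let prob_ge0 A : (0 <= prob A)%E.
Proof. exact: integral_ge0. Qed.

Let prob_sigma_additive : semi_sigma_additive prob.
Proof.
move=> /= F mF tF mUF; rewrite /density_prob; apply: cvg_toP.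
  apply: ereal_nondecreasing_is_cvgn => i j ij.
  by apply: lee_sum_nneg_natr => // k _ _; exact: integral_ge0.
by rewrite ge0_integral_bigcup //; exact: measurable_funTS.
Qed.

HB.instance Definition _ := isMeasure.Build _ _ _ prob prob0 prob_ge0 prob_sigma_additive.

HB.instance Definition _ := @Measure_isProbability.Build _ _ R prob f1.

End density_probability.

Section limit_probability.
Context {R : realType}.
Implicit Types (x y : R).
Local Notation tail_limit := (@tail_limit R).
Local Notation mu := (@lebesgue_measure R).
Hypothesis antitone : forall x y y', 0 < x -> 0 < y -> y <= y' -> tail_limit x y' <= tail_limit x y.

Definition quadrant : set (R * R) := [set a | 0 <= a.1 /\ 0 <= a.2].

Definition quadrant_density : R * R -> \bar R := (fun a => (G a.1 a.2)%:E) \_ quadrant.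

Lemma measurable_quadrant : measurable quadrant.
Proof.
rewrite (_ : quadrant = `[0, +oo[ `*` `[0, +oo[); first exact: measurableX.
by rewrite predeqE => -[a b] /=; rewrite !in_itv /= !andbT.
Qed.

Lemma quadrant_density_ge0 a : (0 <= quadrant_density a)%E.
Proof.
rewrite /quadrant_density patchE; case: ifPn => // /set_mem [a1 a2].
by rewrite lee_fin G_ge0.
Qed.

Lemma measurable_quadrant_density : measurable_fun [set: R * R] quadrant_density.
Proof.
apply/(measurable_restrictT _ measurable_quadrant); apply: measurable_funTS; apply/measurable_EFinP.
by apply: measurable_G; [exact: measurable_fst|exact: measurable_snd].
Qed.

Lemma integral_quadrant_density (I J : set R) y : measurable I -> measurable J ->
  I `<=` [set x | 0 <= x] -> J `<=` [set y | 0 <= y] ->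
  (forall x, 0 <= x -> (\int[mu]_(z in J) (G x z)%:E)%E = (tail_limit x y)%:E) ->
  (\int[mu \x mu]_(a in I `*` J) quadrant_density a = \int[mu]_(x in I) (tail_limit x y)%:E)%E.
Proof.
move=> mI mJ I0 J0 hJ; have mIJ : measurable (I `*` J) by exact: measurableX.
rewrite integral_mkcond fubini_tonelli1 /=; last 2 first.
- apply/(measurable_restrictT _ mIJ); apply: measurable_funTS; exact: measurable_quadrant_density.
- by move=> a; rewrite patchE; case: ifP => // _; exact: quadrant_density_ge0.
rewrite [RHS]integral_mkcond; apply: eq_integral => x _; rewrite /fubini_F [RHS]patchE.
case: ifPn => [/set_mem xI|/negP xI].
  rewrite -hJ; last exact: I0.
  rewrite [RHS]integral_mkcond; apply: eq_integral => z _; rewrite [RHS]patchE.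
  case: ifPn => [/set_mem zJ|/negP zJ].
    rewrite patchE mem_set; last by split.
    by rewrite /quadrant_density patchE mem_set //; split; [exact: I0|exact: J0].
  by rewrite patchE memNset // => -[_ /mem_set].
apply: integral0_eq => z _; rewrite patchE memNset // => -[/mem_set].
by [].
Qed.

(** At y = 0 the tail is the marginal density of the first leader, a Gaussian on the half-line. *)
Lemma integral_tail_limit0 : (\int[mu]_(x in `[0%R, +oo[) (tail_limit x 0)%:E = 1)%E.
Proof.
rewrite (@eq_integral _ _ _ mu _ (fun x => (wk * expR (- x ^+ 2 / 4))%:E)); last first.
  move=> x /set_mem xI; have x0 : 0 <= x by move: xI; rewrite /= in_itv /= andbT.
  by rewrite tail_limitC tail_limit_wedge // wtail_axis.
have dF x : is_derive x (1 : R) (fun u => - erfc (u / 2)) (wk * expR (- x ^+ 2 / 4)).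
  have h : is_derive x (1 : R) (fun u => u / 2) (1 / 2) by exact: drvZr (drv_id x).
  apply: (drv_eq (drvN (@drv_comp R (fun u => u / 2) erfc x _ _ (is_derive_erfc (x / 2)) h))).
  rewrite /wk expr_div_n (_ : - (x ^+ 2 / 2 ^+ 2) = - x ^+ 2 / 4); last by field.
  by field; rewrite gt_eqF // sqrt_pi_gt0.
have w0 : 0 <= wk :> R by rewrite invr_ge0 sqrtr_ge0.
have g0 (x : R) : 0 <= wk * expR (- x ^+ 2 / 4) by rewrite mulr_ge0 // expR_ge0.
rewrite (@integral_is_derivey R _ _ 0 0 g0 dF).
- by rewrite mul0r /erfc erf0 subr0 opprK add0r.
- apply: (is_derive_continuous (g := fun x => wk * (- x / 2 * expR (- x ^+ 2 / 4)))) => x.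
  apply: (drv_eq (drvZl wk (drv_exp (drvZr (4^-1) (drvN (drvX 1 (drv_id x))))))).
  by rewrite expr1; field.
rewrite -oppr0; apply: cvgN; apply: (@cvg_comp _ _ _ (fun u => u / 2) erfc _ (pinfty_nbhs R)); last exact: erfc_cvg.
by apply: gt0_cvgMly; [rewrite invr_gt0|exact: cvg_id].
Qed.

Lemma integral_quadrant_densityT : (\int[mu \x mu]_a quadrant_density a = 1)%E.
Proof.
rewrite -integral_tail_limit0 -(@integral_quadrant_density `[0, +oo[ `[0, +oo[ 0) //.
- rewrite [RHS]integral_mkcond; apply: eq_integral => a _; rewrite [RHS]patchE.
  case: ifPn => // /negP aI; rewrite /quadrant_density patchE memNset // => -[a1 a2].
  by apply: aI; apply/mem_set; split; rewrite /= in_itv /= andbT.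
- by move=> x /=; rewrite in_itv /= andbT.
- by move=> x /=; rewrite in_itv /= andbT.
- by move=> x x0; exact: integral_G.
Qed.

Let mass := @density_prob _ _ R (mu \x mu)%E quadrant_density
  quadrant_density_ge0 measurable_quadrant_density integral_quadrant_densityT.

(* [mass] lives on the product of the sigma-algebras generated by the intervals; the canonical
   structure of [R * R] has the same measurable sets under another display. *)
Definition limit_mass : set (R * R) -> \bar R := mass.

Let limit_mass0 : limit_mass set0 = 0%E. Proof. exact: (measure0 mass). Qed.

Let limit_mass_ge0 A : (0 <= limit_mass A)%E. Proof. exact: (measure_ge0 mass). Qed.

Let limit_mass_sigma_additive : @semi_sigma_additive _ R (R * R)%type limit_mass.
Proof. exact: (@measure_semi_sigma_additive _ _ _ mass). Qed.

HB.instance Definition _ :=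
  isMeasure.Build _ (R * R)%type R limit_mass limit_mass0 limit_mass_ge0 limit_mass_sigma_additive.

Let limit_massT : limit_mass [set: R * R] = 1%E. Proof. exact: (@probability_setT _ _ _ mass). Qed.

HB.instance Definition _ := @Measure_isProbability.Build _ (R * R)%type R limit_mass limit_massT.

Definition limit_prob : probability (R * R)%type R := limit_mass.

Lemma limit_prob_density : has_density limit_prob quadrant G.
Proof. by move=> A mA; rewrite integral_mkcondr. Qed.

Lemma limit_prob_cell x0 x x' y (F : R -> R) : 0 < x0 -> x0 < x -> x <= x' -> 0 <= y ->
  (\int[mu]_(u in `[x, x']) (tail_limit u y)%:E)%E = (F x' - F x)%:E ->
  limit_prob (`]x, x'] `*` `]y, +oo[) = (F x' - F x)%:E.
Proof.
move=> x00 x0x xx' y0 <-; have xp := lt_trans x00 x0x.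
rewrite [LHS](@integral_quadrant_density _ _ y) //.
- rewrite integral_itv_obnd_cbnd //; apply/measurable_EFinP; apply: measurable_funTS.
  rewrite (_ : (fun u => _) = (fun u => if u <= y then weval wtail u y else weval wtail y u)) //.
  apply: measurable_fun_ifT; [exact: measurable_fun_ler|exact: measurable_weval|exact: measurable_weval].
- by move=> z /=; rewrite in_itv /= => /andP[xz _]; exact: le_trans (ltW xp) (ltW xz).
- by move=> z /=; rewrite in_itv /= andbT => yz; exact: le_trans y0 (ltW yz).
move=> u u0; rewrite integral_itv_obnd_cbnd ?integral_G //.
by apply/measurable_EFinP; apply: measurable_funTS; exact: measurable_G.
Qed.

Lemma limit_prob_open : limit_prob (`]0, +oo[ `*` `]0, +oo[) = 1%E.
Proof.
rewrite [LHS](@integral_quadrant_density _ _ 0) //.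
- rewrite integral_itv_obnd_cbnd ?integral_tail_limit0 //; apply/measurable_EFinP; apply: measurable_funTS.
  rewrite (_ : (fun u => _) = (fun u => if u <= 0 then weval wtail u 0 else weval wtail 0 u)) //.
  apply: measurable_fun_ifT; [exact: measurable_fun_ler|exact: measurable_weval|exact: measurable_weval].
- by move=> z /=; rewrite in_itv /= andbT; exact: ltW.
- by move=> z /=; rewrite in_itv /= andbT; exact: ltW.
move=> u u0; rewrite integral_itv_obnd_cbnd ?integral_G //.
by apply/measurable_EFinP; apply: measurable_funTS; exact: measurable_G.
Qed.

End limit_probability.

(** * Step approximation and weak convergence from cells *)

Section step_approximation.
Context {d} {T : measurableType d} {R : realType} (nu : probability T R) (I : finType).
Variables (C : I -> set T) (mC : forall i, measurable (C i)).
Implicit Types (a c : I -> R) (h : T -> R).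

Local Notation step a := (fun z => \sum_i a i * \1_(C i) z).

Lemma measurable_step a : measurable_fun [set: T] (step a).
Proof.
by apply: measurable_sum => i; apply: measurable_funM => //; exact: measurable_indic.
Qed.

Lemma integral_step a : (forall i, 0 <= a i) ->
  (\int[nu]_z (step a z)%:E)%E = (\sum_i a i * fine (nu (C i)))%:E.
Proof.
move=> a0; under eq_integral do rewrite -sumEFin.
rewrite ge0_integral_sum //; last 2 first.
- move=> i; apply/measurable_EFinP; apply: measurable_funM => //; exact: measurable_indic.
- by move=> i z _; rewrite lee_fin mulr_ge0.
rewrite -sumEFin; apply: eq_bigr => i _.
under eq_integral do rewrite EFinM.
rewrite ge0_integralZl //; last 2 first.
- by apply/measurable_EFinP; exact: measurable_indic.
- by rewrite lee_fin.
by rewrite integral_indic // setIT EFinM fineK // fin_num_measure.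
Qed.

Hypothesis disj : forall i j z, C i z -> C j z -> i = j.

Lemma step_in a i z : C i z -> step a z = a i.
Proof.
move=> iz /=; rewrite (bigD1 i) //= indicE mem_set // mulr1 big1 ?addr0 // => j ji.
rewrite indicE memNset ?mulr0 // => jz; move/eqP: ji; apply; exact: disj iz.
Qed.

Lemma step_out a z : (forall i, ~ C i z) -> step a z = 0.
Proof. by move=> oz /=; rewrite big1 // => i _; rewrite indicE memNset ?mulr0. Qed.

Lemma step_approx c h (M e : R) : 0 <= e -> measurable_fun [set: T] h ->
  (forall z, 0 <= h z <= M) -> (forall i, 0 <= c i) ->
  (forall i z, C i z -> `|h z - c i| <= e) ->
  `|fine (\int[nu]_z (h z)%:E)%E - \sum_i c i * fine (nu (C i))| <=
    e + M * (1 - \sum_i fine (nu (C i))).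
Proof.
move=> e0 mh h0M c0 hc.
have h0 z : 0 <= h z by have /andP[] := h0M z.
have hM z : h z <= M by have /andP[] := h0M z.
have M0 : 0 <= M by exact: le_trans (h0 point) (hM point).
have mE (g : T -> R) : measurable_fun [set: T] g -> measurable_fun [set: T] (fun z => (g z)%:E).
  by move=> mg; apply/measurable_EFinP.
have s0 a z : (forall i, 0 <= a i) -> 0 <= step a z.
  by move=> a0; apply: sumr_ge0 => i _; rewrite mulr_ge0.
have icst (r : R) : (\int[nu]_z r%:E = r%:E)%E.
  by rewrite integral_cst //= probability_setT mule1.
have iD (g g' : T -> R) : (forall z, 0 <= g z) -> (forall z, 0 <= g' z) -> measurable_fun [set: T] g ->
    measurable_fun [set: T] g' ->
    (\int[nu]_z (g z + g' z)%:E = \int[nu]_z (g z)%:E + \int[nu]_z (g' z)%:E)%E.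
  move=> g0 g0' mg mg'; under eq_integral do rewrite EFinD.
  by rewrite ge0_integralD //; [by move=> z _; rewrite lee_fin|exact: mE|by move=> z _; rewrite lee_fin|exact: mE].
have ile (g g' : T -> R) : (forall z, 0 <= g z) -> (forall z, g z <= g' z) -> measurable_fun [set: T] g ->
    measurable_fun [set: T] g' -> (\int[nu]_z (g z)%:E <= \int[nu]_z (g' z)%:E)%E.
  move=> g0 gg mg mg'; apply: ge0_le_integral => //.
  - by move=> z _; rewrite lee_fin.
  - exact: mE.
  - exact: mE.
  - by move=> z _; rewrite lee_fin.
have hfin : (\int[nu]_z (h z)%:E)%E \is a fin_num.
  rewrite ge0_fin_numE; last by apply: integral_ge0 => z _; rewrite lee_fin.
  by apply: le_lt_trans (ile h (fun=> M) h0 hM mh (measurable_cst _)) _; rewrite icst ltry.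
have [H HE] : exists H : R, (\int[nu]_z (h z)%:E)%E = H%:E by exists (fine (\int[nu]_z (h z)%:E)%E); rewrite fineK.
have Me0 : 0 <= M + e by exact: addr_ge0.
(* Both comparisons add constants so that all integrands are nonnegative; outside the cells they
   only use 0 <= h <= M. *)
have up := ile (fun z => h z + step (fun=> M) z) (fun z => step c z + (M + e)).
have lo := ile (fun z => step (fun i => c i + M) z) (fun z => h z + (M + e)).
move: up lo; rewrite !iD ?HE ?integral_step ?icst //; try by [move=> i; exact: addr_ge0|exact: measurable_step|move=> z; exact: s0|exact: measurable_cst].
move=> up lo.
have {}up : (H%:E + (\sum_i M * fine (nu (C i)))%:E <= (\sum_i c i * fine (nu (C i)))%:E + (M + e)%:E)%E.
  apply: up; try by [move=> z; apply: addr_ge0 => //; exact: s0|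
    apply: measurable_funD => //; exact: measurable_step].
  move=> z; have [[i iz]|/forallNP nz] := pselect (exists i, C i z).
    rewrite !(step_in _ iz); have := hc i z iz; rewrite ler_norml => /andP[_]; lra.
  by rewrite !step_out //; have := hM z; lra.
have {}lo : ((\sum_i (c i + M) * fine (nu (C i)))%:E <= H%:E + (M + e)%:E)%E.
  apply: lo; try by [move=> z; apply: s0 => i; exact: addr_ge0|exact: measurable_step|
    apply: measurable_funD => //].
  move=> z; have [[i iz]|/forallNP nz] := pselect (exists i, C i z).
    rewrite !(step_in _ iz); have := hc i z iz; rewrite ler_norml => /andP[]; lra.
  by rewrite !step_out //; have := h0 z; lra.
rewrite (eq_bigr (fun i => c i * fine (nu (C i)) + M * fine (nu (C i)))) in lo; last by move=> i _; rewrite mulrDl.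
rewrite big_split /= -mulr_sumr -EFinD lee_fin in lo; rewrite -mulr_sumr -!EFinD lee_fin in up.
rewrite /= mulrBr mulr1; move: (\sum_i c i * _) (M * \sum_i _) up lo => p q up lo.
by rewrite ler_norml; apply/andP; split; lra.
Qed.

Lemma cover_le (B : set T) : measurable B -> (forall z, B z -> exists i, C i z) ->
  fine (nu B) <= \sum_i fine (nu (C i)).
Proof.
move=> mB cov.
have := @ge0_le_integral _ _ _ nu setT measurableT (fun z => (\1_B z)%:E) (fun z => (step (fun=> 1) z)%:E).
rewrite integral_step // integral_indic // setIT => h.
rewrite -lee_fin fineK ?fin_num_measure //; move: h; under eq_bigr do rewrite mul1r; apply.
- by move=> z _; rewrite lee_fin.
- by apply/measurable_EFinP; exact: measurable_indic.
- by apply/measurable_EFinP; exact: measurable_step.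
move=> z _; rewrite lee_fin [leLHS]indicE; have [Bz|Bz] := boolP (z \in B).
  by have [i iz] := cov z (set_mem Bz); rewrite (step_in _ iz).
by rewrite sumr_ge0 // => i _; rewrite mulr_ge0.
Qed.

End step_approximation.

Section weak_convergence.
Context {R : realType}.
Implicit Types (x y u v e : R).

(** An open set of the plane is a countable union of products of balls with rational centres and
    radii 1/(n + 1). *)
Lemma open_measurable_prod (U : set (R * R)) : open U -> measurable U.
Proof.
move=> oU; pose A (pqn : rat * rat * nat) : set (R * R) :=
  ball (ratr pqn.1.1 : R) pqn.2.+1%:R^-1 `*` ball (ratr pqn.1.2 : R) pqn.2.+1%:R^-1.
rewrite (_ : U = [set z | exists pqn, A pqn `<=` U /\ A pqn z]).
  apply: measurable_exists => pqn.
  apply: (@measurableI _ _ [set z | A pqn `<=` U] (A pqn)); first exact: measurable_const.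
  by apply: measurableX; exact: measurable_ball.
rewrite predeqE => -[u v]; split=> [Uz|[pqn [AU Az]]]; last exact: AU.
have /nbhs_ballP[r /= r0 hr] : nbhs (u, v) U by exact: open_nbhs_nbhs.
have [n hn] := nat_above (2 / r).
have n0 : 0 < n.+1%:R^-1 :> R by rewrite invr_gt0 ltr0n.
have nr : 2 * n.+1%:R^-1 < r.
  rewrite ltr_pdivrMr ?ltr0n // mulrC -ltr_pdivrMr //; apply: le_lt_trans hn _; by rewrite ltr_nat.
have near (s : R) : exists p : rat, `|ratr p - s| < n.+1%:R^-1.
  have lts : s - n.+1%:R^-1 < s + n.+1%:R^-1 by rewrite ltrBlDr -addrA ltrDl addr_gt0.
  have [p] := rat_in_itvoo lts.
  by rewrite in_itv /= => h; exists p; rewrite ltr_distl.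
have [p hp] := near u; have [q hq] := near v.
exists (p, q, n); split; last by [].
have tri (a b c : R) : `|a - b| < n.+1%:R^-1 -> `|a - c| < n.+1%:R^-1 -> `|b - c| < r.
  move=> ab ac; rewrite (_ : b - c = (a - c) - (a - b)); last by ring.
  apply: le_lt_trans (ler_normB _ _) _; apply: le_lt_trans nr; move: (n.+1%:R^-1) ab ac => s ab ac.
  by lra.
by move=> [u' v'] [/= h1 h2]; apply: hr; split; [exact: tri hp h1|exact: tri hq h2].
Qed.

Lemma continuous_measurable_prod (f : R * R -> R) : continuous f -> measurable_fun [set: R * R] f.
Proof.
move=> cf; apply: (measurability (@RGenOpens.G R)) => [|/= _ [_] [a [b ->]] <-].
  exact: RGenOpens.measurableE.
rewrite setTI; apply: open_measurable_prod; apply: open_comp => [z _|]; first exact: cf.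
exact: interval_open.
Qed.

Lemma uniform_on_square (f : R * R -> R) (a b e : R) : continuous f -> 0 < e -> exists2 del, 0 < del &
  forall z z', (`[a, b] `*` `[a, b]) z -> `|z.1 - z'.1| < del -> `|z.2 - z'.2| < del ->
    `|f z - f z'| <= e.
Proof.
move=> cf e0; have e20 : 0 < e / 2 by rewrite divr_gt0.
have /compact_near_coveringP cK : compact (`[a, b] `*` `[a, b] : set (R * R)).
  by apply: compact_setX; exact: segment_compact.
have := cK R 0^'+ (fun del z => forall z' : R * R, `|z.1 - z'.1| < del -> `|z.2 - z'.2| < del ->
  `|f z - f z'| <= e) _.
case=> [z _|del /= del0 hdel].
  have /cvgrPdist_le /(_ _ e20) /nbhs_ballP[r /= r0 hr] := cf z.
  have r20 : 0 < r / 2 by rewrite divr_gt0.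
  exists (ball z (r / 2), [set s | s < r / 2]).
    split => /=; first exact: nbhsx_ballx.
    by exists (r / 2) => //= s /=; rewrite sub0r normrN => sr s0; rewrite (le_lt_trans (ler_norm _) sr).
  move=> [z1 s] /= [[b1 b2] sr] z' h1 h2.
  have hz1 : `|f z - f z1| <= e / 2.
    by apply: hr; split; [apply: lt_trans b1 _|apply: lt_trans b2 _]; lra.
  have hz' : `|f z - f z'| <= e / 2.
    have t (p q w : R) : `|p - q| < r / 2 -> `|q - w| < s -> `|p - w| < r.
      move=> pq qw; rewrite (_ : p - w = (p - q) + (q - w)); last by ring.
      by apply: le_lt_trans (ler_normD _ _) _; lra.
    by apply: hr; split; [apply: (t _ z1.1)|apply: (t _ z1.2)].
  rewrite (_ : f z1 - f z' = (f z - f z') - (f z - f z1)); last by ring.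
  by apply: le_trans (ler_normB _ _) _; lra.
exists (del / 2) => [|z z' zK h1 h2]; first by rewrite divr_gt0.
apply: (hdel (del / 2)) => //; rewrite /= ?divr_gt0 //.
by rewrite sub0r normrN gtr0_norm ?divr_gt0 //; lra.
Qed.

(** The shape whose probability [leaders_cell] gives: a tail in the second coordinate. Boxes are
    differences of two such cells. *)
Definition corner_cell x x' y : set (R * R) := `]x, x'] `*` `]y, +oo[.

Lemma measurable_corner_cell x x' y : measurable (corner_cell x x' y).
Proof. exact: measurableX. Qed.

Lemma prob_box d (T : measurableType d) (nu : probability T R) (X : T -> R * R) x x' y y' :
  measurable_fun [set: T] X -> y <= y' ->
  fine (nu (X @^-1` (`]x, x'] `*` `]y, y']))) =
  fine (nu (X @^-1` corner_cell x x' y)) - fine (nu (X @^-1` corner_cell x x' y')).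
Proof.
move=> mX yy'.
have m A : measurable A -> measurable (X @^-1` A) by move=> mA; rewrite -[X in measurable X]setTI; exact: mX.
have m1 := m _ (measurable_corner_cell x x' y').
have m2 : measurable (X @^-1` (`]x, x'] `*` `]y, y'])) by apply: m; exact: measurableX.
rewrite (_ : X @^-1` corner_cell x x' y = X @^-1` (`]x, x'] `*` `]y, y']) `|` X @^-1` corner_cell x x' y'); last first.
  rewrite predeqE => w /=; rewrite /corner_cell /= !in_itv /= !andbT; split.
    by move=> [-> yw]; case: (leP (X w).2 y') => h; [left|right]; rewrite ?yw.
  by move=> [[-> /andP[-> _]]|[-> h]] //; split=> //; exact: le_lt_trans h.
rewrite measureU //; last first.
  rewrite predeqE => w; split => // -[[_ /=]]; rewrite in_itv /= => /andP[_ h1] [_ /=].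
  by rewrite in_itv /= andbT => /lt_le_trans /(_ h1); rewrite ltxx.
by rewrite fineD ?fin_num_measure // addrK.
Qed.

Lemma grid_cover (del : R) (s0 : R) N u : s0 < u -> u <= s0 + N%:R * del ->
  exists i : 'I_N, s0 + i%:R * del < u <= s0 + i.+1%:R * del.
Proof.
move=> su uN; have ex : exists n, u <= s0 + n%:R * del by exists N.
case: (ex_minnP ex) => -[|n] un nmin; first by move: un su; rewrite mul0r addr0 => /le_lt_trans h /h; rewrite ltxx.
have nN : (n < N)%N := nmin _ uN.
exists (Ordinal nN) => /=; rewrite un andbT ltNge; apply/negP => /nmin.
by rewrite ltnn.
Qed.

Section portmanteau.
Context {d} {Omega : measurableType d} (P : probability Omega R).
Variables (X : R -> Omega -> R * R) (mu : probability (R * R)%type R).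
Hypothesis mX : forall t, 0 <= t -> measurable_fun [set: Omega] (X t).
Hypothesis mu_open : mu (`]0, +oo[ `*` `]0, +oo[) = 1%E.
Hypothesis cells : forall x x' y, 0 < x -> x < x' -> 0 < y -> forall e, 0 < e ->
  exists T, forall t, T <= t ->
  `|fine (P (X t @^-1` corner_cell x x' y)) - fine (mu (corner_cell x x' y))| <= e.

(** All mass of the limit lies in the open quadrant, so squares away from the axes, where cells are
    controlled, nearly exhaust it. *)
Lemma square_mass e : 0 < e -> exists ab : R * R, [/\ 0 < ab.1, ab.1 < ab.2 &
  1 - e <= fine (mu (`]ab.1, ab.2] `*` `]ab.1, ab.2]))].
Proof.
move=> e0; pose I (n : nat) : set R := [set` Interval (BRight n.+2%:R^-1) (BRight n.+2%:R)].
have IE n u : I n u = (n.+2%:R^-1 < u <= n.+2%:R) :> Prop by rewrite /I /= in_itv.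
have {}IE n u : I n u <-> (n.+2%:R^-1 < u <= n.+2%:R) by rewrite IE.
pose B n := I n `*` I n.
have p (n : nat) : 0 < n.+2%:R :> R by rewrite ltr0n.
have mB (n : nat) : measurable (B n : set (R * R)) by apply: measurableX; exact: measurable_itv.
have ndI n m : (n <= m)%N -> I n `<=` I m.
  move=> nm u /IE /andP[h1 h2]; apply/IE/andP; split.
    by apply: le_lt_trans h1; rewrite lef_pV2 ?posrE // ler_nat.
  by apply: le_trans h2 _; rewrite ler_nat.
have ndB : nondecreasing_seq B.
  by move=> n m nm; apply/subsetPset => -[u v] [/= h1 h2]; split; [exact: ndI h1|exact: ndI h2].
have UI u : 0 < u -> exists n, I n u.
  move=> u0; have ui0 : 0 < u^-1 by rewrite invr_gt0.
  have [M hM] := nat_above (u + u^-1); exists M.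
  have MM : M%:R <= M.+2%:R :> R by rewrite ler_nat -addn2 leq_addr.
  apply/IE/andP; split; last by lra.
  rewrite -[ltRHS]invrK ltf_pV2 ?posrE //.
  have : (M%:R : R) < M.+2%:R by rewrite ltr_nat ltnS leqnSn.
  lra.
have UB : \bigcup_n B n = `]0, +oo[ `*` `]0, +oo[.
  rewrite predeqE => -[u v]; split=> [[n _ [/= ]]|[/=]]; last rewrite !in_itv /= !andbT.
    by move=> /IE /andP[h1 _] /IE /andP[h2 _]; rewrite !in_itv /= !andbT; split; [apply: le_lt_trans h1|apply: le_lt_trans h2]; rewrite invr_ge0.
  move=> u0 v0; have [n hn] := UI u u0; have [m hm] := UI v v0.
  by exists (maxn n m) => //; split; [apply: ndI hn; exact: leq_maxl|apply: ndI hm; exact: leq_maxr].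
have muU : mu (\bigcup_n B n) = 1%E by rewrite UB.
have : (mu \o B) x @[x --> \oo] --> (1%E : \bar R).
  rewrite -muU; exact: nondecreasing_cvg_mu mB (bigcup_measurable (fun n _ => mB n)) ndB.
move=> /fine_cvgP[_ /cvgrPdist_le /(_ _ e0) [n _ hn]].
exists (n.+2%:R^-1, n.+2%:R); split => /=; first by rewrite invr_gt0.
  rewrite (@lt_trans _ _ 1) ?invf_lt1 ?ltr1n //.
have := hn n (leqnn n); rewrite /= ler_norml => /andP[_].
by rewrite lerBlDr addrC -lerBlDr.
Qed.

Lemma cvg_of_cells (f : R * R -> R) (M : R) : continuous f -> (forall z, 0 <= f z <= M) ->
  forall e, 0 < e -> exists T, forall t, T <= t ->
  `|fine (\int[P]_w (f (X t w))%:E)%E - fine (\int[mu]_z (f z)%:E)%E| <= e.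
Proof.
move=> cf fM e0 e00.
have M0 : 0 <= M by have /andP[h1 h2] := fM (0, 0); exact: le_trans h2.
(* Room for the step approximation under both laws, the mass outside the square counted M times, and
   the discrepancies of the cell probabilities. *)
pose K := 5 + 3 * M; have K0 : 0 < K by rewrite ltr_pwDl // mulr_ge0.
pose e := e0 / K; have e_gt0 : 0 < e by rewrite divr_gt0.
have [[a b] [/= a0 ab mass]] := square_mass e_gt0.
have [eta eta0 heta] := @uniform_on_square f a b e cf e_gt0.
have ba : 0 < b - a by rewrite subr_gt0.
have [n hn] := nat_above ((b - a) / eta).
pose N := n.+1; pose del := (b - a) / N%:R.
have N0 : 0 < N%:R :> R by rewrite ltr0n.
have del0 : 0 < del by rewrite divr_gt0.
have deleta : del < eta.
  rewrite /del ltr_pdivrMr // mulrC -ltr_pdivrMr //; apply: le_lt_trans hn _; by rewrite ltr_nat.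
pose s i : R := a + i%:R * del.
have sN : s N = b by rewrite /s /del mulrC divfK ?gt_eqF // addrC subrK.
have smono i j : (i <= j)%N -> s i <= s j by move=> ij; rewrite lerD2l ler_wpM2r ?ler_nat // ltW.
have sS i : s i < s i.+1 by rewrite ltrD2l ltr_pM2r // ltr_nat.
have s0 i : 0 < s i by rewrite ltr_wpDr // mulr_ge0 // ltW.
pose C (ij : 'I_N * 'I_N) : set (R * R) := `]s ij.1, s ij.1.+1] `*` `]s ij.2, s ij.2.+1].
have mC ij : measurable (C ij) by exact: measurableX.
have sdisj i j u : s i < u -> u <= s i.+1 -> s j < u -> u <= s j.+1 -> i = j.
  move=> h1 h2 h3 h4; apply/eqP; rewrite eqn_leq; apply/andP; split; rewrite leqNgt; apply/negP => /smono h.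
    by have := lt_le_trans h1 (le_trans h4 h); rewrite ltxx.
  by have := lt_le_trans h3 (le_trans h2 h); rewrite ltxx.
have disj ij kl z : C ij z -> C kl z -> ij = kl.
  case: ij kl => [i j] [k l] [/=]; rewrite !in_itv /= => /andP[h1 h2] /andP[h3 h4] [/=].
  rewrite !in_itv /= => /andP[g1 g2] /andP[g3 g4].
  by congr pair; apply: val_inj; [exact: sdisj h1 h2 g1 g2|exact: sdisj h3 h4 g3 g4].
pose c (ij : 'I_N * 'I_N) := f (s ij.1.+1, s ij.2.+1).
have c0 ij : 0 <= c ij by have /andP[] := fM (s ij.1.+1, s ij.2.+1).
have sI (i : 'I_N) : a <= s i.+1 <= b.
  by rewrite -sN smono // andbT lerDl mulr_ge0 // ltW.
have hc ij z : C ij z -> `|f z - c ij| <= e.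
  move=> [/=]; rewrite !in_itv /= => /andP[h1 h2] /andP[h3 h4].
  have ss i : s i.+1 = s i + del by rewrite /s -natr1 mulrDl mul1r addrA.
  rewrite distrC; apply: heta => /=.
  - by split; rewrite /= in_itv /=; exact: sI.
  - by rewrite ger0_norm ?subr_ge0 // ss; rewrite ss in h2; lra.
  - by rewrite ger0_norm ?subr_ge0 // ss; rewrite ss in h4; lra.
have mf : measurable_fun [set: R * R] f.
  exact: continuous_measurable_prod.
have := step_approx mu mC disj (ltW e_gt0) mf fM c0 hc.
set H := fine _; set A := \sum_ij _; set B := \sum_ij _ => bmu.
have B1 : 1 - e <= B.
  apply: le_trans mass _; apply: cover_le => //; first exact: measurableX.
  move=> [u v] [/=]; rewrite !in_itv /= -sN => /andP[h1 h2] /andP[h3 h4].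
  have [i hi] := grid_cover h1 h2; have [j hj] := grid_cover h3 h4.
  by exists (i, j); split; rewrite /= in_itv.
pose p t ij := fine (P (X t @^-1` C ij)).
pose q ij := fine (mu (C ij)).
have S0 : 0 < \sum_(ij : 'I_N * 'I_N) (c ij + 1) + 1.
  by rewrite ltr_pwDr // sumr_ge0 // => ij _; rewrite addr_ge0.
pose e1 := e / (\sum_(ij : 'I_N * 'I_N) (c ij + 1) + 1) / 2.
have e10 : 0 < e1 by rewrite !divr_gt0.
have hT : exists T, forall t, T <= t -> 0 <= t /\ forall ij, `|p t ij - q ij| <= 2 * e1.
  have one (ij : 'I_N * 'I_N) : exists T, forall t, T <= t -> 0 <= t -> `|p t ij - q ij| <= 2 * e1.
    have [T1 h1] := cells (s0 ij.1) (sS ij.1) (s0 ij.2) e10.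
    have [T2 h2] := cells (s0 ij.1) (sS ij.1) (s0 ij.2.+1) e10.
    exists (Num.max T1 T2) => t; rewrite ge_max => /andP[t1 t2] t0.
    rewrite /p /q (prob_box P _ _ (mX t0) (ltW (sS ij.2))).
    have -> := prob_box mu (X := id) (s ij.1) (s ij.1.+1) (@measurable_id _ _ _) (ltW (sS ij.2)).
    have := h1 t t1; have := h2 t t2; rewrite /= !ler_norml !preimage_id => /andP[x1 x2] /andP[y1 y2].
    by apply/andP; split; lra.
  have {}one : exists T : 'I_N * 'I_N -> R, forall ij t, T ij <= t -> 0 <= t -> `|p t ij - q ij| <= 2 * e1.
    by have [T hT] := choice one; exists T.
  have [T hT] := one; exists (\sum_ij `|T ij|) => t Tt.
  have t0 : 0 <= t by apply: le_trans Tt; exact: sumr_ge0.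
  split=> // ij; apply: hT => //; apply: le_trans (ler_norm _) _; apply: le_trans Tt.
  by rewrite (bigD1 ij) //= lerDl sumr_ge0.
have [T {}hT] := hT; exists T => t Tt; have [t0 hp] := hT t Tt.
have mX' := mX t0.
have mD ij : measurable (X t @^-1` C ij) by rewrite -[X in measurable X]setTI; exact: mX'.
have disj' ij kl w : (X t @^-1` C ij) w -> (X t @^-1` C kl) w -> ij = kl by exact: disj.
have := step_approx P mD disj' (ltW e_gt0) (measurableT_comp mf mX') (fun w => fM (X t w)) c0 (fun ij w => hc ij (X t w)).
rewrite -/(p t _); set H' := fine _.
rewrite (_ : \sum_ij c ij * _ = \sum_ij c ij * p t ij) // (_ : \sum_ij fine _ = \sum_ij p t ij) //.
set A' := \sum_ij c ij * p t ij; set B' := \sum_ij p t ij => bP.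
have e1S : 2 * e1 * (\sum_(ij : 'I_N * 'I_N) (c ij + 1)) <= e.
  rewrite /e1 (_ : 2 * _ * _ = e * ((\sum_(ij : 'I_N * 'I_N) (c ij + 1)) / (\sum_(ij : 'I_N * 'I_N) (c ij + 1) + 1))).
    by rewrite ler_piMr ?(ltW e_gt0) // ler_pdivrMr // mul1r lerDl.
  by field; rewrite gt_eqF.
have wsum (g : 'I_N * 'I_N -> R) : (forall ij, 0 <= g ij <= c ij + 1) ->
    `|\sum_ij g ij * p t ij - \sum_ij g ij * q ij| <= e.
  move=> hg; rewrite -sumrB; apply: le_trans (ler_norm_sum _ _ _) _.
  apply: le_trans e1S; rewrite mulr_sumr; apply: ler_sum => ij _.
  have /andP[g0 g1] := hg ij.
  by rewrite -mulrBr normrM (ger0_norm g0) mulrC ler_pM.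
have AA : `|A' - A| <= e by apply: wsum => ij; rewrite c0 lerDl ler01.
have BB : `|B' - B| <= e.
  rewrite /B' /B -sumrB; apply: le_trans (ler_norm_sum _ _ _) _; apply: le_trans e1S.
  rewrite mulr_sumr; apply: ler_sum => ij _; apply: le_trans (hp ij) _.
  rewrite -[leLHS]mulr1; apply: ler_wpM2l; first by rewrite mulr_ge0 // ltW.
  by rewrite lerDr; exact: c0.
have eK : (5 + 3 * M) * e = e0 by rewrite /e mulrC divfK // gt_eqF.
have MB : M * (1 - B) <= M * e by rewrite ler_wpM2l //; lra.
have MB' : M * (1 - B') <= M * (2 * e).
  by rewrite ler_wpM2l //; move: BB; rewrite ler_norml => /andP[]; lra.
have Me : 0 <= M * e by rewrite mulr_ge0 // ltW.
move: bmu bP AA; rewrite !ler_norml => /andP[u1 u2] /andP[v1 v2] /andP[w1 w2].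
by apply/andP; split; lra.
Qed.

Lemma cvg_in_distribution_of_cells : cvg_in_distribution P X mu.
Proof.
split; first by near=> t; apply: mX; near: t; apply: nbhs_pinfty_ge; exact: num_real.
move=> f cf [M0 hM0]; pose M := `|M0|; have fM z : `|f z| <= M by apply: le_trans (hM0 z) (ler_norm _).
(* [cvg_of_cells] handles nonnegative functions; the shift is undone at the end. *)
pose g z := f z + M.
have cg : continuous g by move=> z; apply: cvgD; [exact: cf|exact: cvg_cst].
have gM z : 0 <= g z <= 2 * M by have := fM z; rewrite ler_norml /g => /andP[]; lra.
have mf : measurable_fun [set: R * R] f by exact: continuous_measurable_prod.
have shift d' (T : measurableType d') (nu : probability T R) (Y : T -> R * R) : measurable_fun [set: T] Y ->
    (\int[nu]_w (f (Y w))%:E)%E = (fine (\int[nu]_w (g (Y w))%:E)%E - M)%:E.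
  move=> mY; have mfY : measurable_fun [set: T] (f \o Y) by exact: measurableT_comp.
  have fi : nu.-integrable [set: T] (EFin \o (f \o Y)).
    apply: measurable_bounded_integrable => //.
      by rewrite ltey_eq; apply/orP; left; exact: fin_num_measure.
    by exists M; split; rewrite ?num_real // => x Mx w _; apply: le_trans (fM _) (ltW Mx).
  have ci : nu.-integrable [set: T] (EFin \o (fun=> M)).
    exact: finite_measure_integrable_cst.
  have E := integralD_EFin measurableT fi ci.
  rewrite (_ : (\int[nu]_w (g (Y w))%:E)%E = (\int[nu]_w (f (Y w))%:E + M%:E)%E); last first.
    rewrite [LHS]E; congr (_ + _)%E.
    by rewrite integral_cst //= probability_setT mule1.
  have ff : (\int[nu]_w (f (Y w))%:E)%E \is a fin_num by exact: integrable_fin_num fi.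
  by rewrite fineD // addrK fineK.
rewrite (_ : ('E_mu[f])%E = (fine (\int[mu]_z (g z)%:E)%E - M)%:E); last first.
  by rewrite unlock; exact: (shift _ _ mu id).
apply: (@cvg_trans _ ((fine (\int[P]_w (g (X t w))%:E)%E - M)%:E @[t --> +oo])).
  apply: near_eq_cvg; near=> t; rewrite unlock; apply/esym; apply: (shift _ _ P (X t)).
  by apply: mX; near: t; apply: nbhs_pinfty_ge; exact: num_real.
apply: cvg_EFin; first by near=> t.
apply: cvgB; last exact: cvg_cst.
apply/cvgrPdist_le => e e0; have [T hT] := cvg_of_cells cg gM e0.
near=> t; rewrite distrC; apply: hT; near: t; apply: nbhs_pinfty_ge; exact: num_real.
Unshelve. all: by end_near. Qed.

End portmanteau.

End weak_convergence.

From mathcomp Require Import finmap.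

(** * Leaders described by positions *)

Section leader_values.
Implicit Types (e : int -> int) (k i x y : int).

Lemma card_fset_ge (T : choiceType) (A : {fset T}) (S : set T) (n : nat) :
  (forall x : T, x \in A -> S x) -> (S #= `I_n)%card -> (#|` A| <= n)%N.
Proof.
move=> AS Sn; have h1 : ([set` A] #= `I_(#|` A|))%card by apply/card_eq_fsetP.
by rewrite -card_le_II -(card_le_eql h1) -(card_le_eqr Sn); apply: subset_card_le => x; exact: AS.
Qed.

Lemma is_leader1P e k i : is_leader e k 1 i <->
  k <= i /\ exists x, e x = i /\ forall x', x < x' -> e x' < k.
Proof.
split=> [[ki [x xi [/= kx S1]]]|[ki [x [xi hx]]]]; split=> //; exists x => //.
  split=> // x' xx'; rewrite ltNge; apply/negP => kx'.
  have : (#|` [fset x; x']%fset| <= 1)%N.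
    apply: card_fset_ge S1 => z; rewrite !inE => /orP[/eqP->|/eqP->] //.
    by split=> //; exact: ltW.
  by rewrite cardfs2 lt_eqF.
split; first by rewrite /= xi.
rewrite (_ : [set y | _] = [set` [fset x]%fset]); first by apply/card_eq_fsetP; rewrite cardfs1.
rewrite predeqE => y /=; rewrite inE; split=> [[ky]|/eqP->]; last by rewrite /= xi.
by rewrite le_eqVlt => /predU1P[->//|/hx]; rewrite ltNge ky.
Qed.

Lemma is_leader2P e k i : is_leader e k 2 i <->
  k <= i /\ exists xx : int * int, [/\ xx.1 < xx.2, e xx.1 = i, k <= e xx.2 &
    forall x', xx.1 < x' -> x' <> xx.2 -> e x' < k].
Proof.
split=> [[ki [x xi [/= kx S2]]]|[ki [[x x0] /= [xx0 xi kx0 hx]]]]; split=> //; last first.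
  exists x => //; split; first by rewrite /= xi.
  rewrite (_ : [set y | _] = [set` [fset x; x0]%fset]).
    by apply/card_eq_fsetP; rewrite cardfs2 lt_eqF.
  rewrite predeqE => y /=; rewrite !inE; split=> [[ky]|/orP[/eqP->|/eqP->]]; last 2 first.
  - by rewrite /= xi.
  - by split=> //; exact: ltW.
  rewrite le_eqVlt => /predU1P[->|xy]; first by rewrite eqxx.
  have [->|/eqP yx0] := eqVneq y x0; first by rewrite orbT.
  by have := hx y xy yx0; rewrite ltNge ky.
have [[x0 [xx0 kx0]]|/forallNP none] := pselect (exists x0, x < x0 /\ k <= e x0).
  exists (x, x0); split=> //= x' xx' /eqP x'x0; rewrite ltNge; apply/negP => kx'.
  have : (#|` x' |` [fset x; x0]%fset|%fset <= 2)%N.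
    apply: card_fset_ge S2 => z; rewrite !inE => /orP[/eqP->|/orP[/eqP->|/eqP->]];
      by split=> //; exact: ltW.
  by rewrite cardfsU1 cardfs2 !inE negb_or x'x0 gt_eqF // lt_eqF.
have S1 : ([set y | (e @^-1` [set z | k <= z]) y /\ x <= y] #= `I_1)%card.
  rewrite (_ : [set y | _] = [set` [fset x]%fset]); first by apply/card_eq_fsetP; rewrite cardfs1.
  rewrite predeqE => y /=; rewrite inE; split=> [[ky]|/eqP->] //.
  by rewrite le_eqVlt => /predU1P[->//|xy]; case: (none y).
by have := card_eq_trans (card_esym S1) S2; move/card_eq_II.
Qed.

Lemma is_leader_uniq e k s i j : (s == 1) || (s == 2) -> is_leader e k s i -> is_leader e k s j -> i = j.
Proof.
move=> /orP[]/eqP->.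
  move=> /is_leader1P[ki [x [xi hx]]] /is_leader1P[kj [y [yj hy]]].
  by case: (ltgtP x y) => [/hx|/hy|E]; rewrite ?yj ?xi; [lia|lia|rewrite -xi E].
move=> /is_leader2P[ki [[x x0] /= [xx0 xi kx0 hx]]] /is_leader2P[kj [[y y0] /= [yy0 yj ky0 hy]]].
have [xy|yx|E] := ltgtP x y; last by rewrite -xi E.
- have E : y = x0 by apply: contrapT => /(hx y xy); rewrite yj; lia.
  have : e y0 < k by apply: hx; [exact: lt_trans yy0|rewrite -E => E'; rewrite E' ltxx in yy0].
  by lia.
- have E : x = y0 by apply: contrapT => /(hy x yx); rewrite xi; lia.
  have : e x0 < k by apply: hy; [exact: lt_trans xx0|rewrite -E => E'; rewrite E' ltxx in xx0].
  by lia.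
Qed.

(** The second alternative is the default value of [xget]; it matters for measurability, which
    concerns all outcomes and not just almost all. *)
Lemma leaderP e k s i : (s == 1) || (s == 2) ->
  leader e k s = i <-> is_leader e k s i \/ (i = 0 /\ forall j, ~ is_leader e k s j).
Proof.
move=> s12; rewrite /leader; have [[j hj]|/forallNP none] := pselect (exists j, is_leader e k s j).
  rewrite (@xget_unique _ _ _ j) // => [|j' hj']; last exact: is_leader_uniq hj' hj.
  by split=> [<-|[hi|[_ /(_ j)]//]]; [left|exact: is_leader_uniq hj hi].
rewrite xgetPN //; split=> [<-|[/none|[-> _]]] //.
by right.
Qed.

Lemma leader_second_at e k a b y : second_at k a b y e ->
  leader e k 1 = k + a%:Z /\ leader e k 2 = k + b%:Z.
Proof.
move=> [yb [x [yx xa hx]]]; split; apply/leaderP => //; left.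
  apply/is_leader1P; split; first by lia.
  exists x; split=> // x' xx'; apply: hx; first exact: lt_trans xx'.
  by move=> E; rewrite E ltxx in xx'.
by apply/is_leader2P; split; [lia|exists (y, x); split=> //=; lia].
Qed.

End leader_values.

(** * The rescaled pair of leaders *)

Section leader_process.
Context {d} {Omega : measurableType d} {R : realType} (P : probability Omega R).
Variable tau : int * nat -> {RV P >-> R}.
Hypothesis indep : mutually_independent tau.
Hypothesis exp1 : forall i, exponential_rate1 (tau i).
Variable eta : R -> Omega -> int -> int.
Hypothesis eta0 : forall w x, eta 0 w x = - x.
Hypothesis path_eta :
  {ae P, forall w, tasep_path (rings_at tau w) (fun t => eta t w)}.
Hypothesis meas_eta : forall (t : R) x i, 0 <= t -> measurable [set w | eta t w x = i].
Variable k : int.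

Local Notation tail_limit := (@tail_limit R).

Definition rescaled_leaders (t : R) (w : Omega) : R * R :=
  ((leader (eta t w) k 1 - k)%:~R / Num.sqrt t, (leader (eta t w) k 2 - k)%:~R / Num.sqrt t).

(** Silent bonds confine the search: far right only types below k occur, far left only types at
    least k, so a rightmost and a second rightmost position exist. *)
Lemma good_second_at t w : 0 <= t -> good tau t eta w ->
  exists a b y, second_at k a b y (eta t w).
Proof.
move=> t0 gw; have [_ _ g3 g4 _] := gw.
have [r kr tr] := g3 (- k).
have [l lr tl] := g4 (Order.min r (- k)).
pose Q : pred int := fun z => k <= eta t w z.
have lk : Q l by have := good_left t0 eta0 gw tl (lexx _); rewrite /Q; lia.
have lr1 : l < r + 1 by lia.
have [x kx [xr hx]] := largest_below t0 lr1 lk.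
have [l' lx tl'] := g4 (Order.min (x - 1) (- k)).
have lk' : Q l' by have := good_left t0 eta0 gw tl' (lexx _); rewrite /Q; lia.
have lx' : l' < x by lia.
have [y ky [yx hy]] := largest_below t0 lx' lk'.
rewrite /Q in kx ky hx hy.
exists (absz (eta t w x - k)%R), (absz (eta t w y - k)%R), y; split; first by lia.
exists x; split=> //; first by lia.
move=> x' yx' /eqP; rewrite neq_lt => /orP[x'x|xx'].
  by have := hy _ yx' x'x; rewrite -ltNge.
have [x'r|rx'] := ltP x' (r + 1); first by have := hx _ xx' x'r; rewrite -ltNge.
by have := good_right t0 eta0 gw tr (_ : r < x'); move=> /(_ ltac:(lia)); lia.
Qed.

Lemma measurable_leader t s i : 0 <= t -> (s == 1) || (s == 2) ->
  measurable [set w | leader (eta t w) k s = i].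
Proof.
move=> t0 s12; have meas x j : measurable [set w | eta t w x = j] by exact: meas_eta.
have lt x : measurable [set w | eta t w x < k] by exact: (measurable_eta_lt meas).
have and_ (Q Q' : Omega -> Prop) : measurable [set w | Q w] -> measurable [set w | Q' w] ->
    measurable [set w | Q w /\ Q' w] by exact: measurableI.
have cst (Q : Prop) : measurable [set w : Omega | Q] by exact: measurable_const.
have imp (Q : Prop) (Q' : Omega -> Prop) : measurable [set w | Q' w] -> measurable [set w | Q -> Q' w].
  move=> m; have [q|nq] := pselect Q.
    suff -> : [set w | Q -> Q' w] = [set w | Q' w] by [].
    by rewrite predeqE => w; split=> [h|h _]; [exact: h q|exact: h].
  suff -> : [set w | Q -> Q' w] = setT by [].
  by rewrite predeqE => w; split=> // _ /nq.
have isl j : measurable [set w | is_leader (eta t w) k s j].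
  move: s12 => /orP[]/eqP->.
    rewrite (_ : [set w | _] = [set w | k <= j /\ exists x, eta t w x = j /\ forall x', x < x' -> eta t w x' < k]); last first.
      by rewrite predeqE => w; exact: is_leader1P.
    apply: (and_ (fun=> is_true (k <= j))) => //; apply: measurable_exists => x; apply: (and_) => //.
    by apply: measurable_forall => x'; exact: imp.
  rewrite (_ : [set w | _] = [set w | k <= j /\ exists xx : int * int, (xx.1 < xx.2 /\ eta t w xx.1 = j) /\
      (~ (eta t w xx.2 < k) /\ forall x', (xx.1 < x' /\ x' <> xx.2) -> eta t w x' < k)]); last first.
    rewrite predeqE => w; split=> [/is_leader2P[kj [xx [h1 h2 h3 h4]]]|[kj [xx [[h1 h2] [h3 h4]]]]].
      split=> //; exists xx; split=> //; split; first by apply/negP; rewrite -leNgt.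
      by move=> x' [xx' x'x]; exact: h4.
    apply/is_leader2P; split=> //; exists xx; split=> //; first by rewrite leNgt; apply/negP.
    by move=> x' xx' x'x; exact: h4.
  apply: (and_ (fun=> is_true (k <= j))) => //; apply: measurable_exists => xx; apply: (and_).
    by apply: (and_ (fun=> is_true (xx.1 < xx.2))).
  apply: (and_); first exact: (measurableC (lt _)).
  by apply: measurable_forall => x'; exact: imp.
rewrite (_ : [set w | _] = [set w | is_leader (eta t w) k s i] `|`
  [set w | i = 0 /\ forall j, ~ is_leader (eta t w) k s j]); last first.
  by rewrite predeqE => w; exact: leaderP.
apply: measurableU => //; apply: (and_ (fun=> i = 0)) => //.
by apply: measurable_forall => j; exact: (measurableC (isl j)).
Qed.

Lemma measurable_rescaled_leaders t : 0 <= t -> measurable_fun [set: Omega] (rescaled_leaders t).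
Proof.
move=> t0; have one s : (s == 1) || (s == 2) ->
    measurable_fun [set: Omega] (fun w => (leader (eta t w) k s - k)%:~R / Num.sqrt t).
  move=> s12 _ B _; rewrite setTI.
  rewrite (_ : _ @^-1` B = [set w | exists i, B ((i - k)%:~R / Num.sqrt t) /\ leader (eta t w) k s = i]).
    apply: measurable_exists => i.
    apply: (@measurableI _ _ [set w | B ((i - k)%:~R / Num.sqrt t)] [set w | leader (eta t w) k s = i]).
      exact: measurable_const.
    exact: measurable_leader.
  by rewrite predeqE => w; split=> [h|[i [h E]]]; [exists (leader (eta t w) k s)|rewrite /= E].
by apply: measurable_fun_pair; exact: one.
Qed.

Lemma cutoff_le (z t : R) n : 0 <= z -> (cutoff z t <= n)%N = (z * Num.sqrt t < n%:R).
Proof.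
move=> z0; have /andP[h1 h2] := truncn_itv (mulr_ge0 z0 (sqrtr_ge0 t)).
apply/idP/idP => [h|h]; first by apply: lt_le_trans h2 _; rewrite ler_nat.
by rewrite -(ltr_nat R); exact: le_lt_trans h.
Qed.

Lemma rescaled_leaders_cell t w x x' y a b z : 0 < t -> 0 <= x -> 0 <= x' -> 0 <= y ->
  second_at k a b z (eta t w) ->
  (rescaled_leaders t w \in corner_cell x x' y) =
    ((cutoff x t <= a < cutoff x' t) && (cutoff y t <= b))%N.
Proof.
move=> t0 x0 x0' y0 /leader_second_at[l1 l2]; have s0 : 0 < Num.sqrt t by rewrite sqrtr_gt0.
rewrite [in RHS]ltnNge !cutoff_le // -leNgt.
have E c : (k + c%:Z - k)%:~R = c%:R :> R by rewrite addrAC subrr add0r.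
apply/idP/idP => [/set_mem[/=]|h].
  by rewrite !in_itv /= andbT l1 l2 !E ltr_pdivlMr // ler_pdivrMr // ltr_pdivlMr // => -> ->.
by apply/mem_set; move: h => /andP[h1 h2]; split; rewrite /= in_itv /= ?andbT ?l1 ?l2 ?E
  ltr_pdivlMr // ler_pdivrMr.
Qed.

Lemma prob_rescaled_leaders t x x' y : 0 < t -> 0 <= x -> 0 <= x' -> 0 <= y ->
  P (rescaled_leaders t @^-1` corner_cell x x' y) =
  P [set w | leaders_cell k (cutoff x t) (cutoff x' t) (cutoff y t) (eta t w)].
Proof.
move=> t0 x0 x0' y0; have t0' := ltW t0; apply: measure_ae_eq.
- rewrite -[X in measurable X]setTI; apply: measurable_rescaled_leaders => //; exact: measurable_corner_cell.
- exact: measurable_leaders_cell.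
have := good_ae indep exp1 t0' path_eta; apply: filterS => w gw; split.
  have [a [b [z h]]] := good_second_at t0' gw.
  move=> Xw; have : rescaled_leaders t w \in corner_cell x x' y by exact/mem_set.
  rewrite (rescaled_leaders_cell t0 x0 x0' y0 h) => /andP[ha hb].
  by exists a; split=> //; exists (z, b).
move=> [a [ha [[z b] /= [hb h]]]].
have : rescaled_leaders t w \in corner_cell x x' y by rewrite (rescaled_leaders_cell t0 x0 x0' y0 h) ha.
by move/set_mem.
Qed.

(** Cell probabilities decrease in y, hence so do their limits, which are increments of primitives
    of the tail; the derivative of the difference of two primitives is then nonpositive. *)
Lemma tail_limit_antitone x y y' : 0 < x -> 0 < y -> y <= y' -> tail_limit x y' <= tail_limit x y.
Proof.
move=> x0 y0 yy'; have y0' := lt_le_trans y0 yy'.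
have x20 : 0 < x / 2 by rewrite divr_gt0.
have x2x : x / 2 < x by lra.
have [F [dF _]] := tail_limit_primitive (ltW y0) x20.
have [F' [dF' _]] := tail_limit_primitive (ltW y0') x20.
have [L L0 lip] := @tail_limit_lipschitz R.
rewrite -subr_le0.
refine (@is_derive_nonincreasing_le0 R (fun z => F' z - F z) (fun z => tail_limit z y' - tail_limit z y)
  x 1 (2 * L) ltr01 (mulr_ge0 (ler0n _ 2) L0) _ _ _) => z xz _.
- have xz' : x / 2 < z by exact: lt_le_trans xz.
  by apply: drvB; [exact: dF'|exact: dF].
- have z0 := le_trans (ltW x0) xz.
  have := lip _ _ _ _ (ltW x0) (ltW y0') z0 (ltW y0'); have := lip _ _ _ _ (ltW x0) (ltW y0) z0 (ltW y0).
  rewrite !subrr !normr0 !addr0 !(@ger0_norm _ (z - x)) ?subr_ge0 // !ler_norml.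
  rewrite -mulrA; move: (L * _) => q /andP[p1 p2] /andP[p3 p4]; apply/andP; split; lra.
move: xz; rewrite le_eqVlt => /predU1P[->//|xz].
rewrite lerBlDr -lerBlDl; apply/ler_addgt0Pr => e e0; have e20 : 0 < e / 2 by rewrite divr_gt0.
have [T hT] := prob_leaders_cvg indep exp1 eta0 path_eta meas_eta k x20 x2x xz y0 dF e20.
have [T' hT'] := prob_leaders_cvg indep exp1 eta0 path_eta meas_eta k x20 x2x xz y0' dF' e20.
pose t := Num.max 1 (Num.max T T').
have t1 : 1 <= t by rewrite le_max lexx.
have t0 : 0 <= t by exact: le_trans t1.
have := hT t (_ : T <= t); rewrite !le_max lexx !orbT => /(_ isT).
have := hT' t (_ : T' <= t); rewrite !le_max lexx !orbT => /(_ isT).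
set p' := fine _; set p := fine _.
have pp : p' <= p.
  have m A1 A2 b : measurable [set w | leaders_cell k A1 A2 b (eta t w)] by exact: measurable_leaders_cell.
  apply: fine_le; rewrite ?fin_num_measure //.
  apply: le_measure; [exact/mem_set/m|exact/mem_set/m|].
  move=> w [a [ha [[u b] /= [hb h]]]]; exists a; split=> //; exists (u, b); split=> //=.
  apply: leq_trans hb; rewrite cutoff_le ?(ltW y0) //.
  apply: le_lt_trans (_ : y' * Num.sqrt t < _); first by rewrite ler_wpM2r ?sqrtr_ge0.
  by rewrite -cutoff_le ?(ltW y0').
by rewrite !ler_norml => /andP[p1 p2] /andP[p3 p4]; lra.
Qed.

End leader_process.

Theorem theorem5p4 (R : realType) (d : measure_display)
    (Omega : measurableType d) (P : probability Omega R)
    (eta : R -> Omega -> int -> int) (k1 : int) :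
  is_multitype_tasep P eta ->
  (forall (w : Omega) (x : int), eta 0 w x = - x) ->
  exists mu : probability (R * R)%type R,
    has_density mu [set a : R * R | 0 <= a.1 /\ 0 <= a.2] G /\
    cvg_in_distribution P
      (fun (t : R) (w : Omega) =>
         ((leader (eta t w) k1 1 - k1)%:~R / Num.sqrt t,
          (leader (eta t w) k1 2 - k1)%:~R / Num.sqrt t))
      mu.
Proof.
move=> [meas [tau [indep exp1 path]]] eta0.
have meas_eta (t : R) x i : 0 <= t -> measurable [set w | eta t w x = i] by exact: meas.
have anti := tail_limit_antitone indep exp1 eta0 path meas_eta k1.
exists (limit_prob anti); split; first exact: limit_prob_density.
apply: (@cvg_in_distribution_of_cells _ _ _ P (rescaled_leaders eta k1)).
- by move=> t t0; exact: (measurable_rescaled_leaders meas_eta).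
- exact: limit_prob_open.
(* The primitive is based at x / 2, so that both ends of the cell lie strictly to its right. *)
move=> x x' y x0 xx' y0 e e0; have x20 : 0 < x / 2 by rewrite divr_gt0.
have x2x : x / 2 < x by lra.
have [F [dF iF]] := tail_limit_primitive (ltW y0) x20.
have [T hT] := prob_leaders_cvg indep exp1 eta0 path meas_eta k1 x20 x2x xx' y0 dF e0.
exists (Num.max 1 T) => t; rewrite ge_max => /andP[t1 Tt].
have t0 : 0 < t by exact: lt_le_trans t1.
rewrite (prob_rescaled_leaders indep exp1 eta0 path meas_eta) ?(ltW x0) ?(ltW y0) ?(ltW (lt_trans x0 xx')) //.
rewrite (limit_prob_cell anti x20 x2x (ltW xx') (ltW y0) (iF x x' x2x (ltW xx'))).
exact: hT.
Qed.
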